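(* Suppose $\{\mathcal{A}_i\}$ is a sequence of regular triple bubble complexes that converges in length and area to a triple bubble complex $\mathcal{A}$. If $\mathcal{A}$ does not have any empty chambers, has equal pressure regions and is not a standard triple bubble, then there exists an $N$ such that for every $i>N$, $\mathcal{A}_i$ is not a perimeter minimizer for the areas it encloses.
   Context: All graphs are finite, embedded in the plane $\mathbb{R}^2$, with every vertex of degree at least three. An embedded planar graph encloses areas $A_1,\dots,A_n$ if it separates the plane into $n+1$ regions (not necessarily connected), $n$ of which (the interior regions) have the finite areas $A_1,\dots,A_n$ respectively, the remaining one (the exterior region) having infinite area. An $n$ bubble complex is an embedded planar graph enclosing some $n$ positive areas; a triple bubble complex is a $3$ bubble complex. $\ell(\mathcal{A})$ denotes the total edge length of $\mathcal{A}$. A complex is a perimeter minimizer for the areas it encloses if its length is least among all $n$ bubble complexes enclosing the same areas. A half-variation of an $n$ bubble complex $\mathcal{B}$ is a continuous family $\{\mathcal{B}_t : t\in[0,\epsilon)\}$ of $n$ bubble complexes with $\mathcal{B}_0=\mathcal{B}$. An $n$ bubble complex is regular if: (1) it has finitely many vertices, edges and faces; (2) each edge has constant curvature (arc of a circle or line segment); (3) each vertex is trivalent; (4) edges meet at vertices at angles $2\pi/3$; (5) all edges separating a given pair of regions have the same (signed) curvature; (6) no half-variation preserving all the enclosed areas has negative initial derivative of length at $t=0$. In a regular complex the pressure of the exterior region is $0$, and the pressure of another region is the sum of the signed curvatures of the edges crossed by a path from the exterior to that region that meets the edges transversely in finitely many points; the sign of a crossing is positive if the crossed edge bulges toward the side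 the path is coming from. The complex has equal pressure regions if all interior regions have the same pressure. An empty chamber is a bounded connected component of the exterior region. A standard triple bubble is a regular triple bubble complex with four vertices, six edges and three connected interior regions. Convergence: let $\{\mathcal{A}_i\}$ be a sequence of regular $n$ bubble complexes, $\mathcal{A}_i$ enclosing area $A_{i,m}$ in its $m$th region, $m=1,\dots,n$. It converges in length and area to a regular $n$ bubble complex $\mathcal{A}$ enclosing areas $A_1,\dots,A_n$ if $\lim_{i\to\infty}A_{i,m}=A_m$ for all $m$ and $\lim_{i\to\infty}\ell(\mathcal{A}_i)=\ell(\mathcal{A})$. *)

(* Defs.v *)
From HB Require Import structures.
From mathcomp Require Import all_boot all_order all_algebra.
From mathcomp Require Import all_classical all_reals all_analysis.

Set Implicit Arguments.
Unset Strict Implicit.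
Unset Printing Implicit Defensive.

Import Order.TTheory GRing.Theory Num.Theory.
Import numFieldNormedType.Exports.

Local Open Scope classical_set_scope.
Local Open Scope ring_scope.

(* The plane.  Its topology is the product topology; the library's norm on
   pairs is the sup norm, so the Euclidean norm is introduced separately. *)
Notation plane R := (R * R)%type.

Definition dot (R : realType) (u v : plane R) : R := u.1 * v.1 + u.2 * v.2.

Definition enorm (R : realType) (u : plane R) : R := Num.sqrt (dot u u).

Definition edist (R : realType) (p q : plane R) : R := enorm (p - q).

Definition plane_area (R : realType) (A : set (plane R)) : \bar R :=
  (lebesgue_measure \x lebesgue_measure)%E A.

(* Jordan length of a curve parametrized by [0, 1]: the supremum of the lengths
   of the inscribed polygons. *)
Definition polygon_length (R : realType) (g : R -> plane R) (s : seq R) : R :=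
  let F := g \o nth 1 (0 :: s) in
  \sum_(0 <= k < size s) edist (F k.+1) (F k).

Definition curve_length (R : realType) (g : R -> plane R) : \bar R :=
  ereal_sup [set (polygon_length g s)%:E | s in itv_partition 0 1].

(* Finite multigraphs (loops and multiple edges allowed) embedded in the plane.
   Edges are parametrized by [0, 1]; the values of [curve e] outside [0, 1] are
   irrelevant.  A dart (e, b) is an end of the edge e: the initial one for
   b = false, the final one for b = true. *)
Record embedded_graph (R : realType) := EmbeddedGraph {
  vertex : finType;
  edge : finType;
  position : vertex -> plane R;
  edge_end : edge * bool -> vertex;
  curve : edge -> R -> plane R;
  position_inj : injective position;
  curve_continuous : forall e, {within `[0, 1], continuous (curve e)};
  curve0 : forall e, curve e 0 = position (edge_end (e, false));
  curve1 : forall e, curve e 1 = position (edge_end (e, true));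
  curve_inj : forall e e' t t', 0 < t < 1 -> 0 < t' < 1 ->
    curve e t = curve e' t' -> e = e' /\ t = t';
  curve_vertex : forall e t v, 0 < t < 1 -> curve e t <> position v;
  degree_ge3 : forall v, (3 <= #|[set d | edge_end d == v]%SET|)%N
}.

Section EmbeddedGraphs.
Variables (R : realType) (G : embedded_graph R).

Definition support : set (plane R) :=
  [set p | (exists v : vertex G, p = position v) \/
           (exists (e : edge G) (t : R), 0 <= t <= 1 /\ p = curve e t)].

Definition graph_length : \bar R := (\sum_(e : edge G) curve_length (curve e))%E.

Definition faces : set (set (plane R)) :=
  [set F | exists2 p, (~` support) p & F = connected_component (~` support) p].

(* The parametrization of the edge of a dart, starting from that end. *)
Definition dart_curve (d : edge G * bool) (t : R) : plane R :=
  if d.2 then curve d.1 (1 - t) else curve d.1 t.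

Definition has_direction (d : edge G * bool) (u : plane R) : Prop :=
  (let w := dart_curve d t - position (edge_end d) in
   (w.1 / enorm w, w.2 / enorm w)) @[t --> 0^'+] --> u.

End EmbeddedGraphs.

(* The index None stands for the exterior region, Some m for the interior
   ones.  A region is a union of faces, not necessarily connected. *)
Record complex (R : realType) (n : nat) := Complex {
  graph :> embedded_graph R;
  region : option 'I_n -> set (plane R);
  area : 'I_n -> R;
  region_cover : \bigcup_i region i = ~` support graph;
  region_disjoint : trivIset setT region;
  region_faces : forall i p, region i p ->
    connected_component (~` support graph) p `<=` region i;
  area_gt0 : forall m, 0 < area m;
  interior_area : forall m, plane_area (region (Some m)) = (area m)%:E;
  exterior_area : plane_area (region None) = +oo%E
}.

(* The curves of constant curvature.  [Line p u] is the line through p with unit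
   normal u, [Circle c r] the circle with centre c and radius r > 0. *)
Variant carrier (R : realType) :=
  | Line of plane R & plane R
  | Circle of plane R & R.

Definition on_carrier (R : realType) (s : carrier R) (q : plane R) : Prop :=
  match s with
  | Line p u => enorm u = 1 /\ dot (q - p) u = 0
  | Circle c r => 0 < r /\ edist q c = r
  end.

(* A unit normal, pointing to the side towards which the carrier bulges when
   the carrier is a circle. *)
Definition normal (R : realType) (s : carrier R) (q : plane R) : plane R :=
  match s with
  | Line p u => u
  | Circle c r => ((q.1 - c.1) / r, (q.2 - c.2) / r)
  end.

Definition curvature (R : realType) (s : carrier R) : R :=
  match s with
  | Line p u => 0
  | Circle c r => r^-1
  end.

Section Complexes.
Variables (R : realType) (n : nat).
Implicit Types (B : complex R n) (i j : option 'I_n).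

(* As edges are simple curves, an edge lying on a line is a segment and an edge
   lying on a circle is an arc (or the whole circle, for a loop). *)
Definition carried B (e : edge B) (s : carrier R) : Prop :=
  forall t, 0 <= t <= 1 -> on_carrier s (curve e t).

(* For x = 1 (resp. x = -1): the region i lies along e, on the side to which
   the normal of s (resp. its opposite) points. *)
Definition lies_along B (e : edge B) (s : carrier R) (x : R) i : Prop :=
  forall t, 0 < t < 1 ->
    let q := curve e t in
    let u := normal s q in
    \forall h \near 0^'+, region B i (q.1 + h * x * u.1, q.2 + h * x * u.2).

(* The edge e separates i from j and has signed curvature k when crossed from i
   to j; the sign is positive if e bulges towards i. *)
Definition signed_curvature B (e : edge B) i j (k : R) : Prop :=
  exists2 s, carried e s &
    (lies_along e s 1 i /\ lies_along e s (-1) j /\ k = curvature s) \/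
    (lies_along e s 1 j /\ lies_along e s (-1) i /\ k = - curvature s).

(* The topology behind the continuity of half-variations: B and B' are d-close
   if their edges are at Hausdorff distance at most d and the points at
   distance at least d from the edges of B lie in regions with the same index.
   The combinatorial type may change. *)
Definition close_to (d : R) B B' : Prop :=
  [/\ forall p, support B p -> exists2 q, support B' q & edist p q < d,
      forall q, support B' q -> exists2 p, support B p & edist p q < d &
      forall i p, region B i p -> (forall q, support B q -> d <= edist p q) ->
        region B' i p].

Definition half_variation B (eps : R) (V : R -> complex R n) : Prop :=
  [/\ 0 < eps,
      V 0 = B &
      forall t, 0 <= t < eps -> forall d, 0 < d ->
        exists2 eta, 0 < eta & forall t', 0 <= t' < eps -> `|t' - t| < eta ->
          close_to d (V t) (V t')].

Definition area_preserving B (eps : R) (V : R -> complex R n) : Prop :=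
  forall t m, 0 <= t < eps -> area (V t) m = area B m.

Definition initial_derivative_of_length (V : R -> complex R n) (l : R) : Prop :=
  ((t^-1)%:E * (graph_length (V t) - graph_length (V 0%R)))%E @[t --> 0^'+]
    --> l%:E.

(* Finiteness of the vertices and edges is built into embedded_graph. *)
Record regular B : Prop := Regular {
  regular_faces : finite_set (faces B);
  regular_curvature : forall e : edge B, exists s, carried e s;
  regular_trivalent : forall v : vertex B,
    #|[set d | edge_end d == v]%SET| = 3%N;
  regular_angles : forall d d' : edge B * bool, d != d' ->
    edge_end d = edge_end d' ->
    exists u u', [/\ has_direction d u, has_direction d' u' &
                     dot u u' = cos (2 * pi / 3)];
  regular_pairs : forall i j, i != j -> forall (e e' : edge B) k k',
    signed_curvature e i j k -> signed_curvature e' i j k' -> k = k';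
  regular_stable : forall eps V l, half_variation B eps V ->
    area_preserving B eps V -> initial_derivative_of_length V l -> 0 <= l
}.

(* The path r meets e transversely (away from the vertices) at time t, and k is
   the signed curvature of e for this crossing: the path comes from the side of
   the normal, towards which e bulges, when its velocity v has a negative
   normal component. *)
Definition crossing B (r : R -> plane R) (t k : R) : Prop :=
  exists (e : edge B) (x : R) (s : carrier R) (v : plane R),
    [/\ 0 < x < 1 /\ r t = curve e x,
        carried e s,
        is_derive t 1 r v,
        dot v (normal s (r t)) != 0 &
        k = - Num.sg (dot v (normal s (r t))) * curvature s].

Definition has_pressure B i (P : R) : Prop :=
  exists (r : R -> plane R) (ts : seq R) (k : R -> R),
    [/\ {within `[0, 1], continuous r} /\
        (region B None (r 0) /\ region B i (r 1)),
        uniq ts,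
        forall t, t \in ts <-> 0 <= t <= 1 /\ support B (r t),
        forall t, t \in ts -> crossing B r t (k t) &
        P = \sum_(t <- ts) k t].

Definition equal_pressure_regions B : Prop :=
  exists P, forall m, has_pressure B (Some m) P.

Definition empty_chamber B (C : set (plane R)) : Prop :=
  bounded_set C /\
  exists2 p, region B None p & C = connected_component (region B None) p.

Definition same_areas B B' : Prop := forall m, area B' m = area B m.

Definition perimeter_minimizer B : Prop :=
  forall B', same_areas B B' -> (graph_length B <= graph_length B')%E.

Definition converges_in_length_and_area (A_ : nat -> complex R n) A : Prop :=
  [/\ forall i, regular (A_ i),
      regular A,
      forall m, area (A_ i) m @[i --> \oo] --> area A m &
      graph_length (A_ i) @[i --> \oo] --> graph_length A].

End Complexes.

Definition standard_triple_bubble (R : realType) (B : complex R 3) : Prop :=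
  [/\ regular B,
      #|vertex B| = 4%N,
      #|edge B| = 6%N &
      forall m, connected (region B (Some m))].

(* Main.v *)
Require Import Defs.
From HB Require Import structures.
From mathcomp Require Import all_boot all_order all_algebra.
From mathcomp Require Import all_classical all_reals all_analysis.
From mathcomp Require Import measurable_realfun ring lra.
Require Import Defs.

(** A limit of minimizers is a minimizer: a shorter competitor for the areas of A, scaled down slightly and
completed by tiny lenses far away, would beat some A_i.  So A minimizes, and every edge separates two different
regions, since otherwise it could be cut and shrunk to two small loops.

Pushing the edges sideways by small bumps shows that the curvature of an edge is a difference of pressures, and
scaling that the length is twice the sum of the products of pressure and area.  If all pressures are p, the edges
between interior regions are segments, the exterior edges are arcs of curvature p, and comparison with a disc cut
by three radii bounds p times the length by 2 pi + 15/2.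

Call a dart the side of an edge seen from its left region.  The boundary walks of the interior regions are orbits
of darts.  A flow on the graph that is orthogonal to all of them has a locally constant weighted winding number,
which vanishes as there are no empty chambers; hence there are at least E - V + 1 orbits.  Each has turning a
positive multiple of 2 pi, and the length bound leaves room only for E - V + 1 = #orbits, each of turning 2 pi.
An orbit with n vertices and one exterior arc has arc angle (6 - n) pi / 3, whose chord bounds its segments from
below; with the length bound only three orbits with one exterior arc and three edges remain.  These close up to
the whole graph, which is then a standard triple bubble. *)

Set Implicit Arguments.
Unset Strict Implicit.
Unset Printing Implicit Defensive.

Import Order.TTheory GRing.Theory Num.Theory.
Import numFieldNormedType.Exports.

Local Open Scope classical_set_scope.
Local Open Scope ring_scope.

(** * The plane, areas and lengths *)

(** Every competitor must again be a complex with all degrees at least three, and this dictates its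
    shape: areas are moved by homeomorphisms of the plane or created by a fan of [n + 1] arcs with
    common ends (hence [1 < n]), and a removed edge leaves a loop at each of its ends. The sides of
    an edge are handled locally. A dart knows the region on its left through points on short
    normals, and every point off the graph lies on such a normal: since edges meet at 120 degrees, a
    vertex is never the nearest point of the graph. This ties faces to darts without the Jordan
    curve theorem. Euler's relation enters only as an inequality, obtained from ranks of matrices.
    The opposite inequality comes from length, because an exterior arc turns by [p] times its
    length. The final count is tight: it uses [pi > 61 / 20], and the bound [pi > 3] would leave one
    more configuration. *)

Section PlaneGeometry.
Variable R : realType.
Implicit Types (u v w p q : plane R) (a b c t x y : R).

Definition cross u v : R := u.1 * v.2 - u.2 * v.1.
Definition rot u : plane R := (- u.2, u.1).
Definition ez t : plane R := (cos t, sin t).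

Lemma planeD u v : u + v = (u.1 + v.1, u.2 + v.2). Proof. by []. Qed.
Lemma planeB u v : u - v = (u.1 - v.1, u.2 - v.2). Proof. by []. Qed.
Lemma planeN u : - u = (- u.1, - u.2). Proof. by []. Qed.
Lemma planeZ a u : a *: u = (a * u.1, a * u.2). Proof. by []. Qed.

Lemma plane_eq u v : u.1 = v.1 -> u.2 = v.2 -> u = v.
Proof. by case: u v => [? ?] [? ?] /= -> ->. Qed.

Lemma dot_ge0 u : 0 <= dot u u.
Proof. by rewrite /dot -!expr2 addr_ge0 ?sqr_ge0. Qed.

Lemma enorm_ge0 u : 0 <= enorm u.
Proof. exact: sqrtr_ge0. Qed.

Lemma enorm_sqr u : enorm u ^+ 2 = dot u u.
Proof. by rewrite sqr_sqrtr // dot_ge0. Qed.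

Lemma enormE2 u : enorm u ^+ 2 = u.1 ^+ 2 + u.2 ^+ 2.
Proof. by rewrite enorm_sqr /dot -!expr2. Qed.

Lemma enorm_le u b : 0 <= b -> u.1 ^+ 2 + u.2 ^+ 2 <= b ^+ 2 -> enorm u <= b.
Proof. by move=> b0 h; rewrite -(@ler_pXn2r _ 2) ?nnegrE ?enorm_ge0 // enormE2. Qed.

Lemma enorm_eq0 u : (enorm u == 0) = (u == 0).
Proof.
apply/eqP/eqP => [u0|->]; last by rewrite /enorm /dot /= mulr0 addr0 sqrtr0.
have : u.1 ^+ 2 + u.2 ^+ 2 = 0 by rewrite -enormE2 u0 expr0n.
move/eqP; rewrite paddr_eq0 ?sqr_ge0 // !sqrf_eq0 => /andP[/eqP h1 /eqP h2].
exact: plane_eq.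
Qed.

Lemma enorm0 : enorm (0 : plane R) = 0.
Proof. by apply/eqP; rewrite enorm_eq0. Qed.

Lemma enorm_gt0 u : (0 < enorm u) = (u != 0).
Proof. by rewrite lt_neqAle enorm_ge0 andbT eq_sym enorm_eq0. Qed.

Lemma enormZ a u : enorm (a *: u) = `|a| * enorm u.
Proof.
rewrite /enorm -sqrtr_sqr -sqrtrM ?sqr_ge0 //; congr Num.sqrt.
by rewrite planeZ /dot /=; ring.
Qed.

Lemma enormN u : enorm (- u) = enorm u.
Proof. by rewrite /enorm /dot /= !mulrNN. Qed.

Lemma enormB u v : enorm (u - v) = enorm (v - u).
Proof. by rewrite -enormN opprB. Qed.

Lemma lagrange u v : dot u v ^+ 2 + cross u v ^+ 2 = enorm u ^+ 2 * enorm v ^+ 2.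
Proof. by rewrite !enorm_sqr /dot /cross; ring. Qed.

Lemma dot_le u v : dot u v <= enorm u * enorm v.
Proof.
have h : dot u v ^+ 2 <= (enorm u * enorm v) ^+ 2.
  by rewrite exprMn -lagrange lerDl sqr_ge0.
rewrite (le_trans (ler_norm _)) // -(@ler_pXn2r _ 2) ?nnegrE ?mulr_ge0 ?enorm_ge0 //.
by rewrite real_normK ?num_real.
Qed.

Lemma cross_le u v : cross u v <= enorm u * enorm v.
Proof.
have -> : cross u v = dot (rot u) v by rewrite /cross /dot /rot /=; ring.
apply: le_trans (dot_le _ _) _.
by rewrite /enorm /dot /rot /= mulrNN [u.2 * _ + _]addrC.
Qed.

Lemma norm_dot_le u v : `|dot u v| <= enorm u * enorm v.
Proof.
rewrite ler_norml dot_le andbT lerNl.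
have -> : - dot u v = dot (- u) v by rewrite /dot /=; ring.
by rewrite -[enorm u]enormN dot_le.
Qed.

Lemma norm_cross_le u v : `|cross u v| <= enorm u * enorm v.
Proof.
rewrite ler_norml cross_le andbT lerNl.
have -> : - cross u v = cross (- u) v by rewrite /cross /=; ring.
by rewrite -[enorm u]enormN cross_le.
Qed.

Lemma ler_enormD u v : enorm (u + v) <= enorm u + enorm v.
Proof.
rewrite -(@ler_pXn2r _ 2) ?nnegrE ?addr_ge0 ?enorm_ge0 // sqrrD !enorm_sqr.
have -> : dot (u + v) (u + v) = dot u u + dot u v *+ 2 + dot v v.
  by rewrite /dot /=; ring.
by rewrite lerD2r lerD2l lerMn2r dot_le.
Qed.

Lemma ler_enormB u v : enorm u - enorm v <= enorm (u - v).
Proof. by rewrite lerBlDr -{1}[u](subrK v) ler_enormD. Qed.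

Lemma edist_ge0 p q : 0 <= edist p q. Proof. exact: enorm_ge0. Qed.
Lemma edistxx p : edist p p = 0. Proof. by rewrite /edist subrr enorm0. Qed.
Lemma edistC p q : edist p q = edist q p. Proof. exact: enormB. Qed.
Lemma edist_eq0 p q : (edist p q == 0) = (p == q).
Proof. by rewrite enorm_eq0 subr_eq0. Qed.
Lemma edist_gt0 p q : (0 < edist p q) = (p != q).
Proof. by rewrite enorm_gt0 subr_eq0. Qed.

Lemma edist_triangle q p w : edist p w <= edist p q + edist q w.
Proof. by rewrite /edist -[p - w](subrKA q) ler_enormD. Qed.

Lemma norm_le_enorm u : `|u| <= enorm u.
Proof.
rewrite prod_normE ge_max.
by apply/andP; split; rewrite -(@ler_pXn2r _ 2) ?nnegrE ?enorm_ge0 // enormE2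
  real_normK ?num_real // ?lerDl ?lerDr sqr_ge0.
Qed.

Lemma enorm_le_norm u : enorm u <= `|u| *+ 2.
Proof.
have h1 : `|u.1| <= `|u| by rewrite prod_normE le_max lexx.
have h2 : `|u.2| <= `|u| by rewrite prod_normE le_max lexx orbT.
apply: enorm_le; first by rewrite mulrn_wge0.
rewrite -[u.1 ^+ 2]real_normK ?num_real // -[u.2 ^+ 2]real_normK ?num_real //.
have := normr_ge0 u.1; have := normr_ge0 u.2.
by nra.
Qed.

Lemma norm1_le_enorm u : `|u.1| <= enorm u.
Proof. by apply: le_trans (norm_le_enorm u); rewrite prod_normE le_max lexx. Qed.
Lemma norm2_le_enorm u : `|u.2| <= enorm u.
Proof. by apply: le_trans (norm_le_enorm u); rewrite prod_normE le_max lexx orbT. Qed.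

Lemma enorm_le_sum u : enorm u <= `|u.1| + `|u.2|.
Proof.
apply: enorm_le; first by rewrite addr_ge0.
rewrite -[u.1 ^+ 2]real_normK ?num_real // -[u.2 ^+ 2]real_normK ?num_real //.
have := normr_ge0 u.1; have := normr_ge0 u.2.
by nra.
Qed.

(** The library's norm is the sup norm. It and the Euclidean norm bound each other up to the factor
    2, so Euclidean balls generate the same open sets. *)
Lemma openP (A : set (plane R)) :
  open A <-> forall p, A p -> exists2 e : R, 0 < e & forall q, edist q p < e -> A q.
Proof.
split=> [oA p Ap|h].
  have /nbhs_ballP[e /= e0 he] := open_nbhs_nbhs (conj oA Ap).
  exists e => // q qp; apply: he; rewrite -ball_normE /= distrC.
  exact: le_lt_trans (norm_le_enorm _) qp.
rewrite openE => p /h[e e0 he]; apply/nbhs_ballP; exists (e / 2); first by rewrite /= divr_gt0.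
move=> q; rewrite -ball_normE /= distrC => qp; apply: he.
by rewrite (le_lt_trans (enorm_le_norm _)) // -mulr_natr -ltr_pdivlMr.
Qed.

Lemma continuous_fst : continuous (@fst R R).
Proof. by move=> p; apply: cvg_fst. Qed.

Lemma continuous_snd : continuous (@snd R R).
Proof. by move=> p; apply: cvg_snd. Qed.

Lemma continuous_fst_comp (f : R -> R) : continuous f -> continuous (fun p : plane R => f p.1).
Proof.
by move=> cf p; apply: (@continuous_comp _ _ _ fst f p); [exact: continuous_fst|exact: cf].
Qed.

Section Continuity.
Variables (T : topologicalType).
Implicit Types (f g : T -> plane R).

Lemma continuous_pair (f g : T -> R) z : {for z, continuous f} -> {for z, continuous g} ->
  {for z, continuous (fun z => (f z, g z) : plane R)}.
Proof. by move=> hf hg; apply: (@cvg_pair _ _ _ (nbhs z) (nbhs (f z)) (nbhs (g z))). Qed.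

Lemma cvg_dot (F : set_system T) (FF : Filter F) f g u v :
  f @ F --> u -> g @ F --> v -> (fun z => dot (f z) (g z)) @ F --> dot u v.
Proof.
move=> hf hg; rewrite /dot.
have c1 h w : h @ F --> w -> (fun z => (h z).1) @ F --> w.1.
  by move=> hh; exact: (cvg_comp _ _ hh (@continuous_fst w)).
have c2 h w : h @ F --> w -> (fun z => (h z).2) @ F --> w.2.
  by move=> hh; exact: (cvg_comp _ _ hh (@continuous_snd w)).
by apply: cvgD; apply: cvgM; auto.
Qed.

Lemma cvg_enorm (F : set_system T) (FF : Filter F) f u :
  f @ F --> u -> (fun z => enorm (f z)) @ F --> enorm u.
Proof.
move=> hf; rewrite /enorm.
by apply: (@cvg_comp _ _ _ (fun z => dot (f z) (f z)) Num.sqrt _ (nbhs (dot u u)));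
  [exact: cvg_dot|exact: sqrt_continuous].
Qed.

End Continuity.

Lemma continuous_enorm : continuous (@enorm R).
Proof. by move=> p; apply: cvg_enorm. Qed.

Lemma continuous_edist p : continuous (edist p).
Proof. by move=> q; apply: cvg_enorm; apply: cvgB; [exact: cvg_cst|]. Qed.

Lemma cvg_edistP (T : Type) (F : set_system T) (FF : Filter F) (f : T -> plane R) p :
  f @ F --> p <-> forall e, 0 < e -> \forall t \near F, edist (f t) p < e.
Proof.
split=> [hf e e0|h].
  have /cvgrPdist_lt/(_ (e / 2)) := hf; rewrite divr_gt0 // => /(_ isT).
  apply: filterS => t; rewrite distrC => ht.
  by rewrite (le_lt_trans (enorm_le_norm _)) // -mulr_natr -ltr_pdivlMr.
apply/cvgrPdist_lt => e e0; have := h _ e0; apply: filterS => t ht.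
by rewrite distrC (le_lt_trans (norm_le_enorm _)).
Qed.

Lemma ez_norm t : enorm (ez t) = 1.
Proof. by rewrite /enorm /dot /ez /= -!expr2 cos2Dsin2 sqrtr1. Qed.

Lemma ezD s t : ez (s + t) = cos t *: ez s + sin t *: rot (ez s).
Proof. by rewrite !planeZ /ez /rot planeD; apply: plane_eq => /=; rewrite ?cosD ?sinD; ring. Qed.

Lemma dot_ez s t : dot (ez s) (ez t) = cos (t - s).
Proof. by rewrite cosB /dot /ez /=; ring. Qed.

Lemma cross_ez s t : cross (ez s) (ez t) = sin (t - s).
Proof. by rewrite sinB /cross /ez /=; ring. Qed.

Lemma rot_norm u : enorm (rot u) = enorm u.
Proof. by rewrite /enorm /dot /rot /= mulrNN addrC. Qed.

Lemma ez_rot t : rot (ez t) = ez (t + pi / 2).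
Proof. by rewrite /rot /ez /= cosDpihalf sinDpihalf. Qed.

Lemma ezDpi t : ez (t + pi) = - ez t.
Proof. by apply: plane_eq; rewrite /ez /= ?cosDpi ?sinDpi. Qed.

Lemma decompose u p : enorm u = 1 -> p = dot p u *: u + dot p (rot u) *: rot u.
Proof.
move=> u1; have : u.1 ^+ 2 + u.2 ^+ 2 = 1 by rewrite -enormE2 u1 expr1n.
move=> h; rewrite -[LHS]scale1r -h !planeZ planeD /dot /rot /=.
by apply: plane_eq => /=; ring.
Qed.

Lemma pythagoras u p : enorm u = 1 -> enorm p ^+ 2 = dot p u ^+ 2 + dot p (rot u) ^+ 2.
Proof.
move=> u1; have : u.1 ^+ 2 + u.2 ^+ 2 = 1 by rewrite -enormE2 u1 expr1n.
by move=> h; rewrite -[LHS]mul1r -h enormE2 /dot /rot /=; ring.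
Qed.

Lemma unit_ez u : enorm u = 1 -> exists t, u = ez t.
Proof.
move=> u1; have h : u.1 ^+ 2 + u.2 ^+ 2 = 1 by rewrite -enormE2 u1 expr1n.
have b : -1 <= u.1 <= 1 by have := norm1_le_enorm u; rewrite u1 ler_norml.
have s2 : sin (acos u.1) = `|u.2|.
  rewrite sin_acos // -sqrtr_sqr; congr Num.sqrt; rewrite -h; ring.
case: (leP 0 u.2) => u2.
  by exists (acos u.1); apply: plane_eq; rewrite /= ?acosK // s2 ger0_norm.
by exists (- acos u.1); apply: plane_eq; rewrite /= ?cosN ?sinN ?acosK // s2 ltr0_norm ?opprK.
Qed.

End PlaneGeometry.

(** * Lebesgue measure of the plane and its behaviour under affine maps *)

Section PlaneArea.
Variable R : realType.
Implicit Types (A B : set (plane R)).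

(** The plane as a product of measurable spaces; [meas_plane] and [plane_measure] regard sets of the
    topological plane as subsets of it. *)
Definition mplane := (measurableTypeR R * measurableTypeR R)%type.

Definition plane_measure : {measure set mplane -> \bar R} :=
  (@lebesgue_measure R \x @lebesgue_measure R)%E.

Definition meas_plane A := measurable (A : set mplane).

Lemma plane_areaE A : plane_area A = plane_measure A. Proof. by []. Qed.

Lemma mset_rect (I J : set R) : measurable (I : set (measurableTypeR R)) ->
  measurable (J : set (measurableTypeR R)) -> meas_plane (I `*` J).
Proof. exact: measurableX. Qed.

(** An open set is the countable union of the rational squares that it contains; [F] replaces the
    other squares by the empty set. *)
Lemma open_mset A : open A -> meas_plane A.
Proof.
move=> /openP oA.
pose S (x y r : rat) : set mplane :=
  [set p | `|p.1 - ratr x| < ratr r /\ `|p.2 - ratr y| < ratr r].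
pose F x y r := if `[< S x y r `<=` (A : set mplane) >] then S x y r else set0.
have -> : A = \bigcup_x \bigcup_y \bigcup_r F x y r.
  apply/seteqP; split=> [p Ap|p [x _ [y _ [r _]]]]; last first.
    by rewrite /F; case: asboolP => // h /h.
  have [e e0 he] := oA p Ap.
  have [r /andP[r0 re]] : exists r : rat, 0 < (ratr r : R) < e / 4.
    by have [r] := @rat_in_itvoo R 0 (e / 4) ltac:(lra);
      rewrite in_itv /= => h; exists r.
  have [x /andP[x1 x2]] : exists x : rat, p.1 - ratr r < (ratr x : R) < p.1 + ratr r.
    have [|x] := @rat_in_itvoo R (p.1 - ratr r) (p.1 + ratr r); first by lra.
    by rewrite in_itv /= => h; exists x.
  have [y /andP[y1 y2]] : exists x : rat, p.2 - ratr r < (ratr x : R) < p.2 + ratr r.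
    have [|y] := @rat_in_itvoo R (p.2 - ratr r) (p.2 + ratr r); first by lra.
    by rewrite in_itv /= => h; exists y.
  exists x => //; exists y => //; exists r => //; rewrite /F.
  have Sp : S x y r p by rewrite /S /= !ltr_norml; split; apply/andP; split; lra.
  case: asboolP => // hh; exfalso; apply: hh => q [q1 q2]; apply: he.
  rewrite /edist (le_lt_trans (enorm_le_sum _)) //.
  move: Sp q1 q2; rewrite /S /= !ltr_norml => -[/andP[? ?] /andP[? ?]] /andP[? ?] /andP[? ?].
  have h1 : `|(q - p).1| < 2 * (e / 4) by rewrite planeB /= ltr_norml; apply/andP; split; lra.
  have h2 : `|(q - p).2| < 2 * (e / 4) by rewrite planeB /= ltr_norml; apply/andP; split; lra.
  lra.
apply: bigcupT_measurable_rat => x; apply: bigcupT_measurable_rat => y.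
apply: bigcupT_measurable_rat => r; rewrite /F; case: asboolP => // _.
have -> : S x y r = (ball (ratr x : R) (ratr r) `*` ball (ratr y : R) (ratr r) : set mplane).
  by apply/seteqP; split=> p; rewrite /S -!ball_normE /= ![`|ratr _ - _|]distrC.
by apply: mset_rect; apply: measurable_ball.
Qed.

Lemma closed_mset A : closed A -> meas_plane A.
Proof.
move=> cA; have : meas_plane (~` A) by apply: open_mset; exact: closed_openC.
by move/measurableC; rewrite setCK.
Qed.

Lemma continuous_mfun (f : plane R -> plane R) : continuous f ->
  measurable_fun [set: mplane] (f : mplane -> mplane).
Proof.
move=> cf.
have mf (g : plane R -> R) : continuous g ->
    measurable_fun [set: mplane] (g : mplane -> measurableTypeR R).
  move=> cg; apply: (measurability _ (RGenOpens.measurableE R)) => _ [_ [a [b ->]] <-].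
  rewrite setTI; apply: open_mset.
  by apply: open_comp; [move=> x _; exact: cg|exact: interval_open].
have -> : (f : mplane -> mplane) = (fun p => ((f p).1, (f p).2)).
  by apply/funext => p; case: (f p).
apply: measurable_fun_pair; apply: mf => p.
  by apply: (@continuous_comp _ _ _ f fst p (cf p)); apply: continuous_fst.
by apply: (@continuous_comp _ _ _ f snd p (cf p)); apply: continuous_snd.
Qed.

Lemma mset_preimage (f : plane R -> plane R) A : continuous f -> meas_plane A -> meas_plane (f @^-1` A).
Proof.
move=> cf mA; have := continuous_mfun cf measurableT mA.
by rewrite setTI.
Qed.

Lemma plane_area_ge0 A : (0 <= plane_area A)%E.
Proof. by apply: integral_ge0 => x _; apply: measure_ge0. Qed.

Lemma le_plane_area A B : meas_plane A -> meas_plane B -> A `<=` B -> (plane_area A <= plane_area B)%E.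
Proof. by move=> mA mB AB; apply: (@le_measure _ _ _ plane_measure); rewrite ?inE. Qed.

Lemma plane_areaU A B : meas_plane A -> meas_plane B -> A `&` B = set0 ->
  plane_area (A `|` B) = (plane_area A + plane_area B)%E.
Proof. by move=> mA mB AB; apply: (@measureU _ _ _ plane_measure). Qed.

Lemma plane_area_null A B : meas_plane A -> meas_plane B -> plane_area B = 0%E ->
  A `<=` B -> plane_area A = 0%E.
Proof.
move=> mA mB B0 AB; apply/eqP; rewrite eq_le plane_area_ge0 andbT -B0.
exact: le_plane_area.
Qed.

Lemma plane_areaU_null A B : meas_plane A -> meas_plane B -> plane_area B = 0%E ->
  plane_area (A `|` B) = plane_area A.
Proof.
move=> mA mB B0; apply: (@measureU0 _ _ _ plane_measure) => //.
Qed.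

Lemma plane_area_rect (I J : set R) : measurable (I : set (measurableTypeR R)) ->
  measurable (J : set (measurableTypeR R)) ->
  plane_area (I `*` J) = (lebesgue_measure (I : set (measurableTypeR R)) *
                          lebesgue_measure (J : set (measurableTypeR R)))%E.
Proof. exact: product_measure1E. Qed.

Lemma plane_area_box (a b c d : R) : a <= b -> c <= d ->
  plane_area (`[a, b]%classic `*` `[c, d]%classic) = ((b - a) * (d - c))%:E.
Proof.
move=> ab cd; rewrite plane_area_rect //; try exact: measurable_itv.
rewrite !lebesgue_measure_itv /= !lte_fin.
move: ab cd; rewrite !le_eqVlt => /orP[/eqP->|ab] /orP[/eqP->|cd];
by rewrite ?ltxx ?ab ?cd ?subrr ?mulr0 ?mul0r ?mul0e ?mule0 // -!EFinB -EFinM.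
Qed.

Lemma plane_area_setT : plane_area [set: plane R] = +oo%E.
Proof.
rewrite -setXTT plane_area_rect //.
have -> : lebesgue_measure [set: measurableTypeR R] = +oo%E.
  have -> : [set: measurableTypeR R] = [set` `]-oo, +oo[] by apply/seteqP; split => x //= _; rewrite in_itv.
  by rewrite lebesgue_measure_itv.
by rewrite mulyy.
Qed.

(** Lebesgue measure is determined by its values on half-open intervals, and the image measure has
    the same values there. [lebesgue_scale] is obtained in the same way. *)
Lemma lebesgue_translate (c : R) (X : set (measurableTypeR R)) : measurable X ->
  lebesgue_measure ((fun x => x + c) @^-1` X : set (measurableTypeR R)) = lebesgue_measure X.
Proof.
move=> mX.
have mf : measurable_fun [set: measurableTypeR R] ((fun x => x + c) : measurableTypeR R -> measurableTypeR R).
  by apply: continuous_measurable_fun => x; apply: cvgD; [exact: cvg_id|exact: cvg_cst].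
symmetry; apply: (@lebesgue_measure_unique R (pushforward (@lebesgue_measure R) (fun x : measurableTypeR R => x + c : measurableTypeR R)) _ X mX).
move=> _ [[a b] _ <-]; rewrite /= /pushforward.
have -> : ((fun x : R => x + c) @^-1` `]a, b]) = `]a - c, b - c]%classic.
  by apply/seteqP; split => x /=; rewrite !in_itv /= => /andP[? ?]; apply/andP; split; lra.
rewrite !lebesgue_measure_itv /= !lte_fin ltrD2r; case: ifP => // _.
by rewrite -!EFinB; congr EFin; ring.
Qed.

Lemma lebesgue_scale (c : R) (X : set (measurableTypeR R)) : 0 < c -> measurable X ->
  (c%:E * lebesgue_measure ((fun x => c * x)%R @^-1` X : set (measurableTypeR R)))%E = lebesgue_measure X.
Proof.
move=> c0 mX.
have mf : measurable_fun [set: measurableTypeR R] ((fun x => c * x) : measurableTypeR R -> measurableTypeR R).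
  by apply: continuous_measurable_fun => x; apply: cvgM; [exact: cvg_cst|exact: cvg_id].
symmetry; apply: (@lebesgue_measure_unique R
  (mscale (NngNum (ltW c0)) (pushforward (@lebesgue_measure R) (fun x : measurableTypeR R => c * x : measurableTypeR R))) _ X mX).
move=> _ [[a b] _ <-]; rewrite /= /mscale /= /pushforward.
have -> : ((fun x : R => c * x) @^-1` `]a, b]) = `]a / c, b / c]%classic.
  by apply/seteqP; split => x /=; rewrite !in_itv /= ltr_pdivrMr // ler_pdivlMr // [x * c]mulrC.
rewrite !lebesgue_measure_itv /= !lte_fin ltr_pM2r ?invr_gt0 //; case: ifP => // _; last by rewrite mule0.
by rewrite -!EFinB -EFinM; congr EFin; field; rewrite gt_eqF.
Qed.

(** A product measure is determined by its values on rectangles, so the effect of [f] on areas need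
    only be known for them. *)
Lemma plane_area_unique (f : plane R -> plane R) (k : R) A : 0 <= k -> continuous f -> meas_plane A ->
  (forall I J : set (measurableTypeR R), measurable I -> measurable J ->
    (k%:E * plane_area (f @^-1` (I `*` J)))%E = (lebesgue_measure I * lebesgue_measure J)%E) ->
  (k%:E * plane_area (f @^-1` A))%E = plane_area A.
Proof.
move=> k0 cf mA h.
have mf := continuous_mfun cf.
symmetry; rewrite /plane_area.
exact: (@product_measure_unique _ _ _ _ _ _ _
  (mscale (NngNum k0) (pushforward plane_measure (f : mplane -> mplane)))).
Qed.

Lemma plane_area_translate (v : plane R) A : meas_plane A ->
  plane_area ((fun p => p + v) @^-1` A) = plane_area A.
Proof.
move=> mA; rewrite -[LHS]mul1e; apply: plane_area_unique => //.
  by move=> p; apply: cvgD; [exact: cvg_id|exact: cvg_cst].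
move=> I J mI mJ; rewrite mul1e.
have -> : (fun p : plane R => p + v) @^-1` (I `*` J) =
   ((fun x => x + v.1) @^-1` I) `*` ((fun x => x + v.2) @^-1` J) by [].
have mf (c : R) : measurable_fun [set: measurableTypeR R] ((fun x => x + c) : measurableTypeR R -> measurableTypeR R).
  by apply: continuous_measurable_fun => x; apply: cvgD; [exact: cvg_id|exact: cvg_cst].
have mp (c : R) (K : set (measurableTypeR R)) : measurable K -> measurable ((fun x => x + c) @^-1` K : set (measurableTypeR R)).
  by move=> mK; have := mf c measurableT _ mK; rewrite setTI.
by rewrite plane_area_rect ?lebesgue_translate //; apply: mp.
Qed.

Lemma plane_area_scale (c : R) A : 0 < c -> meas_plane A ->
  ((c ^+ 2)%:E * plane_area ((fun p => c *: p) @^-1` A))%E = plane_area A.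
Proof.
move=> c0 mA; apply: plane_area_unique => //; first exact: sqr_ge0.
  by move=> p; apply: cvgZr; exact: cvg_id.
move=> I J mI mJ.
have -> : (fun p : plane R => c *: p) @^-1` (I `*` J) =
   ((fun x => c * x) @^-1` I) `*` ((fun x => c * x) @^-1` J) by [].
have mf : measurable_fun [set: measurableTypeR R] ((fun x => c * x) : measurableTypeR R -> measurableTypeR R).
  by apply: continuous_measurable_fun => x; apply: cvgM; [exact: cvg_cst|exact: cvg_id].
have mp (K : set (measurableTypeR R)) : measurable K -> measurable ((fun x => c * x) @^-1` K : set (measurableTypeR R)).
  by move=> mK; have := mf measurableT _ mK; rewrite setTI.
rewrite plane_area_rect; try exact: mp.
by rewrite -(lebesgue_scale c0 mI) -(lebesgue_scale c0 mJ) expr2 EFinM -!muleA; congr (_ * _)%E; rewrite muleCA.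
Qed.

(** By Fubini: on each vertical section the shear is a translation. *)
Lemma plane_area_shear (c : R) A : meas_plane A ->
  plane_area ((fun p : plane R => (p.1, p.2 + c * p.1) : plane R) @^-1` A) = plane_area A.
Proof.
move=> mA; rewrite /plane_area /product_measure1; apply: eq_integral => x _ /=.
have mx := measurable_xsection x (mA : measurable (A : set mplane)).
by rewrite -[RHS](lebesgue_translate (c * x)) //; congr lebesgue_measure; apply/seteqP; split=> y; rewrite /xsection /= !inE.
Qed.

Lemma plane_area_swap A : meas_plane A ->
  plane_area ((fun p : plane R => (p.2, p.1) : plane R) @^-1` A) = plane_area A.
Proof.
move=> mA; rewrite -[LHS]mul1e; apply: plane_area_unique => //.
  by move=> p; apply: continuous_pair; [exact: continuous_snd|exact: continuous_fst].
move=> I J mI mJ; rewrite mul1e.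
have -> : (fun p : plane R => (p.2, p.1) : plane R) @^-1` (I `*` J) = J `*` I.
  by apply/seteqP; split=> p /= [].
by rewrite plane_area_rect // muleC.
Qed.

End PlaneArea.
Arguments meas_plane {R} A.

(** * The support of a graph and the components of its complement *)

Section GraphTopology.
Variable R : realType.
Implicit Types (p q : plane R).

Lemma within_of_continuous (T : topologicalType) (A : set R) (f : R -> T) :
  continuous f -> {within A, continuous f}.
Proof. by move=> cf; apply: continuous_subspaceT. Qed.

Lemma within_comp (T U : topologicalType) (A : set R) (f : R -> T) (h : T -> U) :
  {within A, continuous f} -> continuous h -> {within A, continuous (h \o f)}.
Proof.
move=> cf ch x; have H := @continuous_comp (subspace A) T U f h x (cf x).
by apply: H; exact: ch.
Qed.

Definition seg p q (t : R) : plane R := p + t *: (q - p).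

Lemma seg0 p q : seg p q 0 = p.
Proof. by rewrite /seg scale0r addr0. Qed.

Lemma seg1 p q : seg p q 1 = q.
Proof. by rewrite /seg scale1r addrC subrK. Qed.

Lemma seg_continuous p q : continuous (seg p q).
Proof.
move=> t; apply: cvgD; first exact: cvg_cst.
by apply: cvgZl; exact: cvg_id.
Qed.

Lemma edist_seg p q t : edist (seg p q t) p = `|t| * edist q p.
Proof. by rewrite /edist /seg addrAC subrr add0r enormZ. Qed.

Lemma connected_path (f : R -> plane R) (a b : R) :
  {within `[a, b], continuous f} -> connected (f @` `[a, b]).
Proof. by move=> cf; apply: connected_continuous_connected => //; exact: segment_connected. Qed.

Lemma connected_seg p q : connected (seg p q @` `[0, 1]).
Proof. by apply: connected_path; apply: within_of_continuous; exact: seg_continuous. Qed.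

Lemma component_max (A B : set (plane R)) p : connected B -> B p -> B `<=` A ->
  forall q, B q -> connected_component A p q.
Proof. by move=> cB Bp BA; exact: connected_component_max. Qed.

Lemma open_component (A : set (plane R)) p : open A -> open (connected_component A p).
Proof.
move=> /openP oA; apply/openP => q Cq.
have Aq : A q := connected_component_sub Cq.
have [e e0 he] := oA q Aq; exists e => // z zq.
have sub : seg q z @` `[0, 1] `<=` A.
  move=> _ [t t01 <-]; move: t01; rewrite /= in_itv /= => /andP[t0 t1]; apply: he.
  rewrite edist_seg ger0_norm //; apply: le_lt_trans zq.
  by apply: ler_piMl => //; exact: edist_ge0.
have h := component_max (@connected_seg q z) _ sub.
apply: (connected_component_trans Cq); apply: h.
  by exists 0; rewrite ?seg0 //= in_itv /= lexx ler01.
by exists 1; rewrite ?seg1 //= in_itv /= lexx ler01.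
Qed.

Lemma path_compact (T : topologicalType) (f : R -> T) (a b : R) :
  {within `[a, b], continuous f} -> compact (f @` `[a, b]).
Proof. by move=> cf; apply: continuous_compact => //; exact: segment_compact. Qed.

Lemma plane_hausdorff : hausdorff_space (plane R).
Proof. exact: norm_hausdorff. Qed.

Variable G : embedded_graph R.

Lemma supportE : support G =
  (range (@position R G)) `|` \bigcup_(e in [set: edge G]) (@curve R G e @` `[0, 1]).
Proof.
apply/seteqP; split=> p.
  case=> [[v ->]|[e [t [t01 ->]]]]; first by left; exists v.
  by right; exists e => //; exists t.
case=> [[v _ <-]|[e _ [t t01 <-]]]; first by left; exists v.
by right; exists e, t; split => //; move: t01; rewrite /= in_itv.
Qed.

Lemma compact_support : compact (support G).
Proof.
rewrite supportE; apply: compactU.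
  by apply: finite_compact; apply: finite_image; exact: finite_finset.
have -> : \bigcup_(e in [set: edge G]) (@curve R G e @` `[0, 1]) =
   \big[setU/set0]_(e <- enum (edge G)) (@curve R G e @` `[0, 1]).
  rewrite -bigcup_seq; congr bigcup.
  by apply/seteqP; split=> e //= _; rewrite mem_enum.
by apply: bigsetU_compact => e _; apply: path_compact; exact: curve_continuous.
Qed.

Lemma closed_support : closed (support G).
Proof. by apply: compact_closed => //; exact: compact_support. Qed.

Lemma open_complement : open (~` support G).
Proof. by apply: closed_openC; exact: closed_support. Qed.

Lemma bounded_support : exists2 M : R, 0 < M & forall p, support G p -> enorm p < M.
Proof.
have /compact_bounded[M [_ hM]] := compact_support.
pose N := Num.max M 0 + 1.
have hN p : support G p -> `|p| <= N.
  by apply: hM; rewrite /N ltr_pwDr // le_max lexx.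
exists (N *+ 2 + 1) => [|p /hN pN].
  have : 0 <= Num.max M 0 by rewrite le_max lexx orbT.
  by rewrite /N; lra.
have := enorm_le_norm p; lra.
Qed.

End GraphTopology.

Section Regions.
Variables (R : realType) (n : nat) (B : complex R n).
Implicit Types (i j : option 'I_n) (p q : plane R).

Lemma region_compl i p : region B i p -> ~ support B p.
Proof. by move=> h; have : (\bigcup_i region B i) p by [exists i]; rewrite region_cover. Qed.

Lemma region_exists p : ~ support B p -> exists i, region B i p.
Proof. by move=> h; have : (~` support B) p by []; rewrite -region_cover => -[i _]; exists i. Qed.

Lemma region_uniq i j p : region B i p -> region B j p -> i = j.
Proof. by move=> hi hj; apply: (@region_disjoint _ _ B i j) => //; exists p. Qed.

Lemma region_connected (C : set (plane R)) i p : connected C -> C p -> region B i p ->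
  (forall q, C q -> ~ support B q) -> C `<=` region B i.
Proof.
move=> cC Cp ip CS; apply: subset_trans (region_faces ip).
exact: component_max.
Qed.

Lemma open_region i : open (region B i).
Proof.
apply/openP => p ip.
have oC := @open_component R _ p (@open_complement R B).
have /openP/(_ p) := oC; have Cp : connected_component (~` support B) p p.
  by apply: connected_component_refl; exact: region_compl ip.
by move=> /(_ Cp)[e e0 he]; exists e => // q /he /(region_faces ip).
Qed.

Lemma region_seg i p q : region B i p ->
  (forall t, 0 <= t <= 1 -> ~ support B (seg p q t)) -> region B i q.
Proof.
move=> ip h.
have hs : seg p q @` `[0, 1] `<=` region B i.
  apply: (@region_connected _ i p) => //; first exact: connected_seg.
    by exists 0; rewrite ?seg0 //= in_itv /= lexx ler01.
  by move=> _ [t t01 <-]; apply: h; move: t01; rewrite /= in_itv.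
by apply: hs; exists 1; rewrite ?seg1 //= in_itv /= lexx ler01.
Qed.

End Regions.

(** * Complexes from disjoint open regions *)

Section MakeComplex.
Variables (R : realType) (n : nat) (G : embedded_graph R).
Variables (reg : option 'I_n -> set (plane R)) (a : 'I_n -> R).
Hypothesis reg_open : forall i, open (reg i).
Hypothesis reg_disj : forall i j p, reg i p -> reg j p -> i = j.
Hypothesis reg_cover : forall p, ~ support G p <-> exists i, reg i p.
Hypothesis a_gt0 : forall m, 0 < a m.
Hypothesis reg_area : forall m, plane_area (reg (Some m)) = (a m)%:E.

Lemma support_area_fin : (plane_area (support G) < +oo)%E.
Proof.
have [M M0 hM] := bounded_support G.
apply: (@le_lt_trans _ _ (plane_area (`[-M, M]%classic `*` `[-M, M]%classic))).
  apply: le_plane_area; first by apply: closed_mset; exact: closed_support.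
    by apply: mset_rect; exact: measurable_itv.
  move=> p /hM pM; have := norm1_le_enorm p; have := norm2_le_enorm p.
  rewrite !ler_norml => /andP[? ?] /andP[? ?].
  by split; rewrite /= in_itv /=; apply/andP; split; lra.
by rewrite plane_area_box ?ltry //; lra.
Qed.

(** A face is connected and is covered by the disjoint open sets [reg j], so it meets only one of
    them. *)
Lemma mk_regions_faces i p : reg i p ->
  connected_component (~` support G) p `<=` reg i.
Proof.
move=> ip q.
set C := connected_component _ p => Cq.
have Cp : C p by apply: connected_component_refl; apply/reg_cover; exists i.
have CC : connected C by exact: component_connected.
apply: contrapT => niq.
have sC z : C z -> ~ support G z by apply: connected_component_sub.
pose V := \bigcup_(j in [set j | j <> i]) reg j.
have oV : open V by apply: bigcup_open => j _.
have h : C `&` reg i = C; last by move: Cq; rewrite -h => -[].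
apply: CC.
- by exists p.
- by exists (reg i).
- exists (~` V); first by apply: open_closedC.
  apply/seteqP; split=> z [Cz hz]; split => //.
    by case=> j jni /reg_disj/(_ hz).
  have /reg_cover[j jz] := sC z Cz.
  case: (pselect (j = i)) => [<- //|jni].
  by exfalso; apply: hz; exists j.
Qed.

(** The whole plane has infinite area, while the compact support and the finitely many interior
    regions have finite area. *)
Lemma mk_exterior_area : plane_area (reg None) = +oo%E.
Proof.
have mr i : meas_plane (reg i) by apply: open_mset; exact: reg_open.
have : plane_area [set: plane R] = +oo%E by exact: plane_area_setT.
have -> : [set: plane R] = reg None `|` (support G `|` \big[setU/set0]_(m < n) reg (Some m)).
  apply/seteqP; split=> // p _.
  case: (pselect (support G p)) => sp; first by right; left.
  have /reg_cover[[m|] mp] := sp; last by left.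
  by right; right; rewrite (bigD1 m) //=; left.
move=> h; apply: contrapT => /eqP; rewrite -ltey => fin.
have mS : meas_plane (support G) by apply: closed_mset; exact: closed_support.
have mb : meas_plane (\big[setU/set0]_(m < n) reg (Some m)).
  by apply: bigsetU_measurable => m _; exact: mr.
have : (plane_area (reg None `|` (support G `|` \big[setU/set0]_(m < n) reg (Some m))) <
   +oo)%E.
  have mSb := @measurableU _ (mplane R) _ _ mS mb.
  apply: le_lt_trans (@measureU2 _ _ _ (plane_measure R) _ _ (mr None) mSb) _.
  apply: lte_add_pinfty; first exact: fin.
  apply: le_lt_trans (@measureU2 _ _ _ (plane_measure R) _ _ mS mb) _.
  apply: lte_add_pinfty; first exact: support_area_fin.
  have Hs : forall s : seq 'I_n, meas_plane (\big[setU/set0]_(m <- s) reg (Some m)) /\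
      (plane_measure R (\big[setU/set0]_(m <- s) reg (Some m)) < +oo)%E.
    elim=> [|m s [ms fs]]; first by rewrite big_nil measure0; split => //; exact: measurable0.
    rewrite big_cons; split; first exact: (@measurableU _ (mplane R) _ _ (mr (Some m)) ms).
    apply: le_lt_trans (@measureU2 _ _ _ (plane_measure R) _ _ (mr (Some m)) ms) _.
    have e : (plane_area (reg (Some m)) < +oo)%E by rewrite reg_area ltry.
    by apply: lte_add_pinfty; [exact: e|exact: fs].
  by have [] := Hs (index_enum 'I_n).
by rewrite h ltxx.
Qed.

(** Saves the constructions below two fields of [complex]: that regions are unions of faces, and
    that the exterior has infinite area, follow from the rest. *)
Definition mk_complex : complex R n.
Proof.
apply: (@Complex R n G reg a) => //.
- by apply/seteqP; split=> p; [move=> [i _ ip]; apply/reg_cover; exists i|move/reg_cover => [i ip]; exists i].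
- by move=> i j _ _ [p [ip jp]]; exact: reg_disj ip jp.
- exact: mk_regions_faces.
- exact: mk_exterior_area.
Defined.

End MakeComplex.

(** * Derivatives of real functions *)

Section Calculus.
Variable R : realType.
Implicit Types (f g : R -> R) (x a b c : R).

Lemma der_eq f x a b : is_derive x 1 f a -> a = b -> is_derive x 1 f b.
Proof. by move=> h <-. Qed.

Lemma der_cst c x : is_derive x 1 (fun _ : R => c) 0.
Proof. exact: is_derive_cst. Qed.

Lemma der_id x : is_derive x 1 (fun y : R => y) 1.
Proof. exact: is_derive_id. Qed.

Lemma der_D f g x a b : is_derive x 1 f a -> is_derive x 1 g b ->
  is_derive x 1 (fun y => f y + g y) (a + b).
Proof. by move=> hf hg; exact: is_deriveD. Qed.

Lemma der_N f x a : is_derive x 1 f a -> is_derive x 1 (fun y => - f y) (- a).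
Proof. by move=> hf; exact: is_deriveN. Qed.

Lemma der_B f g x a b : is_derive x 1 f a -> is_derive x 1 g b ->
  is_derive x 1 (fun y => f y - g y) (a - b).
Proof. by move=> hf hg; exact: is_deriveB. Qed.

Lemma der_M f g x a b : is_derive x 1 f a -> is_derive x 1 g b ->
  is_derive x 1 (fun y => f y * g y) (a * g x + f x * b).
Proof.
move=> hf hg; apply: der_eq (is_deriveM hf hg) _.
by rewrite /GRing.scale /= addrC [g x * a]mulrC.
Qed.

Lemma der_Z c f x a : is_derive x 1 f a -> is_derive x 1 (fun y => c * f y) (c * a).
Proof. by move=> hf; apply: der_eq (der_M (der_cst c x) hf) _; rewrite mul0r add0r. Qed.

Lemma der_sqr f x a : is_derive x 1 f a -> is_derive x 1 (fun y => f y ^+ 2) (2 * f x * a).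
Proof.
move=> hf; have -> : (fun y => f y ^+ 2) = (fun y => f y * f y) by apply/funext => y; rewrite expr2.
by apply: der_eq (der_M hf hf) _; ring.
Qed.

Lemma der_comp f g x a b : is_derive x 1 f a -> is_derive (f x) 1 g b ->
  is_derive x 1 (fun y => g (f y)) (b * a).
Proof. by move=> hf hg; exact: (@is_derive1_comp R g f x b a hg hf). Qed.

Lemma der_sin f x a : is_derive x 1 f a -> is_derive x 1 (fun y => sin (f y)) (cos (f x) * a).
Proof. by move=> hf; apply: der_comp hf _. Qed.

Lemma der_cos f x a : is_derive x 1 f a -> is_derive x 1 (fun y => cos (f y)) (- sin (f x) * a).
Proof. by move=> hf; apply: der_comp hf _. Qed.

Lemma der_cont f x a : is_derive x 1 f a -> {for x, continuous f}.
Proof.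
by move=> [df _]; apply: differentiable_continuous; apply/derivable1_diffP.
Qed.

Lemma der_le (f df : R -> R) (s t : R) : s <= t -> (forall x, s <= x <= t -> is_derive x 1 f (df x)) ->
  (forall x, s <= x <= t -> 0 <= df x) -> f s <= f t.
Proof.
move=> st hd hn; case: (eqVneq s t) => [->//|nst].
have lst : s < t by rewrite lt_neqAle nst.
have hd' x : x \in `]s, t[ -> is_derive x 1 f (df x).
  by rewrite in_itv /= => /andP[? ?]; apply: hd; rewrite !ltW.
have cf : {within `[s, t], continuous f}.
  apply: continuous_in_subspaceT => x; rewrite inE /= in_itv /= => xst.
  exact: der_cont (hd x xst).
have [c cst e] := MVT lst hd' cf.
rewrite -subr_ge0 e mulr_ge0 ?subr_ge0 //; apply: hn.
by move: cst; rewrite in_itv /= => /andP[? ?]; rewrite !ltW.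
Qed.

End Calculus.

(** * Areas between graphs, and null sets *)

Section AreaUnderGraph.
Variable R : realType.

Definition between (a b : R) (u v : R -> R) : set (plane R) :=
  [set p | a < p.1 < b /\ u p.1 < p.2 < v p.1].

Lemma open_between (a b : R) (u v : R -> R) : continuous u -> continuous v ->
  open (between a b u v).
Proof.
move=> cu cv.
have op (f g : plane R -> R) : continuous f -> continuous g -> open [set p | f p < g p].
  move=> cf cg; have -> : [set p | f p < g p] = (fun p => g p - f p) @^-1` [set x | 0 < x].
    by apply/seteqP; split=> p /=; rewrite subr_gt0.
  by apply: open_comp; [move=> p _; apply: cvgB; [exact: cg|exact: cf]|exact: open_gt].
have -> : between a b u v = ([set p | a < p.1] `&` [set p | p.1 < b]) `&`
    ([set p | u p.1 < p.2] `&` [set p | p.2 < v p.1]).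
  apply/seteqP; split=> p; rewrite /between /=.
    by move=> [/andP[? ?] /andP[? ?]].
  by move=> [[-> ->] [-> ->]].
have cc (x : R) : continuous (fun _ : plane R => x) by move=> p; exact: cvg_cst.
by apply: openI; apply: openI; apply: op => //;
  try exact: continuous_fst; try exact: continuous_snd; exact: continuous_fst_comp.
Qed.

(** Fubini over the vertical sections, followed by the fundamental theorem of calculus. *)
Lemma area_between (a b : R) (u v F : R -> R) : a < b ->
  continuous u -> continuous v ->
  (forall x, a < x < b -> u x <= v x) ->
  {within `[a, b], continuous F} ->
  (forall x, a < x < b -> is_derive x 1 F (v x - u x)) ->
  plane_area (between a b u v) = (F b - F a)%:E.
Proof.
move=> ab cu cv uv cF dF.
have cvu : continuous (fun x => v x - u x) by move=> x; apply: cvgB; [exact: cv|exact: cu].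
transitivity (\int[@lebesgue_measure R]_(x in `]a, b[) ((v x - u x)%:E))%E; last first.
  rewrite integral_itv_bndo_bndc ?integral_itv_obnd_cbnd //; last 2 first.
  - by apply/measurable_EFinP; apply: measurable_funTS; exact: continuous_measurable_fun.
  - by apply/measurable_EFinP; apply: measurable_funTS; exact: continuous_measurable_fun.
  rewrite (@continuous_FTC2 _ _ F) //.
  - by apply: within_of_continuous.
  - have /continuous_within_itvP := cF => /(_ ab)[_ F1 F2].
    split => // x; rewrite in_itv /= => xab.
    by have [] := dF x xab.
  - move=> x; rewrite in_itv /= => xab; have := dF x xab => dFx.
    by rewrite derive1E derive_val.
rewrite /plane_area /product_measure1 [RHS]integral_mkcond.
apply: eq_integral => x _ /=; rewrite /patch mem_setE.
have -> : xsection (between a b u v) x = if a < x < b then `]u x, v x[%classic else set0.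
  rewrite /xsection; apply/seteqP; split=> y /=; rewrite inE /between /=.
    by move=> [-> ?]; rewrite /= in_itv.
  by case: ifP => // -> ; rewrite /= in_itv.
rewrite in_itv /=; case: ifP => xab; last by rewrite measure0.
rewrite lebesgue_measure_itv /= lte_fin -EFinB.
by have := uv x xab; rewrite le_eqVlt => /orP[/eqP->|->//]; rewrite ltxx subrr.
Qed.

Lemma le_area_cover (A : set (plane R)) (N : nat) (c : nat -> plane R) (d : R) :
  0 <= d -> meas_plane A ->
  (forall p, A p -> exists2 k, (k < N)%N & edist p (c k) <= d) ->
  (plane_area A <= (N%:R * (4 * d ^+ 2))%:E)%E.
Proof.
move=> d0 mA h.
pose bx k : set (mplane R) := `[(c k).1 - d, (c k).1 + d]%classic `*` `[(c k).2 - d, (c k).2 + d]%classic.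
have mb k : measurable (bx k) by apply: mset_rect; exact: measurable_itv.
have mU : measurable (\big[setU/set0]_(k < N) bx k) by apply: bigsetU_measurable.
apply: (@le_trans _ _ (plane_measure R (\big[setU/set0]_(k < N) bx k))).
  apply: le_plane_area => // p /h[k kN pk].
  rewrite (bigD1 (Ordinal kN)) //=; left.
  have := norm1_le_enorm (p - c k); have := norm2_le_enorm (p - c k).
  rewrite -/(edist _ _) planeB /= => h2 h1.
  have {}h1 := le_trans h1 pk; have {}h2 := le_trans h2 pk.
  by split; rewrite /= in_itv /=; move: h1 h2; rewrite !ler_norml => /andP[? ?] /andP[? ?]; apply/andP; split; lra.
apply: le_trans (@Boole_inequality _ _ _ (plane_measure R) bx N (fun k _ => mb k)) _ => //.
rewrite (eq_bigr (fun=> (4 * d ^+ 2)%:E)); last first.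
  move=> k _; have := @plane_area_box R ((c k).1 - d) ((c k).1 + d) ((c k).2 - d) ((c k).2 + d).
  rewrite -[X in _ -> X]/(plane_area (bx k) = _) => ->; [congr EFin; ring|lra|lra].
by rewrite sumEFin lee_fin sumr_const card_ord -[_ *+ N]mulr_natl.
Qed.

(** The [N + 2] points with parameters [k / (N + 1)] come within [C / (N + 1)] of every point of the
    curve, so squares around them cover it with total area of order [1 / N]. *)
Lemma null_lipschitz (g : R -> plane R) (C : R) : {within `[0, 1], continuous g} ->
  (forall s t, 0 <= s <= 1 -> 0 <= t <= 1 -> edist (g s) (g t) <= C * `|s - t|) ->
  plane_area (g @` `[0, 1]) = 0%E.
Proof.
move=> cg hg.
have mA : meas_plane (g @` `[0, 1]).
  apply: closed_mset; apply: compact_closed; [exact: plane_hausdorff|exact: path_compact].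
have C0 : 0 <= C.
  have := hg 0 1; rewrite !lexx ler01 /= => /(_ isT isT).
  rewrite sub0r normrN normr1 mulr1; exact/le_trans/edist_ge0.
apply/eqP; rewrite eq_le plane_area_ge0 andbT; apply/lee_addgt0Pr => e e0; rewrite add0e.
(* The [N + 2] squares of side [2 * C / (N + 1)] have total area at most [8 * C ^+ 2 / (N + 1)], as
   [N + 2] is at most [2 * (N + 1)]. *)
have [N hN] : exists N : nat, 8 * C ^+ 2 / e < N.+1%:R.
  by have := truncnS_gt (8 * C ^+ 2 / e); exists (Num.truncn (8 * C ^+ 2 / e)).
have N0 : (0 : R) < N.+1%:R by rewrite ltr0n.
have hA p : (g @` `[0, 1]) p -> exists2 k, (k < N.+2)%N & edist p (g (k%:R / N.+1%:R)) <= C / N.+1%:R.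
  move=> [t t01 <-]; move: t01; rewrite /= in_itv /= => /andP[t0 t1].
  have tN0 : 0 <= t * N.+1%:R by apply: mulr_ge0 => //; exact: ltW.
  have /andP[k1 k2] := truncn_itv tN0.
  set k := Num.truncn _ in k1 k2.
  have kN : (k <= N.+1)%N.
    by rewrite -(ler_nat R); apply: le_trans k1 _; rewrite ler_piMl ?ler0n.
  exists k => //.
  have k01 : 0 <= (k%:R / N.+1%:R : R) <= 1.
    by rewrite divr_ge0 ?ler0n //= ler_pdivrMr // mul1r ler_nat.
  apply: le_trans (hg _ _ _ k01) _; first by rewrite t0.
  apply: ler_wpM2l => //.
  have kt : k%:R / N.+1%:R <= t by rewrite ler_pdivrMr.
  have kt' : t <= (k.+1)%:R / N.+1%:R by rewrite ler_pdivlMr // ltW.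
  rewrite ger0_norm ?subr_ge0 // lerBlDl.
  by move: kt'; rewrite -natr1 mulrDl mul1r.
apply: le_trans (le_area_cover _ mA hA) _; first by rewrite divr_ge0 // ltW.
rewrite lee_fin.
have -> : N.+2%:R * (4 * (C / N.+1%:R) ^+ 2) = (4 * C ^+ 2) * (N.+2%:R / N.+1%:R) / N.+1%:R.
  by field; rewrite gt_eqF.
rewrite ler_pdivrMr // -ler_pdivrMl // mulrC.
have h2 : N.+2%:R / N.+1%:R <= (2 : R).
  by rewrite ler_pdivrMr // -natrM ler_nat mulSn mul1n addnS ltnS leq_addr.
apply: le_trans (ltW hN).
rewrite ler_pM2r ?invr_gt0 //.
have -> : 8 * C ^+ 2 = 4 * C ^+ 2 * 2 by ring.
by apply: ler_wpM2l => //; apply: mulr_ge0 => //; exact: sqr_ge0.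
Qed.

End AreaUnderGraph.

(** * Lengths of curves *)

Section Length.
Variable R : realType.
Implicit Types (g : R -> plane R).

Lemma partition_nth (s : seq R) k : itv_partition 0 1 s -> (k < size s)%N ->
  0 <= nth 1 (0 :: s) k /\ nth 1 (0 :: s) k <= nth 1 (0 :: s) k.+1 /\ nth 1 (0 :: s) k.+1 <= 1.
Proof.
move=> ps ks; have [sp lst] := ps.
have h1 : sorted <=%R (0 :: s).
  by apply: (@sub_path _ <%R <=%R _ 0 s sp) => x y /ltW.
have mono i j : (i <= j)%N -> (j <= size s)%N -> nth 1 (0 :: s) i <= nth 1 (0 :: s) j.
  move=> ij js; apply: (sorted_leq_nth (@le_trans _ _) (@lexx _ _) 1 h1) => //; rewrite inE /= ltnS //.
  exact: leq_trans js.
split; first by rewrite -[X in X <= _]/(nth 1 (0 :: s) 0); apply: mono => //; exact: ltnW.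
split; first exact: mono.
have e1 : nth 1 (0 :: s) (size s) = 1.
  by rewrite -[size s]/(size (0 :: s)).-1 nth_last /=; move/eqP: lst.
by rewrite -[X in _ <= X]e1; apply: mono.
Qed.

Lemma partition_last (s : seq R) : itv_partition 0 1 s -> nth 1 (0 :: s) (size s) = 1.
Proof. by case=> _ /eqP lst; rewrite -[size s]/(size (0 :: s)).-1 nth_last. Qed.

(** [L] acts as an upper estimate of the arc length function: over any partition its increments
    telescope. *)
Lemma curve_length_le g (L : R -> R) :
  (forall s t, 0 <= s -> s <= t -> t <= 1 -> edist (g t) (g s) <= L t - L s) ->
  (curve_length g <= (L 1 - L 0)%:E)%E.
Proof.
move=> h; apply: ge_ereal_sup => _ [s ps <-]; rewrite lee_fin /polygon_length.
apply: (@le_trans _ _ (\sum_(0 <= k < size s) (L (nth 1 (0 :: s) k.+1) - L (nth 1 (0 :: s) k)))).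
  rewrite !big_nat; apply: ler_sum => k /andP[_ ks].
  by have [h1 [h2 h3]] := partition_nth ps ks; apply: h.
by rewrite telescope_sumr // partition_last.
Qed.

Lemma curve_length_ge0 g : (0 <= curve_length g)%E.
Proof.
apply: le_trans (ereal_sup_ubound _); last first.
  by exists [:: 1] => //; split; rewrite /= ?ltr01 ?andbT.
by rewrite lee_fin; apply: sumr_ge0 => k _; exact: edist_ge0.
Qed.

Lemma curve_length_ge_partition g N (h : nat -> R) : (0 < N)%N -> h 0 = 0 -> h N = 1 ->
  (forall k, (k < N)%N -> h k < h k.+1) ->
  ((\sum_(0 <= k < N) edist (g (h k.+1)) (g (h k)))%:E <= curve_length g)%E.
Proof.
case: N => // N _ h0 h1 hS; set M := N.+1 in h1 hS *.
pose s := [seq h k | k <- iota 1 M].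
have sz : size s = M by rewrite size_map size_iota.
have nths k : (k <= M)%N -> nth 1 (0 :: s) k = h k.
  case: k => [|k] kM; first by rewrite h0.
  by rewrite -[LHS]/(nth 1 s k) (nth_map 0%N) ?size_iota // nth_iota // add1n.
apply: le_trans (ereal_sup_ubound _); last first.
  exists s; last by [].
  split; last by rewrite -[last 0 s]/(last 1 (0 :: s)) -nth_last; apply/eqP; rewrite [(size _).-1]sz nths.
  apply/(pathP 1) => i; rewrite sz => iM.
  by rewrite -[nth 1 s i]/(nth 1 (0 :: s) i.+1) !nths //; [exact: hS|exact: ltnW].
rewrite lee_fin /polygon_length sz le_eqVlt; apply/orP; left; apply/eqP.
by rewrite !big_nat; apply: eq_bigr => k /andP[_ kM] /=; rewrite -[nth 1 s k]/(nth 1 (0 :: s) k.+1) !nths // ltnW.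
Qed.

Lemma curve_length_lip (h : plane R -> plane R) (C : R) g : 0 < C ->
  (forall p q, edist (h p) (h q) <= C * edist p q) ->
  (curve_length (h \o g) <= C%:E * curve_length g)%E.
Proof.
move=> C0 hh; apply: ge_ereal_sup => _ [s ps <-].
apply: (@le_trans _ _ (C%:E * (polygon_length g s)%:E)%E); last first.
  by apply: lee_wpmul2l; [rewrite lee_fin ltW|apply: ereal_sup_ubound; exists s].
rewrite -EFinM lee_fin /polygon_length mulr_sumr; apply: ler_sum => k _; exact: hh.
Qed.

End Length.

(** * Limits of minimizers *)

Section HomeoComplex.
Variables (R : realType) (n : nat) (B : complex R n).
Variables (h g : plane R -> plane R).
Hypotheses (ch : continuous h) (cg : continuous g) (hK : cancel h g) (gK : cancel g h).

Lemma homeo_curve_continuous (e : edge B) : {within `[0, 1], continuous (h \o curve e)}.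
Proof.
by apply: within_comp => //; exact: curve_continuous.
Qed.

Lemma homeo_curve_inj (e e' : edge B) t t' : 0 < t < 1 -> 0 < t' < 1 ->
  (h \o curve e) t = (h \o curve e') t' -> e = e' /\ t = t'.
Proof. by move=> ? ? /(can_inj hK); exact: curve_inj. Qed.

Lemma homeo_curve_vertex (e : edge B) t (v : vertex B) : 0 < t < 1 ->
  (h \o curve e) t <> (h \o @position R B) v.
Proof. by move=> ? /(can_inj hK); exact: curve_vertex. Qed.

Definition homeo_graph : embedded_graph R :=
  @EmbeddedGraph R (vertex B) (edge B) (h \o @position R B) (@edge_end R B)
    (fun e => h \o curve e) (inj_comp (can_inj hK) (@position_inj R B))
    homeo_curve_continuous
    (fun e => congr1 h (curve0 e)) (fun e => congr1 h (curve1 e))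
    homeo_curve_inj homeo_curve_vertex (@degree_ge3 R B).

Lemma homeo_support p : support homeo_graph p <-> support B (g p).
Proof.
split=> [[[v ->]|[e [t [t01 ->]]]]|[[v gv]|[e [t [t01 gt]]]]].
- by left; exists v; rewrite /= hK.
- by right; exists e, t; rewrite /= hK.
- by left; exists v; rewrite /= -gv gK.
- by right; exists e, t; split => //; rewrite /= -gt gK.
Qed.

(** All topological conditions pass to the image under a homeomorphism, so only areas and lengths
    remain to be computed. Both the scalings and the bumps of the first variation are of this
    kind. *)
Lemma homeo_complex (a : 'I_n -> R) :
  (forall m, 0 < a m) ->
  (forall m, plane_area (g @^-1` region B (Some m)) = (a m)%:E) ->
  exists B' : complex R n, (forall m, area B' m = a m) /\
    graph_length B' = (\sum_(e : edge B) curve_length (h \o curve e))%E.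
Proof.
move=> a0 ha.
have o i : open (g @^-1` region B i).
  by apply: open_comp; [move=> p _; exact: cg|exact: open_region].
have d i j p : (g @^-1` region B i) p -> (g @^-1` region B j) p -> i = j by exact: region_uniq.
have c p : ~ support homeo_graph p <-> exists i, (g @^-1` region B i) p.
  rewrite homeo_support; split; first exact: region_exists.
  by move=> [i ip]; exact: region_compl ip.
by exists (mk_complex o d c a0 ha).
Qed.

End HomeoComplex.

Section FarExterior.
Variables (R : realType) (n : nat) (B : complex R n).

(** The half-plane to the right of the graph is connected, hence lies in one region, and its
    infinite area makes this region the exterior. *)
Lemma far_half_plane : exists2 M : R, 0 < M &
  (forall p, M <= p.1 -> region B None p) /\ forall p, support B p -> p.1 < M.
Proof.
have [M M0 hM] := bounded_support B.
have sM p : support B p -> p.1 < M.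
  by move=> /hM; apply: le_lt_trans; apply: le_trans (norm1_le_enorm p); exact: ler_norm.
exists M => //; split => //.
have [i iM] : exists i, region B i (M, 0).
  by apply: region_exists => /sM; rewrite ltxx.
have sub p : M <= p.1 -> region B i p.
  move=> Mp; apply: (region_seg iM) => t /andP[t0 t1] /sM.
  by rewrite /seg planeD planeZ /= ltNge; case/negP; nra.
case: i iM sub => // m mM sub; exfalso.
have : (plane_area (`[M, +oo[%classic `*` [set: R]) <= plane_area (region B (Some m)))%E.
  apply: le_plane_area.
  - by apply: mset_rect.
  - by apply: open_mset; exact: open_region.
  - by move=> p [] /=; rewrite in_itv /= andbT => /sub.
rewrite interior_area plane_area_rect //.
have -> : lebesgue_measure [set: measurableTypeR R] = +oo%E.
  have -> : [set: measurableTypeR R] = [set` `]-oo, +oo[] by apply/seteqP; split => x //= _; rewrite in_itv.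
  by rewrite lebesgue_measure_itv.
have -> : lebesgue_measure (`[M, +oo[%classic : set (measurableTypeR R)) = +oo%E.
  by rewrite lebesgue_measure_itv /= ltry.
by rewrite mulyy.
Qed.

End FarExterior.

(** * A fan of lenses in the far exterior *)

Section FanGraph.
Variables (R : realType) (n : nat) (B : complex R n).
Variables (M X w : R) (c : nat -> R).
Hypothesis n_gt1 : (1 < n)%N.
Hypothesis far : forall p, M <= p.1 -> region B None p.
Hypothesis near : forall p, support B p -> p.1 < M.
Hypotheses (MX : M < X) (w_gt0 : 0 < w).
Hypothesis c0 : c 0 = 0.
Hypothesis c_incr : {homo c : i j / (i < j)%N >-> i < j}.

Let f (x : R) := ((x - X) / w) * (1 - (x - X) / w).

Definition fan_position (v : vertex B + bool) : plane R :=
  match v with inl v => position v | inr b => (X + (if b then w else 0), 0) end.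

Definition fan_end (d : (edge B + 'I_n.+1) * bool) : vertex B + bool :=
  match d.1 with inl e => inl (edge_end (e, d.2)) | inr j => inr d.2 end.

(** The [n + 1] parabolic arcs have common ends and heights proportional to [c j]; consecutive arcs
    bound the lens given to one region. Since [1 < n], both ends have degree at least three. *)
Definition fan_curve (e : edge B + 'I_n.+1) : R -> plane R :=
  match e with inl e => curve e | inr j => fun t => (X + w * t, c j * (t * (1 - t))) end.

Lemma fan_c_inj : injective c.
Proof.
move=> i j cij; case: (ltngtP i j) => // /c_incr; rewrite cij ltxx //.
Qed.

Lemma fan_near_position v : (@position R B v).1 < M.
Proof. by apply: near; left; exists v. Qed.

Lemma fan_near_curve e t : 0 <= t <= 1 -> (@curve R B e t).1 < M.
Proof. by move=> t01; apply: near; right; exists e, t. Qed.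

Lemma fan_position_inj : injective fan_position.
Proof.
have MX' := MX; have w0 := w_gt0; move=> [v|b] [v'|b'] /=.
- by move/position_inj => ->.
- by move=> h; have := fan_near_position v; rewrite h /=; case: b' {h} => h; exfalso; lra.
- by move=> h; have := fan_near_position v'; rewrite -h /=; case: b {h} => h; exfalso; lra.
- by case: b b' => -[] //= [] h; exfalso; lra.
Qed.

Lemma fan_curve_continuous e : {within `[0, 1], continuous (fan_curve e)}.
Proof.
case: e => [e|j] /=; first exact: curve_continuous.
apply: within_of_continuous => t.
apply: (@continuous_pair _ _ (fun t => X + w * t) (fun t => c j * (t * (1 - t)))).
  by apply: cvgD; [exact: cvg_cst|apply: cvgM; [exact: cvg_cst|exact: cvg_id]].
apply: cvgM; first exact: cvg_cst.
by apply: cvgM; [exact: cvg_id|apply: cvgB; [exact: cvg_cst|exact: cvg_id]].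
Qed.

Lemma fan_curve0 e : fan_curve e 0 = fan_position (fan_end (e, false)).
Proof. by case: e => [e|j] /=; rewrite ?curve0 // mulr0 mul0r mulr0. Qed.

Lemma fan_curve1 e : fan_curve e 1 = fan_position (fan_end (e, true)).
Proof. by case: e => [e|j] /=; rewrite ?curve1 // mulr1 subrr !mulr0. Qed.

Lemma fan_curve_inj e e' t t' : 0 < t < 1 -> 0 < t' < 1 ->
  fan_curve e t = fan_curve e' t' -> e = e' /\ t = t'.
Proof.
have MX' := MX; have w0 := w_gt0; have oc x : 0 < x < 1 -> 0 <= x <= (1 : R) by move=> /andP[? ?]; rewrite !ltW.
case: e e' => [e|j] [e'|j'] /= h h'.
- by case/(curve_inj h h') => -> ->.
- move=> e1; have := fan_near_curve e (oc _ h); rewrite e1 /=.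
  by case/andP: h' => ? ? ?; exfalso; nra.
- move=> e1; have := fan_near_curve e' (oc _ h'); rewrite -e1 /=.
  by case/andP: h => ? ? ?; exfalso; nra.
- move=> [] /addrI /(mulfI (lt0r_neq0 w_gt0)) tt; subst t' => e1; split=> //.
  have t0 : t * (1 - t) != 0 by case/andP: h => ? ?; rewrite gt_eqF // mulr_gt0 // subr_gt0.
  by have := mulIf t0 e1 => /fan_c_inj /val_inj ->.
Qed.

Lemma fan_curve_vertex e t v : 0 < t < 1 -> fan_curve e t <> fan_position v.
Proof.
have MX' := MX; have w0 := w_gt0; move=> h; have h' : 0 <= t <= 1 by case/andP: h => ? ?; rewrite !ltW.
case: e v => [e|j] [v|b] /=.
- exact: curve_vertex.
- by move=> e1; have := fan_near_curve e h'; rewrite e1 /=; case: b {e1} => ?; lra.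
- move=> e1; have := fan_near_position v; rewrite -e1 /=; case/andP: h => ? ? ?; nra.
- by case/andP: h => ? ?; case: b => -[] h1 _; nra.
Qed.

Lemma fan_degree v : (3 <= #|[set d | fan_end d == v]%SET|)%N.
Proof.
case: v => [v|b].
  apply: leq_trans (degree_ge3 v) _.
  pose g (d : edge B * bool) : (edge B + 'I_n.+1) * bool := (inl d.1, d.2).
  have gi : injective g by move=> [e b] [e' b'] [-> ->].
  rewrite -(card_imset _ gi); apply: subset_leq_card.
  apply/fintype.subsetP => y /imsetP[[e b]]; rewrite inE => /eqP ev ->.
  by rewrite inE /fan_end /= ev.
pose g (j : 'I_n.+1) : (edge B + 'I_n.+1) * bool := (inr j, b).
have gi : injective g by move=> j j' [->].
apply: (@leq_trans #|[set g j | j in 'I_n.+1]%SET|).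
  by rewrite card_imset // card_ord ltnS.
by apply: subset_leq_card; apply/fintype.subsetP => _ /imsetP[j _ ->]; rewrite inE.
Qed.

Definition fan_graph : embedded_graph R :=
  @EmbeddedGraph R (vertex B + bool)%type (edge B + 'I_n.+1)%type fan_position fan_end fan_curve
    fan_position_inj fan_curve_continuous fan_curve0 fan_curve1 fan_curve_inj
    fan_curve_vertex fan_degree.

Definition fan_region (i : option 'I_n) : set (plane R) :=
  match i with
  | Some m => region B (Some m) `|` between X (X + w) (fun x => c m * f x) (fun x => c m.+1 * f x)
  | None => region B None `&` ~` [set p | X <= p.1 <= X + w /\ 0 <= p.2 <= c n * f p.1]
  end.

Lemma fan_f_continuous : continuous f.
Proof.
move=> x; have h : {for x, continuous (fun x => (x - X) / w)}.
  by apply: cvgM; [apply: cvgB; [exact: cvg_id|exact: cvg_cst]|exact: cvg_cst].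
by apply: cvgM; [exact: h|apply: cvgB; [exact: cvg_cst|exact: h]].
Qed.

Lemma fan_cf_continuous a : continuous (fun x => a * f x).
Proof. by move=> x; apply: cvgM; [exact: cvg_cst|exact: fan_f_continuous]. Qed.

Lemma fan_f_gt0 x : X < x < X + w -> 0 < f x.
Proof.
move=> /andP[h1 h2]; rewrite /f mulr_gt0 //; first by rewrite divr_gt0 // subr_gt0.
by rewrite subr_gt0 ltr_pdivrMr // mul1r ltrBlDl.
Qed.

Lemma fan_f_ends : f X = 0 /\ f (X + w) = 0.
Proof. by rewrite /f subrr !mul0r addrAC subrr add0r divff ?gt_eqF // subrr mulr0. Qed.

Lemma fan_supportP p : support fan_graph p <-> support B p \/
  exists2 j : 'I_n.+1, X <= p.1 <= X + w & p.2 = c j * f p.1.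
Proof.
split.
  case=> [[[v|b] ->]|[[e|j] [t [t01 ->]]]] /=.
  - by left; left; exists v.
  - right; exists ord0; rewrite /= ?c0 ?mul0r //.
    by case: b; rewrite ?addr0 lexx ?lerDl ltW.
  - by left; right; exists e, t.
  - right; exists j; rewrite /=.
      by have w0 := w_gt0; case/andP: t01 => ? ?; apply/andP; split; nra.
    rewrite /f; have -> : (X + w * t - X) / w = t by field; rewrite gt_eqF.
    by [].
case=> [[[v ->]|[e [t [t01 ->]]]]|[j /andP[h1 h2] h3]].
- by left; exists (inl v).
- by right; exists (inl e), t.
- right; exists (inr j), ((p.1 - X) / w); split.
    by apply/andP; split; [apply: divr_ge0; [rewrite subr_ge0|exact: ltW]|rewrite ler_pdivrMr // mul1r lerBlDl].
  by apply: plane_eq => /=; [field; rewrite gt_eqF|rewrite h3].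
Qed.

Lemma fan_region_open i : open (fan_region i).
Proof.
case: i => [m|] /=.
  by apply: openU; [exact: open_region|apply: open_between; exact: fan_cf_continuous].
apply: openI; first exact: open_region.
apply: closed_openC.
have -> : [set p | X <= p.1 <= X + w /\ 0 <= p.2 <= c n * f p.1] =
  ((fun p : plane R => p.1) @^-1` [set x | X <= x <= X + w]) `&`
  (((fun p : plane R => p.2) @^-1` [set y | 0 <= y]) `&`
   ((fun p : plane R => c n * f p.1 - p.2) @^-1` [set y | 0 <= y])).
  apply/seteqP; split=> p /=; rewrite subr_ge0; first by move=> [? /andP[? ?]].
  by move=> [-> [-> ->]].
apply: closedI; last apply: closedI.
- apply: closed_comp; first by move=> p _; exact: continuous_fst.
  have -> : [set x | X <= x <= X + w] = [set x | X <= x] `&` [set x | x <= X + w].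
    by apply/seteqP; split=> x /=; [move=> /andP[]|move=> [-> ->]].
  by apply: closedI; [exact: closed_ge|exact: closed_le].
- by apply: closed_comp; [move=> p _; exact: continuous_snd|exact: closed_ge].
- apply: closed_comp; last exact: closed_ge.
  move=> p _; apply: cvgB; last exact: continuous_snd.
  by have := continuous_fst_comp (@fan_cf_continuous (c n)); apply.
Qed.

Lemma fan_between_far m p : between X (X + w) (fun x => c m * f x) (fun x => c m.+1 * f x) p ->
  region B None p.
Proof. by move=> [/andP[h _] _]; apply: far; apply/ltW/(lt_trans MX). Qed.

Lemma fan_c_le i j : (i <= j)%N -> c i <= c j.
Proof. by rewrite leq_eqVlt => /orP[/eqP->//|/c_incr/ltW]. Qed.

Lemma fan_between_K (m : 'I_n) p : between X (X + w) (fun x => c m * f x) (fun x => c m.+1 * f x) p ->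
  X <= p.1 <= X + w /\ 0 <= p.2 <= c n * f p.1.
Proof.
move=> [/andP[h1 h2] /andP[h3 h4]]; have f0 := fan_f_gt0 (introT andP (conj h1 h2)).
split; first by rewrite !ltW.
apply/andP; split.
  have cm : 0 <= c m by rewrite -c0; apply: fan_c_le.
  by apply: le_trans (ltW h3); apply: mulr_ge0 => //; exact: ltW.
by apply: le_trans (ltW h4) _; rewrite ler_pM2r //; apply: fan_c_le.
Qed.

Lemma fan_region_disj i j p : fan_region i p -> fan_region j p -> i = j.
Proof.
have aux (m : 'I_n) : fan_region (Some m) p -> fan_region None p -> False.
  move=> [h|h] [h1 h2]; first by have := region_uniq h h1.
  by apply: h2; exact: fan_between_K h.
case: i j => [m|] [m'|] //.
- move=> [h|h] [h'|h'].
  + exact: region_uniq h h'.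
  + by have := region_uniq h (fan_between_far h').
  + by have := region_uniq h' (fan_between_far h).
  + congr Some; apply: val_inj; case: h h' => [xw /andP[h1 h2]] [_ /andP[h3 h4]].
    have f0 := fan_f_gt0 xw.
    case: (ltngtP m m') => //= mm; exfalso.
      have : c m.+1 * f p.1 <= c m' * f p.1 by rewrite ler_pM2r //; apply: fan_c_le.
      by move=> h; have := lt_le_trans h2 h; rewrite ltNge (ltW h3).
    have : c m'.+1 * f p.1 <= c m * f p.1 by rewrite ler_pM2r //; apply: fan_c_le.
    by move=> h; have := lt_le_trans h4 h; rewrite ltNge (ltW h1).
- by move=> h h'; case: (aux m h h').
- by move=> h h'; case: (aux m' h' h).
Qed.

Lemma fan_region_cover p : ~ support fan_graph p <-> exists i, fan_region i p.
Proof.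
rewrite fan_supportP; split; last first.
  move=> [[m|] h] [sp|[j xw yj]].
  - case: h => [/region_compl/(_ sp)//|/fan_between_far/region_compl/(_ sp)//].
  - case: h => [h|[xw' /andP[h1 h2]]].
      have Mp : M <= p.1 by case/andP: xw => x1 _; exact: ltW (lt_le_trans MX x1).
      by have := region_uniq h (far Mp).
    have f0 := fan_f_gt0 xw'.
    move: h1 h2; rewrite yj !ltr_pM2r // => h1 h2.
    case: (leqP j m) => jm; first by have := fan_c_le jm; rewrite leNgt h1.
    by have := fan_c_le jm; rewrite leNgt h2.
  - by case: h => /region_compl/(_ sp).
  - case: h => _ /=; apply; split=> //; rewrite yj.
    have f0 : 0 <= f p.1.
      case/andP: xw => x1 x2.
      case: (eqVneq X p.1) => [<-|n1]; first by have [-> _] := fan_f_ends.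
      case: (eqVneq p.1 (X + w)) => [->|n2]; first by have [_ ->] := fan_f_ends.
      by apply/ltW/fan_f_gt0; rewrite !lt_neqAle n1 n2 x1.
    have cj : 0 <= c j by rewrite -c0; apply: fan_c_le.
    rewrite mulr_ge0 //=.
    by apply: ler_wpM2r => //; apply: fan_c_le; rewrite -ltnS.
move=> h; have sp : ~ support B p by move=> ?; apply: h; left.
have hj (j : 'I_n.+1) : X <= p.1 <= X + w -> p.2 <> c j * f p.1.
  by move=> xw e; apply: h; right; exists j.
have [[m|] mp] := region_exists sp; first by exists (Some m); left.
case: (pselect (X <= p.1 <= X + w /\ 0 <= p.2 <= c n * f p.1)) => [|K]; last by exists None.
move=> [xw /andP[y0 yn]].
have : exists m : nat, (m < n)%N /\ c m * f p.1 < p.2 < c m.+1 * f p.1.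
  have : forall k, (k <= n)%N -> p.2 <= c k * f p.1 -> exists m : nat, (m < n)%N /\ c m * f p.1 < p.2 < c m.+1 * f p.1.
    elim=> [_|k IH kn yk].
      rewrite c0 mul0r => y1; have := hj ord0 xw; rewrite /= c0 mul0r.
      by move=> e; exfalso; apply: e; apply/eqP; rewrite eq_le y1.
    case: (leP p.2 (c k * f p.1)) => [|yk']; first by apply: IH; apply: ltnW.
    exists k; split=> //; rewrite yk' lt_neqAle yk andbT; apply/eqP.
    have kn' : (k.+1 < n.+1)%N by rewrite ltnS.
    exact: (hj (Ordinal kn') xw).
  by apply; first exact: leqnn.
move=> [m [mn /andP[h1 h2]]]; exists (Some (Ordinal mn)); right.
split; last by rewrite h1.
case/andP: xw; rewrite !le_eqVlt => /orP[/eqP x1|->] /orP[/eqP x2|->] //; exfalso.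
- by move: h1 h2; rewrite -x1; have [-> _] := fan_f_ends; rewrite !mulr0 => ? ?; lra.
- by move: h1 h2; rewrite -x1; have [-> _] := fan_f_ends; rewrite !mulr0 => ? ?; lra.
- by move: h1 h2; rewrite x2; have [_ ->] := fan_f_ends; rewrite !mulr0 => ? ?; lra.
Qed.

Lemma fan_area m :
  plane_area (fan_region (Some m)) = (area B m + (c m.+1 - c m) * w / 6)%:E.
Proof.
rewrite /= plane_areaU.
- rewrite interior_area EFinD; congr (_ + _)%E.
  (* With [s = (x - X) / w] the height of the lens is a multiple of [s * (1 - s)], whose integral
     over [0, 1] is 1 / 6. *)
  pose F x := (c m.+1 - c m) * (w * (((x - X) / w) ^+ 2 / 2 - ((x - X) / w) ^+ 3 / 3)).
  have dF (x : R) : is_derive x 1 F (c m.+1 * f x - c m * f x).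
    have d1 : is_derive x 1 (fun x : R => (x - X) / w) (w^-1).
      apply: der_eq (der_M (der_B (der_id x) (der_cst X x)) (der_cst w^-1 x)) _; ring.
    have d2 := der_sqr d1; have d3 := der_M d1 d2.
    have -> : F = (fun x => (c m.+1 - c m) * (w * (((x - X) / w) ^+ 2 * 2^-1 - (x - X) / w * ((x - X) / w) ^+ 2 * 3^-1))).
      by apply/funext => y; rewrite /F; ring.
    apply: der_eq (der_Z _ (der_Z _ (der_B (der_M d2 (der_cst _ x)) (der_M d3 (der_cst _ x))))) _.
    rewrite /f; field; exact: lt0r_neq0.
  rewrite (@area_between _ _ _ _ _ F) //.
  + congr EFin; rewrite /F subrr mul0r addrAC subrr add0r divff ?gt_eqF //; by field.
  + by rewrite ltrDl.
  + exact: fan_cf_continuous.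
  + exact: fan_cf_continuous.
  + by move=> x /fan_f_gt0 f0; rewrite ler_pM2r //; apply: fan_c_le.
  + apply: within_of_continuous => x; apply: differentiable_continuous.
    by apply/derivable1_diffP; have [] := dF x.
- by apply: open_mset; exact: open_region.
- by apply: open_mset; apply: open_between; exact: fan_cf_continuous.
- by apply/seteqP; split=> p // -[h /fan_between_far] /(region_uniq h).
Qed.

Lemma fan_length : (graph_length fan_graph <= graph_length B + (n.+1%:R * (w + c n))%:E)%E.
Proof.
rewrite /graph_length big_sumType /=; apply: leeD2l.
apply: (@le_trans _ _ (\sum_(j < n.+1) (w + c n)%:E)%E); last first.
  by rewrite sumEFin lee_fin sumr_const card_ord -[_ *+ _]mulr_natl.
apply: lee_sum => j _.
have -> : w + c n = (w + c n) * 1 - (w + c n) * 0 by rewrite mulr0 mulr1 subr0.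
apply: curve_length_le => s t s0 st t1.
have cj0 : 0 <= c j by rewrite -c0; apply: fan_c_le.
have cjn : c j <= c n by apply: fan_c_le; rewrite -ltnS.
apply: le_trans (enorm_le_sum _) _; rewrite planeB /=.
have -> : X + w * t - (X + w * s) = w * (t - s) by ring.
have -> : c j * (t * (1 - t)) - c j * (s * (1 - s)) = (c j * (1 - s - t)) * (t - s) by ring.
have ts : 0 <= t - s by lra.
have b1 : `|1 - s - t| <= 1 by rewrite ler_norml; apply/andP; split; lra.
rewrite !normrM (ger0_norm ts) (gtr0_norm w_gt0) (ger0_norm cj0).
have h : c j * `|1 - s - t| <= c n by apply: le_trans cjn; apply: ler_piMr.
have := ler_wpM2r ts h; lra.
Qed.

End FanGraph.

Section AddArea.
Variables (R : realType) (n : nat).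

(** The bound [eta] depends on [n] and [delta] only, not on the complex; this is what allows
    comparison with late members of a sequence. *)
Lemma add_small_areas (delta : R) : (1 < n)%N -> 0 < delta -> exists2 eta : R, 0 < eta &
  forall (B : complex R n) (a : 'I_n -> R), (forall m, 0 < a m < eta) ->
  exists B' : complex R n, (forall m, area B' m = area B m + a m) /\
    (graph_length B' <= graph_length B + delta%:E)%E.
Proof.
move=> n1 d0; have n0 : (0 : R) < n.+1%:R by rewrite ltr0n.
(* Each of the [n + 1] arcs has length at most [w + c n], hence at most [2 * w]. *)
pose w : R := delta / (2 * n.+1%:R).
have w0 : 0 < w by rewrite divr_gt0 // mulr_gt0.
exists (w ^+ 2 / (6 * n.+1%:R)); first by rewrite divr_gt0 ?exprn_gt0 // mulr_gt0.
move=> B a ha; have [M M0 [far near]] := far_half_plane B.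
(* The increment [6 * a m / w] gives the lens of region [m] the area [a m]. The default 1, for [k]
   at least [n], keeps [c] increasing. *)
pose s (k : nat) : R := if insub k is Some m then a m * 6 / w else 1.
pose c (k : nat) : R := \sum_(i < k) s i.
have s0 k : 0 < s k.
  rewrite /s; case: insubP => [m _ _|//]; case/andP: (ha m) => h _.
  by rewrite divr_gt0 // mulr_gt0.
have cS k : c k.+1 = c k + s k by rewrite /c big_ord_recr.
have c0 : c 0 = 0 by rewrite /c big_ord0.
have cinc : {homo c : i j / (i < j)%N >-> i < j}.
  move=> i j; elim: j => // j IH; rewrite ltnS leq_eqVlt => /orP[/eqP->|/IH h].
    by rewrite cS ltrDl.
  by rewrite cS (lt_trans h) // ltrDl.
have sm (m : 'I_n) : s m = a m * 6 / w by rewrite /s valK.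
have cn : c n <= w.
  apply: (@le_trans _ _ (\sum_(i < n) w / n.+1%:R)); last first.
    rewrite sumr_const card_ord -[_ *+ _]mulr_natl mulrCA; apply: ler_piMr; first exact: ltW.
    by rewrite ler_pdivrMr // mul1r ler_nat.
  apply: ler_sum => m _; rewrite sm; case/andP: (ha m) => _ h.
  rewrite ler_pdivrMr // -ler_pdivlMr //; apply: le_trans (ltW h) _.
  by rewrite le_eqVlt; apply/orP; left; apply/eqP; field; rewrite gt_eqF.
have MX : M < M + 1 by rewrite ltrDl.
have fo := @fan_region_open R n B (M + 1) w c.
have fd := @fan_region_disj R n B M (M + 1) w c far MX w0 c0 cinc.
have fc := @fan_region_cover R n B M (M + 1) w c n1 far near MX w0 c0 cinc.
have aE m : plane_area (fan_region B (M + 1) w c (Some m)) = (area B m + a m)%:E.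
  rewrite (@fan_area R n B M) // cS sm; congr EFin.
  by field; rewrite gt_eqF.
have a0 m : 0 < area B m + a m by rewrite addr_gt0 // ?area_gt0 //; case/andP: (ha m).
exists (mk_complex fo fd fc a0 aE); split => //.
change (graph_length (fan_graph n1 near MX w0 cinc) <= graph_length B + delta%:E)%E.
have L := @fan_length R n B M (M + 1) w c n1 near MX w0 c0 cinc.
apply: le_trans L _.
apply: leeD2l; rewrite lee_fin.
have -> : delta = n.+1%:R * (w + w) by rewrite /w; field; rewrite gt_eqF.
by rewrite ler_pM2l // lerD2l.
Qed.

Lemma scale_complex (B : complex R n) (x : R) : 0 < x ->
  exists B' : complex R n, (forall m, area B' m = x ^+ 2 * area B m) /\
    (graph_length B' <= x%:E * graph_length B)%E.
Proof.
move=> x0; pose h (p : plane R) := x *: p; pose g (p : plane R) := x^-1 *: p.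
have ch y : continuous (fun p : plane R => y *: p) by move=> p; apply: cvgZr; exact: cvg_id.
have hK : cancel h g by move=> p; rewrite /h /g scalerA mulVf ?gt_eqF // scale1r.
have gK : cancel g h by move=> p; rewrite /h /g scalerA mulfV ?gt_eqF // scale1r.
have a0 m : 0 < x ^+ 2 * area B m by rewrite mulr_gt0 ?exprn_gt0 ?area_gt0.
have aE m : plane_area (g @^-1` region B (Some m)) = (x ^+ 2 * area B m)%:E.
  have xV : 0 < x^-1 by rewrite invr_gt0.
  have := plane_area_scale xV (open_mset (@open_region R n B (Some m))).
  rewrite interior_area -/g => e; rewrite EFinM -e muleA -EFinM.
  by rewrite -exprMn mulfV ?gt_eqF // expr1n mul1e.
have [B' [B'a B'l]] := homeo_complex (ch x) (ch x^-1) hK gK a0 aE.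
exists B'; split => //; rewrite B'l /graph_length ge0_sume_distrr; last by move=> e _; exact: curve_length_ge0.
apply: lee_sum => e _; apply: (@curve_length_lip R h x _ x0).
by move=> p q; rewrite /edist /h -scalerBr enormZ gtr0_norm.
Qed.

Lemma limit_minimizer (A_ : nat -> complex R n) (A : complex R n) : (1 < n)%N ->
  converges_in_length_and_area A_ A ->
  (forall N : nat, exists2 i : nat, (N < i)%N & perimeter_minimizer (A_ i)) ->
  perimeter_minimizer A.
Proof.
move=> n1 [_ _ cA cl] hm B sB.
apply/lee_addgt0Pr => d d0.
have [eta eta0 heta] := add_small_areas n1 d0.
pose S := 1 + \sum_m area A m.
have S0 : 0 < S by rewrite ltr_pwDl // sumr_ge0 // => m _; apply/ltW/area_gt0.
have AS m : area A m < S.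
  rewrite /S (bigD1 m) //= addrCA ltrDl ltr_pwDl // sumr_ge0 // => k _; apply/ltW/area_gt0.
(* Scaling by [x] costs a region the area [(1 - x ^+ 2) * area A m], which is positive and below
   [eta] because [area A m < S]. This gap is what the lenses fill, up to the error of the limit. *)
pose x : R := 1 - Num.min (1 / 2) (eta / (2 * S)).
have [m1 [m2 m3]] : 0 < Num.min (1 / 2 : R) (eta / (2 * S)) /\ Num.min (1 / 2) (eta / (2 * S)) <= 1 / 2 /\
    Num.min (1 / 2) (eta / (2 * S)) <= eta / (2 * S).
  have e1 : 0 < eta / (2 * S) by apply: divr_gt0 => //; apply: mulr_gt0.
  split; first by rewrite lt_min e1 andbT; lra.
  by split; rewrite ge_min lexx ?orbT.
have x0 : 0 < x <= 1 by rewrite /x; apply/andP; split; lra.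
have xA m : x ^+ 2 * area A m < area A m /\ area A m < x ^+ 2 * area A m + eta.
  have A0 := area_gt0 A m; have A1 := AS m.
  have h : eta / (2 * S) * (2 * S) = eta by field; rewrite gt_eqF.
  have xE : x = 1 - Num.min (1 / 2) (eta / (2 * S)) by [].
  move: (Num.min _ _) m1 m2 m3 xE => y y0 y1 y2 ->.
  have yA : 0 < y * (2 - y) * area A m by rewrite !mulr_gt0 //; lra.
  split; first by nra.
  have : y * (2 * S) <= eta by rewrite -h ler_pM2r // mulr_gt0.
  by nra.
have ev m : \forall i \near \oo, 0 < area (A_ i) m - x ^+ 2 * area A m < eta.
  have [h1 h2] := xA m.
  have o1 := @cvgr_gt R _ _ _ _ _ (cA m) _ h1; have o2 := @cvgr_lt R _ _ _ _ _ (cA m) _ h2.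
  apply: filterS2 (o1 _) (o2 _) => i; rewrite subr_gt0 ltrBlDl addrC => -> -> //.
have ev' : \forall i \near \oo, forall m, 0 < area (A_ i) m - x ^+ 2 * area A m < eta.
  exact: filter_forall.
rewrite leNgt; apply/negP => lA.
have ev2 : \forall i \near \oo, (graph_length B + d%:E < graph_length (A_ i))%E.
  have H : nbhs (graph_length A) [set y | (graph_length B + d%:E < y)%E].
    by apply: open_nbhs_nbhs; split => //; exact: open_ereal_gt_ereal.
  exact: (cl _ H).
have [N _ hN] : \forall i \near \oo, (graph_length B + d%:E < graph_length (A_ i))%E /\
    forall m, 0 < area (A_ i) m - x ^+ 2 * area A m < eta.
  by near=> i; split; near: i.
have [i Ni mi] := hm N.
have [h1 h2] := hN i (ltnW Ni).
have [B1 [B1a B1l]] := scale_complex B (andP x0).1.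
have {}B1l : (graph_length B1 <= graph_length B)%E.
  apply: le_trans B1l _; rewrite -[leRHS]mul1e; apply: lee_wpmul2r.
    by apply: sume_ge0 => e _; exact: curve_length_ge0.
  by rewrite lee_fin (andP x0).2.
have [B2 [B2a B2l]] := heta B1 _ h2.
have sB2 : same_areas (A_ i) B2 by move=> m; rewrite B2a B1a sB addrC subrK.
have := mi _ sB2; rewrite leNgt => /negP; apply.
apply: le_lt_trans h1; apply: le_trans B2l _.
exact: leeD2r.
Unshelve. all: end_near.
Qed.

End AddArea.

(** * The disc competitor *)

Section Trigonometry.
Variable R : realType.
Implicit Types (x y s t a b : R).

Lemma norm_sin_le x : `|sin x| <= `|x|.
Proof.
have pos y : 0 <= y -> `|sin y| <= y.
  move=> y0; rewrite ler_norml; apply/andP; split.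
    have : 0 + sin 0 <= y + sin y.
      apply: (@der_le R (fun z => z + sin z) (fun z => 1 + cos z * 1) 0 y y0) => z _.
        exact: (der_D (der_id z) (der_sin (der_id z))).
      by have := cos_geN1 z; lra.
    by rewrite /= sin0; lra.
  have : 0 - sin 0 <= y - sin y.
    apply: (@der_le R (fun z => z - sin z) (fun z => 1 - cos z * 1) 0 y y0) => z _.
      exact: (der_B (der_id z) (der_sin (der_id z))).
    by have := cos_le1 z; lra.
  by rewrite /= sin0; lra.
case: (leP 0 x) => x0; first by rewrite (ger0_norm x0) pos.
by have := pos (- x); rewrite sinN normrN (ltr0_norm x0) => h; apply: h; lra.
Qed.

Lemma cos_double_half x : cos x = 1 - 2 * sin (x / 2) ^+ 2.
Proof.
have -> : x = x / 2 + x / 2 by field.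
rewrite cosD; have -> : (x / 2 + x / 2) / 2 = x / 2 by field.
have := cos2Dsin2 (x / 2); lra.
Qed.

Lemma cos_ge_quad x : 1 - x ^+ 2 / 2 <= cos x.
Proof.
rewrite cos_double_half; have := norm_sin_le (x / 2).
rewrite -(@ler_pXn2r _ 2) ?nnegrE // !real_normK ?num_real //; nra.
Qed.

Lemma edist_ez s t : edist (ez s) (ez t) = 2 * `|sin ((s - t) / 2)|.
Proof.
apply/eqP; rewrite -(@eqrXn2 _ 2) ?edist_ge0 ?mulr_ge0 //; apply/eqP.
rewrite enormE2 planeB exprMn real_normK ?num_real //=.
have := cos_double_half (s - t); rewrite cosB.
have := cos2Dsin2 s; have := cos2Dsin2 t; lra.
Qed.

Lemma ez_lip s t : edist (ez s) (ez t) <= `|s - t|.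
Proof.
rewrite edist_ez; have := norm_sin_le ((s - t) / 2).
rewrite normrM [`|2^-1|]gtr0_norm; lra.
Qed.

Lemma cos_eq1 x : - (2 * pi) < x < 2 * pi -> cos x = 1 -> x = 0.
Proof.
move=> /andP[x1 x2] cx.
have s0 : sin (x / 2) = 0.
  have := cos_double_half x; rewrite cx => h; apply/eqP; rewrite -sqrf_eq0; apply/eqP; lra.
apply/eqP; case: (ltgtP x 0) => // x0.
  have := @sin_gt0_pi R (- (x / 2)); rewrite sinN s0 oppr0 ltxx => h.
  by apply: h; apply/andP; split; lra.
have := @sin_gt0_pi R (x / 2); rewrite s0 ltxx => h.
by apply: h; apply/andP; split; lra.
Qed.

Lemma ez_inj a b s t : 0 < a -> 0 < b -> `|s - t| < 2 * pi ->
  a *: ez s = b *: ez t -> a = b /\ s = t.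
Proof.
move=> a0 b0 st e; have ab : a = b.
  by have := congr1 (@enorm R) e; rewrite !enormZ !ez_norm !mulr1 !gtr0_norm.
split => //; subst b; have {}e : ez s = ez t by have := scalerI (lt0r_neq0 a0) e.
have c1 : cos (t - s) = 1 by rewrite -dot_ez e dot_ez subrr cos0.
have : t - s = 0 by apply: cos_eq1 => //; move: st; rewrite ltr_norml => /andP[? ?]; apply/andP; split; lra.
by move/eqP; rewrite subr_eq0 => /eqP ->.
Qed.

Lemma ez_2pi s : ez (s + 2 * pi) = ez s.
Proof. by rewrite /ez mulr_natl cosD2pi sinD2pi. Qed.

Lemma polar (p : plane R) : p != 0 -> exists2 s, 0 <= s < 2 * pi & p = enorm p *: ez s.
Proof.
move=> p0; have np : 0 < enorm p by rewrite enorm_gt0.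
have u1 : enorm ((enorm p)^-1 *: p) = 1 by rewrite enormZ gtr0_norm ?invr_gt0 // mulVf // gt_eqF.
have pE s : (enorm p)^-1 *: p = ez s -> p = enorm p *: ez s.
  by move=> <-; rewrite scalerA mulfV ?gt_eqF // scale1r.
set u := _ *: p in u1 pE.
have b : -1 <= u.1 <= 1 by have := norm1_le_enorm u; rewrite u1 ler_norml.
have h : u.1 ^+ 2 + u.2 ^+ 2 = 1 by rewrite -enormE2 u1 expr1n.
have s2 : sin (acos u.1) = `|u.2|.
  by rewrite sin_acos // -sqrtr_sqr; congr Num.sqrt; rewrite -h; ring.
have a0 := acos_ge0 b; have a1 := acos_lepi b; have pi0 := pi_gt0 R.
case: (leP 0 u.2) => u2.
  exists (acos u.1); first by rewrite a0 /=; lra.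
  by apply: pE; apply: plane_eq; rewrite /= ?acosK // s2 ger0_norm.
have a2 : acos u.1 != 0.
  by apply/eqP => e; move: s2; rewrite e sin0 ltr0_norm // => e2; lra.
have a3 : 0 < acos u.1 by rewrite lt_neqAle eq_sym a2.
exists (- acos u.1 + 2 * pi); first by apply/andP; split; lra.
by apply: pE; rewrite ez_2pi; apply: plane_eq; rewrite /= ?cosN ?sinN ?acosK // s2 ltr0_norm // opprK.
Qed.

(** In the half-plane around the direction [phi] the arcsine gives the polar angle by a formula,
    which is the continuous local choice needed for open sectors and for lifting angles. *)
Lemma polar_near (q : plane R) phi : 0 < dot q (ez phi) ->
  `|cross (ez phi) q / enorm q| < 1 /\ q = enorm q *: ez (phi + asin (cross (ez phi) q / enorm q)).
Proof.
move=> dt; have q0 : q != 0 by apply: contraTneq dt => ->; rewrite /dot /= !mul0r addr0 ltxx.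
have nq : 0 < enorm q by rewrite enorm_gt0.
have nn : enorm q != 0 by rewrite gt_eqF.
set z := cross _ _ / _.
have hh : dot q (ez phi) ^+ 2 + cross (ez phi) q ^+ 2 = enorm q ^+ 2.
  have := lagrange (ez phi) q; rewrite ez_norm expr1n mul1r => <-.
  by congr (_ ^+ 2 + _); rewrite /dot /=; ring.
have e1 : 1 - z ^+ 2 = (dot q (ez phi) / enorm q) ^+ 2.
  by rewrite /z !expr_div_n -hh; field; rewrite hh expf_neq0.
have z1 : `|z| < 1.
  have h : 0 < (dot q (ez phi) / enorm q) ^+ 2 by rewrite exprn_gt0 // divr_gt0.
  rewrite -(@ltr_pXn2r _ 2) ?nnegrE // real_normK ?num_real // expr1n; lra.
have z2 : -1 <= z <= 1 by move: z1; rewrite ltr_norml => /andP[? ?]; apply/andP; split; lra.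
split=> //.
have sz : sin (asin z) = z by apply: asinK; rewrite in_itv.
have cza : cos (asin z) = dot q (ez phi) / enorm q.
  by rewrite cos_asin // e1 sqrtr_sqr ger0_norm // divr_ge0 // ltW.
rewrite ezD sz cza scalerDr !scalerA.
have -> : enorm q * (dot q (ez phi) / enorm q) = dot q (ez phi) by field.
have -> : enorm q * z = dot q (rot (ez phi)).
  have -> : dot q (rot (ez phi)) = cross (ez phi) q by rewrite /dot /cross /rot /=; ring.
  by rewrite /z; field.
by apply: decompose; exact: ez_norm.
Qed.

(** The triple angle formula gives [cos (pi / 6) ^+ 2 = 3 / 4]. If [pi] were at most 61 / 20, the
    estimate [1 - x ^+ 2 / 2 <= cos x] at [pi / 6] would make this cosine too large. The constant 61
    / 60 of the final count is a third of 61 / 20. *)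
Lemma pi_gt305 : 61 / 20 < pi :> R.
Proof.
have c6 : cos (pi / 6) ^+ 2 = 3 / 4 :> R.
  pose t : R := pi / 6.
  have e1 : cos (3 * t) = 0 by rewrite /t (_ : 3 * (pi / 6) = pi / 2) ?cos_pihalf //; field.
  have e3 : cos (3 * t) = 4 * cos t ^+ 3 - 3 * cos t.
    have -> : 3 * t = t + t + t by ring.
    have h := cos2Dsin2 t.
    rewrite !cosD sinD.
    have -> : (cos t * cos t - sin t * sin t) * cos t - (sin t * cos t + cos t * sin t) * sin t =
      cos t ^+ 3 - 3 * cos t * sin t ^+ 2 by ring.
    have -> : sin t ^+ 2 = 1 - cos t ^+ 2 by rewrite -h; ring.
    ring.
  have ct : 0 < cos t.
    apply: cos_gt0_pihalf; have := pi_gt0 R; rewrite /t => p0; apply/andP; split; lra.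
  have : cos t * (4 * cos t ^+ 2 - 3) = 0 by rewrite -e1 e3; ring.
  move/eqP; rewrite mulf_eq0 gt_eqF //= => /eqP; rewrite /t; lra.
rewrite ltNge; apply/negP => pi305; have p0 := pi_gt0 R.
have := cos_ge_quad (pi / 6 : R); set c := cos _ in c6 *; set q := pi / 6 => h.
have q1 : q <= 61 / 120 by rewrite /q; lra.
have q0 : 0 <= q by rewrite /q; lra.
have q2 : q ^+ 2 / 2 <= (61 / 120) ^+ 2 / 2 by nra.
have : 1 - (61 / 120) ^+ 2 / 2 <= c by lra.
by nra.
Qed.

End Trigonometry.

(** * Discs and sectors *)

Section DiscArea.
Variable R : realType.
Implicit Types (r a b x t : R).

Definition disc r : set (plane R) := [set p | enorm p < r].

Definition sector r a b : set (plane R) :=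
  [set p | exists rho phi, [/\ 0 < rho < r, a < phi < b & p = rho *: ez phi]].

Lemma open_disc r : open (disc r).
Proof.
have -> : disc r = (@enorm R) @^-1` [set x | x < r] by [].
by apply: open_comp; [move=> p _; exact: continuous_enorm|exact: open_lt].
Qed.

Lemma open_sector r a b : open (sector r a b).
Proof.
apply/openP => _ [rho [phi [/andP[r0 r1] /andP[p1 p2] ->]]].
pose q0 := rho *: ez phi.
have nq0 : enorm q0 = rho by rewrite enormZ ez_norm mulr1 gtr0_norm.
pose m := Num.min (Num.min 1 (phi - a)) (b - phi).
have m0 : 0 < m by rewrite /m !lt_min ltr01 !subr_gt0 p1 p2.
have [m1 [m2 m3]] : m <= 1 /\ m <= phi - a /\ m <= b - phi.
  by rewrite /m !ge_min !lexx !orbT.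
pose d := sin m.
have m4 : m <= pi / 2 by apply: le_trans m1 _; have := pi_ge2 R; lra.
have d0 : 0 < d by apply: sin_gt0_pi; rewrite m0 /=; have := pi_gt0 R; lra.
have d1 : d <= 1 by exact: sin_le1.
(* Points within [e] of [q0] have norm between [rho / 2] and [r], and the sine of their angular
   deviation from [phi] stays below [d], the sine of [m]. *)
pose e := Num.min (Num.min (rho / 2) (r - rho)) (rho * d / 2).
have e0 : 0 < e by rewrite /e !lt_min subr_gt0 r1 !divr_gt0 // mulr_gt0.
have [e1 [e2 e3]] : e <= rho / 2 /\ e <= r - rho /\ e <= rho * d / 2.
  by rewrite /e !ge_min !lexx !orbT.
exists e => // q; rewrite -/q0 => qe.
have n1 : enorm q < r.
  have := ler_enormB q q0; rewrite nq0 -/(edist q q0); lra.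
have n2 : rho / 2 < enorm q.
  have := ler_enormB q0 q; rewrite nq0 -/(edist q0 q) edistC; lra.
have q0' : q != 0 by rewrite -enorm_gt0; lra.
have dt : 0 < dot q (ez phi).
  have -> : dot q (ez phi) = rho + dot (q - q0) (ez phi).
    rewrite planeB /q0 planeZ /dot /ez /=; have := cos2Dsin2 phi; move: (cos phi) (sin phi) => c s h.
    have -> : (q.1 - rho * c) * c + (q.2 - rho * s) * s = q.1 * c + q.2 * s - rho * (c ^+ 2 + s ^+ 2) by ring.
    by rewrite h; ring.
  have := norm_dot_le (q - q0) (ez phi); rewrite ez_norm mulr1 -/(edist q q0) ler_norml => /andP[h _].
  lra.
pose z := cross (ez phi) q / enorm q.
have cz : `|z| < d.
  rewrite normrM normfV [`|enorm q|]gtr0_norm; last by lra.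
  have -> : cross (ez phi) q = cross (ez phi) (q - q0) by rewrite planeB /q0 planeZ /cross /ez /=; ring.
  rewrite ltr_pdivrMr; last by lra.
  have := norm_cross_le (ez phi) (q - q0); rewrite ez_norm mul1r -/(edist q q0); nra.
have z1 : -1 <= z <= 1 by move: cz; rewrite ltr_norml => /andP[? ?]; apply/andP; split; lra.
have as1 : - m < asin z < m.
  have mI : m \in `[- (pi / 2), pi / 2] by rewrite in_itv /= m4 andbT; lra.
  have mI' : - m \in `[- (pi / 2), pi / 2] by move: mI; rewrite !in_itv /= => /andP[? ?]; apply/andP; split; lra.
  have aI : asin z \in `[- (pi / 2), pi / 2] by rewrite in_itv /= asin_geNpi2 // asin_lepi2.
  have zI : z \in `[-1, 1] by rewrite in_itv.
  rewrite -(ltr_sin mI' aI) -(ltr_sin aI mI) asinK // sinN.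
  by move: cz; rewrite ltr_norml.
exists (enorm q), (phi + asin z); split.
- by rewrite n1 andbT; lra.
- by case/andP: as1 => ? ?; apply/andP; split; lra.
- by have [_] := polar_near dt.
Qed.

(** The primitive [x * sqrt (1 - x ^+ 2) + asin x] is not differentiable at the ends of the disc.
    Truncating at abscissae [sin t] and [- sin t] leaves area at least [2 * t]; then [t] tends to
    [pi / 2]. *)
Lemma disc_area_ge r : 0 < r -> ((pi * r ^+ 2)%:E <= plane_area (disc r))%E.
Proof.
move=> r0; have pi0 := pi_gt0 R.
have unit t : 0 < t < pi / 2 -> ((2 * t)%:E <= plane_area (disc 1))%E.
  move=> /andP[t0 t1].
  pose u (x : R) := Num.sqrt (1 - x ^+ 2).
  have cu : continuous u.
    move=> x; apply: (@continuous_comp _ _ _ (fun x : R => 1 - x ^+ 2) Num.sqrt); last exact: sqrt_continuous.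
    by apply: cvgB; [exact: cvg_cst|apply: cvgM; exact: cvg_id].
  have cnu : continuous (fun x => - u x) by move=> x; apply: cvgN; exact: cu.
  have s0 : 0 < sin t by apply: sin_gt0_pi; rewrite t0 /=; lra.
  have tI : t \in `[- (pi / 2), pi / 2] by rewrite in_itv /=; apply/andP; split; lra.
  have pI : pi / 2 \in `[- (pi / 2), pi / 2 : R] by rewrite in_itv /=; apply/andP; split; lra.
  have s1 : sin t < 1 by rewrite -(sin_pihalf R) (ltr_sin tI pI).
  pose F x := x * u x + asin x.
  have dF x : - sin t <= x <= sin t -> is_derive x 1 F (u x - - u x).
    move=> /andP[x1 x2]; have xx : -1 < x < 1 by apply/andP; split; lra.
    have x3 : 0 < 1 - x ^+ 2 by nra.
    have un : u x != 0 by rewrite gt_eqF // sqrtr_gt0.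
    have d1 : is_derive x 1 (fun x : R => 1 - x ^+ 2) (0 - 2 * x * 1).
      exact: (der_B (der_cst 1 x) (der_sqr (der_id x))).
    have d2 := der_comp d1 (is_derive1_sqrt x3).
    have d3 := is_derive1_asin xx.
    apply: der_eq (der_D (der_M (der_id x) d2) d3) _.
    have e : u x ^+ 2 = 1 - x ^+ 2 by rewrite sqr_sqrtr // ltW.
    rewrite -/(u x); have -> : x * ((2 * u x)^-1 * (0 - 2 * x * 1)) = - x ^+ 2 / u x by field.
    have -> : x ^+ 2 = 1 - u x ^+ 2 by rewrite e; ring.
    by field.
  have cF : {within `[- sin t, sin t], continuous F}.
    apply: continuous_in_subspaceT => x; rewrite inE /= in_itv /= => xst.
    exact: der_cont (dF x xst).
  have A := @area_between R (- sin t) (sin t) (fun x => - u x) u F _ cnu cu _ cF _.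
  apply: le_trans (@le_plane_area _ (between (- sin t) (sin t) (fun x => - u x) u) _ _ _ _); last first.
  - move=> p [/andP[h1 h2] /andP[h3 h4]].
    have : p.2 ^+ 2 < u p.1 ^+ 2.
      have u0 : 0 <= u p.1 by exact: sqrtr_ge0.
      by nra.
    rewrite sqr_sqrtr; last by nra.
    move=> h5; rewrite /disc /= -(@ltr_pXn2r _ 2) ?nnegrE ?enorm_ge0 // enormE2 expr1n; lra.
  - by apply: open_mset; exact: open_disc.
  - by apply: open_mset; exact: open_between.
  - have A1 : - sin t < sin t by lra.
    have A2 x : - sin t < x < sin t -> - u x <= u x.
      by move=> _; have u0 : 0 <= u x := sqrtr_ge0 _; lra.
    have A3 x : - sin t < x < sin t -> is_derive x 1 F (u x - - u x).
      by move=> /andP[x1 x2]; apply: dF; rewrite !ltW.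
    rewrite (A A1 A2 A3) lee_fin /F.
    have -> : u (sin t) = cos t.
        rewrite /u; have -> : 1 - sin t ^+ 2 = cos t ^+ 2 by have := cos2Dsin2 t; lra.
        by rewrite sqrtr_sqr ger0_norm //; apply/ltW/cos_gt0_pihalf/andP; split; lra.
    have -> : u (- sin t) = cos t.
      rewrite /u sqrrN; have -> : 1 - sin t ^+ 2 = cos t ^+ 2 by have := cos2Dsin2 t; lra.
      by rewrite sqrtr_sqr ger0_norm //; apply/ltW/cos_gt0_pihalf/andP; split; lra.
    have c0 : 0 < cos t by apply: cos_gt0_pihalf; apply/andP; split; lra.
    rewrite sinK // -sinN sinK; last by move: tI; rewrite !in_itv /= => /andP[? ?]; apply/andP; split; lra.
    rewrite sinN; nra.
have h1 : (pi%:E <= plane_area (disc 1))%E.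
  apply/lee_subgt0Pr => e e0.
  pose t := Num.max (pi / 4) (pi / 2 - e / 2).
  have [t1 t2] : pi / 4 <= t /\ pi / 2 - e / 2 <= t by rewrite /t !le_max !lexx orbT.
  have t3 : t < pi / 2 by rewrite /t gt_max; apply/andP; split; lra.
  have t0 : 0 < t < pi / 2 by rewrite t3 andbT; lra.
  apply: le_trans (unit t t0); rewrite -EFinB lee_fin; lra.
have rV : 0 < r^-1 by rewrite invr_gt0.
have := plane_area_scale rV (open_mset (@open_disc 1)).
have -> : (fun p : plane R => r^-1 *: p) @^-1` disc 1 = disc r.
  apply/seteqP; split=> p; rewrite /disc /= enormZ gtr0_norm // mulrC ltr_pdivrMr // mul1r //.
move=> e; rewrite -e in h1.
have : ((r ^+ 2)%:E * pi%:E <= (r ^+ 2)%:E * ((r^-1 ^+ 2)%:E * plane_area (disc r)))%E.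
  by apply: lee_wpmul2l => //; rewrite lee_fin sqr_ge0.
have -> : ((r ^+ 2)%:E * ((r^-1 ^+ 2)%:E * plane_area (disc r)) = plane_area (disc r))%E.
  by rewrite muleA -EFinM -exprMn mulfV ?gt_eqF // expr1n mul1e.
by rewrite -EFinM mulrC.
Qed.

Lemma disc_area_scale r : 0 < r ->
  plane_area (disc r) = ((r ^+ 2)%:E * plane_area (disc 1))%E.
Proof.
move=> r0; have rV : 0 < r^-1 by rewrite invr_gt0.
rewrite -(plane_area_scale rV (open_mset (@open_disc 1))).
have -> : (fun p : plane R => r^-1 *: p) @^-1` disc 1 = disc r.
  apply/seteqP; split=> p; rewrite /disc /= enormZ gtr0_norm // mulrC ltr_pdivrMr // mul1r //.
by rewrite muleA -EFinM -exprMn mulfV ?gt_eqF // expr1n mul1e.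
Qed.

Lemma disc_area_fin r : (plane_area (disc r) < +oo)%E.
Proof.
case: (leP r 0) => r0.
  have -> : disc r = set0.
    by apply/seteqP; split=> p //; rewrite /disc /= => h; have := enorm_ge0 p; lra.
  by rewrite plane_areaE measure0.
apply: (@le_lt_trans _ _ (plane_area (`[-r, r]%classic `*` `[-r, r]%classic))).
  apply: le_plane_area; first by apply: open_mset; exact: open_disc.
    by apply: mset_rect; exact: measurable_itv.
  move=> p; rewrite /disc /= => pM; have := norm1_le_enorm p; have := norm2_le_enorm p.
  rewrite !ler_norml => /andP[? ?] /andP[? ?].
  by split; rewrite /= in_itv /=; apply/andP; split; lra.
by rewrite plane_area_box ?ltry //; lra.
Qed.

End DiscArea.

Section SectorArea.
Variable R : realType.
Variable r : R.
Hypothesis r_gt0 : 0 < r.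

Definition strip (u : plane R) (d : R) : set (plane R) :=
  [set p | enorm p < r /\ `|cross u p| < d].

Lemma open_strip (u : plane R) (d : R) : open (strip u d).
Proof.
have -> : strip u d =
   (@enorm R) @^-1` [set x | x < r] `&` (fun p => `|dot (rot u) p|) @^-1` [set x | x < d].
  apply/seteqP; split=> p; rewrite /strip /=; have -> : cross u p = dot (rot u) p by rewrite /cross /dot /rot /=; ring.
    by []. by [].
apply: openI; apply: open_comp; try exact: open_lt.
  by move=> p _; exact: continuous_enorm.
move=> p _; apply: (@continuous_comp _ _ _ (fun p => dot (rot u) p) (fun x : R => `|x|)); last exact: norm_continuous.
by apply: cvg_dot; [exact: cvg_cst|exact: cvg_id].
Qed.

(** Up to a swap of coordinates the first component of [u] is at least 1 / 2 in absolute value, so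
    the strip lies between two parallel lines at vertical distance [4 * d] over an interval of
    length [2 * r]. *)
Lemma strip_area (u : plane R) (d : R) : enorm u = 1 -> 0 < d ->
  (plane_area (strip u d) <= (16 * r * d)%:E)%E.
Proof.
move=> u1 d0; have r0 := r_gt0.
have aux (v : plane R) : enorm v = 1 -> 1 / 2 <= `|v.1| ->
    (plane_area (strip v d) <= (16 * r * d)%:E)%E.
  move=> v1 hv; have nv : v.1 != 0 by apply: contraTneq hv => ->; rewrite normr0; lra.
  pose lo (x : R) := v.2 / v.1 * x - 2 * d; pose hi (x : R) := v.2 / v.1 * x + 2 * d.
  have cl (c : R) : continuous (fun x : R => v.2 / v.1 * x + c).
    by move=> x; apply: cvgD; [apply: cvgM; [exact: cvg_cst|exact: cvg_id]|exact: cvg_cst].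
  have clo : continuous lo by exact: cl.
  have chi : continuous hi by exact: cl.
  have dF (x : R) : is_derive x 1 (fun x : R => 4 * d * x) (hi x - lo x).
    by apply: der_eq (der_Z (4 * d) (der_id x)) _; rewrite /hi /lo; ring.
  have A := @area_between R (- r) r lo hi (fun x => 4 * d * x) _ clo chi _ _ (fun x _ => dF x).
  apply: le_trans (@le_plane_area _ _ (between (- r) r lo hi) _ _ _) _; last first.
  - rewrite A; first by rewrite lee_fin; nra.
    + lra.
    + by move=> x _; rewrite /lo /hi; lra.
    + apply: within_of_continuous => x; exact: der_cont (dF x).
  - move=> p [/= pr pd]; split.
      by have := norm1_le_enorm p; rewrite ler_norml => /andP[? ?]; apply/andP; split; lra.
    have e : `|p.2 - v.2 / v.1 * p.1| < 2 * d.
      have -> : p.2 - v.2 / v.1 * p.1 = cross v p / v.1 by rewrite /cross; field.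
      rewrite normrM normfV ltr_pdivrMr ?normr_gt0 //; nra.
    by move: e; rewrite ltr_norml => /andP[? ?]; rewrite /lo /hi; apply/andP; split; lra.
  - by apply: open_mset; exact: open_between.
  - by apply: open_mset; exact: open_strip.
case: (leP (1 / 2) `|u.1|) => hu; first exact: aux.
have hu2 : 1 / 2 <= `|u.2|.
  have : u.1 ^+ 2 + u.2 ^+ 2 = 1 by rewrite -enormE2 u1 expr1n.
  rewrite -[u.1 ^+ 2]real_normK ?num_real // -[u.2 ^+ 2]real_normK ?num_real //.
  have := normr_ge0 u.1; have := normr_ge0 u.2; nra.
have := aux (u.2, u.1).
have -> : enorm (u.2, u.1) = 1 by rewrite -u1 /enorm /dot /= addrC.
move=> /(_ erefl hu2); rewrite -(plane_area_swap (open_mset (@open_strip (u.2, u.1) d))).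
have e (p : plane R) : enorm (p.2, p.1) = enorm p by rewrite /enorm /dot /= addrC.
have c p : `|cross (u.2, u.1) (p.2, p.1)| = `|cross u p|.
  by rewrite -normrN; congr `|_|; rewrite /cross /=; ring.
have -> // : (fun p : plane R => (p.2, p.1) : plane R) @^-1` strip (u.2, u.1) d = strip u d.
by apply/seteqP; split=> p; rewrite /strip /= e c.
Qed.

Definition sector_area (a b : R) : R := fine (plane_area (sector r a b)).

Lemma sector_disc a b : sector r a b `<=` disc r.
Proof.
move=> _ [rho [phi [/andP[r0 r1] _ ->]]].
by rewrite /disc /= enormZ ez_norm mulr1 gtr0_norm.
Qed.

Lemma sector_areaE a b : plane_area (sector r a b) = (sector_area a b)%:E.
Proof.
rewrite /sector_area fineK // ge0_fin_numE ?plane_area_ge0 //.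
apply: le_lt_trans (disc_area_fin r).
by apply: le_plane_area; [apply: open_mset; exact: open_sector|apply: open_mset; exact: open_disc|exact: sector_disc].
Qed.

Lemma ray_null t : plane_area [set p | exists2 rho, 0 <= rho <= r & p = rho *: ez t] = 0%E.
Proof.
have r0 := r_gt0; pose g (x : R) := (x * r) *: ez t.
have cg : continuous g.
  move=> x; apply: cvgZl; by apply: cvgM; [exact: cvg_id|exact: cvg_cst].
have -> : [set p | exists2 rho, 0 <= rho <= r & p = rho *: ez t] = g @` `[0, 1].
  apply/seteqP; split=> p.
    move=> [rho /andP[h1 h2] ->]; exists (rho / r); last by rewrite /g divfK // gt_eqF.
    by rewrite /= in_itv /=; apply/andP; split; [exact: divr_ge0 (ltW _)|rewrite ler_pdivrMr // mul1r].
  move=> [x x01 <-]; move: x01; rewrite /= in_itv /= => /andP[? ?].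
  by exists (x * r) => //; apply/andP; split; nra.
apply: (@null_lipschitz R g r); first exact: within_of_continuous.
move=> s s' _ _; rewrite /g /edist -scalerBl enormZ ez_norm mulr1 -mulrBl normrM mulrC.
by rewrite (gtr0_norm r0).
Qed.

Lemma ray_meas t : meas_plane [set p | exists2 rho, 0 <= rho <= r & p = rho *: ez t].
Proof.
have r0 := r_gt0; pose g (x : R) := x *: ez t.
have cg : continuous g by move=> x; apply: cvgZl; exact: cvg_id.
have -> : [set p | exists2 rho, 0 <= rho <= r & p = rho *: ez t] = g @` `[0, r].
  apply/seteqP; split=> p; first by move=> [rho h ->]; exists rho => //=; rewrite in_itv.
  by move=> [x x01 <-]; exists x => //; move: x01; rewrite /= in_itv.
apply: closed_mset; apply: compact_closed; first exact: plane_hausdorff.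
by apply: path_compact; exact: within_of_continuous.
Qed.

Lemma sector_split a b c : a <= b -> b <= c -> 0 <= a -> c <= 2 * pi ->
  sector_area a c = sector_area a b + sector_area b c.
Proof.
move=> ab bc a0 cp; have r0 := r_gt0.
suff : plane_area (sector r a c) = (plane_area (sector r a b) + plane_area (sector r b c))%E.
  by rewrite !sector_areaE -EFinD => -[].
have ms x y : meas_plane (sector r x y) by apply: open_mset; exact: open_sector.
have dis : sector r a b `&` sector r b c = set0.
  apply/seteqP; split=> // p [[rho [phi [/andP[h1 h2] /andP[h3 h4] ->]]] [rho' [phi' [/andP[k1 k2] /andP[k3 k4]]]]].
  move/(ez_inj h1 k1) => h; have [] := h _; first by rewrite ltr_norml; apply/andP; split; lra.
  by move=> _ e; lra.
rewrite -(plane_areaU (ms _ _) (ms _ _) dis).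
set U := sector r a b `|` _.
have mU : meas_plane U by exact: (@measurableU _ (mplane R) _ _ (ms a b) (ms b c)).
rewrite -(plane_areaU_null mU (ray_meas b) (ray_null b)).
have mUr : meas_plane (U `|` [set p | exists2 rho, 0 <= rho <= r & p = rho *: ez b]).
  exact: (@measurableU _ (mplane R) _ _ mU (ray_meas b)).
apply/eqP; rewrite eq_le; apply/andP; split.
  apply: le_plane_area => // _ [rho [phi [h1 /andP[h3 h4] ->]]].
  case: (ltgtP phi b) => hb.
  - by left; left; exists rho, phi; rewrite h3 hb.
  - by left; right; exists rho, phi; rewrite hb h4.
  - by right; exists rho; [case/andP: h1 => ? ?; rewrite !ltW|rewrite hb].
case: (eqVneq a b) => [e|nab].
  rewrite (plane_areaU_null mU (ray_meas b) (ray_null b)); apply: le_plane_area => //.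
  rewrite /U e; move=> _ [] [rho [phi [h1 /andP[h3 h4] ->]]]; first by lra.
  by exists rho, phi; rewrite h3 h4.
rewrite (plane_areaU_null mU (ray_meas b) (ray_null b)); apply: le_plane_area => //.
move=> _ [] [rho [phi [h1 /andP[h3 h4] ->]]]; exists rho, phi; split=> //; apply/andP; split; lra.
Qed.

Lemma sector_area_ge0 a b : 0 <= sector_area a b.
Proof. by rewrite -lee_fin -sector_areaE plane_area_ge0. Qed.

Lemma sector_area0 a : sector_area a a = 0.
Proof.
rewrite /sector_area; have -> : sector r a a = set0.
  by apply/seteqP; split=> // p [rho [phi [_ /andP[? ?] _]]]; lra.
by rewrite plane_areaE measure0.
Qed.

(** A thin sector lies in a strip around its first ray. The constant is crude; only continuity in
    the angle matters. *)
Lemma sector_area_lip a b : a <= b -> sector_area a b <= 32 * r ^+ 2 * (b - a).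
Proof.
move=> ab; have r0 := r_gt0; case: (eqVneq a b) => [->|nab].
  by rewrite sector_area0 subrr mulr0.
have d0 : 0 < 2 * r * (b - a) by rewrite !mulr_gt0 // subr_gt0 lt_neqAle nab.
have := strip_area (ez_norm a) d0.
have -> : 16 * r * (2 * r * (b - a)) = 32 * r ^+ 2 * (b - a) by ring.
move=> h; rewrite -lee_fin -sector_areaE; apply: le_trans h.
apply: le_plane_area; [by apply: open_mset; exact: open_sector|apply: open_mset; exact: open_strip|].
move=> _ [rho [phi [/andP[h1 h2] /andP[h3 h4] ->]]] /=.
rewrite /strip /= enormZ ez_norm mulr1 gtr0_norm //; split=> //.
have -> : cross (ez a) (rho *: ez phi) = rho * sin (phi - a).
  by rewrite sinB planeZ /cross /ez /=; ring.
rewrite normrM gtr0_norm //.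
have := norm_sin_le (phi - a); rewrite (ger0_norm (_ : 0 <= phi - a)); last by lra.
have := normr_ge0 (sin (phi - a)); nra.
Qed.

Lemma sector_full : plane_area (disc r) = (sector_area 0 (2 * pi))%:E.
Proof.
have r0 := r_gt0; have pi0 := pi_gt0 R.
have mS : meas_plane (sector r 0 (2 * pi)) by apply: open_mset; exact: open_sector.
have mD : meas_plane (disc r) by apply: open_mset; exact: open_disc.
rewrite -sector_areaE; apply/eqP; rewrite eq_le; apply/andP; split; last first.
  by apply: le_plane_area => //; exact: sector_disc.
rewrite -(plane_areaU_null mS (ray_meas 0) (ray_null 0)).
apply: le_plane_area => //; first exact: (@measurableU _ (mplane R) _ _ mS (ray_meas 0)).
move=> p; rewrite /disc /= => pr.
case: (eqVneq p 0) => [->|p0].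
  by right; exists 0; [rewrite lexx ltW|rewrite scale0r].
have [s /andP[s0 s1] e] := polar p0.
case: (eqVneq s 0) => [s00|ns].
  by right; exists (enorm p); [rewrite enorm_ge0 ltW|rewrite -s00].
by left; exists (enorm p), s; rewrite enorm_gt0 p0 pr s1 lt_neqAle eq_sym ns s0.
Qed.

(** Sectors of prescribed areas are found by continuity alone, so no formula for the area of a
    sector is required. *)
Lemma sector_ivt x : 0 <= x <= sector_area 0 (2 * pi) ->
  exists2 t, 0 <= t <= 2 * pi & sector_area 0 t = x.
Proof.
move=> /andP[x0 x1]; have r0 := r_gt0; have pi0 := pi_gt0 R.
pose cl (t : R) : R := Num.max 0 (Num.min (2 * pi) t).
have cl1 t : 0 <= cl t <= 2 * pi.
  by rewrite /cl le_max lexx /= ge_max ge_min lexx /= andbT; lra.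
have cl2 t : 0 <= t <= 2 * pi -> cl t = t by move=> /andP[h1 h2]; rewrite /cl (min_idPr h2) (max_idPr h1).
have lipcl s t : `|sector_area 0 (cl s) - sector_area 0 (cl t)| <= 32 * r ^+ 2 * `|cl s - cl t|.
  wlog st : s t / cl s <= cl t.
    move=> H; case: (leP (cl s) (cl t)) => h; first exact: H.
    by rewrite distrC [`|cl s - _|]distrC; apply: H; exact: ltW.
  have /andP[s0 s1] := cl1 s; have /andP[t0 t1] := cl1 t.
  rewrite (sector_split s0 st) // opprD addrA subrr sub0r normrN (ger0_norm (sector_area_ge0 _ _)).
  rewrite distrC (ger0_norm (_ : 0 <= cl t - cl s)) ?subr_ge0 //; exact: sector_area_lip.
have clE t : cl t = if t < 0 then 0 else if 2 * pi < t then 2 * pi else t.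
  rewrite /cl; case: (ltP t 0) => t0.
    by rewrite min_r ?max_l //; [exact: ltW|lra].
  case: (ltP (2 * pi) t) => tp; first by rewrite max_r //; lra.
  by rewrite max_r.
have cl3 s t : `|cl s - cl t| <= `|s - t|.
  wlog st : s t / s <= t.
    move=> H; case: (leP s t) => h; first exact: H.
    by rewrite distrC [`|s - _|]distrC; apply: H; exact: ltW.
  rewrite distrC [`|s - _|]distrC !ger0_norm ?subr_ge0 // !clE; have p0 := pi_gt0 R; clear -st p0;
  case: (ltP s 0); case: (ltP t 0); case: (ltP (2 * pi) s); case: (ltP (2 * pi) t) => *; lra.
have cf : {within `[0, 2 * pi], continuous (fun t => sector_area 0 (cl t))}.
  apply: within_of_continuous => t; apply/cvgrPdist_lt => e e0.
  have k0 : 0 < 32 * r ^+ 2 + 1 by have := sqr_ge0 r; lra.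
  near=> s.
  apply: le_lt_trans (lipcl _ _) _; apply: le_lt_trans (ler_wpM2l _ (cl3 _ _)) _; first by have := sqr_ge0 r; lra.
  have : `|t - s| < e / (32 * r ^+ 2 + 1).
    near: s; apply/nbhs_ballP; exists (e / (32 * r ^+ 2 + 1)); first by rewrite /= divr_gt0.
    by move=> z.
  rewrite ltr_pdivlMr //; have := normr_ge0 (t - s); nra.
have p0 : 0 <= 2 * pi :> R by lra.
have e0 : sector_area 0 (cl 0) = 0 by rewrite cl2 ?lexx //= sector_area0.
have e1 : sector_area 0 (cl (2 * pi)) = sector_area 0 (2 * pi) by rewrite cl2 // lexx p0.
have [t] : exists2 c, c \in `[0, 2 * pi] & sector_area 0 (cl c) = x.
  by apply: IVT => //; rewrite e0 e1 ge_min x0 le_max x1 orbT.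
by rewrite in_itv /= => t01; rewrite cl2 // => e; exists t.
Unshelve. all: end_near.
Qed.

End SectorArea.

(** * The disc cut by three radii *)

Section DiscGraph.
Variables (R : realType) (r : R) (th : nat -> R).
Hypothesis r_gt0 : 0 < r.
Hypotheses (th0 : th 0 = 0) (th01 : th 0 < th 1) (th12 : th 1 < th 2)
  (th23 : th 2 < th 3) (th3 : th 3 = 2 * pi).

Lemma th_range (i : 'I_3) : 0 <= th i < 2 * pi.
Proof.
have h0 := th0; have h1 := th01; have h2 := th12; have h3 := th23; have h4 := th3.
by case: i => [[|[|[|i]]] hi] //=; apply/andP; split; lra.
Qed.

Lemma th_step (i : 'I_3) : th i < th i.+1 <= 2 * pi.
Proof.
have h0 := th0; have h1 := th01; have h2 := th12; have h3 := th23; have h4 := th3.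
by case: i => [[|[|[|i]]] hi] //=; apply/andP; split; lra.
Qed.

Lemma th_order (i j : 'I_3) : (i < j)%N -> th i.+1 <= th j.
Proof.
have h0 := th0; have h1 := th01; have h2 := th12; have h3 := th23; have h4 := th3.
by case: i j => [[|[|[|i]]] hi] [[|[|[|j]]] hj] //= _; lra.
Qed.

Lemma th_inj (i j : 'I_3) : th i = th j -> i = j.
Proof.
move=> e; apply: val_inj; case: (ltngtP i j) => // h.
  by exfalso; have := th_order h; have := th_step i; rewrite e => /andP[? _] ?; lra.
by exfalso; have := th_order h; have := th_step j; rewrite e => /andP[? _] ?; lra.
Qed.

Lemma th_cases s : 0 <= s < 2 * pi -> exists i : 'I_3, th i <= s < th i.+1.
Proof.
have h0 := th0; have h1 := th01; have h2 := th12; have h3 := th23; have h4 := th3.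
move=> /andP[s0 s1]; case: (ltP s (th 1)) => s2.
  by exists (@Ordinal 3 0 isT) => /=; apply/andP; split; lra.
case: (ltP s (th 2)) => s3.
  by exists (@Ordinal 3 1 isT) => /=; apply/andP; split; lra.
by exists (@Ordinal 3 2 isT) => /=; apply/andP; split; lra.
Qed.

Lemma th_uniq (i j : 'I_3) s : th i < s < th i.+1 -> th j <= s < th j.+1 -> i = j.
Proof.
move=> /andP[a1 a2] /andP[b1 b2]; apply: val_inj; case: (ltngtP i j) => // h;
by exfalso; have := th_order h; lra.
Qed.

(** [None] is the centre. The edges [(false, i)] are the radii and the edges [(true, i)] the arcs of
    the circle. *)
Definition disc_position (v : option 'I_3) : plane R :=
  if v is Some i then r *: ez (th i) else 0.

Definition disc_end (d : (bool * 'I_3) * bool) : option 'I_3 :=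
  match d with
  | ((false, i), b) => if b then Some i else None
  | ((true, i), b) => if b then Some (ordS i) else Some i
  end.

Definition disc_curve (e : bool * 'I_3) (t : R) : plane R :=
  let: (b, i) := e in
  if b then r *: ez (th i + t * (th i.+1 - th i)) else (t * r) *: ez (th i).

Lemma disc_position_norm i : enorm (disc_position (Some i)) = r.
Proof. by rewrite enormZ ez_norm mulr1 gtr0_norm. Qed.

Lemma disc_angle (i : 'I_3) (t : R) : 0 < t < 1 -> th i < th i + t * (th i.+1 - th i) < th i.+1.
Proof.
by move=> /andP[t0 t1]; have /andP[h _] := th_step i; apply/andP; split; nra.
Qed.

Lemma angle_small (s t : R) : 0 <= s < 2 * pi -> 0 <= t < 2 * pi -> `|s - t| < 2 * pi.
Proof. by move=> /andP[? ?] /andP[? ?]; rewrite ltr_norml; apply/andP; split; lra. Qed.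

Lemma disc_angle_range (i : 'I_3) s : th i < s < th i.+1 -> 0 <= s < 2 * pi.
Proof.
have /andP[h1 h2] := th_range i; have /andP[h3 h4] := th_step i.
by move=> /andP[h5 h6]; apply/andP; split; lra.
Qed.

Lemma disc_position_inj : injective disc_position.
Proof.
have r0 := r_gt0; move=> [i|] [j|] //=.
- move/(ez_inj r0 r0); case; first exact: angle_small (th_range i) (th_range j).
  by move=> _ /th_inj ->.
- by move=> h; exfalso; have := disc_position_norm i; rewrite /= h enorm0; lra.
- by move=> h; exfalso; have := disc_position_norm j; rewrite /= -h enorm0; lra.
Qed.

Lemma ez_continuous : continuous (@ez R).
Proof.
move=> t; apply: (@continuous_pair _ _ cos sin); first exact: continuous_cos.
exact: continuous_sin.
Qed.

Lemma disc_curve_continuous e : {within `[0, 1], continuous (disc_curve e)}.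
Proof.
apply: within_of_continuous; case: e => [[] i] t /=.
  have h1 : {for t, continuous (fun t : R => th i + t * (th i.+1 - th i))}.
    by apply: cvgD; [exact: cvg_cst|apply: cvgM; [exact: cvg_id|exact: cvg_cst]].
  have h := @continuous_comp R R (plane R) _ (@ez R) t h1 (@ez_continuous _).
  by apply: cvgZr; exact: h.
by apply: cvgZl; apply: cvgM; [exact: cvg_id|exact: cvg_cst].
Qed.

Lemma disc_curve0 e : disc_curve e 0 = disc_position (disc_end (e, false)).
Proof. by case: e => [[] i] /=; rewrite ?mul0r ?addr0 ?scale0r. Qed.

Lemma disc_curve1 e : disc_curve e 1 = disc_position (disc_end (e, true)).
Proof.
case: e => [[] i] /=; rewrite ?mul1r //; congr (_ *: _).
have -> : th i + (th i.+1 - th i) = th i.+1 by ring.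
case: i => [[|[|[|i]]] hi] //=.
by rewrite th3 th0 -[2 * pi]add0r ez_2pi.
Qed.

Lemma disc_curve_norm e t : 0 < t < 1 -> enorm (disc_curve e t) = if e.1 then r else t * r.
Proof.
have r0 := r_gt0; move=> /andP[t0 t1]; case: e => [[] i] /=; rewrite enormZ ez_norm mulr1 gtr0_norm //.
exact: mulr_gt0.
Qed.

Lemma disc_curve_inj e e' t t' : 0 < t < 1 -> 0 < t' < 1 ->
  disc_curve e t = disc_curve e' t' -> e = e' /\ t = t'.
Proof.
have r0 := r_gt0; move=> ht ht' E.
have := congr1 (@enorm R) E; rewrite !disc_curve_norm //.
have /andP[t0 t1] := ht; have /andP[t0' t1'] := ht'.
case: e e' E => [[] i] [[] j] /= E N; try by exfalso; nra.
- have [] := ez_inj r0 r0 _ E.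
    by apply: angle_small; apply: disc_angle_range; exact: disc_angle.
  move=> _ e1; have h := disc_angle i ht; have := disc_angle j ht'; rewrite -e1.
  move=> /andP[/ltW h1 h2]; have ij : i = j by apply: th_uniq h _; rewrite h1.
  subst j; split=> //; have /andP[h3 _] := th_step i.
  have : (t - t') * (th i.+1 - th i) = 0 by lra.
  move/eqP; rewrite mulf_eq0 => /orP[] /eqP; lra.
- have [] := ez_inj (mulr_gt0 t0 r0) (mulr_gt0 t0' r0) _ E.
    exact: angle_small (th_range i) (th_range j).
  by move=> /(mulIf (lt0r_neq0 r0)) -> /th_inj ->.
Qed.

Lemma disc_curve_vertex e t v : 0 < t < 1 -> disc_curve e t <> disc_position v.
Proof.
have r0 := r_gt0; move=> ht E; have := congr1 (@enorm R) E; rewrite !disc_curve_norm //.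
have /andP[t0 t1] := ht.
case: v E => [j|]; last by rewrite /= enorm0; case: e => [[] i] /= E; nra.
rewrite disc_position_norm; case: e => [[] i] /= E N; last by nra.
have [] := ez_inj r0 r0 _ E.
  by apply: angle_small; [apply: disc_angle_range; exact: disc_angle|exact: th_range].
move=> _ e1; have h := disc_angle i ht.
have ij : i = j by apply: th_uniq h _; rewrite e1 lexx; have /andP[] := th_step j.
by subst j; rewrite e1 ltxx in h.
Qed.

Lemma card_ge3 (T : finType) (A : {set T}) (x y z : T) :
  x \in A -> y \in A -> z \in A -> x != y -> x != z -> y != z -> (3 <= #|A|)%N.
Proof.
move=> xA yA zA xy xz yz; apply: (@leq_trans #|[set x; y; z]%SET|).
  by rewrite finset.setUC cardsU1 cards2 !inE negb_or xy ![z == _]eq_sym xz yz.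
by apply: subset_leq_card; apply/fintype.subsetP => u; rewrite !inE => /orP[/orP[]|] /eqP ->.
Qed.

Lemma disc_degree v : (3 <= #|[set d | disc_end d == v]%SET|)%N.
Proof.
case: v => [i|].
  apply: (@card_ge3 _ _ ((false, i), true) ((true, i), false) ((true, ord_pred i), true));
  by rewrite ?inE /= ?ord_predK ?eqxx // !xpair_eqE ?andbF.
apply: (@card_ge3 _ _ ((false, @Ordinal 3 0 isT), false) ((false, @Ordinal 3 1 isT), false) ((false, @Ordinal 3 2 isT), false));
by rewrite ?inE.
Qed.

Definition disc_graph : embedded_graph R :=
  EmbeddedGraph disc_position_inj disc_curve_continuous disc_curve0 disc_curve1
    disc_curve_inj disc_curve_vertex disc_degree.

Definition disc_region (i : option 'I_3) : set (plane R) :=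
  if i is Some m then sector r (th m) (th m.+1) else [set p | r < enorm p].

Lemma disc_region_open i : open (disc_region i).
Proof.
case: i => [m|]; first exact: open_sector.
have -> : disc_region None = (@enorm R) @^-1` [set x | r < x] by [].
by apply: open_comp; [move=> p _; exact: continuous_enorm|exact: open_gt].
Qed.

Lemma disc_region_disj i j p : disc_region i p -> disc_region j p -> i = j.
Proof.
have r0 := r_gt0.
have aux m : disc_region (Some m) p -> disc_region None p -> False.
  move=> [rho [phi [/andP[h1 h2] _ ->]]] /=; rewrite enormZ ez_norm mulr1 gtr0_norm //; lra.
case: i j => [m|] [m'|] //; first last.
- by move=> h h'; case: (aux m' h' h).
- by move=> h h'; case: (aux m h h').
move=> [rho [phi [/andP[h1 h2] h3 ->]]] [rho' [phi' [/andP[k1 k2] k3]]].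
move/(ez_inj h1 k1); case; first exact: angle_small (disc_angle_range h3) (disc_angle_range k3).
move=> _ e; subst phi'; congr Some; apply: th_uniq h3 _; case/andP: k3 => /ltW -> -> //.
Qed.

Lemma disc_support_cases p : support disc_graph p ->
  enorm p = r \/ exists2 rho, 0 <= rho <= r & exists i : 'I_3, p = rho *: ez (th i).
Proof.
have r0 := r_gt0; have rr := lexx r.
case=> [[[i|] ->]|[[[] i] [t [/andP[t0 t1] ->]]]] /=.
- by left; rewrite enormZ ez_norm mulr1 gtr0_norm.
- by right; exists 0; [rewrite lexx ltW|exists ord0; rewrite scale0r].
- by left; rewrite enormZ ez_norm mulr1 gtr0_norm.
- by right; exists (t * r); [apply/andP; split; nra|exists i].
Qed.

Lemma disc_region_cover p : ~ support disc_graph p <-> exists i, disc_region i p.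
Proof.
have r0 := r_gt0; split; last first.
  move=> [[m|] h] /disc_support_cases[n|[rho /andP[h1 h2] [i e]]].
  - have := sector_disc h; rewrite /disc /= n; lra.
  - case: h => rho' [phi [/andP[k1 k2] k3 e']].
    have rp : 0 < rho.
      rewrite lt_neqAle h1 andbT; apply/eqP => e0; move: e; rewrite -e0 scale0r e' => e1.
      have := congr1 (@enorm R) e1; rewrite enormZ ez_norm mulr1 enorm0 gtr0_norm //; lra.
    rewrite e' in e; have [] := ez_inj k1 rp _ e.
      exact: angle_small (disc_angle_range k3) (th_range i).
    move=> _ e2; have im : m = i by apply: th_uniq k3 _; rewrite e2 lexx; have /andP[] := th_step i.
    by subst i; rewrite e2 ltxx in k3.
  - by rewrite /= n in h; lra.
  - by move: h; rewrite /= e enormZ ez_norm mulr1 ger0_norm //; lra.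
move=> h.
have p0 : p != 0.
  by apply/eqP => p0; apply: h; left; exists None.
have [s s01 e] := polar p0; have [i /andP[i1 i2]] := th_cases s01.
have np : 0 < enorm p by rewrite enorm_gt0.
case: (ltgtP (enorm p) r) => pr; last 2 first.
- by exists None.
- exfalso; apply: h; right; exists (true, i), ((s - th i) / (th i.+1 - th i)).
  have d0 : 0 < th i.+1 - th i by lra.
  split; first by apply/andP; split; [apply: divr_ge0; lra|rewrite ler_pdivrMr //; lra].
  rewrite /= {1}e pr; congr (_ *: ez _); field; lra.
case: (eqVneq (th i) s) => is0.
  exfalso; apply: h; right; exists (false, i), (enorm p / r).
  split; first by apply/andP; split; [apply: divr_ge0; lra|rewrite ler_pdivrMr //; lra].
  by rewrite /= divfK ?gt_eqF // is0.
by exists (Some i), (enorm p), s; rewrite np pr i2 lt_neqAle is0 i1.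
Qed.

Lemma disc_length : (graph_length disc_graph <= ((2 * pi + 3) * r)%:E)%E.
Proof.
have r0 := r_gt0; rewrite /graph_length.
have le e : (curve_length (disc_curve e) <= (if e.1 then r * (th e.2.+1 - th e.2) else r)%:E)%E.
  case: e => [[] i] /=.
    have -> : r * (th i.+1 - th i) = (r * (th i.+1 - th i)) * 1 - (r * (th i.+1 - th i)) * 0 by ring.
    apply: curve_length_le => s t s0 st t1; rewrite /edist -scalerBr enormZ gtr0_norm //.
    rewrite -[enorm _]/(edist _ _) -mulrBr -mulrA; apply: ler_wpM2l; first exact: ltW.
    apply: le_trans (ez_lip _ _) _.
    have -> : th i + t * (th i.+1 - th i) - (th i + s * (th i.+1 - th i)) = (th i.+1 - th i) * (t - s) by ring.
    rewrite ger0_norm // mulr_ge0 ?subr_ge0 //; have /andP[] := th_step i; lra.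
  have -> : r = r * 1 - r * 0 by ring.
  apply: curve_length_le => s t s0 st t1; rewrite /edist -scalerBl enormZ ez_norm mulr1.
  by rewrite -mulrBl -mulrBr mulrC ger0_norm // mulr_ge0 ?subr_ge0 // ltW.
apply: (@le_trans _ _ (\sum_(e : bool * 'I_3) (if e.1 then r * (th e.2.+1 - th e.2) else r)%:E)%E).
  by apply: lee_sum => e _; exact: le.
rewrite sumEFin lee_fin.
have -> : \sum_(e : bool * 'I_3) (if e.1 then r * (th e.2.+1 - th e.2) else r) =
   \sum_(b : bool) \sum_(i < 3) (if b then r * (th i.+1 - th i) else r).
  by rewrite pair_bigA.
rewrite big_bool /= !big_ord_recr !big_ord0 /=.
rewrite th3 th0; lra.
Qed.

End DiscGraph.

Section DiscCompetitor.
Variable R : realType.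

Lemma disc_competitor (a : 'I_3 -> R) : (forall m, 0 < a m) ->
  exists r : R, [/\ 0 < r, pi * r ^+ 2 <= \sum_m a m &
    exists B : complex R 3, (forall m, area B m = a m) /\
      (graph_length B <= ((2 * pi + 3) * r)%:E)%E].
Proof.
move=> a0; have pi0 := pi_gt0 R.
pose S := \sum_m a m.
have SE : S = a (@Ordinal 3 0 isT) + a (@Ordinal 3 1 isT) + a (@Ordinal 3 2 isT).
  rewrite /S !big_ord_recr big_ord0 /= add0r.
  by congr (a _ + a _ + a _); apply: val_inj.
set a1 := a (@Ordinal 3 0 isT) in SE; set a2 := a (@Ordinal 3 1 isT) in SE.
set a3 := a (@Ordinal 3 2 isT) in SE.
have p1 : 0 < a1 := a0 _. have p2 : 0 < a2 := a0 _. have p3 : 0 < a3 := a0 _.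
(* The radius is fixed through the actual area [c] of the unit disc. From [pi <= c] follows the
   inequality [pi * r ^+ 2 <= S], which is the direction wanted. *)
pose c := fine (plane_area (@disc R 1)).
have cE : plane_area (@disc R 1) = c%:E.
  by rewrite /c fineK // ge0_fin_numE ?plane_area_ge0 // disc_area_fin.
have cpi : pi <= c.
  have := @disc_area_ge R 1 ltr01; rewrite cE lee_fin expr1n mulr1 //.
have c0 : 0 < c by lra.
pose r := Num.sqrt (S / c).
have S0 : 0 < S by rewrite SE; lra.
have r0 : 0 < r by rewrite sqrtr_gt0 divr_gt0.
have r2 : r ^+ 2 = S / c by rewrite sqr_sqrtr // ltW // divr_gt0.
exists r; split => //.
  rewrite r2 -/S mulrCA; apply: ler_piMr; first exact: ltW.
  by rewrite ler_pdivrMr // mul1r.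
have full : sector_area r 0 (2 * pi) = S.
  apply: EFin_inj; rewrite -sector_full // disc_area_scale // cE -EFinM r2; congr EFin.
  by field; rewrite gt_eqF.
have [t1 /andP[t10 t11] e1] : exists2 t, 0 <= t <= 2 * pi & sector_area r 0 t = a1.
  by apply: sector_ivt => //; rewrite full SE; apply/andP; split; move: p1 p2 p3; clear; lra.
have [t2 /andP[t20 t21] e2] : exists2 t, 0 <= t <= 2 * pi & sector_area r 0 t = a1 + a2.
  by apply: sector_ivt => //; rewrite full SE; apply/andP; split; move: p1 p2 p3; clear; lra.
pose th k := nth (2 * pi) [:: 0; t1; t2] k.
have h01 : th 0 < th 1.
  rewrite /th /= lt_neqAle t10 andbT; apply/eqP => e; move: e1 p1; rewrite -e sector_area0 => <-; by rewrite ltxx.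
have h12 : th 1 < th 2.
  rewrite /th /= ltNge; apply/negP => h.
  have := sector_split r0 t20 h (lexx _) t11; rewrite e1 e2 => hh.
  have : sector_area r t2 t1 < 0 by move: hh p2; clear; lra.
  by rewrite ltNge sector_area_ge0.
have h23 : th 2 < th 3.
  rewrite /th /= lt_neqAle t21 andbT; apply/eqP => e; move: e2; rewrite e full SE => e2.
  have a30 : a3 = 0 by move: e2; clear; lra.
  by move: p3; rewrite a30 ltxx.
have hE (m : 'I_3) : plane_area (disc_region r th (Some m)) = (a m)%:E.
  rewrite /disc_region sector_areaE; congr EFin.
  case: m => [[|[|[|m]]] hm] //=.
  - by rewrite -[RHS]/(a (Ordinal hm)) (_ : Ordinal hm = @Ordinal 3 0 isT) //; apply: val_inj.
  - have := sector_split r0 t10 (ltW h12) (lexx _) t21; rewrite e1 e2 /th /= => h.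
    have -> : sector_area r t1 t2 = a2 by apply: (addrI a1).
    by congr a; apply: val_inj.
  - have := sector_split r0 t20 (ltW h23) (lexx _) (lexx _); rewrite full SE e2 /th /= => h.
    have -> : sector_area r t2 (2 * pi) = a3 by move: h; clear; lra.
    by congr a; apply: val_inj.
have E0 : th 0 = 0 by []. have E3 : th 3 = 2 * pi by [].
have fo := @disc_region_open R r th.
have fd := @disc_region_disj R r th r0 E0 h01 h12 h23 E3.
have fc := @disc_region_cover R r th r0 E0 h01 h12 h23 E3.
exists (mk_complex fo fd fc a0 hE); split => //.
have L := @disc_length R r th r0 E0 h01 h12 h23 E3.
exact: L.
Qed.

End DiscCompetitor.

(** * Circular arcs and darts *)

Section Lifting.
Variable R : realType.
Implicit Types (s t x : R).

(* Cousin's lemma: an additive property of intervals that holds for all small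
   intervals holds for all intervals. *)
Lemma cousin (P : R -> R -> Prop) (a b : R) : a <= b ->
  (forall x, a <= x <= b -> exists2 d : R, 0 < d &
    forall s t, a <= s -> s <= x -> x <= t -> t <= b -> x - d < s -> t < x + d -> P s t) ->
  (forall s t u, a <= s -> s <= t -> t <= u -> u <= b -> P s t -> P t u -> P s u) -> P a b.
Proof.
move=> ab loc tr.
pose S : set R := [set t | a <= t <= b /\ P a t].
have Sa : S a.
  have [|d d0 hd] := loc a; first by rewrite lexx.
  by split; [rewrite lexx|apply: hd; rewrite ?lexx ?ltrBlDr ?ltrDl].
have Sb : has_sup S by split; [exists a|exists b => t [/andP[]]].
pose c := sup S.
have ac : a <= c by apply: sup_upper_bound.
have cb : c <= b by apply: ge_sup; [exists a|move=> t [/andP[]]].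
have [|d d0 hd] := loc c; first by rewrite ac.
have [t St tc] := sup_adherent d0 Sb; rewrite -/c in tc.
have tc' : t <= c by apply: sup_upper_bound.
case: St => /andP[at_ tb] Pat.
pose u := Num.min b (c + d / 2).
have uc : c <= u by rewrite /u le_min cb /=; lra.
have ub : u <= b by rewrite /u ge_min lexx.
have ucd : u < c + d by rewrite /u gt_min; apply/orP; right; lra.
have Pau : P a u by apply: (tr a t u) => //; [lra|apply: hd].
have uc2 : u <= c by apply: sup_upper_bound => //; split => //; rewrite ub andbT; lra.
have ecu : u = c by apply/eqP; rewrite eq_le uc2.
have -> // : b = u.
by move: ecu; rewrite /u; case: (leP b (c + d / 2)) => h e //; lra.
Qed.

Lemma ezB a b c : ez a = ez b -> ez (a + c - b) = ez c :> plane R.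
Proof.
move=> [ca sa]; have e := cos2Dsin2 b.
have -> : a + c - b = c + (a - b) by ring.
rewrite ezD cosB sinB ca sa; have -> : sin b * cos b - cos b * sin b = 0 by ring.
by have -> : cos b * cos b + sin b * sin b = 1; [rewrite -e; ring|rewrite scale0r addr0 scale1r].
Qed.

Lemma continuous_min_c c : continuous (fun x : R => Num.min x c).
Proof. by move=> x; apply: (@continuous_min _ _ id (fun=> c)); [exact: cvg_id|exact: cvg_cst]. Qed.

Lemma continuous_max_c c : continuous (fun x : R => Num.max x c).
Proof. by move=> x; apply: (@continuous_max _ _ id (fun=> c)); [exact: cvg_id|exact: cvg_cst]. Qed.

(** Near each parameter [w] stays in a half-plane, where the arcsine formula lifts the angle;
    Cousin's lemma assembles these local lifts. *)
Lemma angle_lift (w : R -> plane R) : continuous w -> (forall t, w t != 0) ->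
  exists2 th : R -> R, continuous th & forall t, 0 <= t <= 1 -> w t = enorm (w t) *: ez (th t).
Proof.
move=> cw w0.
pose P s t := exists2 th : R -> R, continuous th & forall x, s <= x <= t -> w x = enorm (w x) *: ez (th x).
apply: (@cousin P 0 1) => //.
- move=> x _; have [phi _ e] := polar (w0 x).
  have n0 : 0 < enorm (w x) by rewrite enorm_gt0.
  have /cvg_edistP := cw x => /(_ _ n0) /nbhs_ballP[d /= d0 hd].
  exists d => // s t _ sx xt _ xs tx.
  pose cl y := Num.max (Num.min y t) s.
  have cl1 y : s <= cl y <= t.
    by rewrite /cl le_max lexx orbT ge_max ge_min lexx orbT (le_trans sx xt).
  have cl2 y : s <= y <= t -> cl y = y by move=> /andP[h1 h2]; rewrite /cl (min_l h2) (max_l h1).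
  have dt y : 0 < dot (w (cl y)) (ez phi).
    have /andP[h1 h2] := cl1 y.
    have : edist (w (cl y)) (w x) < enorm (w x).
      by apply: hd; rewrite /ball /= ltr_norml; apply/andP; split; lra.
    have -> : dot (w (cl y)) (ez phi) = enorm (w x) + dot (w (cl y) - w x) (ez phi).
      rewrite {2}e planeB planeZ /dot /ez /=; have := cos2Dsin2 phi.
      move: (cos phi) (sin phi) => c0 s0 h.
      rewrite [RHS](_ : _ = (w (cl y)).1 * c0 + (w (cl y)).2 * s0 + enorm (w x) * (1 - (c0 ^+ 2 + s0 ^+ 2))); last by ring.
      by rewrite h subrr mulr0 addr0.
    have := norm_dot_le (w (cl y) - w x) (ez phi); rewrite ez_norm mulr1 -/(edist _ _) ler_norml => /andP[? _]; lra.
  exists (fun y => phi + asin (cross (ez phi) (w (cl y)) / enorm (w (cl y)))); last first.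
    by move=> y yst; have [_] := polar_near (dt y); rewrite (cl2 y yst).
  move=> y; apply: cvgD; first exact: cvg_cst.
  have [z1 _] := polar_near (dt y).
  have ccl : continuous cl.
    move=> z; apply: (@continuous_comp _ _ _ (fun z => Num.min z t) (fun z => Num.max z s)).
      exact: continuous_min_c.
    exact: continuous_max_c.
  have cwc : {for y, continuous (fun y => w (cl y))}.
    by apply: (@continuous_comp _ _ _ cl w y (ccl y)); exact: cw.
  apply: (@continuous_comp _ _ _ (fun y => cross (ez phi) (w (cl y)) / enorm (w (cl y))) (@asin R)); last first.
    by apply: continuous_asin; move: z1; rewrite ltr_norml.
  apply: cvgM.
    have -> : (fun y => cross (ez phi) (w (cl y))) = (fun y => dot (rot (ez phi)) (w (cl y))).
      by apply/funext => z; rewrite /cross /dot /rot /=; ring.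
    have -> : cross (ez phi) (w (cl y)) = dot (rot (ez phi)) (w (cl y)) by rewrite /cross /dot /rot /=; ring.
    by apply: cvg_dot; [exact: cvg_cst|exact: cwc].
  by apply: cvgV; [rewrite enorm_eq0|apply: cvg_enorm; exact: cwc].
- move=> s t u _ st tu _ [th1 c1 h1] [th2 c2 h2].
  (* [th1] is frozen after [t] and [th2] before [t]. The shift [th1 t - th2 t] that joins them is a
     period, since both angles describe the direction of [w t]. *)
  exists (fun x => th1 (Num.min x t) + th2 (Num.max x t) - th2 t).
    move=> x; apply: cvgB; last exact: cvg_cst.
    apply: cvgD.
      by apply: (@continuous_comp _ _ _ (fun x => Num.min x t) th1); [exact: continuous_min_c|exact: c1].
    by apply: (@continuous_comp _ _ _ (fun x => Num.max x t) th2); [exact: continuous_max_c|exact: c2].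
  move=> x /andP[sx xu]; case: (leP x t) => xt.
    by rewrite addrK; apply: h1; rewrite sx.
  rewrite ezB; first by apply: h2; rewrite xu ltW.
  have nt : enorm (w t) != 0 by rewrite enorm_eq0.
  apply: (scalerI nt); rewrite -h1 ?st ?lexx // -h2 ?tu ?lexx //.
Qed.

(** Composition with this retraction turns continuity within [0, 1] into continuity on the whole
    line. *)
Definition clamp01 (t : R) := Num.max (Num.min t 1) 0.

Lemma clamp01_range t : 0 <= clamp01 t <= 1.
Proof. by rewrite /clamp01 le_max lexx orbT ge_max ge_min lexx orbT ler01. Qed.

Lemma clamp01_id t : 0 <= t <= 1 -> clamp01 t = t.
Proof. by move=> /andP[h1 h2]; rewrite /clamp01 (min_l h2) (max_l h1). Qed.

Lemma clamp01_continuous (T : topologicalType) (g : R -> T) : {within `[0, 1], continuous g} ->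
  continuous (g \o clamp01).
Proof.
move=> cg t.
have cc : continuous clamp01.
  move=> z; have h := @continuous_comp R R R (fun z : R => Num.min z 1) (fun z : R => Num.max z 0) z.
  exact: (h (@continuous_min_c _ _) (@continuous_max_c _ _)).
have h : (clamp01 x @[x --> t]) `=>` within `[0, 1] (nbhs (clamp01 t)).
  move=> A /= hA; have H : \forall x \near t, `[0, 1]%classic (clamp01 x) -> A (clamp01 x) := cc t _ hA.
  change (\forall x \near t, A (clamp01 x)); apply: filterS H => x; apply.
  by rewrite /= in_itv; exact: clamp01_range.
have ct : `[0, 1]%classic (clamp01 t) by rewrite /= in_itv; exact: clamp01_range.
have cgt : g x @[x --> within `[0, 1] (nbhs (clamp01 t))] --> g (clamp01 t).
  by rewrite (nbhs_subspace_in ct); exact: cg.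
exact: cvg_trans (cvg_app g h) cgt.
Qed.

(** Edges are injective only on the open interval, since a loop has equal ends. Monotonicity is
    therefore obtained inside and carried to the ends by one-sided limits. *)
Lemma increasing_ends (f : R -> R) : {within `[0, 1], continuous f} ->
  (forall s t, 0 < s -> s < t -> t < 1 -> f s < f t) ->
  forall s t, 0 <= s -> s < t -> t <= 1 -> f s < f t.
Proof.
move=> cf inc; have [_ f0 f1] := (continuous_within_itvP f (@ltr01 R)).1 cf.
have h0 x : 0 < x < 1 -> f 0 <= f x.
  move=> /andP[x0 x1]; rewrite leNgt; apply/negP => h.
  have near1 : \forall t \near 0^'+, f x < f t by apply: cvgr_gt f0 _ h.
  have near2 : \forall t \near (0 : R)^'+, t < x by apply: nbhs_right_lt.
  have near3 : \forall t \near (0 : R)^'+, 0 < t by exact: nbhs_right_gt.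
  have [t [[t1 t2] t3]] := @filter_ex _ _ (at_right_proper_filter 0) _ (filterI (filterI near1 near2) near3).
  by have := inc t x t3 t2 x1; rewrite ltNge (ltW t1).
have h1 x : 0 < x < 1 -> f x <= f 1.
  move=> /andP[x0 x1]; rewrite leNgt; apply/negP => h.
  have near1 : \forall t \near 1^'-, f t < f x by apply: cvgr_lt f1 _ h.
  have near2 : \forall t \near (1 : R)^'-, x < t by apply: nbhs_left_gt.
  have near3 : \forall t \near (1 : R)^'-, t < 1 by exact: nbhs_left_lt.
  have [t [[t1 t2] t3]] := @filter_ex _ _ (at_left_proper_filter 1) _ (filterI (filterI near1 near2) near3).
  by have := inc x t x0 t2 t3; rewrite ltNge (ltW t1).
have k0 x : 0 < x < 1 -> f 0 < f x.
  move=> /andP[x0 x1]; apply: le_lt_trans (h0 (x / 2) _) _; first by apply/andP; split; lra.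
  by apply: inc; lra.
have k1 x : 0 < x < 1 -> f x < f 1.
  move=> /andP[x0 x1]; apply: lt_le_trans (h1 ((x + 1) / 2) _); last by apply/andP; split; lra.
  by apply: inc; lra.
move=> s t; rewrite le_eqVlt => /orP[/eqP<-|s0] st; rewrite le_eqVlt => /orP[/eqP t1|t1]; try subst t.
- by apply: lt_trans (k0 (1 / 2) _) (k1 (1 / 2) _); apply/andP; split; lra.
- by apply: k0; rewrite st.
- by apply: k1; rewrite s0.
- exact: inc.
Qed.

Lemma monotone_of_inj (f : R -> R) : {within `[0, 1], continuous f} ->
  (forall s t, 0 < s < 1 -> 0 < t < 1 -> f s = f t -> s = t) ->
  (forall s t, 0 <= s -> s < t -> t <= 1 -> f s < f t) \/
  (forall s t, 0 <= s -> s < t -> t <= 1 -> f t < f s).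
Proof.
move=> cf inj.
have cf' : {within `]0, 1[, continuous f}.
  by apply: continuous_subspaceW cf => x /=; rewrite !in_itv /= => /andP[? ?]; rewrite !ltW.
have inj' : {in `]0, 1[ &, injective f} by move=> x y; rewrite !in_itv /=; exact: inj.
have [m|m] := itv_continuous_inj_mono cf' inj'.
  left; apply: increasing_ends => // s t s0 st t1.
  by apply: m => //; rewrite in_itv /=; apply/andP; split; lra.
right; have H : forall s t, 0 <= s -> s < t -> t <= 1 -> - f s < - f t.
  apply: (@increasing_ends (fun x => - f x)).
    by move=> x; apply: continuousN; exact: cf.
  move=> s t s0 st t1; rewrite ltrN2.
  by apply: m => //; rewrite in_itv /=; apply/andP; split; lra.
by move=> s t s0 st t1; have := H s t s0 st t1; rewrite ltrN2.
Qed.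

End Lifting.

(** * Curves of constant curvature *)

Section Arcs.
Variable R : realType.
Implicit Types (z : plane R) (psi k s t L r : R).

(* The unit speed curve with start z, initial direction ez psi and signed
   curvature k (positive when it turns left). *)
Definition arc_pt z psi k s : plane R :=
  if k == 0 then z + s *: ez psi
  else z + k^-1 *: (rot (ez psi) - rot (ez (psi + k * s))).

Lemma arc_pt0 z psi k : arc_pt z psi k 0 = z.
Proof. by rewrite /arc_pt; case: eqP => _; rewrite ?scale0r ?mulr0 ?addr0 // subrr scaler0 addr0. Qed.

Lemma der_arc1 z psi k s : is_derive s 1 (fun s => (arc_pt z psi k s).1) (cos (psi + k * s)).
Proof.
rewrite /arc_pt; case: eqP => [->|/eqP k0].
  rewrite mul0r addr0; have -> : (fun s => (z + s *: ez psi).1) = (fun s => z.1 + s * cos psi) by [].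
  by apply: der_eq (der_D (der_cst _ s) (der_M (der_id s) (der_cst _ s))) _; ring.
have -> : (fun s => (z + k^-1 *: (rot (ez psi) - rot (ez (psi + k * s)))).1) =
   (fun s => z.1 + k^-1 * (- sin psi - - sin (psi + k * s))) by [].
apply: der_eq (der_D (der_cst _ s) (der_Z _ (der_B (der_cst _ s) (der_N (der_sin (der_D (der_cst _ s) (der_Z k (der_id s)))))))) _.
by field.
Qed.

Lemma der_arc2 z psi k s : is_derive s 1 (fun s => (arc_pt z psi k s).2) (sin (psi + k * s)).
Proof.
rewrite /arc_pt; case: eqP => [->|/eqP k0].
  rewrite mul0r addr0; have -> : (fun s => (z + s *: ez psi).2) = (fun s => z.2 + s * sin psi) by [].
  by apply: der_eq (der_D (der_cst _ s) (der_M (der_id s) (der_cst _ s))) _; ring.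
have -> : (fun s => (z + k^-1 *: (rot (ez psi) - rot (ez (psi + k * s)))).2) =
   (fun s => z.2 + k^-1 * (cos psi - cos (psi + k * s))) by [].
apply: der_eq (der_D (der_cst _ s) (der_Z _ (der_B (der_cst _ s) (der_cos (der_D (der_cst _ s) (der_Z k (der_id s))))))) _.
by field.
Qed.

Lemma arc_ptD z psi k s t : arc_pt z psi k (s + t) = arc_pt (arc_pt z psi k s) (psi + k * s) k t.
Proof.
rewrite /arc_pt; case: eqP => [->|/eqP k0]; first by rewrite mul0r addr0 scalerDl addrA.
by rewrite -addrA -scalerDr subrKA mulrDr addrA.
Qed.

Lemma arc_pt_rev z psi k L s :
  arc_pt (arc_pt z psi k L) (psi + k * L + pi) (- k) s = arc_pt z psi k (L - s).
Proof.
rewrite arc_ptD /arc_pt oppr_eq0; case: eqP => [->|/eqP k0].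
  by rewrite ezDpi scalerN scaleNr.
congr (_ + _); rewrite invrN scaleNr -scalerN opprB; congr (_ *: _).
have rN u : rot (- u) = - rot u :> plane R by rewrite /rot planeN.
have -> : psi + k * L + pi + - k * s = psi + k * L + k * - s + pi by ring.
by rewrite !ezDpi !rN opprK addrC.
Qed.

(** Projected on the direction of the chord, the velocity is at most [dl] by Cauchy-Schwarz, so [l]
    minus the projection is nondecreasing. *)
Lemma plane_mvt (x y dx dy l dl : R -> R) s t : s <= t ->
  (forall r, s <= r <= t -> is_derive r 1 x (dx r)) ->
  (forall r, s <= r <= t -> is_derive r 1 y (dy r)) ->
  (forall r, s <= r <= t -> is_derive r 1 l (dl r)) ->
  (forall r, s <= r <= t -> 0 <= dl r /\ dx r ^+ 2 + dy r ^+ 2 <= dl r ^+ 2) ->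
  edist (x t, y t) (x s, y s) <= l t - l s.
Proof.
move=> st hx hy hl hd; pose v : plane R := (x t - x s, y t - y s).
rewrite -[edist _ _]/(enorm v); case: (eqVneq v 0) => v0.
  rewrite v0 enorm0 subr_ge0; apply: (der_le st hl) => r /hd[] //.
have nv : 0 < enorm v by rewrite enorm_gt0.
pose f r := l r - (v.1 / enorm v * x r + v.2 / enorm v * y r).
have fE : f s <= f t.
  apply: (@der_le R f (fun r => dl r - (v.1 / enorm v * dx r + v.2 / enorm v * dy r)) s t st) => r hr.
    exact: der_B (hl r hr) (der_D (der_Z _ (hx r hr)) (der_Z _ (hy r hr))).
  have [d0 d1] := hd r hr; rewrite subr_ge0.
  have -> : v.1 / enorm v * dx r + v.2 / enorm v * dy r = dot v (dx r, dy r) / enorm v.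
    by rewrite /dot /=; field; rewrite gt_eqF.
  rewrite ler_pdivrMr // mulrC; apply: le_trans (dot_le _ _) _.
  by apply: ler_wpM2l; [exact: ltW|exact: enorm_le].
move: fE; rewrite /f.
have e : v.1 / enorm v * (x t - x s) + v.2 / enorm v * (y t - y s) = enorm v.
  rewrite -[x t - x s]/v.1 -[y t - y s]/v.2.
  have -> : v.1 / enorm v * v.1 + v.2 / enorm v * v.2 = (v.1 ^+ 2 + v.2 ^+ 2) / enorm v by ring.
  by rewrite -enormE2 expr2 mulfK // gt_eqF.
lra.
Qed.

Lemma arc_lip z psi k s t : edist (arc_pt z psi k s) (arc_pt z psi k t) <= `|s - t|.
Proof.
wlog st : s t / t <= s.
  move=> H; case: (leP t s) => h; first exact: H.
  by rewrite edistC distrC; apply: H; exact: ltW.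
rewrite ger0_norm ?subr_ge0 //.
have := @plane_mvt (fun s => (arc_pt z psi k s).1) (fun s => (arc_pt z psi k s).2)
  (fun s => cos (psi + k * s)) (fun s => sin (psi + k * s)) id (fun=> 1) t s st.
have pE p : (p.1, p.2) = p :> plane R by case: p.
rewrite !pE; apply.
- by move=> r _; exact: der_arc1.
- by move=> r _; exact: der_arc2.
- by move=> r _; rewrite ler01 cos2Dsin2 expr1n.
Qed.

Lemma arc_continuous z psi k : continuous (arc_pt z psi k).
Proof.
move=> t; apply/cvg_edistP => e e0; apply/nbhs_ballP; exists e => //= s.
by rewrite /ball /= distrC; apply: le_lt_trans; exact: arc_lip.
Qed.

Lemma arc_direction z psi k s : 0 <= s ->
  edist (arc_pt z psi k s) (z + s *: ez psi) <= `|k| * s ^+ 2.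
Proof.
move=> s0.
have := @plane_mvt (fun r => (arc_pt z psi k r).1 - (z.1 + r * cos psi)) (fun r => (arc_pt z psi k r).2 - (z.2 + r * sin psi))
  (fun r => cos (psi + k * r) - cos psi) (fun r => sin (psi + k * r) - sin psi) (fun r => `|k| * s * r) (fun=> `|k| * s) 0 s s0.
rewrite arc_pt0 !mul0r !addr0 !subrr mulr0 subr0.
have -> : `|k| * s * s = `|k| * s ^+ 2 by ring.
have -> : edist ((arc_pt z psi k s).1 - (z.1 + s * cos psi), (arc_pt z psi k s).2 - (z.2 + s * sin psi)) (0, 0) =
  edist (arc_pt z psi k s) (z + s *: ez psi) by rewrite /edist -[(0, 0)]/(0 : plane R) subr0.
apply.
- move=> r _; apply: der_eq (der_B (der_arc1 _ _ _ r) (der_D (der_cst _ r) (der_M (der_id r) (der_cst _ r)))) _; ring.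
- move=> r _; apply: der_eq (der_B (der_arc2 _ _ _ r) (der_D (der_cst _ r) (der_M (der_id r) (der_cst _ r)))) _; ring.
- by move=> r _; apply: der_eq (der_Z _ (der_id r)) _; rewrite mulr1.
- move=> r /andP[r0 r1]; split; first by rewrite mulr_ge0.
  have := ez_lip (psi + k * r) psi; rewrite -(@ler_pXn2r _ 2) ?nnegrE ?edist_ge0 // enormE2 planeB /= => h.
  apply: le_trans h _; rewrite [psi + _]addrC addrK normrM (ger0_norm r0) ler_pXn2r ?nnegrE ?mulr_ge0 //.
  exact: ler_wpM2l.
Qed.

(** The chord is at least its projection on the initial tangent, and the cosine is at least
    [1 - x ^+ 2 / 2]. The defect is cubic in [s], so inscribed polygons reach the full length in the
    limit. *)
Lemma arc_chord_ge z psi k s : 0 <= s ->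
  s - k ^+ 2 * s ^+ 3 / 2 <= edist (arc_pt z psi k s) z.
Proof.
move=> s0; pose f r := cos psi * (arc_pt z psi k r).1 + sin psi * (arc_pt z psi k r).2 - (1 - k ^+ 2 * s ^+ 2 / 2) * r.
have fE : f 0 <= f s.
  apply: (@der_le R f (fun r => cos psi * cos (psi + k * r) + sin psi * sin (psi + k * r) - (1 - k ^+ 2 * s ^+ 2 / 2)) 0 s s0) => r hr.
    apply: der_eq (der_B (der_D (der_Z _ (der_arc1 z psi k r)) (der_Z _ (der_arc2 z psi k r))) (der_Z _ (der_id r))) _.
    by rewrite mulr1.
  rewrite -cosB; have -> : psi - (psi + k * r) = - (k * r) by ring.
  rewrite cosN; have := cos_ge_quad (k * r); case/andP: hr => r0 rs.
  have : (k * r) ^+ 2 <= k ^+ 2 * s ^+ 2.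
    by rewrite exprMn; apply: ler_wpM2l; [exact: sqr_ge0|rewrite ler_pXn2r ?nnegrE].
  lra.
move: fE; rewrite /f arc_pt0 mulr0 subr0 => fE.
have := dot_le (arc_pt z psi k s - z) (ez psi); rewrite ez_norm mulr1 => h.
apply: le_trans h; rewrite /dot /= .
have -> : s - k ^+ 2 * s ^+ 3 / 2 = (1 - k ^+ 2 * s ^+ 2 / 2) * s by ring.
lra.
Qed.

(* Up to sign, the power of the point p with respect to the circle carrying the
   arc; positive on its left side. *)
Definition arc_side z psi k (p : plane R) : R :=
  dot (p - z) (rot (ez psi)) - k / 2 * dot (p - z) (p - z).

Lemma arc_side_normal z psi k s h :
  arc_side z psi k (arc_pt z psi k s + h *: rot (ez (psi + k * s))) = h - k / 2 * h ^+ 2.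
Proof.
have e1 := cos2Dsin2 psi; have e2 := cos2Dsin2 (psi + k * s).
have zK u : z + u - z = u by rewrite addrAC subrr add0r.
rewrite /arc_side /arc_pt; case: eqP => [->|/eqP k0].
  rewrite -(addrA z) !zK !mul0r !addr0 !subr0 planeD !planeZ /dot /rot /ez /=.
  transitivity (h * (cos psi ^+ 2 + sin psi ^+ 2)); first by ring.
  by rewrite e1 mulr1.
rewrite -(addrA z) !zK planeD !planeZ /dot /rot /ez /=.
move: e1 e2; move: (cos _) (sin psi) (cos (_ + _)) (sin (_ + _)) => c s' c' s'' e1 e2.
have -> : (k^-1 * (- s' - - s'') + h * - s'') * - s' + (k^-1 * (c - c') + h * c') * c - k / 2 * ((k^-1 * (- s' - - s'') + h * - s'') * (k^-1 * (- s' - - s'') + h * - s'') + (k^-1 * (c - c') + h * c') * (k^-1 * (c - c') + h * c')) =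
  (k^-1 / 2) * ((c ^+ 2 + s' ^+ 2) - (c' ^+ 2 + s'' ^+ 2)) + (h - k / 2 * h ^+ 2) * (c' ^+ 2 + s'' ^+ 2) by field.
by rewrite e1 e2 subrr mulr0 add0r mulr1.
Qed.

Lemma arc_side_arc z psi k s : arc_side z psi k (arc_pt z psi k s) = 0.
Proof.
by have := arc_side_normal z psi k s 0; rewrite scale0r addr0 expr0n /= mulr0 subr0.
Qed.

(** [sig] is the arc length function of [g]; strict monotonicity together with [arc_sig_onto]
    encodes its continuity. *)
Record is_arc (g : R -> plane R) z psi k L (sig : R -> R) : Prop := IsArc {
  arc_len_gt0 : 0 < L;
  arc_sig0 : sig 0 = 0;
  arc_sig1 : sig 1 = L;
  arc_sig_inc : forall s t, 0 <= s -> s < t -> t <= 1 -> sig s < sig t;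
  arc_sig_onto : forall s, 0 <= s <= L -> exists2 t, 0 <= t <= 1 & sig t = s;
  arc_sigE : forall t, 0 <= t <= 1 -> g t = arc_pt z psi k (sig t) }.

Lemma arc_sig_le g z psi k L sig : is_arc g z psi k L sig ->
  forall s t, 0 <= s -> s <= t -> t <= 1 -> sig s <= sig t.
Proof.
move=> h s t s0; rewrite le_eqVlt => /orP[/eqP->//|st] t1.
exact: ltW (arc_sig_inc h s0 st t1).
Qed.

Lemma arc_length g z psi k L sig : is_arc g z psi k L sig -> curve_length g = L%:E.
Proof.
move=> h; have L0 := arc_len_gt0 h.
apply/eqP; rewrite eq_le; apply/andP; split.
  have -> : L = sig 1 - sig 0 by rewrite (arc_sig0 h) (arc_sig1 h) subr0.
  apply: curve_length_le => s t s0 st t1.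
  rewrite !(arc_sigE h) ?s0 ?t1 ?(le_trans s0 st) ?(le_trans st t1) //.
  apply: le_trans (arc_lip _ _ _ _ _) _; rewrite ger0_norm // subr_ge0.
  exact: (arc_sig_le h s0 st t1).
apply/lee_subgt0Pr => e e0.
(* With [N] equal pieces each chord misses at most [k ^+ 2 * (L / N) ^+ 3 / 2], which adds up to
   [C / N ^+ 2]. *)
pose C := k ^+ 2 * L ^+ 3 / 2.
have C0 : 0 <= C by rewrite /C; have := sqr_ge0 k; have := exprn_ge0 3 (ltW L0); nra.
pose N := (Num.truncn (C / e)).+1.
have N0 : (0 : R) < N%:R by rewrite ltr0n.
have NC : C / N%:R < e.
  by rewrite ltr_pdivrMr // mulrC -ltr_pdivrMr //; exact: truncnS_gt.
pose a (j : nat) : R := j%:R / N%:R * L.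
have ha j : (j <= N)%N -> 0 <= a j <= L.
  move=> jN; have h1 : 0 <= (j%:R / N%:R : R) <= 1.
    by rewrite divr_ge0 //= ler_pdivrMr // mul1r ler_nat.
  by rewrite /a; apply/andP; split; nra.
have ex j : exists t, (j <= N)%N -> 0 <= t <= 1 /\ sig t = a j.
  case: (leqP j N) => jN; last by exists 0.
  by have [t t01 st] := arc_sig_onto h (ha j jN); exists t.
have [tt htt] := choice ex.
have inj s t : 0 <= s <= 1 -> 0 <= t <= 1 -> sig s = sig t -> s = t.
  move=> /andP[s0 s1] /andP[t0 t1] e1; case: (ltgtP s t) => // st.
    by have := arc_sig_inc h s0 st t1; rewrite e1 ltxx.
  by have := arc_sig_inc h t0 st s1; rewrite e1 ltxx.
have tt0 : tt 0 = 0.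
  by have [h1 h2] := htt 0 isT; apply: inj; rewrite ?lexx ?ler01 // h2 (arc_sig0 h) /a mul0r mul0r.
have tt1 : tt N = 1.
  have [h1 h2] := htt N (leqnn _); apply: inj; rewrite ?lexx ?ler01 //.
  by rewrite h2 (arc_sig1 h) /a divff ?mul1r // gt_eqF.
have aS j : a j.+1 = a j + L / N%:R by rewrite /a -natr1; field; rewrite gt_eqF.
have ttS j : (j < N)%N -> tt j < tt j.+1.
  move=> jN; have [/andP[h1 h2] h3] := htt j (ltnW jN); have [/andP[k1 k2] k3] := htt j.+1 jN.
  rewrite ltNge; apply/negP => hle; have := arc_sig_le h k1 hle h2.
  by rewrite h3 k3 aS leNgt ltrDl divr_gt0.
apply: le_trans (curve_length_ge_partition g _ tt0 tt1 ttS); last by [].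
rewrite -EFinB lee_fin.
apply: (@le_trans _ _ (\sum_(0 <= j < N) (L / N%:R - k ^+ 2 * (L / N%:R) ^+ 3 / 2))).
  rewrite sumr_const_nat subn0 -[_ *+ N]mulr_natl.
  have -> : N%:R * (L / N%:R - k ^+ 2 * (L / N%:R) ^+ 3 / 2) = L - C / N%:R / N%:R.
    by rewrite /C; field; rewrite gt_eqF.
  rewrite lerB //; apply: le_trans _ (ltW NC).
  rewrite ler_pdivrMr //; apply: ler_peMr; first by rewrite divr_ge0.
  by rewrite ler1n.
rewrite !big_nat; apply: ler_sum => j /andP[_ jN].
have [h1 h2] := htt j (ltnW jN); have [k1 k2] := htt j.+1 jN.
rewrite !(arc_sigE h) // h2 k2 aS arc_ptD; apply: arc_chord_ge.
by rewrite divr_ge0 // ltW.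
Qed.

End Arcs.

(** * Edges as arcs *)

Section CarriedArcs.
Variable R : realType.

Lemma arc_of_param (g : R -> plane R) (f : R -> R) (G : R -> plane R) psi k :
  {within `[0, 1], continuous f} ->
  (forall s t, 0 <= s -> s < t -> t <= 1 -> f s < f t) ->
  (forall t, 0 <= t <= 1 -> g t = G (f t)) ->
  (forall s, G (f 0 + s) = arc_pt (g 0) psi k s) ->
  is_arc g (g 0) psi k (f 1 - f 0) (fun t => f t - f 0).
Proof.
move=> cf inc gG GE; have f01 : f 0 < f 1 by apply: inc; rewrite ?lexx ?ltr01.
split.
- by rewrite subr_gt0.
- by rewrite subrr.
- by [].
- by move=> s t s0 st t1; rewrite ltrD2r; exact: inc.
- move=> s /andP[s0 s1].
  have [t] : exists2 t, t \in `[0, 1] & f t = f 0 + s.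
    by apply: IVT => //; rewrite ge_min le_max; apply/andP; split; apply/orP; [left|right]; lra.
  by rewrite in_itv /= => t01 ft; exists t => //; rewrite ft addrAC subrr add0r.
- by move=> t t01; rewrite gG // -GE; congr G; ring.
Qed.

Lemma param_period (g : R -> plane R) (f : R -> R) (G : R -> plane R) p :
  {within `[0, 1], continuous f} ->
  (forall s t, 0 <= s -> s < t -> t <= 1 -> f s < f t) ->
  (forall t, 0 <= t <= 1 -> g t = G (f t)) ->
  (forall s t, 0 < s < 1 -> 0 < t < 1 -> g s = g t -> s = t) ->
  (forall x, G (x + p) = G x) -> 0 < p -> f 1 - f 0 <= p.
Proof.
move=> cf inc gG inj per p0; rewrite leNgt; apply/negP => h.
have ivt x : f 0 < x < f 1 -> exists2 t, 0 < t < 1 & f t = x.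
  move=> /andP[x0 x1].
  have [t] : exists2 t, t \in `[0, 1] & f t = x.
    by apply: IVT => //; rewrite ge_min le_max; apply/andP; split; apply/orP; [left|right]; lra.
  rewrite in_itv /= => /andP[t0 t1] ft; exists t => //; rewrite !lt_neqAle t0 t1 !andbT.
  by apply/andP; split; apply/eqP => e; [move: ft; rewrite -e => ft; lra|move: ft; rewrite e => ft; lra].
have [s s01 fs] : exists2 s, 0 < s < 1 & f s = f 0 + (f 1 - f 0 - p) / 2.
  by apply: ivt; apply/andP; split; lra.
have [t t01 ft] : exists2 t, 0 < t < 1 & f t = f s + p.
  by apply: ivt; rewrite fs; apply/andP; split; lra.
have oc x : 0 < x < 1 -> 0 <= x <= (1 : R) by move=> /andP[? ?]; rewrite !ltW.
have e : s = t by apply: inj => //; rewrite !gG ?oc // ft per.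
by move: ft; rewrite e => ft; lra.
Qed.

(** On a line the parameter is the coordinate along it, on a circle a lifted angle. Either is
    injective inside, hence monotone, and the sense of monotonicity fixes the direction or the sign
    of the curvature. *)
Lemma carried_arc (g : R -> plane R) (c : carrier R) : {within `[0, 1], continuous g} ->
  (forall s t, 0 < s < 1 -> 0 < t < 1 -> g s = g t -> s = t) ->
  (forall t, 0 <= t <= 1 -> on_carrier c (g t)) ->
  exists psi k L sig, is_arc g (g 0) psi k L sig /\ `|k| * L <= 2 * pi.
Proof.
move=> cg inj onc; have pi0 := pi_gt0 R.
have oc x : 0 < x < 1 -> 0 <= x <= (1 : R) by move=> /andP[? ?]; rewrite !ltW.
have I0 : 0 <= (0 : R) <= 1 by rewrite lexx ler01.
case: c onc => [p u|c r] onc.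
  have [u1 _] := onc 0 I0.
  have ru : enorm (rot u) = 1 by rewrite rot_norm.
  pose f t := dot (g t - p) (rot u).
  have gE t : 0 <= t <= 1 -> g t = p + f t *: rot u.
    move=> /onc[_ h]; rewrite /f {1}(_ : g t = p + (g t - p)); last by rewrite addrC subrK.
    by congr (_ + _); rewrite {1}(decompose (g t - p) u1) h scale0r add0r.
  have cf : {within `[0, 1], continuous f}.
    have cd : continuous (fun q : plane R => dot (q - p) (rot u)).
      move=> q; apply: cvg_dot; last exact: cvg_cst.
      by apply: cvgB; [exact: cvg_id|exact: cvg_cst].
    exact: (within_comp cg cd).
  have injf s t : 0 < s < 1 -> 0 < t < 1 -> f s = f t -> s = t.
    by move=> hs ht e; apply: inj => //; rewrite !gE ?oc // e.
  have [inc|dec] := monotone_of_inj cf injf.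
    have [psi epsi] := unit_ez ru.
    exists psi, 0, (f 1 - f 0), (fun t => f t - f 0); split; last by rewrite normr0 mul0r; lra.
    apply: (@arc_of_param g f (fun x => p + x *: rot u)) => // s.
    by rewrite /arc_pt eqxx gE // -epsi scalerDl addrA.
  have nru : enorm (- rot u) = 1 by rewrite enormN.
  have [psi epsi] := unit_ez nru.
  exists psi, 0, ((- f 1) - (- f 0)), (fun t => (- f t) - (- f 0)); split; last by rewrite normr0 mul0r; lra.
  apply: (@arc_of_param g (fun t => - f t) (fun x => p - x *: rot u)) => //.
  - by move=> x; apply: continuousN; exact: cf.
  - by move=> s t s0 st t1; rewrite ltrN2; exact: dec.
  - by move=> t t01; rewrite scaleNr opprK gE.
  - by move=> s; rewrite /arc_pt eqxx gE // -epsi scalerDl scaleNr opprD opprK scalerN addrA.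
have [r0 _] := onc 0 I0.
have nE t : 0 <= t <= 1 -> enorm (g t - c) = r by move=> /onc[].
pose w t := g (clamp01 t) - c.
have cw : continuous w.
  by move=> t; apply: cvgB; [exact: (clamp01_continuous cg)|exact: cvg_cst].
have w0 t : w t != 0 by rewrite -enorm_gt0 nE // clamp01_range.
have [th cth thE] := angle_lift cw w0.
have gE t : 0 <= t <= 1 -> g t = c + r *: ez (th t).
  move=> t01; have := thE t t01; rewrite /w clamp01_id // nE // => <-.
  by rewrite addrC subrK.
have injth s t : 0 < s < 1 -> 0 < t < 1 -> th s = th t -> s = t.
  by move=> hs ht e; apply: inj => //; rewrite !gE ?oc // e.
have cr (a : R) : {within `[0, 1], continuous (fun t => a * th t)}.
  by apply: within_of_continuous => t; apply: cvgM; [exact: cvg_cst|exact: cth].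
have rn : r != 0 by rewrite gt_eqF.
have [inc|dec] := monotone_of_inj (within_of_continuous cth) injth.
  have inc' s t : 0 <= s -> s < t -> t <= 1 -> r * th s < r * th t.
    by move=> s0 st t1; rewrite ltr_pM2l //; exact: inc.
  have gG t : 0 <= t <= 1 -> g t = c + r *: ez ((r * th t) / r).
    by move=> t01; rewrite gE // mulrAC divff // mul1r.
  exists (th 0 + pi / 2), r^-1, (r * th 1 - r * th 0), (fun t => r * th t - r * th 0); split.
    apply: (@arc_of_param g (fun t => r * th t) (fun x => c + r *: ez (x / r))) => // s.
    rewrite /arc_pt invr_eq0 (negbTE rn) invrK gE // !ez_rot.
    have -> : th 0 + pi / 2 + pi / 2 = th 0 + pi by field.
    have -> : th 0 + pi / 2 + r^-1 * s + pi / 2 = th 0 + s / r + pi by field.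
    have -> : (r * th 0 + s) / r = th 0 + s / r by field.
    by rewrite !ezDpi opprK scalerDr scalerN addrA addrK.
  have := @param_period g (fun t => r * th t) (fun x => c + r *: ez (x / r)) (r * (2 * pi)) (cr r) inc' gG inj.
  move=> h; rewrite gtr0_norm ?invr_gt0 // mulrC ler_pdivrMr // [2 * pi * r]mulrC; apply: h.
    by move=> x; rewrite mulrDl [r * (2 * pi)]mulrC mulfK // ez_2pi.
  by rewrite mulr_gt0 //; lra.
have inc' s t : 0 <= s -> s < t -> t <= 1 -> - r * th s < - r * th t.
  by move=> s0 st t1; rewrite !mulNr ltrN2 ltr_pM2l //; exact: dec.
have gG t : 0 <= t <= 1 -> g t = c + r *: ez (- ((- r * th t) / r)).
  by move=> t01; rewrite gE // mulrAC mulNr divff // mulN1r opprK.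
exists (th 0 - pi / 2), (- r^-1), (- r * th 1 - - r * th 0), (fun t => - r * th t - - r * th 0); split.
  apply: (@arc_of_param g (fun t => - r * th t) (fun x => c + r *: ez (- (x / r)))) => // s.
  rewrite /arc_pt oppr_eq0 invr_eq0 (negbTE rn) invrN invrK gE // !ez_rot.
  have -> : th 0 - pi / 2 + pi / 2 = th 0 by ring.
  have -> : th 0 - pi / 2 + - r^-1 * s + pi / 2 = th 0 - s / r by ring.
  have -> : - ((- r * th 0 + s) / r) = th 0 - s / r by field.
  by rewrite scaleNr scalerBr opprB -addrA [_ *: ez (th 0) + _]addrC subrK.
have := @param_period g (fun t => - r * th t) (fun x => c + r *: ez (- (x / r))) (r * (2 * pi)) (cr (- r)) inc' gG inj.
move=> h; rewrite normrN gtr0_norm ?invr_gt0 // mulrC ler_pdivrMr // [2 * pi * r]mulrC; apply: h.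
  move=> x; have -> : - ((x + r * (2 * pi)) / r) = - (x / r) - 2 * pi by field.
  by rewrite -{2}[- (x / r)](subrK (2 * pi)) ez_2pi.
by rewrite mulr_gt0 //; lra.
Qed.

End CarriedArcs.

Record arcs (R : realType) (G : embedded_graph R) := Arcs {
  arc_psi : edge G -> R;
  arc_k : edge G -> R;
  arc_l : edge G -> R;
  arc_sig : edge G -> R -> R;
  arcsP : forall e, is_arc (curve e) (curve e 0) (arc_psi e) (arc_k e) (arc_l e) (arc_sig e);
  arc_turn : forall e, `|arc_k e| * arc_l e <= 2 * pi }.

Lemma regular_arcs (R : realType) (n : nat) (B : complex R n) : regular B -> inhabited (arcs B).
Proof.
move=> rB.
have ex (e : edge B) : exists d : (R * R * R) * (R -> R),
    is_arc (curve e) (curve e 0) d.1.1.1 d.1.1.2 d.1.2 d.2 /\ `|d.1.1.2| * d.1.2 <= 2 * pi.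
  have [c hc] := regular_curvature rB e.
  have [|psi [k [L [sig [h1 h2]]]]] := carried_arc (@curve_continuous R B e) _ hc.
    by move=> s t hs ht /(curve_inj hs ht)[].
  by exists (psi, k, L, sig).
have [d hd] := choice ex.
exists; exact: (@Arcs R B (fun e => (d e).1.1.1) (fun e => (d e).1.1.2) (fun e => (d e).1.2)
  (fun e => (d e).2) (fun e => (hd e).1) (fun e => (hd e).2)).
Qed.

(** * Darts with their arc length parametrization *)

Section Darts.
Variables (R : realType) (G : embedded_graph R) (S : arcs G).
Implicit Types (d : edge G * bool) (e : edge G) (p q : plane R) (s t h : R).

Definition rev d : edge G * bool := (d.1, ~~ d.2).
Definition dorg d : plane R := position (edge_end d).
Definition dlen d : R := arc_l S d.1.
Definition dk d : R := if d.2 then - arc_k S d.1 else arc_k S d.1.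
Definition dpsi d : R :=
  if d.2 then arc_psi S d.1 + arc_k S d.1 * arc_l S d.1 + pi else arc_psi S d.1.
(** Unit speed parametrization from the origin of the dart, with direction angle [dang] and left
    normal [dnor]; [rev] exchanges the two sides of the edge. *)
Definition dpt d s : plane R := arc_pt (dorg d) (dpsi d) (dk d) s.
Definition dang d s : R := dpsi d + dk d * s.
Definition dnor d s : plane R := rot (ez (dang d s)).

Lemma revK : involutive rev.
Proof. by case=> e b; rewrite /rev /= negbK. Qed.

Lemma rev_neq d : rev d != d.
Proof. by case: d => e []; rewrite /rev xpair_eqE andbF. Qed.

Lemma dlen_gt0 d : 0 < dlen d.
Proof. exact: arc_len_gt0 (arcsP S d.1). Qed.

Lemma dlen_rev d : dlen (rev d) = dlen d. Proof. by []. Qed.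

Lemma dk_rev d : dk (rev d) = - dk d.
Proof. by rewrite /dk /=; case: d.2; rewrite //= opprK. Qed.

Lemma dorg_false e : dorg (e, false) = curve e 0.
Proof. by rewrite curve0. Qed.

Lemma dorg_true e : dorg (e, true) = dpt (e, false) (arc_l S e).
Proof.
rewrite /dorg -curve1 /dpt dorg_false.
have h := arcsP S e; rewrite (arc_sigE h) ?ler01 ?lexx //.
by rewrite (arc_sig1 h).
Qed.

Lemma dpt_rev d s : dpt (rev d) s = dpt d (dlen d - s).
Proof.
have e1 e t : dpt (e, true) t = dpt (e, false) (arc_l S e - t).
  by rewrite {1}/dpt dorg_true /dpt /dpsi /dk /= arc_pt_rev.
case: d => e [] /=; rewrite /rev /= ?e1 //.
by rewrite /dlen /= opprB addrC subrK.
Qed.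

Lemma ez_dang_rev d s : ez (dang (rev d) s) = - ez (dang d (dlen d - s)).
Proof.
rewrite /dang dk_rev; case: d => e [] /=; rewrite /dpsi /dk /rev /dlen /=.
  rewrite -ezDpi opprK.
  have -> : arc_psi S e + arc_k S e * arc_l S e + pi + - arc_k S e * (arc_l S e - s) + pi =
    arc_psi S e + arc_k S e * s + 2 * pi by ring.
  by rewrite ez_2pi.
by rewrite -ezDpi; congr ez; ring.
Qed.

Lemma rotN p : rot (- p) = - rot p.
Proof. by rewrite /rot planeN. Qed.

Lemma dnor_rev d s : dnor (rev d) s = - dnor d (dlen d - s).
Proof. by rewrite /dnor ez_dang_rev rotN. Qed.

Lemma dpt0 d : dpt d 0 = dorg d.
Proof. exact: arc_pt0. Qed.

Lemma dptL d : dpt d (dlen d) = dorg (rev d).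
Proof. by rewrite -(subr0 (dlen d)) -dpt_rev dpt0. Qed.

Lemma edge_param e t : 0 <= t <= 1 -> curve e t = dpt (e, false) (arc_sig S e t).
Proof. by move=> t01; rewrite (arc_sigE (arcsP S e) t01) /dpt dorg_false. Qed.

Lemma arc_sig_range e t : 0 < t < 1 -> 0 < arc_sig S e t < arc_l S e.
Proof.
move=> /andP[t0 t1]; have h := arcsP S e; apply/andP; split.
  by rewrite -(arc_sig0 h); apply: (arc_sig_inc h) => //; exact: ltW.
by rewrite -(arc_sig1 h); apply: (arc_sig_inc h) => //; exact: ltW.
Qed.

Lemma edge_param_inv d s : 0 < s < dlen d -> exists2 t, 0 < t < 1 & curve d.1 t = dpt d s.
Proof.
have aux e r : 0 < r < arc_l S e -> exists2 t, 0 < t < 1 & curve e t = dpt (e, false) r.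
  move=> /andP[r0 r1]; have h := arcsP S e.
  have [|t t01 st] := arc_sig_onto h (_ : 0 <= r <= _); first by rewrite !ltW.
  exists t; last by rewrite edge_param // st.
  case/andP: t01 => t0 t1; rewrite !lt_neqAle t0 t1 !andbT.
  apply/andP; split; apply/eqP => e0; [move: st; rewrite -e0 (arc_sig0 h) => st; lra|move: st; rewrite e0 (arc_sig1 h) => st; lra].
case: d => e [] /= sL; last exact: aux.
have [|t t01 ct] := aux e (arc_l S e - s); first by move: sL; rewrite /dlen /= => /andP[? ?]; apply/andP; split; lra.
by exists t => //; rewrite ct -[(e, true)]/(rev (e, false)) dpt_rev.
Qed.

Lemma dpt_support d s : 0 <= s <= dlen d -> support G (dpt d s).
Proof.
move=> /andP[s0 s1].
case: (eqVneq s 0) => [->|n0]; first by left; exists (edge_end d); rewrite dpt0.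
case: (eqVneq s (dlen d)) => [->|n1]; first by left; exists (edge_end (rev d)); rewrite dptL.
have [|t /andP[t0 t1] <-] := @edge_param_inv d s; first by rewrite !lt_neqAle eq_sym n0 n1 s0.
by right; exists d.1, t; rewrite !ltW.
Qed.

Lemma support_darts p : support G p ->
  (exists v : vertex G, p = position v) \/ exists e s, 0 < s < arc_l S e /\ p = dpt (e, false) s.
Proof.
case=> [h|[e [t [/andP[t0 t1] ->]]]]; first by left.
case: (eqVneq t 0) => [->|n0]; first by left; exists (edge_end (e, false)); rewrite curve0.
case: (eqVneq t 1) => [->|n1]; first by left; exists (edge_end (e, true)); rewrite curve1.
have t01 : 0 < t < 1 by rewrite !lt_neqAle eq_sym n0 n1 t0.
by right; exists e, (arc_sig S e t); rewrite arc_sig_range // edge_param // t0.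
Qed.

Lemma dpt_inj d d' s s' : 0 < s < dlen d -> 0 < s' < dlen d' -> dpt d s = dpt d' s' ->
  (d' = d /\ s' = s) \/ (d' = rev d /\ s' = dlen d - s).
Proof.
have aux e e' r r' : 0 < r < arc_l S e -> 0 < r' < arc_l S e' ->
    dpt (e, false) r = dpt (e', false) r' -> e = e' /\ r = r'.
  move=> hr hr' E.
  have sg e1 t : 0 < t < 1 -> 0 <= t <= (1 : R) by move=> /andP[? ?]; rewrite !ltW.
  have [/andP[r0 r1] /andP[r0' r1']] := (hr, hr').
  have h := arcsP S e; have h' := arcsP S e'.
  have [|t t01 st] := arc_sig_onto h (_ : 0 <= r <= _); first by rewrite !ltW.
  have [|t' t01' st'] := arc_sig_onto h' (_ : 0 <= r' <= _); first by rewrite !ltW.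
  have io e1 (x y : R) : 0 <= x <= 1 -> arc_sig S e1 x = y -> 0 < y < arc_l S e1 -> 0 < x < 1.
    move=> /andP[x0 x1] xy /andP[y0 y1]; have h1 := arcsP S e1; rewrite !lt_neqAle x0 x1 !andbT.
    apply/andP; split; apply/eqP => e0; [move: xy; rewrite -e0 (arc_sig0 h1) => xy; lra|move: xy; rewrite e0 (arc_sig1 h1) => xy; lra].
  have t02 := io e t r t01 st hr; have t02' := io e' t' r' t01' st' hr'.
  have : curve e t = curve e' t' by rewrite !edge_param // st st'.
  by move=> /(curve_inj t02 t02')[ee tt]; subst e' t'; rewrite -st -st'.
have fl e b s0 : 0 < s0 < arc_l S e -> exists2 r, 0 < r < arc_l S e &
    dpt (e, b) s0 = dpt (e, false) r /\ s0 = if b then arc_l S e - r else r.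
  move=> hs; case: b; last by exists s0.
  exists (arc_l S e - s0); first by case/andP: hs => ? ?; apply/andP; split; lra.
  by rewrite -[(e, true)]/(rev (e, false)) dpt_rev; split => //; ring.
case: d d' => [e b] [e' b'] hs hs' E.
have [r hr [E1 e1]] := fl e b s hs; have [r' hr' [E1' e1']] := fl e' b' s' hs'.
have [ee rr] := aux e e' r r' hr hr' (etrans (esym E1) (etrans E E1')); subst e' r'.
case: (boolP (b == b')) => [/eqP bb|nb]; [left|right]; split.
- by rewrite bb.
- by rewrite e1 e1' bb.
- by congr (_, _); move: nb; case: (b); case: (b').
- by rewrite e1 e1' /dlen /=; move: nb; case: (b); case: (b') => //= _; ring.
Qed.

Lemma dpt_vertex d s (v : vertex G) : 0 < s < dlen d -> dpt d s <> position v.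
Proof. by move=> /edge_param_inv[t t01 <-]; exact: curve_vertex. Qed.

Lemma dpt_lip d s t : edist (dpt d s) (dpt d t) <= `|s - t|.
Proof. exact: arc_lip. Qed.

(** [has_direction] refers to the given parametrization. In terms of arc length the curve leaves its
    initial tangent ray only by a quadratic term, so the normalized secants tend to the tangent. *)
Lemma has_directionP d u : has_direction d u -> u = ez (dpsi d).
Proof.
move=> hu.
(* The arc length travelled along the dart up to parameter [t]. *)
pose tau t := if d.2 then arc_l S d.1 - arc_sig S d.1 (1 - t) else arc_sig S d.1 t.
have h := arcsP S d.1.
have tauE t : 0 <= t <= 1 -> dart_curve d t = dpt d (tau t).
  move=> /andP[t0 t1]; rewrite /dart_curve /tau; case: d {hu tau h} => e [] /=.
    rewrite edge_param; last by apply/andP; split; lra.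
    by rewrite -[(e, true)]/(rev (e, false)) dpt_rev /dlen /=; congr (dpt _ _); ring.
  by rewrite edge_param // t0.
have tau_small ep : 0 < ep -> \forall t \near 0^'+, 0 < tau t < ep.
  move=> ep0; pose m := Num.min ep (arc_l S d.1).
  have m0 : 0 < m by rewrite lt_min ep0 (arc_len_gt0 h).
  have [m1 m2] : m <= ep /\ m <= arc_l S d.1 by rewrite /m !ge_min !lexx orbT.
  have ex : exists2 b, 0 < b <= 1 & forall t, 0 < t < b -> 0 < tau t < ep.
    rewrite /tau; case: d.2.
      have [|b /andP[b0 b1] sb] := arc_sig_onto h (_ : 0 <= arc_l S d.1 - m <= _).
        by apply/andP; split; lra.
      have b1' : b < 1.
        rewrite lt_neqAle b1 andbT; apply/eqP => e; move: sb; rewrite e (arc_sig1 h); lra.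
      exists (1 - b); first by apply/andP; split; lra.
      move=> t /andP[t0 t1]; have s1 : arc_sig S d.1 (1 - t) < arc_sig S d.1 1.
        by apply: (arc_sig_inc h); lra.
      have s2 : arc_sig S d.1 b < arc_sig S d.1 (1 - t) by apply: (arc_sig_inc h); lra.
      by move: s1; rewrite (arc_sig1 h) => s1; apply/andP; split; lra.
    have [|b /andP[b0 b1] sb] := arc_sig_onto h (_ : 0 <= m <= _).
      by rewrite m2 ltW.
    have b0' : 0 < b.
      rewrite lt_neqAle b0 andbT; apply/eqP => e; move: sb; rewrite -e (arc_sig0 h); lra.
    exists b; first by rewrite b0'.
    move=> t /andP[t0 t1]; have s1 : arc_sig S d.1 0 < arc_sig S d.1 t by apply: (arc_sig_inc h); lra.
    have s2 : arc_sig S d.1 t < arc_sig S d.1 b by apply: (arc_sig_inc h); lra.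
    by move: s1; rewrite (arc_sig0 h) => s1; apply/andP; split; lra.
  have [b /andP[b0 _] hb] := ex.
  near=> t; apply: hb; apply/andP; split; near: t; [exact: nbhs_right_gt|exact: nbhs_right_lt].
have lim : (let w := dart_curve d t - position (edge_end d) in
    (w.1 / enorm w, w.2 / enorm w)) @[t --> 0^'+] --> ez (dpsi d).
  apply/cvg_edistP => ep ep0.
  pose c := `|dk d| + 1; have c0 : 0 < c by rewrite ltr_pwDr.
  near=> t.
  have t01 : 0 <= t <= 1.
    apply/andP; split; first by apply/ltW; near: t; exact: nbhs_right_gt.
    by apply/ltW; near: t; apply: nbhs_right_lt; exact: ltr01.
  have /andP[s0 s1] : 0 < tau t < Num.min (1 / (2 * c)) (ep / (4 * c)).
    by near: t; apply: tau_small; rewrite lt_min !divr_gt0 // ?mulr_gt0.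
  rewrite /= (tauE t t01).
  move: s1; rewrite lt_min => /andP[s1 s2]; move: (tau t) s0 s1 s2 => s s0 s1 s2.
  have D := arc_direction (dorg d) (dpsi d) (dk d) (ltW s0).
  rewrite -/(dorg d); pose w := dpt d s - dorg d; rewrite -/w.
  have Dw : enorm (w - s *: ez (dpsi d)) <= c * s ^+ 2.
    have -> : w - s *: ez (dpsi d) = dpt d s - (dorg d + s *: ez (dpsi d)) by rewrite /w opprD addrA.
    by apply: le_trans D _; rewrite ler_wpM2r ?sqr_ge0 // /c lerDl.
  have nsu : enorm (s *: ez (dpsi d)) = s by rewrite enormZ ez_norm mulr1 gtr0_norm.
  have cs : c * s < 1 / 2.
    by move: s1; rewrite ltr_pdivlMr ?mulr_gt0 //; lra.
  have cs2 : c * s ^+ 2 <= s / 2 by rewrite expr2; nra.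
  have nw1 : s / 2 <= enorm w.
    have := ler_enormB (s *: ez (dpsi d)) w; rewrite nsu enormB => ?; lra.
  have nw2 : `|enorm w - s| <= c * s ^+ 2.
    have := ler_enormB (s *: ez (dpsi d)) w; have := ler_enormB w (s *: ez (dpsi d)).
    rewrite nsu [enorm (s *: _ - w)]enormB ler_norml => ? ?; apply/andP; split; lra.
  have w0 : 0 < enorm w by lra.
  have -> : (w.1 / enorm w, w.2 / enorm w) = (enorm w)^-1 *: w.
    by rewrite planeZ; apply: plane_eq => /=; rewrite mulrC.
  rewrite /edist; have -> : (enorm w)^-1 *: w - ez (dpsi d) =
     (enorm w)^-1 *: ((w - s *: ez (dpsi d)) + (s - enorm w) *: ez (dpsi d)).
    have -> : w - s *: ez (dpsi d) + (s - enorm w) *: ez (dpsi d) = w - enorm w *: ez (dpsi d).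
      by rewrite [(s - _) *: _]scalerBl addrA subrK.
    rewrite [RHS]scalerBr; congr (_ - _).
    by rewrite scalerA mulVf ?scale1r // gt_eqF.
  rewrite enormZ gtr0_norm ?invr_gt0 // mulrC ltr_pdivrMr //.
  apply: le_lt_trans (ler_enormD _ _) _; rewrite enormZ ez_norm mulr1 distrC.
  have : s * (4 * c) < ep by move: s2; rewrite ltr_pdivlMr ?mulr_gt0.
  move=> s3; have : 2 * (c * s ^+ 2) < ep * (s / 2) by rewrite expr2; nra.
  have : ep * (s / 2) <= ep * enorm w by rewrite ler_pM2l.
  lra.
have pf : ProperFilter ((0 : R)^'+) by exact: at_right_proper_filter.
exact: (cvg_unique (@plane_hausdorff R) hu lim).
Unshelve. all: end_near.
Qed.

End Darts.

(** * The two sides of an edge *)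

Section Strips.
Variables (R : realType) (G : embedded_graph R) (S : arcs G).
Implicit Types (d : edge G * bool) (e : edge G) (p q : plane R) (s t h : R) (P : set (plane R)).

Lemma compact_edges (D : pred (edge G)) :
  compact (\bigcup_(e in [set e | D e]) (@curve R G e @` `[0, 1])).
Proof.
have -> : \bigcup_(e in [set e | D e]) (@curve R G e @` `[0, 1]) =
   \big[setU/set0]_(e <- enum (edge G) | D e) (@curve R G e @` `[0, 1]).
  rewrite -bigcup_seq_cond; congr bigcup.
  by apply/seteqP; split=> e /=; [move=> De; rewrite De mem_enum|move=> /andP[]].
by apply: bigsetU_compact => e _; apply: path_compact; exact: curve_continuous.
Qed.

(** The vertices and the other edges form a compact set that misses the point. *)
Lemma edge_isolated d s : 0 < s < dlen S d -> exists2 r : R, 0 < r &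
  forall q, edist q (dpt S d s) < r -> support G q ->
  exists2 s', 0 < s' < dlen S d & q = dpt S d s'.
Proof.
move=> hs.
pose K := (range (@position R G)) `|` \bigcup_(e in [set e | e != d.1]) (@curve R G e @` `[0, 1]).
have cK : compact K.
  rewrite /K; apply: compactU; last exact: (@compact_edges (fun e => e != d.1)).
  by apply: finite_compact; apply: finite_image; exact: finite_finset.
have /closed_openC/openP oK : closed K by apply: compact_closed => //; exact: plane_hausdorff.
have nK : (~` K) (dpt S d s).
  case=> [[v _ e]|[e /= ne [t t01 et]]]; first exact: (@dpt_vertex _ _ S d s v hs).
  move: t01; rewrite /= in_itv /= => t01.
  have : support G (dpt S d s) by rewrite -et; right; exists e, t.
  have [t' t01' et'] := edge_param_inv hs.
  move=> _; case/andP: t01 => t0 t1.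
  case: (eqVneq t 0) => [t00|n0].
    by apply: (@dpt_vertex _ _ S d s (edge_end (e, false)) hs); rewrite -et t00 curve0.
  case: (eqVneq t 1) => [t10|n1].
    by apply: (@dpt_vertex _ _ S d s (edge_end (e, true)) hs); rewrite -et t10 curve1.
  have t02 : 0 < t < 1 by rewrite !lt_neqAle eq_sym n0 n1 t0.
  by have [ee _] := curve_inj t02 t01' (etrans et (esym et')); rewrite ee eqxx in ne.
have [r r0 hr] := oK _ nK; exists r => // q /hr nKq [[v qv]|[e [t [t01 qt]]]].
  by exfalso; apply: nKq; left; exists v.
case: (eqVneq e d.1) => [ed|ne]; last first.
  by exfalso; apply: nKq; right; exists e => //; exists t => //; rewrite /= in_itv.
case/andP: t01 => t0 t1.
case: (eqVneq t 0) => [t00|n0].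
  by exfalso; apply: nKq; left; exists (edge_end (e, false)); rewrite // qt t00 curve0.
case: (eqVneq t 1) => [t10|n1].
  by exfalso; apply: nKq; left; exists (edge_end (e, true)); rewrite // qt t10 curve1.
have t02 : 0 < t < 1 by rewrite !lt_neqAle eq_sym n0 n1 t0.
have sr := arc_sig_range S e t02.
case: d hs {K cK oK nK hr nKq} ed => d b hs /= ed; subst d.
case: b hs => hs; last by exists (arc_sig S e t) => //; rewrite qt (edge_param S) // t0.
exists (arc_l S e - arc_sig S e t); first by case/andP: sr => ? ?; rewrite /dlen /=; apply/andP; split; lra.
rewrite -[(e, true)]/(rev (e, false)) dpt_rev qt (edge_param S) ?t0 // /dlen /=.
by congr (dpt _ _); ring.
Qed.

Lemma dnor_norm d s : enorm (dnor S d s) = 1.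
Proof. by rewrite /dnor rot_norm ez_norm. Qed.

Lemma edist_shift p u h : enorm u = 1 -> edist (p + h *: u) p = `|h|.
Proof. by move=> u1; rewrite /edist addrAC subrr add0r enormZ u1 mulr1. Qed.

Definition dside d p : R := arc_side (dorg d) (dpsi S d) (dk S d) p.

Lemma dside_normal d s h : dside d (dpt S d s + h *: dnor S d s) = h - dk S d / 2 * h ^+ 2.
Proof. exact: arc_side_normal. Qed.

Lemma dside_arc d s : dside d (dpt S d s) = 0.
Proof. exact: arc_side_arc. Qed.

(** Near one point of the dart only the dart itself has to be avoided, and there [dside] vanishes
    whereas it equals [h - k / 2 * h ^+ 2] on the normal. Cousin's lemma makes the width uniform. *)
Lemma strip_clear d a b : 0 < a -> a <= b -> b < dlen S d -> exists2 h0 : R, 0 < h0 &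
  forall s h, a <= s <= b -> 0 < h < h0 -> ~ support G (dpt S d s + h *: dnor S d s).
Proof.
move=> a0 ab bL.
pose P x y := exists2 h0 : R, 0 < h0 &
  forall s h, x <= s <= y -> 0 < h < h0 -> ~ support G (dpt S d s + h *: dnor S d s).
apply: (@cousin R P a b ab).
- move=> x /andP[ax xb].
  have [|r r0 hr] := @edge_isolated d x; first by apply/andP; split; lra.
  exists (r / 2); first by rewrite divr_gt0.
  move=> s t _ sx xt _ xs tx.
  pose m := Num.min (r / 2) (1 / (`|dk S d| + 1)).
  have k0 : 0 < `|dk S d| + 1 by rewrite ltr_wpDl.
  have m0 : 0 < m by rewrite lt_min !divr_gt0.
  exists m => // s' h /andP[ss st] /andP[h0]; rewrite lt_min => /andP[h1 h2] sup.
  have [|s'' _ E] := hr _ _ sup.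
    apply: le_lt_trans (edist_triangle (dpt S d s') _ _) _.
    rewrite edist_shift ?dnor_norm // gtr0_norm //.
    have : edist (dpt S d s') (dpt S d x) < r / 2.
      by apply: le_lt_trans (dpt_lip _ _ _ _) _; rewrite ltr_norml; apply/andP; split; lra.
    lra.
  have := dside_normal d s' h; rewrite E dside_arc => e.
  move: h2; rewrite ltr_pdivlMr // => h2.
  have := ler_norm (dk S d); nra.
- move=> s t u _ st tu _ [h1 h10 H1] [h2 h20 H2].
  exists (Num.min h1 h2); first by rewrite lt_min h10.
  move=> s' h /andP[ss su] /andP[h0]; rewrite lt_min => /andP[hh1 hh2].
  case: (leP s' t) => st'; first by apply: H1; apply/andP.
  by apply: H2; [rewrite su ltW|rewrite h0].
Qed.

(** Unions of faces. The notion covers regions, single components and the levels of a winding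
    function, so facts about sides are proved once for all three. *)
Definition face_closed P := forall p, P p -> ~ support G p /\
  connected_component (~` support G) p `<=` P.

Lemma face_closed_path P (f : R -> plane R) a b : face_closed P -> continuous f ->
  (forall t, 0 <= t <= 1 -> ~ support G (f (a + t * (b - a)))) -> P (f a) -> P (f b).
Proof.
move=> hP cf av Pa; have [_ sub] := hP _ Pa; apply: sub.
pose g t := f (a + t * (b - a)).
have cg : {within `[0, 1], continuous g}.
  apply: within_of_continuous => t.
  apply: (@continuous_comp _ _ _ (fun t => a + t * (b - a)) f); last exact: cf.
  by apply: cvgD; [exact: cvg_cst|apply: cvgM; [exact: cvg_id|exact: cvg_cst]].
have g0 : g 0 = f a by rewrite /g mul0r addr0.
have g1 : g 1 = f b by rewrite /g mul1r addrC subrK.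
apply: (@component_max R _ (g @` `[0, 1])).
- exact: connected_path.
- by exists 0; rewrite ?g0 //= in_itv /= lexx ler01.
- by move=> _ [t t01 <-]; apply: av; move: t01; rewrite /= in_itv.
- by exists 1; rewrite ?g1 //= in_itv /= lexx ler01.
Qed.

Lemma face_closed_seg P p q : face_closed P -> (forall t, 0 <= t <= 1 -> ~ support G (seg p q t)) ->
  P p -> P q.
Proof.
move=> hP av Pp; rewrite -(seg1 p q); apply: (@face_closed_path P (seg p q) 0 1) => //.
- exact: seg_continuous.
- by move=> t t01; rewrite add0r subr0 mulr1; exact: av.
- by rewrite seg0.
Qed.

(* P contains the points just to the left of the dart d. *)
Definition near_left d P := forall s, 0 < s < dlen S d -> exists2 h0 : R, 0 < h0 &
  forall h, 0 < h < h0 -> P (dpt S d s + h *: dnor S d s).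

Lemma dnor_continuous d : continuous (dnor S d).
Proof.
move=> s; have c1 : {for s, continuous (fun s => dpsi S d + dk S d * s)}.
  by apply: cvgD; [exact: cvg_cst|apply: cvgM; [exact: cvg_cst|exact: cvg_id]].
apply: (@continuous_pair _ _ (fun s => - sin (dpsi S d + dk S d * s)) (fun s => cos (dpsi S d + dk S d * s))).
  apply: cvgN; apply: (@continuous_comp _ _ _ (fun s => dpsi S d + dk S d * s) sin); first exact: c1.
  exact: continuous_sin.
apply: (@continuous_comp _ _ _ (fun s => dpsi S d + dk S d * s) cos); first exact: c1.
exact: continuous_cos.
Qed.

(** One clear normal segment decides the side of the whole dart: descend along it to the edge,
    follow the edge inside a clear strip, and ascend along any other normal. *)
Lemma near_left_intro P d s h : face_closed P -> 0 < s < dlen S d -> 0 < h ->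
  (forall h', 0 < h' <= h -> ~ support G (dpt S d s + h' *: dnor S d s)) ->
  P (dpt S d s + h *: dnor S d s) -> near_left d P.
Proof.
move=> hP /andP[s0 sL] h0 av Ph s1 /andP[s10 s1L].
pose a := Num.min s s1; pose b := Num.max s s1.
have [ab1 ab2] : a <= s <= b /\ a <= s1 <= b.
  by rewrite /a /b !ge_min !le_max !lexx !orbT.
have a0 : 0 < a by rewrite /a lt_min s0.
have bL : b < dlen S d by rewrite /b gt_max sL.
have [|m0 m00 H] := @strip_clear d a b a0 _ bL; first by case/andP: ab1; lra.
pose m := Num.min h (m0 / 2).
have mp : 0 < m by rewrite lt_min h0 divr_gt0.
have [mh mm] : m <= h /\ m <= m0 / 2 by rewrite /m !ge_min !lexx orbT.
have P1 : P (dpt S d s + m *: dnor S d s).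
  apply: (@face_closed_path P (fun x => dpt S d s + x *: dnor S d s) h m) => //.
    by move=> x; apply: cvgD; [exact: cvg_cst|apply: cvgZl; exact: cvg_id].
  by move=> t /andP[t0 t1]; apply: av; apply/andP; split; nra.
have P2 : P (dpt S d s1 + m *: dnor S d s1).
  apply: (@face_closed_path P (fun x => dpt S d x + m *: dnor S d x) s s1) => //.
    move=> x; apply: cvgD; first exact: arc_continuous.
    by apply: cvgZr; exact: dnor_continuous.
  move=> t /andP[t0 t1]; apply: H; last by apply/andP; split; lra.
  by case/andP: ab1 => ? ?; case/andP: ab2 => ? ?; apply/andP; split; nra.
exists m0 => // h1 /andP[h10 h11].
apply: (@face_closed_path P (fun x => dpt S d s1 + x *: dnor S d s1) m h1) => //.
  by move=> x; apply: cvgD; [exact: cvg_cst|apply: cvgZl; exact: cvg_id].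
move=> t /andP[t0 t1]; apply: H => //; apply/andP; split; nra.
Qed.

Lemma near_left_meet d P P' : near_left d P -> near_left d P' -> exists p, P p /\ P' p.
Proof.
have L0 := dlen_gt0 S d; have h : 0 < dlen S d / 2 < dlen S d by apply/andP; split; lra.
move=> /(_ _ h)[h1 h10 H1] /(_ _ h)[h2 h20 H2].
pose m := Num.min h1 h2 / 2.
have m0 : 0 < m by rewrite divr_gt0 // lt_min h10.
have [m1 m2] : Num.min h1 h2 <= h1 /\ Num.min h1 h2 <= h2 by rewrite !ge_min !lexx orbT.
exists (dpt S d (dlen S d / 2) + m *: dnor S d (dlen S d / 2)).
by split; [apply: H1|apply: H2]; rewrite m0 /= /m; move: m0; rewrite /m => m0; lra.
Qed.

Lemma enorm_shift_sqr w psi s :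
  enorm (w - s *: ez psi) ^+ 2 = enorm w ^+ 2 - 2 * s * dot w (ez psi) + s ^+ 2.
Proof.
rewrite !enormE2 planeB planeZ /dot /ez /=; have := cos2Dsin2 psi.
move: (cos psi) (sin psi) => a b ab.
transitivity (w.1 ^+ 2 + w.2 ^+ 2 - 2 * s * (w.1 * a + w.2 * b) + s ^+ 2 * (a ^+ 2 + b ^+ 2)); first by ring.
by rewrite ab mulr1.
Qed.

(** If the angle between the arc and [p - q] were acute, moving along the arc would shorten the
    distance to first order, while its curvature costs only second order. *)
Lemma nearest_halftangent p q psi k (r : R) : 0 < r ->
  (forall s, 0 <= s < r -> support G (arc_pt q psi k s)) ->
  (forall q', support G q' -> edist p q <= edist p q') -> dot (p - q) (ez psi) <= 0.
Proof.
move=> r0 sup near; rewrite leNgt; apply/negP => c0.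
pose w := p - q; pose c := dot w (ez psi); rewrite -/w -/c in c0.
have W0 : 0 < enorm w.
  by rewrite enorm_gt0; apply: contraTneq c0 => e; rewrite /c e /dot /= !mul0r addr0 ltxx.
have cW : c <= enorm w by have := dot_le w (ez psi); rewrite ez_norm mulr1.
pose K := `|k| + 1; have K0 : 0 < K by rewrite ltr_wpDl.
(* For this [s] the gain, at least [s * c / (2 * enorm w)], exceeds the curvature error, the
   absolute value of [k] times [s ^+ 2]. *)
pose s := Num.min (Num.min (r / 2) c) (c / (4 * enorm w * K)).
have s0 : 0 < s by rewrite /s !lt_min c0 !divr_gt0 // !mulr_gt0.
have [s1 [s2 s3]] : s <= r / 2 /\ s <= c /\ s <= c / (4 * enorm w * K).
  by rewrite /s !ge_min !lexx !orbT.
have := near (arc_pt q psi k s) (sup s _); rewrite -/w => near1.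
have {near1}near1 : enorm w <= edist p (arc_pt q psi k s).
  by apply: near1; apply/andP; split; lra.
have D := arc_direction q psi k (ltW s0).
have tri : edist p (arc_pt q psi k s) <= enorm (w - s *: ez psi) + `|k| * s ^+ 2.
  apply: le_trans (edist_triangle (q + s *: ez psi) _ _) _.
  rewrite [X in _ + X]edistC; apply: lerD => //.
  by rewrite /edist /w opprD addrA.
have n1 : enorm (w - s *: ez psi) <= enorm w - s * c / (2 * enorm w).
  have h : s * c / (2 * enorm w) <= enorm w by rewrite ler_pdivrMr ?mulr_gt0 //; nra.
  apply: enorm_le; first by rewrite subr_ge0.
  rewrite -enormE2 enorm_shift_sqr -/c.
  have -> : (enorm w - s * c / (2 * enorm w)) ^+ 2 = enorm w ^+ 2 - s * c + (s * c / (2 * enorm w)) ^+ 2.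
    by field; rewrite gt_eqF.
  have := sqr_ge0 (s * c / (2 * enorm w)); nra.
have k1 : `|k| * s ^+ 2 < s * c / (2 * enorm w).
  have h : s * (4 * enorm w * K) <= c by rewrite -ler_pdivlMr // !mulr_gt0.
  rewrite ltr_pdivlMr ?mulr_gt0 // expr2.
  have hk : `|k| <= K by rewrite /K lerDl.
  have : `|k| * (s * (2 * enorm w)) <= K * (s * (2 * enorm w)).
    by apply: ler_wpM2r => //; rewrite !mulr_ge0 // ltW.
  nra.
lra.
Qed.

End Strips.

Lemma cos_2pi3 (R : realType) : cos (2 * pi / 3 : R) = - (1 / 2).
Proof.
have e3 : 2 * pi / 3 = pi / 3 + pi / 3 :> R by field.
have e4 : 2 * pi / 3 = - (pi / 3) + pi :> R by field.
have pi0 := pi_gt0 R.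
move: e3 e4; set t := pi / 3; set x := 2 * pi / 3 => e3 e4.
have c0 : 0 < cos t by apply: cos_gt0_pihalf; rewrite /t; apply/andP; split; lra.
have e5 : cos x = - cos t by rewrite e4 cosDpi cosN.
have e6 : cos x = cos t ^+ 2 - sin t ^+ 2 by rewrite e3 cosD !expr2.
have e2 := cos2Dsin2 t.
have : (cos t + 1) * (2 * cos t - 1) = 0.
  have -> : (cos t + 1) * (2 * cos t - 1) = cos t ^+ 2 - sin t ^+ 2 + (cos t ^+ 2 + sin t ^+ 2) + cos t - 1 by ring.
  rewrite e2 -e6 e5; ring.
by rewrite e5 => /eqP; rewrite mulf_eq0 => /orP[] /eqP; lra.
Qed.

Lemma sin_2pi3 (R : realType) : 0 < sin (2 * pi / 3 : R) /\ sin (2 * pi / 3 : R) ^+ 2 = 3 / 4.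
Proof.
have pi0 := pi_gt0 R; split; first by apply: sin_gt0_pi; apply/andP; split; lra.
by have := cos2Dsin2 (2 * pi / 3 : R); rewrite cos_2pi3 => h; lra.
Qed.

(** * Nearest points of the graph *)

Section Nearest.
Variables (R : realType) (n : nat) (B : complex R n) (S : arcs B).
Hypothesis rB : regular B.
Implicit Types (d : edge B * bool) (e : edge B) (p q : plane R) (s t h : R) (P : set (plane R)).

Lemma region_face_closed i : face_closed B (region B i).
Proof. by move=> p ip; split; [exact: region_compl ip|exact: region_faces]. Qed.

Lemma lab_exists d : exists i, near_left S d (region B i).
Proof.
have L0 := dlen_gt0 S d; have hs : 0 < dlen S d / 2 < dlen S d by apply/andP; split; lra.
have [a0 aL] : 0 < dlen S d / 2 /\ dlen S d / 2 < dlen S d by split; lra.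
have [h0 h00 H] := strip_clear a0 (lexx _) aL.
have [|i hi] := @region_exists R n B (dpt S d (dlen S d / 2) + (h0 / 2) *: dnor S d (dlen S d / 2)).
  by apply: H; rewrite ?lexx //; apply/andP; split; lra.
exists i; apply: near_left_intro (@region_face_closed i) hs _ _ hi; first by lra.
by move=> h' /andP[h1 h2]; apply: H; rewrite ?lexx //; apply/andP; split; lra.
Qed.

Lemma dir_dot d d' : d != d' -> edge_end d = edge_end d' ->
  dot (ez (dpsi S d)) (ez (dpsi S d')) = - (1 / 2).
Proof.
move=> dd e; have [u [u' [h1 h2 h3]]] := regular_angles rB dd e.
rewrite -(has_directionP S h1) -(has_directionP S h2) h3.
exact: cos_2pi3.
Qed.

Lemma vertex_darts (v : vertex B) : exists d1 d2 d3,
  [/\ [/\ d1 != d2, d1 != d3 & d2 != d3],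
      [/\ edge_end d1 = v, edge_end d2 = v & edge_end d3 = v] &
      forall d, edge_end d = v -> [\/ d = d1, d = d2 | d = d3]].
Proof.
have := regular_trivalent rB v; set A := [set d | edge_end d == v]%SET.
rewrite cardE; case E : (enum A) => [|d1 [|d2 [|d3 [|]]]] // _.
have mA d : (edge_end d == v) = (d \in [:: d1; d2; d3]) by rewrite -E mem_enum inE.
have := enum_uniq A; rewrite E /= !inE negb_or andbT => /andP[/andP[h1 h2] h3].
exists d1, d2, d3; split; first by split.
  by split; apply/eqP; rewrite mA !inE eqxx ?orbT.
by move=> d /eqP; rewrite mA !inE => /orP[/eqP->|/orP[]/eqP->]; [constructor 1|constructor 2|constructor 3].
Qed.

Lemma sum_three_dirs d1 d2 d3 : d1 != d2 -> d1 != d3 -> d2 != d3 ->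
  edge_end d1 = edge_end d2 -> edge_end d1 = edge_end d3 ->
  ez (dpsi S d1) + ez (dpsi S d2) + ez (dpsi S d3) = 0.
Proof.
move=> n12 n13 n23 e12 e13.
have h1 := dir_dot n12 e12; have h2 := dir_dot n13 e13.
have h3 := dir_dot n23 (etrans (esym e12) e13).
apply/eqP; rewrite -enorm_eq0 -sqrf_eq0 enormE2 !planeD /ez /=.
move: h1 h2 h3; rewrite /dot /ez /=.
have := cos2Dsin2 (dpsi S d1); have := cos2Dsin2 (dpsi S d2); have := cos2Dsin2 (dpsi S d3).
move: (cos _) (sin (dpsi S d1)) (cos _) (sin (dpsi S d2)) (cos _) (sin (dpsi S d3)) => a a' b b' c c' *.
by apply/eqP; lra.
Qed.

(** The three edge directions sum to zero and each has nonpositive product with [p - position v].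
    Hence all three products vanish, and two independent directions force [p] to be the vertex. *)
Lemma nearest_vertex_free p (v : vertex B) : (forall q, support B q -> edist p (position v) <= edist p q) ->
  p = position v.
Proof.
move=> near; have [d1 [d2 [d3 [[n12 n13 n23] [v1 v2 v3] _]]]] := vertex_darts v.
have H d : edge_end d = v -> dot (p - position v) (ez (dpsi S d)) <= 0.
  move=> dv; apply: (@nearest_halftangent R B p (position v) (dpsi S d) (dk S d) (dlen S d)) => //.
    exact: dlen_gt0.
  by move=> s /andP[s0 sL]; rewrite -dv; apply: dpt_support; rewrite s0 ltW.
have := sum_three_dirs n12 n13 n23 (etrans v1 (esym v2)) (etrans v1 (esym v3)).
have := dir_dot n12 (etrans v1 (esym v2)).
move=> e12 esum; suff w0 : p - position v = 0 by apply/eqP; rewrite -subr_eq0 w0.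
move: (H _ v1) (H _ v2) (H _ v3) e12 esum; move: (p - position v) => w.
rewrite /dot /ez !planeD /= => h1 h2 h3 h12 [s1 s2].
have u1 := cos2Dsin2 (dpsi S d1); have u2 := cos2Dsin2 (dpsi S d2).
move: (cos (dpsi S d1)) (sin (dpsi S d1)) (cos (dpsi S d2)) (sin (dpsi S d2)) (cos (dpsi S d3)) (sin (dpsi S d3))
  h1 h2 h3 h12 s1 s2 u1 u2 => a a' b b' c c' h1 h2 h3 h12 s1 s2 u1 u2.
have hs : (w.1 * a + w.2 * a') + (w.1 * b + w.2 * b') + (w.1 * c + w.2 * c') = 0.
  transitivity (w.1 * (a + b + c) + w.2 * (a' + b' + c')); first by ring.
  by rewrite s1 s2; ring.
have z1 : w.1 * a + w.2 * a' = 0 by lra.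
have z2 : w.1 * b + w.2 * b' = 0 by lra.
have cr : (a * b' - a' * b) ^+ 2 = 3 / 4.
  transitivity ((a ^+ 2 + a' ^+ 2) * (b ^+ 2 + b' ^+ 2) - (a * b + a' * b') ^+ 2); first by ring.
  by rewrite u1 u2 h12; field.
have cr0 : a * b' - a' * b != 0 by rewrite -sqrf_eq0 cr; apply: lt0r_neq0; lra.
have w1 : w.1 * (a * b' - a' * b) = 0.
  transitivity ((w.1 * a + w.2 * a') * b' - (w.1 * b + w.2 * b') * a'); first by ring.
  by rewrite z1 z2; ring.
have w2 : w.2 * (a * b' - a' * b) = 0.
  transitivity ((w.1 * b + w.2 * b') * a - (w.1 * a + w.2 * a') * b); first by ring.
  by rewrite z1 z2; ring.
apply: plane_eq => /=.
  by move/eqP: w1; rewrite mulf_eq0 (negbTE cr0) orbF => /eqP.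
by move/eqP: w2; rewrite mulf_eq0 (negbTE cr0) orbF => /eqP.
Qed.

Lemma nearest_edge p d s : 0 < s < dlen S d ->
  (forall q, support B q -> edist p (dpt S d s) <= edist p q) ->
  p = dpt S d s + dot (p - dpt S d s) (dnor S d s) *: dnor S d s.
Proof.
have half d' s' : 0 < s' < dlen S d' ->
    (forall q, support B q -> edist p (dpt S d' s') <= edist p q) ->
    dot (p - dpt S d' s') (ez (dang S d' s')) <= 0.
  move=> /andP[s0 sL] near.
  apply: (@nearest_halftangent R B p (dpt S d' s') _ (dk S d') (dlen S d' - s')) => //; first by lra.
  move=> t /andP[t0 tL]; rewrite -arc_ptD; apply: dpt_support; apply/andP; split; lra.
move=> hs near; have h1 := half d s hs near.
have hs' : 0 < dlen S d - s < dlen S (rev d) by rewrite dlen_rev; case/andP: hs => ? ?; apply/andP; split; lra.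
have rs : dpt S (rev d) (dlen S d - s) = dpt S d s by rewrite dpt_rev; congr dpt; ring.
have := half (rev d) _ hs'; rewrite rs => /(_ near).
rewrite ez_dang_rev; have -> : dlen S d - (dlen S d - s) = s by ring.
set w := p - dpt S d s in h1 *; rewrite {1}/dot /= => h2.
have e0 : dot w (ez (dang S d s)) = 0 by move: h1 h2; rewrite /dot /=; lra.
have := decompose w (ez_norm (dang S d s)); rewrite e0 scale0r add0r -/(dnor S d s) => <-.
by rewrite /w addrC subrK.
Qed.

(** The nearest point lies inside an edge, and there both half-tangents make [p] a point of the
    normal. Every point off the graph thus gets a dart that has it on its left. *)
Lemma nearest_dart p : support B !=set0 -> ~ support B p -> exists d s h,
  [/\ 0 < s < dlen S d, 0 < h, p = dpt S d s + h *: dnor S d s &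
      forall q, support B q -> h <= edist p q].
Proof.
move=> ne np.
have cd : {within support B, continuous (edist p)}.
  by apply: continuous_subspaceT => q; exact: (@continuous_edist R p).
have [q] := compact_EVT_min ne (@compact_support R B) cd.
rewrite inE => sq nearq.
have near q' : support B q' -> edist p q <= edist p q' by move=> h; apply: nearq; rewrite inE.
case: (support_darts S sq) => [[v qv]|[e [s [hs qe]]]].
  by exfalso; apply: np; rewrite (@nearest_vertex_free p v) -?qv.
have := @nearest_edge p (e, false) s hs; rewrite -qe => /(_ near) pE.
set h := dot _ _ in pE.
have dq : edist p q = `|h| by rewrite {1}pE edist_shift // dnor_norm.
case: (ltgtP h 0) => h0; last first.
- by exfalso; apply: np; rewrite pE h0 scale0r addr0.
- exists (e, false), s, h; split=> //; first by rewrite -qe.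
  by move=> q' /near; rewrite dq gtr0_norm.
exists (rev (e, false)), (arc_l S e - s), (- h); split.
- by case/andP: hs => ? ?; rewrite /dlen /=; apply/andP; split; lra.
- by rewrite oppr_gt0.
- rewrite dpt_rev dnor_rev scalerN scaleNr opprK.
  have -> : dlen S (e, false) - (arc_l S e - s) = s by rewrite /dlen /=; ring.
  by rewrite -qe.
by move=> q' /near; rewrite dq ltr0_norm.
Qed.

End Nearest.

Lemma small_multiple (R : realType) (K x : R) : 0 < x -> 100 * K * x <= 1 -> K * x ^+ 2 <= x / 100 /\ K * x < 1.
Proof. by move=> x0 h; split; nra. Qed.

(** * The sectors at a vertex *)

Section Vertices.
Variables (R : realType) (n : nat) (B : complex R n) (S : arcs B).
Hypothesis rB : regular B.
Implicit Types (d : edge B * bool) (e : edge B) (p q : plane R) (s t h : R) (P : set (plane R)).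

(** As [h] is the distance to the graph, the normal segment up to the point is clear, so the point
    lies in the face just left of the dart. *)
Lemma near_left_at P d s h : face_closed B P -> 0 < s < dlen S d -> 0 < h ->
  (forall q, support B q -> h <= edist (dpt S d s + h *: dnor S d s) q) ->
  near_left S d P <-> P (dpt S d s + h *: dnor S d s).
Proof.
move=> hP hs h0 far.
have av h' : 0 < h' <= h -> ~ support B (dpt S d s + h' *: dnor S d s).
  move=> /andP[h'0 h'h] /far; rewrite /edist.
  have -> : dpt S d s + h *: dnor S d s - (dpt S d s + h' *: dnor S d s) = (h - h') *: dnor S d s.
    by rewrite opprD addrACA subrr add0r scalerBl.
  by rewrite enormZ dnor_norm mulr1 ger0_norm; lra.
split; last exact: near_left_intro.
set p := _ + _; move=> nP.
have np : ~ support B p by apply: av; rewrite h0 lexx.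
pose C := connected_component (~` support B) p.
have Cp : C p by exact: connected_component_refl.
have fC : face_closed B C.
  move=> q Cq; split; first exact: (connected_component_sub Cq).
  by rewrite /C -(same_connected_component Cq).
have nC : near_left S d C by exact: near_left_intro av Cp.
have [q [Pq Cq]] := near_left_meet nP nC.
have [_ sub] := hP q Pq; apply: sub.
by rewrite -(same_connected_component Cq).
Qed.

(** A point close to the middle of a dart has its nearest point on the same edge, and the sign of
    [dside] tells on which side. *)
Lemma edge_nbhd d s : 0 < s < dlen S d -> exists2 r : R, 0 < r &
  forall p, edist p (dpt S d s) < r -> ~ support B p ->
  (0 < dside S d p /\ forall P, face_closed B P -> near_left S d P <-> P p) \/
  (dside S d p < 0 /\ forall P, face_closed B P -> near_left S (rev d) P <-> P p).
Proof.
move=> hs; have [r r0 iso] := edge_isolated hs.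
pose K := `|dk S d| + 1; have K0 : 0 < K by rewrite ltr_wpDl.
pose m := Num.min (r / 2) (1 / K).
have m0 : 0 < m by rewrite lt_min !divr_gt0.
have [m1 m2] : m <= r / 2 /\ m <= 1 / K by rewrite /m !ge_min !lexx orbT.
exists m => // p pm np.
have ne : support B !=set0.
  by exists (dpt S d s); apply: dpt_support; case/andP: hs => ? ?; rewrite !ltW.
have [d1 [s1 [h1 [hs1 h10 pE far]]]] := nearest_dart S rB ne np.
have h1m : h1 < m.
  apply: le_lt_trans pm; apply: far; apply: dpt_support.
  by case/andP: hs => ? ?; rewrite !ltW.
have kh : `|dk S d| * h1 < 1.
  have : h1 * K < 1 by rewrite -ltr_pdivlMr //; lra.
  by rewrite /K mulrDr mulr1 mulrC; lra.
have kb := ler_norm (dk S d); have kb' := ler_norm (- dk S d); rewrite normrN in kb'.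
have [||s' hs' qE] := iso (dpt S d1 s1).
- apply: le_lt_trans (edist_triangle p _ _) _; rewrite edistC {1}pE edist_shift ?dnor_norm // gtr0_norm //.
  by lra.
- by apply: dpt_support; case/andP: hs1 => ? ?; rewrite !ltW.
have nl P : face_closed B P -> near_left S d1 P <-> P p.
  by move=> hP; rewrite pE; apply: near_left_at => // q; rewrite -pE; exact: far.
case: (dpt_inj hs' hs1 (esym qE)) => -[e1 e2]; subst d1 s1; [left|right]; split=> //.
  by rewrite pE dside_normal expr2; nra.
rewrite pE dpt_rev dnor_rev.
have -> : dlen S d - (dlen S d - s') = s' by ring.
by rewrite scalerN -scaleNr dside_normal sqrrN expr2; nra.
Qed.

Lemma vertex_isolated v : exists2 r : R, 0 < r & forall q, edist q (position v) < r -> support B q ->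
  exists d s, [/\ edge_end d = v, 0 <= s < dlen S d, q = dpt S d s & s <= 2 * edist q (position v)].
Proof.
(* On the first [b d] of a dart the curvature is too small to bring the chord below [s / 2].
   Everything else, namely the other vertices and the edges trimmed by [a] at their ends in [v], is
   a compact set [K] that misses [v]. *)
pose b d := Num.min (dlen S d / 2) (1 / (`|dk S d| + 1)).
have K0 d : 0 < `|dk S d| + 1 by rewrite ltr_wpDl.
have b0 d : 0 < b d by have := dlen_gt0 S d; rewrite /b lt_min => ?; rewrite !divr_gt0.
have [b1 b2] : (forall d, b d <= dlen S d / 2) /\ (forall d, b d <= 1 / (`|dk S d| + 1)).
  by split=> d; rewrite /b !ge_min !lexx ?orbT.
pose a d := if edge_end d == v then b d else 0.
have ab d : 0 <= a d <= b d by rewrite /a; case: ifP => _; rewrite ?lexx ?ltW.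
pose piece e := dpt S (e, false) @` `[a (e, false), arc_l S e - a (e, true)].
pose K := [set position w | w in [set w | w != v]] `|` \bigcup_(e in [set: edge B]) piece e.
have cK : compact K.
  rewrite /K; apply: compactU.
    by apply: finite_compact; apply: finite_image; exact: finite_finset.
  have -> : \bigcup_(e in [set: edge B]) piece e = \big[setU/set0]_(e <- enum (edge B)) piece e.
    by rewrite -bigcup_seq; congr bigcup; apply/seteqP; split=> e //= _; rewrite mem_enum.
  apply: bigsetU_compact => e _; apply: path_compact; apply: within_of_continuous; exact: arc_continuous.
have /closed_openC/openP oK : closed K by apply: compact_closed => //; exact: plane_hausdorff.
have nK : (~` K) (position v).
  case=> [[w /= wv /position_inj e]|[e _ [s]]]; first by rewrite e eqxx in wv.
  rewrite /= in_itv /= => /andP[s0 s1] E.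
  case: (eqVneq s 0) => [sz|sn0].
    move: E; rewrite sz dpt0 => /position_inj ev; move: s0; rewrite /a ev eqxx sz.
    by have := b0 (e, false); lra.
  case: (eqVneq s (arc_l S e)) => [sz|sn1].
    move: E; rewrite sz -[arc_l S e]/(dlen S (e, false)) dptL => /position_inj ev.
    by move: s1; rewrite /a ev eqxx sz; have := b0 (e, true); lra.
  have [a1 a2] := (ab (e, false), ab (e, true)).
  apply: (@dpt_vertex R B S (e, false) s v) => //; rewrite /dlen /= !lt_neqAle sn1 eq_sym sn0 /=.
  by case/andP: a1 => ? ?; case/andP: a2 => ? ?; apply/andP; split; lra.
have [r r0 hr] := oK _ nK; exists r => // q qr sq; have nKq := hr q qr.
have fin d s : edge_end d = v -> 0 <= s <= b d -> q = dpt S d s ->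
    exists d s, [/\ edge_end d = v, 0 <= s < dlen S d, q = dpt S d s & s <= 2 * edist q (position v)].
  move=> dv /andP[s0 sb] qE; exists d, s; split=> //.
    by rewrite s0 /=; have := b1 d; have := dlen_gt0 S d; lra.
  have ch := arc_chord_ge (dorg d) (dpsi S d) (dk S d) s0.
  rewrite qE -dv -/(dorg d); move: ch; rewrite -/(dpt S d s).
  have ks : s * (`|dk S d| + 1) <= 1 by rewrite -ler_pdivlMr //; have := b2 d; lra.
  have ks' : `|dk S d| * s <= 1 by rewrite mulrDr mulr1 mulrC in ks; lra.
  have : dk S d ^+ 2 * s ^+ 3 / 2 <= s / 2.
    rewrite -(real_normK (num_real (dk S d))).
    have -> : `|dk S d| ^+ 2 * s ^+ 3 / 2 = (`|dk S d| * s) ^+ 2 * s / 2 by ring.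
    have : (`|dk S d| * s) ^+ 2 <= 1 by rewrite expr_le1 // mulr_ge0.
    by nra.
  by lra.
case: (support_darts S sq) => [[w qw]|[e [s [/andP[s0 s1] qE]]]].
  case: (eqVneq w v) => [wv|wv]; last by exfalso; apply: nKq; left; exists w.
  have [d [_ [_ [_ [dv _ _] _]]]] := vertex_darts rB v.
  by apply: (fin d 0) => //; rewrite ?lexx ?ltW // dpt0 /dorg dv qw wv.
case: (leP (a (e, false)) s) => h1; last first.
  move: h1; rewrite /a; case: ifP => [/eqP ev|_] h1; last by lra.
  by apply: (fin (e, false) s) => //; rewrite !ltW.
case: (leP s (arc_l S e - a (e, true))) => h2.
  by exfalso; apply: nKq; right; exists e => //; exists s => //=; rewrite in_itv /= h1.
move: h2; rewrite /a; case: ifP => [/eqP ev|_] h2; last by lra.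
apply: (fin (e, true) (arc_l S e - s)) => //; first by apply/andP; split; lra.
by rewrite -[(e, true)]/(rev (e, false)) dpt_rev qE; congr dpt; rewrite /dlen /=; ring.
Qed.

(** Common constants for the darts at [v]: within radius [r] the graph consists of these darts, and
    each follows its tangent ray up to [K * s ^+ 2]. *)
Lemma vertex_rays v : exists (r K : R), [/\ 0 < r /\ 0 < K,
  (forall d s, edge_end d = v -> 0 <= s -> edist (dpt S d s) (position v + s *: ez (dpsi S d)) <= K * s ^+ 2),
  (forall d, edge_end d = v -> r < dlen S d),
  (forall d, edge_end d = v -> `|dk S d| <= K) &
  forall q, edist q (position v) < r -> support B q ->
  exists d s, [/\ edge_end d = v, 0 <= s < dlen S d, q = dpt S d s & s <= 2 * edist q (position v)]].
Proof.
have [r r0 iso] := vertex_isolated v.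
pose K := 1 + \sum_(d : edge B * bool) `|dk S d|.
have kK d : `|dk S d| <= K.
  by rewrite /K (bigD1 d) //= addrCA lerDl addr_ge0 ?sumr_ge0.
have [d1 [d2 [d3 [_ _ all]]]] := vertex_darts rB v.
pose m := Num.min r (Num.min (dlen S d1) (Num.min (dlen S d2) (dlen S d3)) / 2).
have L0 := dlen_gt0 S.
have m0 : 0 < m by rewrite !lt_min r0 divr_gt0 // !lt_min !L0.
exists m, K; split=> //.
- by split=> //; rewrite ltr_pwDl // sumr_ge0.
- move=> d s dv s0; rewrite -dv; apply: le_trans (arc_direction _ _ _ s0) _.
  by rewrite ler_wpM2r ?sqr_ge0.
- have [M1 [M2 M3]] : Num.min (dlen S d1) (Num.min (dlen S d2) (dlen S d3)) <= dlen S d1 /\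
    Num.min (dlen S d1) (Num.min (dlen S d2) (dlen S d3)) <= dlen S d2 /\
    Num.min (dlen S d1) (Num.min (dlen S d2) (dlen S d3)) <= dlen S d3 by rewrite !ge_min !lexx !orbT.
  have mM : m <= Num.min (dlen S d1) (Num.min (dlen S d2) (dlen S d3)) / 2 by rewrite /m ge_min lexx orbT.
  move=> d /all[] ->; [have := L0 d1|have := L0 d2|have := L0 d3]; lra.
- by move=> q qm; apply: iso; apply: lt_le_trans qm _; rewrite /m ge_min lexx.
Qed.

Lemma ray_far x psi s : 0 <= s -> dot x (ez psi) <= 0 -> enorm x <= enorm (x - s *: ez psi).
Proof.
move=> s0 xd; rewrite -(@ler_pXn2r _ 2) ?nnegrE ?enorm_ge0 // enorm_shift_sqr.
by have := sqr_ge0 s; nra.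
Qed.

(* The point at distance rho of the vertex making the angle pi / 6 with the dart d, to the left or right of d. *)
Definition wedge_pt d (rho x : R) : plane R :=
  dorg d + rho *: (sin (2 * pi / 3) *: ez (dpsi S d) + (x / 2) *: rot (ez (dpsi S d))).

Lemma wedge_other d d' x : d != d' -> edge_end d = edge_end d' -> x ^+ 2 = 1 ->
  dot (sin (2 * pi / 3) *: ez (dpsi S d) + (x / 2) *: rot (ez (dpsi S d))) (ez (dpsi S d')) <= 0.
Proof.
move=> dd e x1; have h := dir_dot S rB dd e; have [s0 s1] := sin_2pi3 R.
set sg := sin (2 * pi / 3) in s0 s1 *.
set u := ez (dpsi S d) in h *; set w := ez (dpsi S d') in h *.
have := lagrange u w; rewrite !ez_norm h => hl.
have -> : dot (sg *: u + (x / 2) *: rot u) w = sg * dot u w + x / 2 * cross u w.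
  by rewrite !planeZ planeD /dot /cross /rot /=; ring.
rewrite h.
have : (x * cross u w) ^+ 2 = sg ^+ 2 by rewrite exprMn x1 s1; lra.
move/eqP; rewrite eqf_sqr => /orP[] /eqP e1; lra.
Qed.

(** [sin (2 * pi / 3)] is the cosine of [pi / 6], so the wedge point has distance about [rho / 2]
    from [d], while the other darts leave the vertex at no acute angle to it and stay at distance
    about [rho]. Its nearest point is therefore on [d], and the sign of [dside] selects the side. *)
Lemma wedge_dart d x : x ^+ 2 = 1 -> exists2 r : R, 0 < r & forall (rho : R) P, 0 < rho < r -> face_closed B P ->
  near_left S (if x == 1 then d else rev d) P <-> P (wedge_pt d rho x).
Proof.
move=> x1; have [r [K [[r0 K0] dirK rL kK iso]]] := vertex_rays (edge_end d).
have [s0 s1] := sin_2pi3 R.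
have sl1 : sin (2 * pi / 3 : R) < 1 by nra.
pose m := Num.min (r / 4) (1 / (100 * K)).
have m0 : 0 < m by rewrite lt_min !divr_gt0 // mulr_gt0.
have [m1 m2] : m <= r / 4 /\ m <= 1 / (100 * K) by rewrite /m !ge_min !lexx orbT.
exists m => // rho P /andP[rho0 rhom] hP.
have rK : 100 * K * rho <= 1.
  have : rho * (100 * K) <= 1 by rewrite -ler_pdivlMr ?mulr_gt0 //; lra.
  by rewrite mulrC.
have xe : x = 1 \/ x = -1.
  by move/eqP: x1; rewrite sqrf_eq1 => /orP[] /eqP ->; [left|right].
set p := wedge_pt d rho x.
set sg := sin (2 * pi / 3) in s0 s1 sl1; set u := ez (dpsi S d).
have u1 : enorm u = 1 by rewrite ez_norm.
have pv : p - position (edge_end d) = rho *: (sg *: u + (x / 2) *: rot u).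
  by rewrite /p /wedge_pt addrAC subrr add0r.
have nx : enorm (sg *: u + (x / 2) *: rot u) = 1.
  apply/eqP; rewrite -(@eqrXn2 _ 2) ?enorm_ge0 ?ler01 // expr1n (pythagoras _ u1).
  have uu : u.1 ^+ 2 + u.2 ^+ 2 = 1 by rewrite -enormE2 u1 expr1n.
  have -> : dot (sg *: u + (x / 2) *: rot u) u = sg * (u.1 ^+ 2 + u.2 ^+ 2) by rewrite !planeZ planeD /dot /rot /=; ring.
  have -> : dot (sg *: u + (x / 2) *: rot u) (rot u) = x / 2 * (u.1 ^+ 2 + u.2 ^+ 2) by rewrite !planeZ planeD /dot /rot /=; ring.
  by rewrite uu !mulr1 !exprMn x1 s1; apply/eqP; field.
have npv : edist p (position (edge_end d)) = rho by rewrite /edist pv enormZ nx mulr1 gtr0_norm.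
have dsp : dside S d p = x * rho / 2 - dk S d / 2 * rho ^+ 2.
  rewrite /dside /arc_side -/(dorg d) -/u -[dorg d]/(position (edge_end d)) -enorm_sqr -/(edist _ _) npv pv.
  have uu : u.1 ^+ 2 + u.2 ^+ 2 = 1 by rewrite -enormE2 u1 expr1n.
  congr (_ - _); transitivity (x * rho / 2 * (u.1 ^+ 2 + u.2 ^+ 2)); first by rewrite !planeZ planeD /dot /rot /=; ring.
  by rewrite uu mulr1.
have [kb1 kb2] : dk S d <= K /\ - K <= dk S d.
  by have := kK d erefl; rewrite ler_norml => /andP[].
have rhosg : 0 < rho * sg < dlen S d.
  by have := rL d erefl; rewrite mulr_gt0 //= => ?; nra.
have D0 := dirK d (rho * sg) erefl (ltW (andP rhosg).1).
have pd0 : edist p (dpt S d (rho * sg)) <= rho / 2 + K * rho ^+ 2.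
  apply: le_trans (edist_triangle (position (edge_end d) + (rho * sg) *: u) _ _) _.
  apply: lerD; last first.
    rewrite edistC; apply: le_trans D0 _; rewrite ler_pM2l // ler_pXn2r ?nnegrE ?mulr_ge0 ?ltW //.
    by rewrite -[X in _ < X]mulr1 ltr_pM2l.
  rewrite /edist; have -> : p - (position (edge_end d) + (rho * sg) *: u) = (rho * (x / 2)) *: rot u.
    by rewrite opprD addrA pv scalerDr !scalerA addrAC subrr add0r.
  rewrite enormZ rot_norm u1 mulr1.
  have : `|x| = 1 by apply/eqP; rewrite -(@eqrXn2 _ 2) // real_normK ?num_real // x1 expr1n.
  by move=> xx; rewrite !normrM xx (gtr0_norm rho0) [`|_^-1|]gtr0_norm //; lra.
have ray d' s' (y : plane R) : edge_end d' = edge_end d -> 0 <= s' <= 4 * rho ->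
    enorm (y - position (edge_end d) - s' *: ez (dpsi S d')) - 16 * K * rho ^+ 2 <= edist y (dpt S d' s').
  move=> ev /andP[s'0 s'4].
  have D := dirK d' s' ev s'0.
  have := edist_triangle (dpt S d' s') y (position (edge_end d) + s' *: ez (dpsi S d')).
  have : K * s' ^+ 2 <= 16 * K * rho ^+ 2.
    have -> : 16 * K * rho ^+ 2 = K * (4 * rho) ^+ 2 by ring.
    by rewrite ler_pM2l // ler_pXn2r ?nnegrE // mulr_ge0 // ltW.
  by rewrite {1}/edist opprD addrA => *; lra.
have np : ~ support B p.
  move=> sp; have [|d' [s' [ev hs' pE s'4]]] := iso p _ sp; first by rewrite npv; lra.
  have s'0 : 0 <= s' by case/andP: hs'.
  have := ray d' s' p ev; rewrite -pE edistxx pv s'0 /= npv in s'4 * => /(_ _) h.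
  have {h}h : enorm (rho *: (sg *: u + (x / 2) *: rot u) - s' *: ez (dpsi S d')) <= 16 * K * rho ^+ 2.
    by rewrite -subr_le0; apply: h; lra.
  case: (eqVneq d d') => [dd|dd]; last first.
    have := wedge_other dd (esym ev) x1; rewrite -/sg -/u => w.
    have : enorm (rho *: (sg *: u + (x / 2) *: rot u)) <= enorm (rho *: (sg *: u + (x / 2) *: rot u) - s' *: ez (dpsi S d')).
      apply: ray_far => //; have -> z (a b : plane R) : dot (z *: a) b = z * dot a b by rewrite planeZ /dot /=; ring.
      by rewrite pmulr_rle0.
    by rewrite enormZ nx mulr1 gtr0_norm // => ?; nra.
  have := dside_arc S d s'; rewrite dd -pE -dd dsp => e.
  have : (x - dk S d * rho) * rho = 0 by lra.
  move/eqP; rewrite mulf_eq0 (gt_eqF rho0) orbF => /eqP e3.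
  by case: xe => ex; nra.
have ne : support B !=set0.
  by exists (position (edge_end d)); left; exists (edge_end d).
have [d1 [s1' [h1 [hs1 h10 pE far]]]] := nearest_dart S rB ne np.
have h1r : h1 <= rho / 2 + K * rho ^+ 2.
  apply: le_trans pd0; apply: far; apply: dpt_support.
  by case/andP: rhosg => ? ?; rewrite !ltW.
have Kr : K * rho ^+ 2 <= rho / 100 by case: (small_multiple rho0 rK).
have pq : edist p (dpt S d1 s1') = h1 by rewrite {1}pE edist_shift ?dnor_norm // gtr0_norm.
have qv : edist (dpt S d1 s1') (position (edge_end d)) <= h1 + rho.
  by apply: le_trans (edist_triangle p _ _) _; rewrite edistC pq npv.
have sq : support B (dpt S d1 s1') by apply: dpt_support; case/andP: hs1 => ? ?; rewrite !ltW.
have [|d' [s' [ev /andP[s'0 s'L] qE s'4]]] := iso _ _ sq; first by lra.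
have s'n : s' != 0.
  by apply/eqP => z; apply: (@dpt_vertex _ _ S d1 s1' (edge_end d') hs1); rewrite qE z dpt0.
have s'p : 0 < s' by rewrite lt_neqAle eq_sym s'n.
have dd : d = d'.
  apply/eqP; apply: contraT => dd.
  have := ray d' s' p ev; rewrite -qE pq pv => h.
  have := wedge_other dd (esym ev) x1; rewrite -/sg -/u => w.
  have : enorm (rho *: (sg *: u + (x / 2) *: rot u)) <= enorm (rho *: (sg *: u + (x / 2) *: rot u) - s' *: ez (dpsi S d')).
    apply: ray_far => //; have -> z (a b : plane R) : dot (z *: a) b = z * dot a b by rewrite planeZ /dot /=; ring.
    by rewrite pmulr_rle0.
  rewrite enormZ nx mulr1 gtr0_norm // => h'.
  have := h _; rewrite s'0 /= => {}h.
  have : s' <= 4 * rho by lra.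
  by move=> /h; lra.
subst d'.
have hs' : 0 < s' < dlen S d by rewrite s'p.
have kr : K * rho < 1 by case: (small_multiple rho0 rK).
have kh : K * h1 < 1.
  by apply: le_lt_trans kr; rewrite ler_pM2l //; lra.
have : d1 = if x == 1 then d else rev d.
  case: (dpt_inj hs' hs1 (esym qE)) => -[e1 e2]; rewrite e1.
    case: xe => ex; rewrite ex; first by rewrite eqxx.
    by exfalso; move: dsp; rewrite pE e1 e2 dside_normal ex expr2 => ?; nra.
  case: xe => ex; rewrite ex; last first.
    by rewrite eq_sym -subr_eq0 opprK gt_eqF ?addr_gt0.
  exfalso; move: dsp; rewrite pE e1 e2 dpt_rev dnor_rev.
  have -> : dlen S d - (dlen S d - s') = s' by ring.
  by rewrite scalerN -scaleNr dside_normal sqrrN ex !expr2 => ?; nra.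
move=> <-; rewrite pE; apply: near_left_at => // q; rewrite -pE; exact: far.
Qed.

Lemma ez_shift a b c : ez a = ez b -> ez (a + c) = ez (b + c) :> plane R.
Proof. by move=> e; rewrite !ezD e. Qed.

Lemma dart_eq d d' : edge_end d = edge_end d' -> ez (dpsi S d) = ez (dpsi S d') -> d = d'.
Proof.
move=> e ee; apply/eqP; apply: contraT => dd.
have := dir_dot S rB dd e; rewrite ee -enorm_sqr ez_norm; lra.
Qed.

(** Both other darts make the angle [2 * pi / 3] with [d]; the sign of the cross product shows which
    one comes next counterclockwise. *)
Lemma turn_exists d : exists d', edge_end d' = edge_end d /\ ez (dpsi S d') = ez (dpsi S d + 2 * pi / 3).
Proof.
have [d2 [d3 [n2 n3 n23 v2 v3]]] : exists d2 d3,
    [/\ d != d2, d != d3, d2 != d3, edge_end d = edge_end d2 & edge_end d = edge_end d3].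
  have [a [b [c [[ab ac bc] [va vb vc] all]]]] := vertex_darts rB (edge_end d).
  case: (all d erefl) => e; [exists b, c|exists a, c|exists a, b]; subst d; split=> //; by rewrite eq_sym.
have [s0 s1] := sin_2pi3 R.
have h2 := dir_dot S rB n2 v2.
have fin d' : dot (ez (dpsi S d)) (ez (dpsi S d')) = - (1 / 2) ->
    cross (ez (dpsi S d)) (ez (dpsi S d')) = sin (2 * pi / 3) -> ez (dpsi S d') = ez (dpsi S d + 2 * pi / 3).
  move=> e1 e2; rewrite ezD cos_2pi3 -e1 -e2 {1}(decompose (ez (dpsi S d')) (ez_norm (dpsi S d))).
  by congr (_ *: _ + _ *: _); rewrite /dot /cross /rot /=; ring.
have := lagrange (ez (dpsi S d)) (ez (dpsi S d2)); rewrite !ez_norm h2 => hl.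
have : cross (ez (dpsi S d)) (ez (dpsi S d2)) ^+ 2 = sin (2 * pi / 3) ^+ 2 by rewrite s1; lra.
move/eqP; rewrite eqf_sqr => /orP[] /eqP e; first by exists d2; split=> //; exact: fin.
exists d3; split=> //; apply: fin; first exact: dir_dot.
have [] := sum_three_dirs S rB n2 n3 n23 v2 v3; rewrite /ez /= => z1 z2.
rewrite -[RHS]opprK -e /cross /ez /=.
have -> : sin (dpsi S d3) = - sin (dpsi S d) - sin (dpsi S d2) by lra.
have -> : cos (dpsi S d3) = - cos (dpsi S d) - cos (dpsi S d2) by lra.
by ring.
Qed.

Definition turn d := projT1 (cid (turn_exists d)).

Lemma turn_end d : edge_end (turn d) = edge_end d.
Proof. by rewrite /turn; case: cid => ? []. Qed.

Lemma turn_dir d : ez (dpsi S (turn d)) = ez (dpsi S d + 2 * pi / 3).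
Proof. by rewrite /turn; case: cid => ? []. Qed.

Lemma turn3 d : turn (turn (turn d)) = d.
Proof.
apply: dart_eq; rewrite ?turn_end // turn_dir.
rewrite (ez_shift _ (turn_dir _)) (ez_shift _ (ez_shift _ (turn_dir _))).
have -> : dpsi S d + 2 * pi / 3 + 2 * pi / 3 + 2 * pi / 3 = dpsi S d + 2 * pi by field.
by rewrite ez_2pi.
Qed.

Lemma turn_inj : injective turn.
Proof. by move=> d d' e; rewrite -(turn3 d) e turn3. Qed.

Lemma turn_neq d : turn d != d.
Proof.
apply/eqP => e; have := turn_dir d; rewrite e => h.
have := dot_ez (dpsi S d) (dpsi S d + 2 * pi / 3); rewrite -h -enorm_sqr ez_norm.
by rewrite addrAC subrr add0r cos_2pi3; lra.
Qed.

Lemma turn2_neq d : turn (turn d) != d.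
Proof. by apply/eqP => e; have := turn_neq d; rewrite -{1}e turn3 eqxx. Qed.

Lemma turn_third d d' : edge_end d' = edge_end d -> d' != d -> d' != turn d -> d' = turn (turn d).
Proof.
move=> e n1 n2.
have [a [b [c [_ [va vb vc] all]]]] := vertex_darts rB (edge_end d).
have t1 := turn_neq d; have t2 := turn2_neq d; have t3 := turn_neq (turn d).
apply/eqP; apply: contraT => n3.
have /card_uniqP e4 : uniq [:: d; d'; turn d; turn (turn d)].
  by rewrite /= !inE !negb_or ![d == _]eq_sym n1 n2 n3 t1 t2 eq_sym t3.
have : (#|[:: d; d'; turn d; turn (turn d)]| <= 3)%N.
  rewrite -(regular_trivalent rB (edge_end d)); apply/subset_leq_card/fintype.subsetP => x.
  by rewrite !inE => /or4P[] /eqP ->; rewrite ?turn_end ?e.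
by rewrite e4.
Qed.

Lemma wedge_turn d rho : wedge_pt (turn d) rho (-1) = dorg d + rho *: rot (ez (dpsi S d)).
Proof.
have [_ s1] := sin_2pi3 R.
rewrite /wedge_pt /dorg turn_end turn_dir; congr (_ + _ *: _); rewrite ezD cos_2pi3.
set sg := sin (2 * pi / 3) in s1 *; set u := ez _.
rewrite !(planeZ, planeD) /rot /=; apply: plane_eq => /=.
  by transitivity (- (sg ^+ 2 + 1 / 4) * sin (dpsi S d)); [field|rewrite s1; field].
by transitivity ((sg ^+ 2 + 1 / 4) * cos (dpsi S d)); [field|rewrite s1; field].
Qed.

(** The sector between [d] and the next dart counterclockwise belongs to one face: the wedge point
    left of [d] and the one right of [turn d] are joined by a segment that avoids the graph.
    Boundary walks pass vertices by this lemma alone. *)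
Lemma near_left_turn P d : face_closed B P -> near_left S d P <-> near_left S (rev (turn d)) P.
Proof.
move=> hP; have [s0 s1] := sin_2pi3 R.
have [r [K [[r0 K0] dirK rL kK iso]]] := vertex_rays (edge_end d).
have [r1 r10 w1] := @wedge_dart d 1 (expr1n _ _).
have [r2 r20 w2] := @wedge_dart (turn d) (-1) (sqrr_sign R 1).
pose m := Num.min (Num.min r1 r2) (Num.min r (1 / (100 * K))).
have m0 : 0 < m by rewrite !lt_min r10 r20 r0 divr_gt0 // mulr_gt0.
have [m1 [m2 [m3 m4]]] : [/\ m <= r1, m <= r2, m <= r & m <= 1 / (100 * K)].
  by split; rewrite /m !ge_min !lexx ?orbT.
pose rho := m / 2; have rho0 : 0 < rho by rewrite divr_gt0.
have rK : 100 * K * rho <= 1.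
  have : m * (100 * K) <= 1 by rewrite -ler_pdivlMr ?mulr_gt0.
  by rewrite /rho; nra.
have {w1}w1 : near_left S d P <-> P (wedge_pt d rho 1).
  by have := w1 rho P _ hP; rewrite eqxx; apply; rewrite rho0 /rho /=; lra.
have {w2}w2 : near_left S (rev (turn d)) P <-> P (wedge_pt (turn d) rho (-1)).
  have := w2 rho P _ hP; rewrite ifF; first by apply; rewrite rho0 /rho /=; lra.
  by apply/eqP => ?; lra.
set p := wedge_pt d rho 1 in w1; set p' := wedge_pt _ _ _ in w2.
set sg := sin (2 * pi / 3) in s0 s1; pose u := ez (dpsi S d); pose w := ez (dpsi S (turn d)).
have uu : u.1 ^+ 2 + u.2 ^+ 2 = 1 by rewrite -enormE2 ez_norm expr1n.
have wE : w = - (1 / 2) *: u + sg *: rot u by rewrite /w turn_dir ezD cos_2pi3.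
have clear t : 0 <= t <= 1 -> ~ support B (seg p p' t).
  move=> t01 sy; set y := seg p p' t in sy.
  pose a := 1 - t; have /andP[a0 a1] : 0 <= a <= 1 by rewrite /a; case/andP: t01 => ? ?; apply/andP; split; lra.
  pose x : plane R := (a * sg) *: u + (1 - a / 2) *: rot u.
  have yv : y - position (edge_end d) = rho *: x.
    rewrite /y /seg /p' wedge_turn /p /wedge_pt -/u -/sg -[dorg d]/(position (edge_end d)) /x /a !planeZ.
    by rewrite !planeB !planeD; apply: plane_eq => /=; field.
  have x1 : enorm x <= 1.
    apply: enorm_le => //; rewrite -enormE2 (pythagoras _ (ez_norm (dpsi S d))) -/u.
    have -> : dot x u = a * sg * (u.1 ^+ 2 + u.2 ^+ 2) by rewrite /x !planeZ planeD /dot /rot /=; ring.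
    have -> : dot x (rot u) = (1 - a / 2) * (u.1 ^+ 2 + u.2 ^+ 2) by rewrite /x !planeZ planeD /dot /rot /=; ring.
    by rewrite uu !mulr1 exprMn s1; nra.
  have nyv : edist y (position (edge_end d)) <= rho.
    by rewrite /edist yv enormZ gtr0_norm // ler_piMr // ltW.
  have [|d' [s' [ev /andP[s'0 s'L] yE s'4]]] := iso y _ sy; first by rewrite /rho in nyv *; lra.
  have D := dirK d' s' ev s'0; rewrite -yE /edist opprD addrA yv in D.
  have Ks : K * s' ^+ 2 <= K * (2 * rho) ^+ 2.
    have s'2 : s' <= 2 * rho by lra.
    by rewrite ler_pM2l // ler_pXn2r ?nnegrE //; lra.
  (* The segment keeps distance [rho / 2] from the three tangent rays, measured along the normal of
     [d] or of [turn d]; the third ray points away from it. *)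
  have low : rho / 2 <= enorm (rho *: x - s' *: ez (dpsi S d')).
    have proj (z v : plane R) : enorm v = 1 -> `|dot z v| <= enorm z.
      by move=> v1; have := norm_dot_le z v; rewrite v1 mulr1.
    case: (eqVneq d' d) => [dd|n1].
      apply: le_trans (proj _ (rot u) _); last by rewrite rot_norm ez_norm.
      have -> : dot (rho *: x - s' *: ez (dpsi S d')) (rot u) = rho * (1 - a / 2) * (u.1 ^+ 2 + u.2 ^+ 2).
        by rewrite dd -/u /x !(planeZ, planeD, planeN) /dot /rot /=; ring.
      by rewrite uu mulr1; apply: le_trans (ler_norm _); nra.
    case: (eqVneq d' (turn d)) => [dd|n2].
      apply: le_trans (proj _ (- rot w) _); last by rewrite enormN rot_norm ez_norm.
      have -> : dot (rho *: x - s' *: ez (dpsi S d')) (- rot w) = rho * (a * sg ^+ 2 + (1 - a / 2) / 2) * (u.1 ^+ 2 + u.2 ^+ 2).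
        by rewrite dd -/w wE /x !(planeZ, planeD, planeN) /dot /rot /=; ring.
      by rewrite uu mulr1 s1; apply: le_trans (ler_norm _); nra.
    have ds : ez (dpsi S d) + ez (dpsi S (turn d)) + ez (dpsi S d') = 0.
      by apply: sum_three_dirs => //; rewrite ?turn_end // eq_sym // turn_neq.
    have d'E : ez (dpsi S d') = - (1 / 2) *: u - sg *: rot u.
      move: ds; rewrite -/u -/w wE => /eqP; rewrite addrC addr_eq0 => /eqP ->.
      by rewrite !planeZ planeB !planeD planeN; apply: plane_eq => /=; field.
    apply: le_trans (ray_far s'0 _); last first.
      rewrite d'E; have -> : dot (rho *: x) (- (1 / 2) *: u - sg *: rot u) = - (rho * sg * (u.1 ^+ 2 + u.2 ^+ 2)).
        by rewrite /x !(planeZ, planeD, planeN) /dot /rot /=; field.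
      by rewrite uu mulr1 oppr_le0 mulr_ge0 // ltW.
    apply: le_trans (proj _ (rot u) _); last by rewrite rot_norm ez_norm.
    have -> : dot (rho *: x) (rot u) = rho * (1 - a / 2) * (u.1 ^+ 2 + u.2 ^+ 2).
      by rewrite /x !planeZ !planeD /dot /rot /=; ring.
    by rewrite uu mulr1; apply: le_trans (ler_norm _); nra.
  have : K * (2 * rho) ^+ 2 < rho / 2 by rewrite expr2; nra.
  by lra.
split=> [/w1|/w2] Pp; first by apply/w2; exact: (face_closed_seg hP clear Pp).
apply/w1; apply: (face_closed_seg hP _ Pp) => t /andP[t0 t1].
have -> : seg p' p t = seg p p' (1 - t).
  by rewrite /seg !planeB !planeZ !planeD; apply: plane_eq => /=; ring.
by apply: clear; apply/andP; split; lra.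
Qed.

End Vertices.

(** * Cutting an edge *)

Section Cones.
Variables (R : realType) (n : nat) (B : complex R n) (S : arcs B).
Hypothesis rB : regular B.
Implicit Types (d : edge B * bool) (x y : R).

(** Coordinates along and across the initial tangent of [d]. With the absolute value of [y] at most
    [x / 4], and [x] small and positive, such points can meet no edge except that of [d]. *)
Definition cone d x y : plane R :=
  dorg d + (x *: ez (dpsi S d) + y *: rot (ez (dpsi S d))).

Lemma cone_dot d d' x y : edge_end d = edge_end d' -> d != d' -> 0 < x -> `|y| <= x / 4 ->
  dot (x *: ez (dpsi S d) + y *: rot (ez (dpsi S d))) (ez (dpsi S d')) < 0.
Proof.
move=> e dd x0 yx; set u := ez _; set w := ez (dpsi S d').
have -> : dot (x *: u + y *: rot u) w = x * dot u w + y * dot (rot u) w.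
  by rewrite !(planeZ, planeD) /dot /=; ring.
rewrite (dir_dot S rB dd e).
have := norm_dot_le (rot u) w; rewrite rot_norm !ez_norm mulr1 => h.
have : `|y * dot (rot u) w| <= x / 4 by rewrite normrM; have := normr_ge0 y; nra.
by have := ler_norm (y * dot (rot u) w); lra.
Qed.

Lemma cone_norm d x y : 0 < x -> `|y| <= x / 4 -> 0 < edist (cone d x y) (dorg d) <= 2 * x.
Proof.
move=> x0 yx; rewrite /edist /cone addrAC subrr add0r; apply/andP; split.
  have := norm_dot_le (x *: ez (dpsi S d) + y *: rot (ez (dpsi S d))) (ez (dpsi S d)).
  have -> : dot (x *: ez (dpsi S d) + y *: rot (ez (dpsi S d))) (ez (dpsi S d)) = x.
    rewrite -[RHS]mulr1 -(cos2Dsin2 (dpsi S d)) !(planeZ, planeD) /dot /=; ring.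
  by rewrite ez_norm mulr1 gtr0_norm //; lra.
apply: le_trans (ler_enormD _ _) _; rewrite !enormZ rot_norm ez_norm !mulr1 gtr0_norm //.
lra.
Qed.

Lemma cone_inj d x y x' y' : cone d x y = cone d x' y' -> x = x' /\ y = y'.
Proof.
have co a b : a = dot (cone d a b - dorg d) (ez (dpsi S d)) /\ b = dot (cone d a b - dorg d) (rot (ez (dpsi S d))).
  rewrite /cone addrAC subrr add0r !(planeZ, planeD) /dot /=.
  by split; rewrite -[LHS]mulr1 -(cos2Dsin2 (dpsi S d)); ring.
by move=> e; have [h1 h2] := co x y; have [h1' h2'] := co x' y'; split; [rewrite h1 h1' e|rewrite h2 h2' e].
Qed.

Lemma cone_clear d : exists2 r : R, 0 < r & forall x y, 0 < x -> x < r -> `|y| <= x / 4 ->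
  support B (cone d x y) -> exists2 s : R, 0 < s < dlen S d & cone d x y = dpt S d s.
Proof.
have [r [K [[r0 K0] dirK _ _ iso]]] := vertex_rays S rB (edge_end d).
pose m := Num.min (r / 2) (1 / (8 * K)).
have m0 : 0 < m by rewrite lt_min !divr_gt0 // mulr_gt0.
have [m1 m2] : m <= r / 2 /\ m <= 1 / (8 * K) by rewrite /m !ge_min !lexx orbT.
exists m => // x y x0 xm yx sup.
have /andP[c0 c1] := cone_norm d x0 yx.
have [|d' [s [ev /andP[s0 sL] E s2]]] := iso _ _ sup; first by rewrite -/(dorg d); lra.
have sn0 : 0 < s.
  rewrite lt_neqAle eq_sym s0 andbT; apply/eqP => z; move: c0.
  by rewrite E z dpt0 /dorg ev edistxx ltxx.
case: (eqVneq d d') => [dd|dd]; first by subst d'; exists s; rewrite ?sn0.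
have w := cone_dot (esym ev) dd x0 yx.
have D := dirK d' s ev s0.
set u := ez (dpsi S d') in w D.
have : dot (dpt S d' s - (position (edge_end d) + s *: u)) u >= - (K * s ^+ 2).
  have := norm_dot_le (dpt S d' s - (position (edge_end d) + s *: u)) u.
  by rewrite ez_norm mulr1 ler_norml => /andP[h _]; rewrite /edist in D; lra.
rewrite -E opprD addrA /cone [_ - position _]addrAC subrr add0r.
set z := _ + _ in w *.
have -> : dot (z - s *: u) u = dot z u - s.
  rewrite -[s in RHS]mulr1 -(cos2Dsin2 (dpsi S d')) /u !(planeZ, planeD, planeN) /dot /=; ring.
have Ks : K * s < 1.
  have : x * (8 * K) < 1 by rewrite -ltr_pdivlMr ?mulr_gt0 //; lra.
  have s4 : s <= 4 * x by rewrite -/(dorg d) in s2; lra.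
  by move=> ?; nra.
by rewrite expr2 => h; nra.
Qed.

Lemma cone_disjoint d d' : d != d' -> exists2 r : R, 0 < r & forall x y x' y',
  0 < x < r -> `|y| <= x / 4 -> 0 < x' < r -> `|y'| <= x' / 4 -> cone d x y <> cone d' x' y'.
Proof.
move=> dd; case: (eqVneq (edge_end d) (edge_end d')) => e.
  exists 1 => // x y x' y' /andP[x0 _] yx /andP[x'0 _] yx' E.
  have := cone_dot e dd x0 yx.
  have -> : x *: ez (dpsi S d) + y *: rot (ez (dpsi S d)) = x' *: ez (dpsi S d') + y' *: rot (ez (dpsi S d')).
    by move: E; rewrite /cone /dorg e => /addrI.
  have -> : dot (x' *: ez (dpsi S d') + y' *: rot (ez (dpsi S d'))) (ez (dpsi S d')) = x'.
    rewrite -[RHS]mulr1 -(cos2Dsin2 (dpsi S d')) !(planeZ, planeD) /dot /=; ring.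
  by lra.
have D0 : 0 < edist (dorg d) (dorg d').
  by rewrite edist_gt0; apply: contra_neq e; exact: position_inj.
exists (edist (dorg d) (dorg d') / 4); first by rewrite divr_gt0.
move=> x y x' y' /andP[x0 xr] yx /andP[x'0 xr'] yx' E.
have /andP[_ c1] := cone_norm d x0 yx; have /andP[_ c2] := cone_norm d' x'0 yx'.
by have := edist_triangle (cone d x y) (dorg d) (dorg d'); rewrite [edist (dorg d) (cone _ _ _)]edistC {2}E => ?; lra.
Qed.

End Cones.

Section Removal.
Variables (R : realType) (n : nat) (B : complex R n) (S : arcs B) (e0 : edge B) (i0 : option 'I_n) (rho : R).
Hypothesis rB : regular B.
Hypothesis left0 : near_left S (e0, false) (region B i0).
Hypothesis right0 : near_left S (e0, true) (region B i0).
Hypothesis rho0 : 0 < rho.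
Hypothesis clear : forall b x y, 0 < x -> x < rho -> `|y| <= x / 4 ->
  support B (cone S (e0, b) x y) ->
  exists2 s : R, 0 < s < dlen S (e0, b) & cone S (e0, b) x y = dpt S (e0, b) s.
Hypothesis apart : forall x y x' y',
  0 < x < rho -> `|y| <= x / 4 -> 0 < x' < rho -> `|y'| <= x' / 4 ->
  cone S (e0, false) x y <> cone S (e0, true) x' y'.

(** The loop stays in the cone at its vertex, and the quotient of [loop_y] by [loop_x] determines
    [t], so the loop is simple. *)
Definition loop_x (t : R) : R := rho * (t * (1 - t)).
Definition loop_y (t : R) : R := loop_x t * (1 - 2 * t) / 4.
Definition loop b (t : R) : plane R := cone S (e0, b) (loop_x t) (loop_y t).

Lemma loop_range t : 0 < t < 1 -> 0 < loop_x t < rho /\ `|loop_y t| <= loop_x t / 4.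
Proof.
move=> /andP[t0 t1]; have r0 := rho0.
have h0 : 0 < t * (1 - t) by rewrite mulr_gt0 // subr_gt0.
have h : 0 < loop_x t by rewrite mulr_gt0.
split; first by rewrite h /= /loop_x; have : t * (1 - t) < 1 by [nra]; nra.
by rewrite /loop_y; move: (loop_x t) h => z h; rewrite ler_norml; apply/andP; split; nra.
Qed.

Lemma loop_lip b s t : 0 <= s <= 1 -> 0 <= t <= 1 -> edist (loop b s) (loop b t) <= 3 * rho * `|s - t|.
Proof.
move=> /andP[s0 s1] /andP[t0 t1]; rewrite /edist /loop /cone.
have -> : dorg (e0, b) + (loop_x s *: ez (dpsi S (e0, b)) + loop_y s *: rot (ez (dpsi S (e0, b)))) -
  (dorg (e0, b) + (loop_x t *: ez (dpsi S (e0, b)) + loop_y t *: rot (ez (dpsi S (e0, b))))) =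
  (loop_x s - loop_x t) *: ez (dpsi S (e0, b)) + (loop_y s - loop_y t) *: rot (ez (dpsi S (e0, b))).
  by rewrite opprD addrACA subrr add0r opprD addrACA -!scalerBl.
apply: le_trans (ler_enormD _ _) _; rewrite !enormZ rot_norm ez_norm !mulr1.
have -> : loop_x s - loop_x t = rho * (1 - s - t) * (s - t) by rewrite /loop_x; ring.
have -> : loop_y s - loop_y t = rho * ((1 - 3 * (s + t) + 2 * (s * s + s * t + t * t)) / 4) * (s - t).
  by rewrite /loop_y /loop_x; field.
rewrite !normrM (gtr0_norm rho0) -mulrDl ler_wpM2r // -mulrDr [3 * rho]mulrC ler_pM2l //.
have h1 : `|1 - s - t| <= 1 by rewrite ler_norml; apply/andP; split; lra.
have h2 : `|1 - 3 * (s + t) + 2 * (s * s + s * t + t * t)| <= 7.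
  by rewrite ler_norml; apply/andP; split; nra.
have -> : `|4^-1| = 4^-1 :> R by rewrite gtr0_norm.
lra.
Qed.

Lemma loop_continuous b : continuous (loop b).
Proof.
have cx : continuous loop_x.
  move=> t; apply: cvgM; first exact: cvg_cst.
  by apply: cvgM; [exact: cvg_id|apply: cvgB; [exact: cvg_cst|exact: cvg_id]].
have cy : continuous loop_y.
  move=> t; apply: cvgM; last exact: cvg_cst.
  apply: cvgM; first exact: cx.
  by apply: cvgB; [exact: cvg_cst|apply: cvgM; [exact: cvg_cst|exact: cvg_id]].
move=> t; apply: cvgD; first exact: cvg_cst.
by apply: cvgD; apply: cvgZl; [exact: cx|exact: cy].
Qed.

(** [inr b] is a loop at the end [b] of [e0]. It takes the place of the dart [(e0, b)] in the count
    of degrees, which therefore do not drop below three. *)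
Definition rem_edge := ({e : edge B | e != e0} + bool)%type.

Definition rem_end (d : rem_edge * bool) : vertex B :=
  match d.1 with inl e => edge_end (val e, d.2) | inr b => edge_end (e0, b) end.

Definition rem_curve (e : rem_edge) : R -> plane R :=
  match e with inl e => curve (val e) | inr b => loop b end.

Lemma rem_continuous e : {within `[0, 1], continuous (rem_curve e)}.
Proof.
by case: e => [e|b] /=; [exact: curve_continuous|apply: within_of_continuous; exact: loop_continuous].
Qed.

Lemma loop_ends b : loop b 0 = dorg (e0, b) /\ loop b 1 = dorg (e0, b).
Proof.
by rewrite /loop /cone /loop_y /loop_x !(mul0r, mulr0, subrr, scale0r, addr0).
Qed.

Lemma rem_curve0 e : rem_curve e 0 = position (rem_end (e, false)).
Proof. by case: e => [e|b] /=; [exact: curve0|exact: (loop_ends b).1]. Qed.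

Lemma rem_curve1 e : rem_curve e 1 = position (rem_end (e, true)).
Proof. by case: e => [e|b] /=; [exact: curve1|exact: (loop_ends b).2]. Qed.

Lemma loop_support b t : 0 < t < 1 -> support B (loop b t) ->
  exists2 s : R, 0 < s < 1 & loop b t = curve e0 s.
Proof.
move=> /loop_range[/andP[x0 x1] yx] /(clear x0 x1 yx)[s hs E].
by have [s' hs' E'] := edge_param_inv hs; exists s' => //; rewrite /loop E -E'.
Qed.

Lemma rem_curve_inj e e' t t' : 0 < t < 1 -> 0 < t' < 1 ->
  rem_curve e t = rem_curve e' t' -> e = e' /\ t = t'.
Proof.
have key (e1 : {e : edge B | e != e0}) b s s' : 0 < s < 1 -> 0 < s' < 1 -> curve (val e1) s <> loop b s'.
  move=> hs hs' E; have [|r hr E'] := @loop_support b s' hs'.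
    by rewrite -E; right; exists (val e1), s; case/andP: hs => ? ?; rewrite !ltW.
  have [ee _] := curve_inj hs hr (etrans E E').
  by have := valP e1; rewrite /= ee eqxx.
move=> ht ht'; case: e e' => [e|b] [e'|b'] /=.
- by move/(curve_inj ht ht') => -[/val_inj -> ->].
- by move/(key _ _ _ _ ht ht').
- by move/esym/(key _ _ _ _ ht' ht).
- have [h1 h2] := loop_range ht; have [h1' h2'] := loop_range ht'.
  move=> E; have bb : b = b'.
    case: b b' E => [] [] // E; exfalso; [exact: (apart h1' h2' h1 h2 (esym E))|exact: (apart h1 h2 h1' h2' E)].
  subst b'; split=> //; have [xx yy] := @cone_inj R n B S (e0, b) _ _ _ _ E.
  have /andP[x0 _] := h1; move: yy; rewrite /loop_y -xx => yy.
  have : loop_x t * (t - t') = 0 by lra.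
  by move/eqP; rewrite mulf_eq0 (gt_eqF x0) /= subr_eq0 => /eqP.
Qed.

Lemma rem_curve_vertex e t (v : vertex B) : 0 < t < 1 -> rem_curve e t <> position v.
Proof.
move=> ht; case: e => [e|b] /=; first exact: curve_vertex.
move=> E; have [|s hs E'] := @loop_support b t ht; first by left; exists v.
by apply: (@curve_vertex R B e0 s v hs); rewrite -E'.
Qed.

Lemma rem_degree v : (3 <= #|[set d | rem_end d == v]%SET|)%N.
Proof.
apply: leq_trans (degree_ge3 v) _.
pose f (d : edge B * bool) : rem_edge * bool :=
  if insub d.1 is Some e then (inl e, d.2) else (inr d.2, false).
have fi : injective f.
  move=> [e b] [e' b']; rewrite /f /=; case: insubP => [x _ <-|]; case: insubP => [x' _ <-|] //.
    by case=> -> ->.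
  by rewrite !negbK => /eqP -> /eqP -> [->].
rewrite -(card_imset _ fi); apply/subset_leq_card/fintype.subsetP => _ /imsetP[[e b] + ->].
rewrite !inE /f /rem_end /=; case: insubP => [x _ <-|] //=.
by rewrite negbK => /eqP ->.
Qed.

Definition rem_graph : embedded_graph R :=
  @EmbeddedGraph R (vertex B) rem_edge (@position R B) rem_end rem_curve
    (@position_inj R B) rem_continuous rem_curve0 rem_curve1 rem_curve_inj rem_curve_vertex rem_degree.

Definition rem_open : set (plane R) := [set p | exists2 s : R, 0 < s < dlen S (e0, false) & p = dpt S (e0, false) s].
Definition rem_loops : set (plane R) := (loop false @` `[0, 1]) `|` (loop true @` `[0, 1]).
Definition rem_wide (i : option 'I_n) : set (plane R) := region B i `|` (if i == i0 then rem_open else set0).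
(** The inside of a loop keeps the index that its points had. Areas change only by null sets: the
    removed open edge and the two loops. *)
Definition rem_region (i : option 'I_n) : set (plane R) := rem_wide i `\` rem_loops.

Lemma closed_rem_loops : closed rem_loops.
Proof.
apply: closedU; apply: compact_closed; (try exact: plane_hausdorff);
  apply: path_compact; apply: within_of_continuous; exact: loop_continuous.
Qed.

Lemma rem_open_curve p : rem_open p <-> exists2 t, 0 < t < 1 & p = curve e0 t.
Proof.
split; first by case=> s /edge_param_inv[t t01 E] ->; exists t.
case=> t t01 ->; exists (arc_sig S e0 t); first exact: arc_sig_range.
by apply: edge_param; case/andP: t01 => ? ?; rewrite !ltW.
Qed.

Lemma rem_support p : support rem_graph p <-> (support B p /\ ~ rem_open p) \/ rem_loops p.
Proof.
split.
  case=> [[v ->]|[[e|b] [t [t01 ->]]]] /=.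
  - by left; split; [left; exists v|move/rem_open_curve => -[t t01 /esym]; exact: curve_vertex].
  - left; split; first by right; exists (val e), t.
    move/rem_open_curve => -[s hs E].
    case/andP: t01 => t0 t1.
    case: (eqVneq t 0) => [tz|tn0]; first by move: E; rewrite tz curve0 => /esym; exact: curve_vertex.
    case: (eqVneq t 1) => [tz|tn1]; first by move: E; rewrite tz curve1 => /esym; exact: curve_vertex.
    have ht : 0 < t < 1 by rewrite !lt_neqAle tn1 t1 eq_sym tn0 t0.
    by have [ee _] := curve_inj ht hs E; have := valP e; rewrite /= ee eqxx.
  - by right; case: b; [right|left]; exists t => //; rewrite /= in_itv.
case=> [[[[v ->]|[e [t [t01 pE]]]] no]|]; first by left; exists v.
- case: (eqVneq e e0) => [ee|ne]; last by right; exists (inl (exist _ e ne)), t.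
  subst e; case/andP: t01 => t0 t1; left.
  case: (eqVneq t 0) => [tz|tn0]; first by exists (edge_end (e0, false)); rewrite pE tz curve0.
  case: (eqVneq t 1) => [tz|tn1]; first by exists (edge_end (e0, true)); rewrite pE tz curve1.
  exfalso; apply: no; apply/rem_open_curve; exists t => //.
  by rewrite !lt_neqAle tn1 t1 eq_sym tn0 t0.
by case=> -[t]; rewrite /= in_itv /= => t01 <-; right; [exists (inr false), t|exists (inr true), t].
Qed.

Lemma rem_wide_open i : open (rem_wide i).
Proof.
apply/openP => p [ip|].
  have /openP/(_ p ip)[r r0 hr] := @open_region R n B i.
  by exists r => // q /hr; left.
case: ifP => // /eqP -> [s hs ->].
have [r1 r10 iso] := edge_isolated hs; have [r2 r20 nb] := edge_nbhd rB hs.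
exists (Num.min r1 r2); first by rewrite lt_min r10.
move=> q; rewrite lt_min => /andP[q1 q2].
case: (pselect (support B q)) => sq; last first.
  left; case: (nb q q2 sq) => -[_ h]; apply/(h (region B i0)); [exact: region_face_closed|exact: left0|exact: region_face_closed|exact: right0].
by have [s' hs' E] := iso q q1 sq; right; rewrite eqxx; exists s'.
Qed.

Lemma rem_region_open i : open (rem_region i).
Proof. by apply: openI; [exact: rem_wide_open|exact: (closed_openC closed_rem_loops)]. Qed.

Lemma rem_open_support p : rem_open p -> support B p.
Proof. by move/rem_open_curve => -[t /andP[t0 t1] ->]; right; exists e0, t; rewrite !ltW. Qed.

Lemma rem_region_disj i j p : rem_region i p -> rem_region j p -> i = j.
Proof.
case=> [[ip|ip] _] [[jp|jp] _].
- exact: region_uniq ip jp.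
- by move: jp; case: ifP => // _ /rem_open_support sp; have := region_compl ip.
- by move: ip; case: ifP => // _ /rem_open_support sp; have := region_compl jp.
- by move: ip jp; case: eqP => // ->; case: eqP.
Qed.

Lemma rem_region_cover p : ~ support rem_graph p <-> exists i, rem_region i p.
Proof.
split.
  move=> np; have nl : ~ rem_loops p by move=> h; apply: np; apply/rem_support; right.
  case: (pselect (rem_open p)) => ro; first by exists i0; split=> //; right; rewrite eqxx.
  have /region_exists[i ip] : ~ support B p by move=> h; apply: np; apply/rem_support; left.
  by exists i; split=> //; left.
move=> [i [wp nl]] /rem_support[[sp nro]|//].
case: wp => [/region_compl //|]; by case: ifP.
Qed.

Lemma rem_loops_null : meas_plane rem_loops /\ plane_area rem_loops = 0%E.
Proof.
have ml b : meas_plane (loop b @` `[0, 1]).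
  apply: closed_mset; apply: compact_closed; first exact: plane_hausdorff.
  by apply: path_compact; apply: within_of_continuous; exact: loop_continuous.
have nl b : plane_area (loop b @` `[0, 1]) = 0%E.
  apply: (@null_lipschitz R (loop b) (3 * rho)); first by apply: within_of_continuous; exact: loop_continuous.
  by move=> s t hs ht; exact: loop_lip.
split; first exact: (@measurableU _ (mplane R) _ _ (ml false) (ml true)).
by rewrite /rem_loops plane_areaU_null.
Qed.

Lemma rem_open_null : meas_plane rem_open /\ plane_area rem_open = 0%E.
Proof.
pose g t := dpt S (e0, false) (dlen S (e0, false) * t).
have cg : continuous g.
  move=> t; apply: (@continuous_comp R R (plane R) (fun t : R => dlen S (e0, false) * t) (dpt S (e0, false))).
    by apply: cvgM; [exact: cvg_cst|exact: cvg_id].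
  exact: arc_continuous.
have L0 := dlen_gt0 S (e0, false).
have mg : meas_plane (g @` `[0, 1]).
  apply: closed_mset; apply: compact_closed; first exact: plane_hausdorff.
  by apply: path_compact; apply: within_of_continuous.
have ng : plane_area (g @` `[0, 1]) = 0%E.
  apply: (@null_lipschitz R g (dlen S (e0, false))); first exact: within_of_continuous.
  by move=> s t _ _; apply: le_trans (dpt_lip _ _ _ _) _; rewrite -mulrBr normrM gtr0_norm.
have mo : meas_plane rem_open.
  have -> : rem_open = (g @` `[0, 1]) `\` (range (@position R B)).
    apply/seteqP; split=> [p [s /andP[s0 sL] ->]|p [[t]]].
      split; last by case=> v _ /esym; apply: dpt_vertex; rewrite s0.
      exists (s / dlen S (e0, false)); last by rewrite /g mulrC divfK // gt_eqF.
      by rewrite /= in_itv /= divr_ge0 ?(ltW s0) ?(ltW L0) //= ler_pdivrMr // mul1r ltW.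
    rewrite /= in_itv /= => /andP[t0 t1] <- nv; exists (dlen S (e0, false) * t) => //.
    have le1 : dlen S (e0, false) * t <= dlen S (e0, false) by rewrite -[X in _ <= X]mulr1 ler_pM2l.
    rewrite !lt_neqAle mulr_ge0 ?(ltW L0) //= le1 !andbT.
    apply/andP; split; apply/eqP => z; apply: nv.
      by exists (edge_end (e0, false)) => //; rewrite /g -z dpt0.
    by exists (edge_end (e0, true)) => //; rewrite /g z dptL.
  apply: (@measurableD _ (mplane R)) => //.
  apply: closed_mset; apply: compact_closed; first exact: plane_hausdorff.
  by apply: finite_compact; apply: finite_image; exact: finite_finset.
split=> //; apply: (plane_area_null mo mg ng) => p [s /andP[s0 sL] ->].
exists (s / dlen S (e0, false)); last by rewrite /g mulrC divfK // gt_eqF.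
by rewrite /= in_itv /= divr_ge0 ?(ltW s0) ?(ltW L0) //= ler_pdivrMr // mul1r ltW.
Qed.

Lemma rem_region_area m : plane_area (rem_region (Some m)) = (area B m)%:E.
Proof.
have [ml nl] := rem_loops_null; have [mo no] := rem_open_null.
have mr : meas_plane (rem_region (Some m)) by apply: open_mset; exact: rem_region_open.
rewrite -(plane_areaU_null mr ml nl).
have mb : meas_plane (region B (Some m)) by apply: open_mset; exact: open_region.
rewrite -interior_area -(plane_areaU_null mb mo no).
have mbo := @measurableU _ (mplane R) _ _ mb mo.
rewrite -(plane_areaU_null mbo ml nl).
have mrl := @measurableU _ (mplane R) _ _ mr ml.
rewrite -(plane_areaU_null mrl mo no); congr plane_area.
apply/seteqP; split=> p.
  case=> [[[[h|h] _]|h]|h]; [by left; left| |by right|by left; right].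
  by left; right; move: h; case: ifP.
case=> [[h|h]|h]; [|by right|by left; right].
case: (pselect (rem_loops p)) => l; first by left; right.
by left; left; split=> //; left.
Qed.

Definition rem_complex : complex R n :=
  @mk_complex R n rem_graph rem_region (area B) rem_region_open rem_region_disj rem_region_cover
    (@area_gt0 R n B) rem_region_area.

Lemma rem_length : (graph_length rem_complex + (dlen S (e0, false))%:E <= graph_length B + (6 * rho)%:E)%E.
Proof.
have r0 := rho0.
have ll b : (curve_length (loop b) <= (3 * rho)%:E)%E.
  apply: le_trans (@curve_length_le R (loop b) (fun t => 3 * rho * t) _) _; last by rewrite lee_fin; lra.
  move=> s t s0 st t1; rewrite -mulrBr.
  apply: le_trans (loop_lip _ _ _) _; [apply/andP; split; lra|apply/andP; split; lra|].
  by rewrite ger0_norm // subr_ge0.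
pose z b := fine (curve_length (loop b)).
have zE b : curve_length (loop b) = (z b)%:E.
  rewrite fineK // ge0_fin_numE ?curve_length_ge0 //; apply: le_lt_trans (ll b) _; exact: ltry.
have z3 b : z b <= 3 * rho by rewrite -lee_fin -zE.
have -> : graph_length B = (\sum_(e : edge B) arc_l S e)%:E.
  by rewrite -sumEFin; apply: eq_bigr => e _; exact: arc_length (arcsP S e).
have -> : graph_length rem_complex = (\sum_(e : rem_edge) match e with inl e => arc_l S (val e) | inr b => z b end)%:E.
  rewrite -sumEFin; apply: eq_bigr => -[e|b] _ /=; [exact: arc_length (arcsP S _)|exact: zE].
rewrite -!EFinD lee_fin big_sumType /= big_bool /=.
rewrite (bigD1 e0) //= [X in X + (z _ + _)](_ : _ = \sum_(e | e != e0) arc_l S e).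
  by have := z3 true; have := z3 false; rewrite /dlen /=; lra.
by rewrite [RHS](reindex_omap (val : {e : edge B | e != e0} -> edge B) insub) => [|e h] /=; [apply: eq_bigl => e; rewrite valK eqxx (valP e)|rewrite insubT].
Qed.

End Removal.

Section SidesDiffer.
Variables (R : realType) (n : nat) (B : complex R n) (S : arcs B).
Hypothesis rB : regular B.
Hypothesis mB : perimeter_minimizer B.
Implicit Types (d : edge B * bool).

Definition lab d : option 'I_n := projT1 (cid (lab_exists S d)).

Lemma near_lab d : near_left S d (region B (lab d)).
Proof. by rewrite /lab; case: cid. Qed.
Arguments near_lab : clear implicits.

Lemma lab_uniq d i : near_left S d (region B i) -> lab d = i.
Proof. by move=> h; have [p [h1 h2]] := near_left_meet (near_lab d) h; exact: region_uniq h1 h2. Qed.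

Lemma lab_turn d : lab (rev (turn S rB d)) = lab d.
Proof.
apply: lab_uniq.
exact: (near_left_turn S rB d (@region_face_closed R n B (lab d))).1 (near_lab d).
Qed.

Lemma sides_differ d : lab (rev d) <> lab d.
Proof.
wlog : d / d.2 = false.
  move=> h; case: d => e [] /= ; last exact: (h (e, false)).
  by move=> e1; apply: (h (e, false)) => //; rewrite e1.
case: d => e0 b /= -> E.
have [r1 r10 c1] := cone_clear S rB (e0, false).
have [r2 r20 c2] := cone_clear S rB (e0, true).
have [r3 r30 c3] := @cone_disjoint R n B S rB (e0, false) (e0, true) (rev_neq (e0, true)).
(* The two loops cost at most [6 * m], which is half the length saved. *)
pose m := Num.min (Num.min r1 r2) (Num.min r3 (dlen S (e0, false) / 12)).
have L0 := dlen_gt0 S (e0, false).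
have m0 : 0 < m by rewrite !lt_min r10 r20 r30 divr_gt0.
have [m1 m2 m3 m4] : [/\ m <= r1, m <= r2, m <= r3 & m <= dlen S (e0, false) / 12].
  by split; rewrite /m !ge_min !lexx ?orbT.
have cl b' x y : 0 < x -> x < m -> `|y| <= x / 4 -> support B (cone S (e0, b') x y) ->
  exists2 s : R, 0 < s < dlen S (e0, b') & cone S (e0, b') x y = dpt S (e0, b') s.
  by case: b' => x0 xm; [apply: c2|apply: c1] => //; lra.
have ap x y x' y' : 0 < x < m -> `|y| <= x / 4 -> 0 < x' < m -> `|y'| <= x' / 4 ->
  cone S (e0, false) x y <> cone S (e0, true) x' y'.
  by move=> /andP[h1 h2] h3 /andP[h4 h5] h6; apply: c3 => //; apply/andP; split; lra.
have hr : near_left S (e0, true) (region B (lab (e0, false))).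
  by rewrite -E; exact: near_lab.
have := rem_length rB (near_lab (e0, false)) hr m0 cl ap.
set B' := rem_complex _ _ _ _ _ _ => len.
have := mB (B' := B') (fun=> erefl).
have -> : graph_length B = (\sum_(e : edge B) arc_l S e)%:E.
  by rewrite -sumEFin; apply: eq_bigr => e _; exact: arc_length (arcsP S e).
move: len; have -> : graph_length B = (\sum_(e : edge B) arc_l S e)%:E.
  by rewrite -sumEFin; apply: eq_bigr => e _; exact: arc_length (arcsP S e).
move: (graph_length B') => [z| |] //.
rewrite -!EFinD !lee_fin => h1 h2; exfalso.
by move: (\sum_(e : edge B) _) h1 h2 => s h1 h2; clear B' c1 c2 c3 cl ap E hr; lra.
Qed.

End SidesDiffer.

(** * First variation *)

Section Frames.
Variable R : realType.
Implicit Types (p q z : plane R) (a c s t x : R) (A : set (plane R)).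

Definition frame z a q : plane R := z + (q.1 *: ez a + q.2 *: rot (ez a)).
Definition coord z a p : plane R := (dot (p - z) (ez a), dot (p - z) (rot (ez a))).

Lemma coordK z a : cancel (coord z a) (frame z a).
Proof. by move=> p; rewrite /frame /= -(decompose (p - z) (ez_norm a)) subrKC. Qed.

Lemma frameK z a : cancel (frame z a) (coord z a).
Proof.
move=> q; have h : cos a ^+ 2 = 1 - sin a ^+ 2 by rewrite -(cos2Dsin2 a) addrK.
rewrite /coord /frame [z + _]addrC addrK; case: q => x y.
apply: plane_eq; rewrite /dot /ez /rot /= /GRing.scale /= /GRing.scale /=; ring: h.
Qed.

Lemma edist_frame z a p q : edist (frame z a p) (frame z a q) = edist p q.
Proof.
rewrite /edist /enorm; congr Num.sqrt; rewrite /frame opprD addrACA subrr add0r.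
have h : cos a ^+ 2 = 1 - sin a ^+ 2 by rewrite -(cos2Dsin2 a) addrK.
 case: p q => p1 p2 [q1 q2].
rewrite /dot /ez /rot /= /GRing.scale /= /GRing.scale /=; ring: h.
Qed.

Lemma edist_coord z a p q : edist (coord z a p) (coord z a q) = edist p q.
Proof. by rewrite -(edist_frame z a) !coordK. Qed.

Lemma coord_continuous z a : continuous (coord z a).
Proof.
move=> q; apply/cvg_edistP => e e0; near=> t; rewrite edist_coord.
by near: t; move: e e0; apply/cvg_edistP; exact: cvg_id.
Unshelve. all: by end_near. Qed.

Lemma plane_area_shear1 c A : meas_plane A ->
  plane_area ((fun p : plane R => (p.1 + c * p.2, p.2) : plane R) @^-1` A) = plane_area A.
Proof.
move=> mA; pose sw := fun p : plane R => (p.2, p.1) : plane R.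
have csw : continuous sw by move=> p; apply: continuous_pair; [exact: continuous_snd|exact: continuous_fst].
have csh : continuous (fun p : plane R => (p.1, p.2 + c * p.1) : plane R).
  move=> p; apply: continuous_pair; first exact: continuous_fst.
  by apply: cvgD; [exact: continuous_snd|apply: cvgM; [exact: cvg_cst|exact: continuous_fst]].
by rewrite -(plane_area_swap mA) -(plane_area_shear c (mset_preimage csw mA))
  -(plane_area_swap (mset_preimage csh (mset_preimage csw mA))).
Qed.

(** A rotation is the product of three shears; [t] is minus the tangent of half the angle. *)
Lemma plane_area_turn_aux c s A : c ^+ 2 + s ^+ 2 = 1 -> 1 + c != 0 -> meas_plane A ->
  plane_area ((fun p : plane R => (c * p.1 - s * p.2, s * p.1 + c * p.2) : plane R) @^-1` A) = plane_area A.
Proof.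
move=> cs c1 mA; pose t := - s / (1 + c).
have tE : t * (1 + c) = - s by rewrite /t divfK.
have stE : 1 + s * t = c.
  apply: (mulIf c1); have -> : (1 + s * t) * (1 + c) = 1 + c + s * (t * (1 + c)) by ring.
  rewrite tE; have := cs; move: (s) => x h; have -> : x * - x = c ^+ 2 - 1 by rewrite -h; ring.
  ring.
have csh1 : continuous (fun p : plane R => (p.1 + t * p.2, p.2) : plane R).
  move=> p; apply: (continuous_pair (f := fun p : plane R => p.1 + t * p.2) (g := snd)); last exact: continuous_snd.
  by apply: cvgD; [exact: continuous_fst|apply: cvgM; [exact: cvg_cst|exact: continuous_snd]].
have csh2 : continuous (fun p : plane R => (p.1, p.2 + s * p.1) : plane R).
  move=> p; apply: continuous_pair; first exact: continuous_fst.
  by apply: cvgD; [exact: continuous_snd|apply: cvgM; [exact: cvg_cst|exact: continuous_fst]].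
rewrite -(plane_area_shear1 t mA).
rewrite -(plane_area_shear s (mset_preimage csh1 mA)).
rewrite -(plane_area_shear1 t (mset_preimage csh2 (mset_preimage csh1 mA))).
congr plane_area; apply/seteqP; split=> p /=.
  have -> // : (c * p.1 - s * p.2, s * p.1 + c * p.2) =
    (p.1 + t * p.2 + t * (p.2 + s * (p.1 + t * p.2)), p.2 + s * (p.1 + t * p.2)).
  have -> : p.1 + t * p.2 + t * (p.2 + s * (p.1 + t * p.2)) = p.1 * (1 + s * t) + p.2 * (t * (1 + (1 + s * t))) by ring.
  have -> : p.2 + s * (p.1 + t * p.2) = s * p.1 + (1 + s * t) * p.2 by ring.
  by rewrite stE tE; congr pair; ring.
have -> // : (c * p.1 - s * p.2, s * p.1 + c * p.2) =
    (p.1 + t * p.2 + t * (p.2 + s * (p.1 + t * p.2)), p.2 + s * (p.1 + t * p.2)).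
have -> : p.1 + t * p.2 + t * (p.2 + s * (p.1 + t * p.2)) = p.1 * (1 + s * t) + p.2 * (t * (1 + (1 + s * t))) by ring.
have -> : p.2 + s * (p.1 + t * p.2) = s * p.1 + (1 + s * t) * p.2 by ring.
by rewrite stE tE; congr pair; ring.
Qed.

(** The half turn, for which the tangent is undefined, is the square of a quarter turn. *)
Lemma plane_area_turn c s A : c ^+ 2 + s ^+ 2 = 1 -> meas_plane A ->
  plane_area ((fun p : plane R => (c * p.1 - s * p.2, s * p.1 + c * p.2) : plane R) @^-1` A) = plane_area A.
Proof.
move=> cs mA; have [c1|c1] := eqVneq (1 + c) 0; last exact: plane_area_turn_aux.
have cE : c = - 1 by lra.
have sE : s = 0 by apply/eqP; rewrite -sqrf_eq0; apply/eqP; move: cs; rewrite cE; lra.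
have h01 : (0 : R) ^+ 2 + 1 ^+ 2 = 1 by ring.
have n1 : 1 + 0 != 0 :> R by rewrite addr0 oner_neq0.
have ct : continuous (fun p : plane R => (0 * p.1 - 1 * p.2, 1 * p.1 + 0 * p.2) : plane R).
  move=> p; apply: (continuous_pair (f := fun p : plane R => 0 * p.1 - 1 * p.2) (g := fun p => 1 * p.1 + 0 * p.2));
    [apply: cvgB|apply: cvgD]; apply: cvgM; try exact: cvg_cst;
  by [exact: continuous_fst|exact: continuous_snd].
rewrite -(plane_area_turn_aux h01 n1 mA) -(plane_area_turn_aux h01 n1 (mset_preimage ct mA)).
congr plane_area; rewrite cE sE; apply/seteqP; split=> p /=.
  by have -> // : (-1 * p.1 - 0 * p.2, 0 * p.1 + -1 * p.2) =
    (0 * (0 * p.1 - 1 * p.2) - 1 * (1 * p.1 + 0 * p.2), 1 * (0 * p.1 - 1 * p.2) + 0 * (1 * p.1 + 0 * p.2));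
    congr pair; ring.
by have <- // : (-1 * p.1 - 0 * p.2, 0 * p.1 + -1 * p.2) =
    (0 * (0 * p.1 - 1 * p.2) - 1 * (1 * p.1 + 0 * p.2), 1 * (0 * p.1 - 1 * p.2) + 0 * (1 * p.1 + 0 * p.2));
    congr pair; ring.
Qed.

Lemma plane_area_frame z a A : meas_plane A -> plane_area (frame z a @^-1` A) = plane_area A.
Proof.
move=> mA.
have ct : continuous (fun p : plane R => p + z).
  by move=> p; apply: cvgD; [exact: cvg_id|exact: cvg_cst].
rewrite -(plane_area_translate z mA) -(plane_area_turn (cos2Dsin2 a) (mset_preimage ct mA)).
congr plane_area; apply/seteqP; split=> p /=; rewrite /frame /ez /rot.
  have -> // : z + (p.1 *: (cos a, sin a) + p.2 *: (- sin a, cos a)) =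
    (cos a * p.1 - sin a * p.2, sin a * p.1 + cos a * p.2) + z.
  by apply: plane_eq => /=; rewrite /GRing.scale /=; ring.
have -> // : z + (p.1 *: (cos a, sin a) + p.2 *: (- sin a, cos a)) =
    (cos a * p.1 - sin a * p.2, sin a * p.1 + cos a * p.2) + z.
by apply: plane_eq => /=; rewrite /GRing.scale /=; ring.
Qed.

End Frames.

Section PerturbedIdentity.
Variables (R : realType) (psi : plane R -> plane R).
Implicit Types (p q : plane R).

Definition perturb p : plane R := p + psi p.

Hypothesis psi_lip : forall p q, enorm (psi p - psi q) <= edist p q / 2.
Hypothesis psi_onto : forall q, exists p, perturb p = q.

(** A perturbation with Lipschitz constant 1 / 2 shrinks distances at most by the factor 2, which
    gives injectivity and the continuity of the inverse. *)
Lemma perturb_homeo : exists g : plane R -> plane R,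
  [/\ continuous perturb, continuous g, cancel perturb g &
      cancel g perturb].
Proof.
pose g q := projT1 (cid (psi_onto q)).
have gK : cancel g perturb by move=> q; rewrite /g; case: cid.
have lo p q : edist p q <= 2 * edist (perturb p) (perturb q).
  have := psi_lip p q; rewrite /edist /perturb => h.
  have : enorm (p - q) <= enorm (p + psi p - (q + psi q)) + enorm (psi p - psi q).
    rewrite -[enorm (psi p - psi q)]enormN; apply: le_trans (ler_enormD _ _).
    by rewrite le_eqVlt; apply/orP; left; apply/eqP; congr enorm; rewrite opprD addrACA addrK.
  lra.
have hK : cancel perturb g.
  move=> p; apply/eqP; rewrite -edist_eq0 eq_le sqrtr_ge0 andbT.
  by apply: le_trans (lo _ _) _; rewrite gK /edist subrr enorm0 mulr0.
exists g; split=> //.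
  move=> p; apply/cvg_edistP => e e0; near=> q.
  have : edist q p < e / 2.
    by near: q; move: (e / 2) (divr_gt0 e0 (ltr0Sn R 1)); apply/cvg_edistP; exact: cvg_id.
  move=> hq; have := psi_lip q p.
  have : edist (perturb q) (perturb p) <= edist q p + enorm (psi q - psi p).
    by rewrite /edist /perturb opprD addrACA; exact: ler_enormD.
  by lra.
move=> p; apply/cvg_edistP => e e0; near=> q.
have : edist q p < e / 2.
  by near: q; move: (e / 2) (divr_gt0 e0 (ltr0Sn R 1)); apply/cvg_edistP; exact: cvg_id.
by have := lo (g q) (g p); rewrite !gK; lra.
Unshelve. all: by end_near. Qed.

End PerturbedIdentity.

Lemma antiderivative (R : realType) (f : R -> R) (a b : R) : continuous f ->
  exists F : R -> R, forall x, a <= x <= b -> is_derive x 1 F (f x).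
Proof.
move=> cf; exists (fun x => \int[@lebesgue_measure R]_(t in `[a - 1, x]) f t)%R => x /andP[ax xb].
have int : (@lebesgue_measure R).-integrable `[a - 1, b + 1] (EFin \o f).
  apply: (@continuous_compact_integrable R f); first exact: segment_compact.
  exact: within_of_continuous.
have [xb1 ax1] : x < b + 1 /\ a - 1 < x by split; lra.
have [h1 h2] := continuous_FTC1_closed xb1 int ax1 (cf x).
split; first exact: h1.
by rewrite -h2 derive1E.
Qed.

(** * A bump across an arc *)

Section Profile.
Variables (R : realType) (k rho : R).
Hypothesis rho0 : 0 < rho.
Hypothesis krho : `|k| * rho <= 1 / 8.
Implicit Types (x y c : R) (p q : plane R).

(** The arc of curvature [k] tangent to the first axis at 0, as a graph. It is
    [(1 - sqrt (1 - k ^+ 2 * x ^+ 2)) / k] in a rationalized form that includes [k = 0]. *)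
Definition arc_height x : R := k * x ^+ 2 / (1 + Num.sqrt (1 - k ^+ 2 * x ^+ 2)).

Lemma arc_height_continuous : continuous arc_height.
Proof.
move=> x; apply: cvgM.
  by apply: cvgM; [exact: cvg_cst|apply: cvgM; exact: cvg_id].
apply: cvgV; first by rewrite lt0r_neq0 // ltr_wpDr ?sqrtr_ge0.
apply: cvgD; first exact: cvg_cst.
apply: continuous_cvg; first exact: sqrt_continuous.
apply: cvgB; first exact: cvg_cst.
by apply: cvgM; [exact: cvg_cst|apply: cvgM; exact: cvg_id].
Qed.

Lemma arc_heightE x : `|x| <= rho -> exists2 w : R, 0 <= w & w ^+ 2 = 1 - k ^+ 2 * x ^+ 2 /\
  arc_height x * (1 + w) = k * x ^+ 2.
Proof.
move=> hx; exists (Num.sqrt (1 - k ^+ 2 * x ^+ 2)); first exact: sqrtr_ge0.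
rewrite sqr_sqrtr; last first.
  have : `|k| * `|x| <= 1 / 8 by apply: le_trans krho; rewrite ler_wpM2l.
  by rewrite -normrM -exprMn ler_norml => /andP[]; move: (k * x) => t; nra.
split=> //; rewrite /arc_height divfK // lt0r_neq0 // ltr_wpDr ?sqrtr_ge0 //.
Qed.

Lemma arc_height_small x : `|x| <= rho -> `|arc_height x| <= rho / 2.
Proof.
move=> hx; have [w w0 [_ hE]] := arc_heightE hx.
have : `|arc_height x| * (1 + w) = `|k| * `|x| * `|x|.
  by rewrite -{1}(ger0_norm (addr_ge0 ler01 w0)) -normrM hE normrM normrX expr2 mulrA.
have : `|k| * `|x| <= 1 / 8 by apply: le_trans krho; rewrite ler_wpM2l.
move: (`|k| * _) (normr_ge0 x) (normr_ge0 (arc_height x)) => t h1 h2 h3; nra.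
Qed.

(** With [g] the height of the arc, the equation of the circle factors as
    [(y - g) * (1 - (k * y + k * g) / 2)], and the second factor is positive on the box. *)
Lemma side_height x y : `|x| <= rho -> `|y| <= 2 * rho ->
  (0 < y - k / 2 * (x ^+ 2 + y ^+ 2)) = (arc_height x < y) /\
  (y - k / 2 * (x ^+ 2 + y ^+ 2) < 0) = (y < arc_height x).
Proof.
move=> hx hy; have [w w0 [wE hE]] := arc_heightE hx.
set g := arc_height x in hE *.
have gE : k * g = 1 - w.
  have : (1 + w) * (k * g - (1 - w)) = 0.
    have -> : (1 + w) * (k * g - (1 - w)) = k * (g * (1 + w)) - 1 + w ^+ 2 by ring.
    by rewrite hE wE; ring.
  by move/eqP; rewrite mulf_eq0 => /orP[] /eqP; lra.
have ky : `|k * y| <= 1 / 4.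
  rewrite normrM; apply: (@le_trans _ _ (`|k| * (2 * rho))); first by rewrite ler_wpM2l.
  by move: krho; lra.
have [ky1 ky2] : k * y <= 1 / 4 /\ - (1 / 4) <= k * y by move: ky; rewrite ler_norml => /andP[].
have fac : y - k / 2 * (x ^+ 2 + y ^+ 2) = (y - g) * (1 - (k * y + k * g) / 2).
  have -> : k / 2 * (x ^+ 2 + y ^+ 2) = (k * x ^+ 2) / 2 + k / 2 * y ^+ 2 by ring.
  rewrite -hE.
  have -> : g * (1 + w) = g * (2 - k * g) by rewrite gE; ring.
  by field.
have f0 : 0 < 1 - (k * y + k * g) / 2 by rewrite gE; lra.
by rewrite fac (pmulr_lgt0 _ f0) (pmulr_llt0 _ f0) subr_gt0 subr_lt0.
Qed.

(** Equal to [rho ^+ 2 - q.1 ^+ 2] where [q.2] is at most [rho] in absolute value, so displaced arcs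
    and swept areas are given by polynomials in the abscissa; beyond that it is cut down in a
    Lipschitz way to 0 at height [2 * rho]. *)
Definition profile q : R :=
  Num.max 0 (Num.min (rho ^+ 2 - Num.min `|q.1| rho ^+ 2) (rho * (2 * rho - `|q.2|))).

Lemma profile_lip p q : `|profile p - profile q| <= 3 * rho * edist p q.
Proof.
have r0 := rho0.
have mn (a b c : R) : `|Num.min a b - Num.min c b| <= `|a - c|.
  have := ler_norm (a - c); have := ler_norm (c - a); rewrite distrC.
  move: `|a - c| (normr_ge0 (a - c)) => z z0 h1 h2.
  by case: (leP a b); case: (leP c b) => *; rewrite ler_norml; apply/andP; split; lra.
have mx (a b c : R) : `|Num.max 0 (Num.min a b) - Num.max 0 (Num.min c b)| <= `|a - c|.
  apply: le_trans (mn a b c); move: (Num.min a b) (Num.min c b) => x y.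
  have := ler_norm (x - y); have := ler_norm (y - x); rewrite distrC.
  move: `|x - y| (normr_ge0 (x - y)) => z z0 h1 h2.
  by case: (leP 0 x); case: (leP 0 y) => *; rewrite ler_norml; apply/andP; split; lra.
have mx2 (a b c : R) : `|Num.max 0 (Num.min a b) - Num.max 0 (Num.min a c)| <= `|b - c|.
  by rewrite ![Num.min a _]minC; exact: mx.
have e1 : `|p.1 - q.1| <= edist p q := norm1_le_enorm (p - q).
have e2 : `|p.2 - q.2| <= edist p q := norm2_le_enorm (p - q).
have z0 : 0 <= edist p q := enorm_ge0 _.
have [h1 h2] : `|Num.min `|p.1| rho - Num.min `|q.1| rho| <= `|p.1 - q.1| /\
               `| `|p.2| - `|q.2| | <= `|p.2 - q.2|.
  split; last exact: ler_dist_dist.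
  exact: le_trans (mn _ _ _) (ler_dist_dist p.1 q.1).
have bm (t : R) : 0 <= Num.min `|t| rho <= rho by rewrite le_min normr_ge0 ltW //= ge_min lexx orbT.
pose m := Num.max 0 (Num.min (rho ^+ 2 - Num.min `|q.1| rho ^+ 2) (rho * (2 * rho - `|p.2|))).
have a1 : `|profile p - m| <= (Num.min `|p.1| rho + Num.min `|q.1| rho) * `|p.1 - q.1|.
  apply: le_trans (mx _ _ _) _.
  have -> : rho ^+ 2 - Num.min `|p.1| rho ^+ 2 - (rho ^+ 2 - Num.min `|q.1| rho ^+ 2) =
    (Num.min `|p.1| rho + Num.min `|q.1| rho) * (Num.min `|q.1| rho - Num.min `|p.1| rho) by ring.
  rewrite normrM ger0_norm; last by have := bm p.1; have := bm q.1; lra.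
  by apply: ler_wpM2l; [have := bm p.1; have := bm q.1; lra|rewrite distrC].
have a2 : `|m - profile q| <= rho * `|p.2 - q.2|.
  apply: le_trans (mx2 _ _ _) _.
  have -> : rho * (2 * rho - `|p.2|) - rho * (2 * rho - `|q.2|) = rho * (`|q.2| - `|p.2|) by ring.
  by rewrite normrM gtr0_norm //; apply: ler_wpM2l; [exact: ltW|rewrite distrC].
have : `|profile p - profile q| <= `|profile p - m| + `|m - profile q|.
  by apply: le_trans (ler_normD _ _); rewrite addrA subrK.
have := bm p.1; have := bm q.1.
move: a1 a2 e1 e2 z0.
move: (Num.min _ _) (Num.min _ _) (`|p.1 - q.1|) (`|p.2 - q.2|) (normr_ge0 (p.1 - q.1)) (edist p q).
move=> u v a b a0 z *; nra.
Qed.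

Lemma profile_core q : `|q.1| <= rho -> `|q.2| <= rho -> profile q = rho ^+ 2 - q.1 ^+ 2.
Proof.
move=> h1 h2; rewrite /profile (min_l h1) real_normK ?num_real //.
have := sqr_ge0 q.1; have := h2; have : q.1 ^+ 2 <= rho ^+ 2 by move: h1; rewrite ler_norml => /andP[]; move: (q.1) => x *; nra.
move=> *; rewrite min_l; last by have := rho0; nra.
by rewrite max_r //; lra.
Qed.

Lemma profile_out q : rho <= `|q.1| \/ 2 * rho <= `|q.2| -> profile q = 0.
Proof.
have r0 := rho0; case=> h; rewrite /profile; apply: max_l.
  by rewrite (min_r h) subrr ge_min lexx.
by rewrite ge_min; apply/orP; right; nra.
Qed.

Definition shifted c q : plane R := (q.1, q.2 + c * profile q).

Section Shift.
Variable c : R.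
Hypothesis c_small : `|c| * (6 * rho) <= 1.

Lemma shifted_mono x y y' : y < y' -> (shifted c (x, y)).2 < (shifted c (x, y')).2.
Proof.
move=> yy; rewrite /shifted /=.
have := profile_lip (x, y) (x, y').
have -> : edist (x, y) (x, y') = y' - y.
  rewrite /edist /enorm /dot /= subrr mulr0 add0r -expr2 sqrtr_sqr distrC gtr0_norm //.
  by rewrite subr_gt0.
move=> h; have : `|c * profile (x, y) - c * profile (x, y')| <= (y' - y) / 2.
  rewrite -mulrBr normrM; apply: le_trans (ler_wpM2l (normr_ge0 _) h) _.
  have -> : `|c| * (3 * rho * (y' - y)) = `|c| * (6 * rho) * ((y' - y) / 2) by field.
  by rewrite ger_pMl ?divr_gt0 ?subr_gt0.
by rewrite ler_norml => /andP[]; lra.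
Qed.

Lemma shifted_lt x y y' : ((shifted c (x, y)).2 < (shifted c (x, y')).2) = (y < y').
Proof.
case: (ltgtP y y') => [h|h|->]; last exact: ltxx.
  exact: shifted_mono.
by apply/negbTE; rewrite -leNgt ltW //; exact: shifted_mono.
Qed.

Lemma shifted_onto q : `|q.2| <= 2 * rho -> exists2 y, `|y| <= 2 * rho & shifted c (q.1, y) = q.
Proof.
move=> hq; have r0 := rho0.
have cf : {within `[- (2 * rho), 2 * rho], continuous (fun y => (shifted c (q.1, y)).2)}.
  apply: within_of_continuous => y; rewrite /shifted /=; apply: cvgD; first exact: cvg_id.
  apply: cvgM; first exact: cvg_cst.
  apply/cvgrPdist_le => e e0; near=> t.
  apply: le_trans (profile_lip _ _) _.
  rewrite /edist /enorm /dot /= subrr mulr0 add0r -expr2 sqrtr_sqr.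
  rewrite mulrC -ler_pdivlMr; last by rewrite mulr_gt0.
  near: t; have : 0 < e / (3 * rho) by rewrite divr_gt0 // mulr_gt0.
  by move: (e / _); apply/cvgrPdist_le; exact: cvg_id.
have ends z : `|z| = 2 * rho -> (shifted c (q.1, z)).2 = z.
  by move=> hz; rewrite /shifted /= profile_out ?mulr0 ?addr0 //=; right; rewrite hz.
have [||y hy yE] := @IVT _ _ (- (2 * rho)) (2 * rho) q.2 _ cf.
- lra.
- rewrite ends ?normrN ?gtr0_norm ?mulr_gt0 // ends ?gtr0_norm ?mulr_gt0 //.
  by move: hq; rewrite ler_norml min_l ?max_r //; lra.
exists y; first by rewrite ler_norml; move: hy; rewrite in_itv.
by apply: plane_eq.
Unshelve. all: by end_near. Qed.

End Shift.

(** [4 * rho ^+ 3 / 3] is the integral of [rho ^+ 2 - x ^+ 2] from [- rho] to [rho]; [Z1] and [Z2]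
    are the areas above and below the undisplaced graph. *)
Lemma bump_area (h : R -> R) : continuous h -> (forall x, `|x| <= rho -> `|h x| <= rho / 2) ->
  exists Z1 Z2 : R, forall c, `|c| * (6 * rho) <= 1 ->
    plane_area (between (- rho) rho (fun x => h x + c * (rho ^+ 2 - x ^+ 2)) (fun=> 2 * rho)) =
      (Z1 - c * (4 * rho ^+ 3 / 3))%:E /\
    plane_area (between (- rho) rho (fun=> - (2 * rho)) (fun x => h x + c * (rho ^+ 2 - x ^+ 2))) =
      (Z2 + c * (4 * rho ^+ 3 / 3))%:E.
Proof.
move=> ch hs; have r0 := rho0.
have [F dF] := antiderivative (- rho) rho ch.
have cv c : continuous (fun x => h x + c * (rho ^+ 2 - x ^+ 2)).
  move=> x; apply: cvgD; first exact: ch.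
  by apply: cvgM; [exact: cvg_cst|apply: cvgB; [exact: cvg_cst|apply: cvgM; exact: cvg_id]].
have dG c x : - rho <= x <= rho -> is_derive x 1 (fun x => F x + c * (rho ^+ 2 * x - x ^+ 2 * x / 3)) (h x + c * (rho ^+ 2 - x ^+ 2)).
  move=> hx; apply: der_D; first exact: dF.
  apply: der_Z; apply: der_B.
    by apply: (der_eq (der_Z _ (der_id x))); rewrite mulr1.
  apply: (der_eq (der_M (der_M (der_sqr (der_id x)) (der_id x)) (der_cst 3^-1 x))).
  by rewrite mulr0 addr0; field.
have bnd c x : `|c| * (6 * rho) <= 1 -> - rho < x < rho -> - (2 * rho) <= h x + c * (rho ^+ 2 - x ^+ 2) <= 2 * rho.
  move=> hc hx; have hx' : `|x| <= rho by rewrite ler_norml; case/andP: hx => *; rewrite !ltW.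
  have := hs x hx'; rewrite ler_norml => /andP[h1 h2].
  have b0 : 0 <= rho ^+ 2 - x ^+ 2 <= rho ^+ 2 by case/andP: hx => *; apply/andP; split; nra.
  have : `|c * (rho ^+ 2 - x ^+ 2)| <= rho.
    rewrite normrM (ger0_norm (andP b0).1).
    apply: (@le_trans _ _ (`|c| * rho ^+ 2)); first by rewrite ler_wpM2l ?(andP b0).2.
    by move: hc; move: `|c| (normr_ge0 c) => z *; nra.
  by rewrite ler_norml => /andP[*]; apply/andP; split; lra.
have wc (f df : R -> R) : (forall x, - rho <= x <= rho -> is_derive x 1 f (df x)) ->
    {within `[- rho, rho], continuous f}.
  move=> df'; apply: continuous_in_subspaceT => x; rewrite inE /= in_itv /= => hx.
  exact: der_cont (df' x hx).
have rr : - rho < rho by lra.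
have cc (a : R) : continuous (fun _ : R => a) by move=> x; exact: cvg_cst.
have inner x : - rho < x < rho -> - rho <= x <= rho by case/andP => *; rewrite !ltW.
exists (4 * rho ^+ 2 - (F rho - F (- rho))), (4 * rho ^+ 2 + (F rho - F (- rho))) => c hc; split.
  have d1 x : - rho <= x <= rho -> is_derive x 1 (fun x => 2 * rho * x - (F x + c * (rho ^+ 2 * x - x ^+ 2 * x / 3)))
      (2 * rho - (h x + c * (rho ^+ 2 - x ^+ 2))).
    by move=> hx; apply: der_B (dG _ _ hx); apply: (der_eq (der_Z _ (der_id x))); rewrite mulr1.
  have le1 x : - rho < x < rho -> h x + c * (rho ^+ 2 - x ^+ 2) <= 2 * rho.
    by move=> hx; case/andP: (bnd c x hc hx).
  have d2 x : - rho < x < rho -> is_derive x 1 _ _ := fun hx => d1 x (inner x hx).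
  by rewrite (area_between rr (cv c) (cc _) le1 (wc _ _ d1) d2); congr EFin; field.
have d1 x : - rho <= x <= rho -> is_derive x 1 (fun x => (F x + c * (rho ^+ 2 * x - x ^+ 2 * x / 3)) - - (2 * rho) * x)
    ((h x + c * (rho ^+ 2 - x ^+ 2)) - - (2 * rho)).
  by move=> hx; apply: (der_B (dG _ _ hx)); apply: (der_eq (der_Z _ (der_id x))); rewrite mulr1.
have le1 x : - rho < x < rho -> - (2 * rho) <= h x + c * (rho ^+ 2 - x ^+ 2).
  by move=> hx; case/andP: (bnd c x hc hx).
have d2 x : - rho < x < rho -> is_derive x 1 _ _ := fun hx => d1 x (inner x hx).
by rewrite (area_between rr (cc _) (cv c) le1 (wc _ _ d1) d2); congr EFin; field.
Qed.

End Profile.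

(** Both sides are the equation of the same circle or line, written from different base points. *)
Lemma arc_side_move (R : realType) (z : plane R) psi k s p :
  arc_side z psi k p = arc_side (arc_pt z psi k s) (psi + k * s) k p.
Proof.
have := arc_side_arc z psi k s; rewrite /arc_side.
have : k *: (arc_pt z psi k s - z) = rot (ez psi) - rot (ez (psi + k * s)).
  rewrite /arc_pt; case: eqVneq => [->|k0]; first by rewrite mul0r addr0 scale0r subrr.
  by rewrite addrC addKr scalerA divff // scale1r.
move: (arc_pt z psi k s) (rot (ez psi)) (rot (ez (psi + k * s))) => a n m.
case: a z n m p => [a1 a2] [z1 z2] [n1 n2] [m1 m2] [p1 p2] [].
rewrite /dot /= /GRing.scale /= => h1 h2 h3.
have -> : m1 = n1 - k * (a1 - z1) by rewrite h1; ring.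
have -> : m2 = n2 - k * (a2 - z2) by rewrite h2; ring.
by apply/eqP; rewrite -subr_eq0; apply/eqP; rewrite -[RHS]h3; field.
Qed.

Lemma arc_side_frame (R : realType) (z : plane R) psi k q :
  arc_side z psi k (frame z psi q) = q.2 - k / 2 * (q.1 ^+ 2 + q.2 ^+ 2).
Proof.
have e1 : dot (frame z psi q - z) (ez psi) = q.1 := congr1 fst (frameK z psi q).
have e2 : dot (frame z psi q - z) (rot (ez psi)) = q.2 := congr1 snd (frameK z psi q).
rewrite /arc_side e2.
have := pythagoras (frame z psi q - z) (ez_norm psi); rewrite enorm_sqr => ->.
by rewrite e1 e2.
Qed.

Lemma glue_pieces (R : realType) (P : R -> R -> Prop) (x0 x1 x2 x3 : R) : x1 <= x2 ->
  (forall x y z, P x y -> P y z -> P x z) ->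
  (forall x y, x0 <= x -> x <= y -> y <= x1 -> P x y) ->
  (forall x y, x1 <= x -> x <= y -> y <= x2 -> P x y) ->
  (forall x y, x2 <= x -> x <= y -> y <= x3 -> P x y) ->
  forall x y, x0 <= x -> x <= y -> y <= x3 -> P x y.
Proof.
move=> x12 tr p1 p2 p3.
have p12 x y : x0 <= x -> x <= y -> y <= x2 -> P x y.
  move=> h1 h2 h3; have [?|/ltW ?] := lerP y x1; first exact: p1.
  have [?|/ltW ?] := lerP x1 x; first exact: p2.
  by apply: (tr _ x1); [exact: p1|exact: p2].
move=> x y h1 h2 h3; have [?|/ltW ?] := lerP y x2; first exact: p12.
have [?|/ltW ?] := lerP x2 x; first exact: p3.
by apply: (tr _ x2); [exact: p12|exact: p3].
Qed.

(** * Length of a displaced arc *)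

Section CentralArc.
Variables (R : realType) (k s1 : R).
Hypothesis s10 : 0 < s1.
Hypothesis ks1 : `|k| * s1 <= 1 / 8.
Implicit Types (s t c : R).

Let X s := (arc_pt 0 0 k s).1.
Let Y s := (arc_pt 0 0 k s).2.
Let rho := X s1.

Lemma frame_arc (z : plane R) a s : frame z a (arc_pt 0 0 k s) = arc_pt z a k s.
Proof.
rewrite /arc_pt; case: eqVneq => [_|k0]; rewrite /frame; apply: plane_eq;
  rewrite /= /GRing.scale /= /GRing.scale /= ?cos0 ?sin0 ?cosD ?sinD ?add0r ?cos0 ?sin0; ring.
Qed.

Lemma arc_even s : X (- s) = - X s /\ Y (- s) = Y s.
Proof.
rewrite /X /Y /arc_pt; case: eqVneq => [_|k0] /=; rewrite /GRing.scale /= /GRing.scale /= !cos0 !sin0 ?add0r.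
  by split; ring.
by rewrite mulrN cosN sinN; split; ring.
Qed.

Lemma derX s : is_derive s 1 X (cos (k * s)).
Proof. by have := der_arc1 0 0 k s; rewrite add0r. Qed.

Lemma derY s : is_derive s 1 Y (sin (k * s)).
Proof. by have := der_arc2 0 0 k s; rewrite add0r. Qed.

Lemma arcX_incr s t : 0 <= s -> s <= t -> `|k| * t <= pi / 2 -> X s <= X t.
Proof.
move=> s0 st kt; apply: (der_le st (fun x _ => derX x)) => x /andP[sx xt].
apply: cos_ge0_pihalf; rewrite -ler_norml normrM; apply: le_trans kt.
by rewrite ler_wpM2l // ger0_norm //; lra.
Qed.

Lemma arcX_ge s : 0 <= s <= s1 -> s / 2 <= X s.
Proof.
move=> /andP[s0 ss].
have d (x : R) : is_derive x 1 (fun x : R => X x - 2^-1 * x) (cos (k * x) - 2^-1).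
  by apply: der_B (derX x) _; apply: (der_eq (der_Z _ (der_id x))); rewrite mulr1.
have := der_le s0 (fun x _ => d x).
have -> : X 0 - 2^-1 * 0 = 0 by rewrite /X arc_pt0 mulr0 subrr.
rewrite subr_ge0 mulrC; apply=> x /andP[x0 xs].
have := cos_ge_quad (k * x).
have : `|k * x| <= 1 / 8.
  by rewrite normrM; apply: le_trans ks1; rewrite ler_wpM2l // ger0_norm //; lra.
by rewrite ler_norml => /andP[]; move: (k * x) => y *; nra.
Qed.

Lemma rho_ge : s1 / 2 <= rho.
Proof. by apply: arcX_ge; rewrite lexx ltW. Qed.

Lemma rho_gt0 : 0 < rho.
Proof. by have := rho_ge; have := s10; lra. Qed.

Lemma rho_le : rho <= s1.
Proof.
have := arc_lip 0 0 k s1 0; rewrite subr0 gtr0_norm // arc_pt0 /edist subr0.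
by apply: le_trans; apply: le_trans (norm1_le_enorm _); exact: ler_norm.
Qed.

Lemma krho_small : `|k| * rho <= 1 / 8.
Proof. by apply: le_trans ks1; rewrite ler_wpM2l // rho_le. Qed.

Lemma arcY_small s : `|s| <= s1 -> `|Y s| <= rho.
Proof.
wlog s0 : s / 0 <= s.
  move=> h; case: (lerP 0 s) => [/h//|sn] hs; rewrite -[s]opprK (arc_even (- s)).2.
  by apply: h; rewrite ?normrN //; lra.
rewrite ger0_norm // => ss.
have := arc_direction 0 0 k s0; rewrite add0r => h.
have : `|Y s| <= `|k| * s ^+ 2.
  apply: le_trans h; rewrite /edist; apply: le_trans (norm2_le_enorm _).
  by rewrite /= /GRing.scale /= sin0 mulr0 subr0.
move/le_trans; apply.
have := rho_ge.
have : `|k| * s <= 1 / 8 by apply: le_trans ks1; rewrite ler_wpM2l.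
by rewrite expr2 mulrA; move: (`|k| * s) rho => a b *; nra.
Qed.

Lemma arcX_small s : `|s| <= s1 -> `|X s| <= rho.
Proof.
wlog s0 : s / 0 <= s.
  move=> h; case: (lerP 0 s) => [/h//|sn] hs; rewrite -[s]opprK (arc_even (- s)).1 normrN.
  by apply: h; rewrite ?normrN //; lra.
rewrite ger0_norm // => ss; rewrite ger0_norm; last by apply: le_trans (arcX_ge (s := s) _); rewrite ?s0 //; lra.
apply: arcX_incr => //; apply: le_trans ks1 _; have := pi_gt305 R; lra.
Qed.

(** The rest of the arc does not return to the box: up to a quarter turn its abscissa grows, and
    from there to a half turn its height is at least the radius, which is at least [8 * rho]. *)
Lemma arc_outside s : s1 <= `|s| -> `|k| * `|s| <= pi -> rho <= `|X s| \/ 2 * rho <= `|Y s|.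
Proof.
wlog s0 : s / 0 <= s.
  move=> h; case: (lerP 0 s) => [/h//|sn] hs; rewrite -[s]opprK (arc_even (- s)).1 (arc_even (- s)).2 !normrN.
  by rewrite -(normrN s) in hs *; apply: h => //; lra.
rewrite ger0_norm // => ss ks.
have [h|h] := lerP (`|k| * s) (pi / 2).
  by left; apply: le_trans (ler_norm _); apply: arcX_incr => //; exact: ltW.
right; have k0 : k != 0 by apply: contraTneq h => ->; rewrite normr0 mul0r -leNgt divr_ge0 // pi_ge0.
have nk : 0 < `|k| by rewrite normr_gt0.
have YE : `|k| * `|Y s| = 1 - cos (k * s).
  rewrite -normrM /Y /arc_pt (negbTE k0) /= /GRing.scale /= /GRing.scale /= cos0 !add0r mulVKf //.
  by rewrite ger0_norm // subr_ge0 cos_le1.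
have : cos (k * s) <= 0.
  have -> : cos (k * s) = cos (`|k| * s).
    by case: (ger0P k) => // _; rewrite mulNr cosN.
  rewrite -[`|k| * s](subrK pi) cosDpi oppr_le0.
  apply: cos_ge0_pihalf; apply/andP; split; lra.
move=> cs0; rewrite -(ler_pM2l nk); apply: (@le_trans _ _ (1 - cos (k * s))); last by rewrite -YE.
have := krho_small; have := rho_gt0; move: cs0.
by move: rho `|k| nk (cos _) => *; nra.
Qed.

(** An estimate to second order in [c]: the linear term is the curvature times the swept area, and
    the rest is at most [a = 2 * rho ^+ 2 * c ^+ 2] per unit length. *)
Lemma shifted_arc_length c h : `|c| * (6 * rho) <= 1 -> s1 <= h -> `|k| * h <= pi ->
  exists2 L : R -> R, L h - L (- h) = 2 * h - c * k * (4 * rho ^+ 3 / 3) + 2 * rho ^+ 2 * c ^+ 2 * (2 * h) &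
  forall s t, - h <= s -> s <= t -> t <= h ->
    edist (shifted rho c (arc_pt 0 0 k t)) (shifted rho c (arc_pt 0 0 k s)) <= L t - L s.
Proof.
move=> hc sh kh; have r0 := rho_gt0; have s1_gt0 := s10.
pose W s := shifted rho c (arc_pt 0 0 k s).
(* Its derivative is [- 2 * X s * cos (k * s) * sin (k * s)], the linear change of speed. As [X] is
   [rho] and [- rho] at the ends, the first summand vanishes there and [G] increases in total by
   [- k * (4 * rho ^+ 3 / 3)]. *)
pose G s := (rho ^+ 2 - X s ^+ 2) * sin (k * s) - k * (rho ^+ 2 * X s - X s ^+ 2 * X s / 3).
(* Clamping makes the term with [G] constant outside the box, where the arc is not displaced. *)
pose cl s := Num.max (- s1) (Num.min s s1).
pose a := 2 * rho ^+ 2 * c ^+ 2.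
have a0 : 0 <= a by apply: mulr_ge0; [apply: mulr_ge0 => //|]; exact: sqr_ge0.
have hXs1 : X s1 = rho by [].
have hXs1' : X (- s1) = - rho by rewrite (arc_even s1).1.
have inside s t : - s1 <= s -> s <= t -> t <= s1 -> edist (W t) (W s) <= (1 + a) * (t - s) + c * (G t - G s).
  move=> h1 st h2.
  have WE x : - s1 <= x <= s1 -> W x = (X x, Y x + c * (rho ^+ 2 - X x ^+ 2)).
    move=> /andP[*]; have xs : `|x| <= s1 by rewrite ler_norml; apply/andP.
    by rewrite /W /shifted (profile_core r0 (arcX_small xs) (arcY_small xs)).
  rewrite !WE; try (apply/andP; split; lra).
  have -> : (1 + a) * (t - s) + c * (G t - G s) = ((1 + a) * t + c * G t) - ((1 + a) * s + c * G s) by ring.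
  pose dL x := 1 + a - c * (2 * X x * cos (k * x)) * sin (k * x).
  apply: (plane_mvt (x := X) (y := fun x => Y x + c * (rho ^+ 2 - X x ^+ 2)) (dx := fun x => cos (k * x)) (dy := fun x => sin (k * x) - c * (2 * X x * cos (k * x)))
    (l := fun x => (1 + a) * x + c * G x) (dl := dL) st) => r hr.
  - exact: derX.
  - apply: (der_eq (der_D (derY r) (der_Z c (der_B (der_cst (rho ^+ 2) r) (der_sqr (derX r)))))).
    by rewrite sub0r mulrN.
  - have dk : is_derive r 1 (fun x => k * x) k by apply: (der_eq (der_Z k (der_id r))); rewrite mulr1.
    have dX3 := der_M (der_M (der_sqr (derX r)) (derX r)) (der_cst 3^-1 r).
    apply: (der_eq (der_D (der_Z (1 + a) (der_id r)) (der_Z c (der_B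
      (der_M (der_B (der_cst (rho ^+ 2) r) (der_sqr (derX r))) (der_sin dk))
      (der_Z k (der_B (der_Z (rho ^+ 2) (derX r)) dX3)))))).
    by rewrite /dL; field.
  - have xs : `|r| <= s1 by rewrite ler_norml; case/andP: hr => *; apply/andP; split; lra.
    have := arcX_small xs; rewrite ler_norml => /andP[b1 b2].
    have hcs : cos (k * r) ^+ 2 + sin (k * r) ^+ 2 = 1 := cos2Dsin2 _.
    have cb : `|c * X r| <= 1 / 6.
      rewrite normrM; apply: (@le_trans _ _ (`|c| * rho)); first by rewrite ler_wpM2l // ler_norml b1 b2.
      by move: hc; lra.
    have csb : `|cos (k * r) * sin (k * r)| <= 1.
      by rewrite ler_norml; apply/andP; split; nra.
    have e0 : `|c * (2 * X r * cos (k * r)) * sin (k * r)| <= 1.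
      have -> : c * (2 * X r * cos (k * r)) * sin (k * r) = 2 * ((c * X r) * (cos (k * r) * sin (k * r))) by ring.
      rewrite normrM [`|2|]gtr0_norm // normrM.
      by move: (`|c * X r|) (`|cos _ * _|) (normr_ge0 (c * X r)) (normr_ge0 (cos (k * r) * sin (k * r))) cb csb => u v *; nra.
    have aE : 4 * (c * X r) ^+ 2 * cos (k * r) ^+ 2 <= 2 * a.
      have : X r ^+ 2 <= rho ^+ 2 by nra.
      have : 0 <= c ^+ 2 by exact: sqr_ge0.
      have : cos (k * r) ^+ 2 <= 1 by rewrite -hcs lerDl sqr_ge0.
      have := sqr_ge0 (X r); rewrite exprMn /a.
      move: (c ^+ 2) (X r ^+ 2) (cos (k * r) ^+ 2) (sqr_ge0 (cos (k * r))) (rho ^+ 2) => u v w w0 z v0 w1 u0 vz.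
      have : u * v * w <= u * z * 1 by rewrite ler_pM // ?mulr_ge0 // ler_wpM2l.
      lra.
    move: e0; rewrite /dL; set e := c * _ * _ => /ler_normlP[e1 e2].
    split; first by lra.
    have -> : cos (k * r) ^+ 2 + (sin (k * r) - c * (2 * X r * cos (k * r))) ^+ 2 =
      (cos (k * r) ^+ 2 + sin (k * r) ^+ 2) - 2 * e + 4 * (c * X r) ^+ 2 * cos (k * r) ^+ 2 by rewrite /e; ring.
    have := sqr_ge0 (a - e); rewrite hcs; nra.
have outside s : s1 <= `|s| -> `|s| <= h -> W s = arc_pt 0 0 k s.
  move=> ss s_h; rewrite /W /shifted (profile_out r0) ?mulr0 ?addr0; first by apply: plane_eq.
  by apply: arc_outside => //; apply: le_trans kh; rewrite ler_wpM2l.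
have outer s t : s1 <= `|s| -> `|s| <= h -> s1 <= `|t| -> `|t| <= h -> s <= t -> edist (W t) (W s) <= (1 + a) * (t - s).
  move=> h1 h2 h3 h4 st; rewrite !outside //; apply: le_trans (arc_lip _ _ _ _ _) _.
  rewrite ger0_norm ?subr_ge0 // -[X in X <= _]mul1r ler_wpM2r ?subr_ge0 //; lra.
exists (fun s => (1 + a) * s + c * G (cl s)).
  have -> : cl h = s1 by rewrite /cl min_r // max_r //; lra.
  have -> : cl (- h) = - s1 by rewrite /cl min_l ?max_l //; lra.
  by rewrite /G hXs1 hXs1' /a (mulrN k s1) sinN; field.
move=> s t hs st th; rewrite -/(W t) -/(W s).
have low x : x <= - s1 -> cl x = - s1 by move=> *; rewrite /cl min_l ?max_l //; lra.
have mid x : - s1 <= x -> x <= s1 -> cl x = x by move=> *; rewrite /cl min_l ?max_r //; lra.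
have high x : s1 <= x -> cl x = s1 by move=> *; rewrite /cl min_r ?max_r //; lra.
clearbody W G cl a; clear -outer inside low mid high sh s1_gt0 hs st th.
pose P x y := edist (W y) (W x) <= (1 + a) * y + c * G (cl y) - ((1 + a) * x + c * G (cl x)).
have tr x y z : P x y -> P y z -> P x z.
  by rewrite /P => h1 h2; have := edist_triangle (W y) (W z) (W x); lra.
have p1 x y : - h <= x -> x <= y -> y <= - s1 -> P x y.
  move=> *; rewrite /P !low //; try lra.
  have [nx ny] : `|x| = - x /\ `|y| = - y by rewrite !ler0_norm; lra.
  have := @outer x y; rewrite nx ny => o.
  have : edist (W y) (W x) <= (1 + a) * (y - x) by apply: o; lra.
  lra.
have p2 x y : - s1 <= x -> x <= y -> y <= s1 -> P x y.
  move=> *; rewrite /P !mid //; try lra.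
  have : edist (W y) (W x) <= (1 + a) * (y - x) + c * (G y - G x) by apply: inside; lra.
  lra.
have p3 x y : s1 <= x -> x <= y -> y <= h -> P x y.
  move=> *; rewrite /P !high //; try lra.
  have [nx ny] : `|x| = x /\ `|y| = y by rewrite !ger0_norm; lra.
  have := @outer x y; rewrite nx ny => o.
  have : edist (W y) (W x) <= (1 + a) * (y - x) by apply: o; lra.
  lra.
change (P s t).
by apply: (glue_pieces _ tr p1 p2 p3); lra.
Qed.

End CentralArc.

(** * Simultaneous bumps on all edges *)

Section Bumps.
Variables (R : realType) (n : nat) (B : complex R n) (S : arcs B).
Hypothesis rB : regular B.
Hypothesis sides : forall e : edge B, lab S (e, false) != lab S (e, true).
Implicit Types (e : edge B) (p q : plane R) (s t : R) (x : edge B -> R) (i : option 'I_n).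

Definition mid e := dpt S (e, false) (arc_l S e / 2).
Definition ang e := dang S (e, false) (arc_l S e / 2).

Lemma half_len e : 0 < arc_l S e / 2 < dlen S (e, false).
Proof. by have := dlen_gt0 S (e, false); rewrite /dlen /= => h; apply/andP; split; lra. Qed.

Definition clear_at e (z : plane R) (r : R) := forall p, edist p z < r ->
  (support B p -> exists2 s, 0 < s < arc_l S e & p = dpt S (e, false) s) /\
  forall i, region B i p <-> (0 < dside S (e, false) p /\ i = lab S (e, false)) \/
                             (dside S (e, false) p < 0 /\ i = lab S (e, true)).

Lemma edge_clear e s : 0 < s < arc_l S e ->
  exists2 r : R, 0 < r & clear_at e (dpt S (e, false) s) r.
Proof.
move=> hs; have [r1 r10 iso] := @edge_isolated R B S (e, false) s hs.
have [r2 r20 nb] := edge_nbhd (S := S) rB (d := (e, false)) hs.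
exists (Num.min r1 r2) => [|p]; first by rewrite lt_min r10.
rewrite lt_min => /andP[p1 p2]; split=> [sp|i]; first exact: iso.
have ne : region B i p -> ~ support B p by move=> h; exact: (region_compl h).
split=> [h|h].
  case: (nb p p2 (ne h)) => -[sgn fc]; [left|right]; split=> //; apply/esym.
    exact: lab_uniq ((fc _ (@region_face_closed R n B i)).2 h).
  exact: lab_uniq ((fc _ (@region_face_closed R n B i)).2 h).
have np : ~ support B p.
  move=> /(iso p p1)[s' _ pE].
  by case: h => -[]; rewrite pE dside_arc ltxx.
case: (nb p p2 np) => -[sgn fc].
  case: h => -[h ->]; last by have := lt_trans sgn h; rewrite ltxx.
  exact: (fc _ (@region_face_closed R n B _)).1 (@near_lab R n B S (e, false)).
case: h => -[h ->]; first by have := lt_trans sgn h; rewrite ltxx.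
exact: (fc _ (@region_face_closed R n B _)).1 (@near_lab R n B S (e, true)).
Qed.

(** The factor 8 keeps the bumps apart: a box lies within [3 * s1 e] of the midpoint of [e], while
    all other midpoints are at least [8 * s1 e] away. *)
Lemma bump_radii : exists s1 : edge B -> R, forall e,
  [/\ 0 < s1 e, `|arc_k S e| * s1 e <= 1 / 8, s1 e <= arc_l S e / 2 & clear_at e (mid e) (8 * s1 e)].
Proof.
suff h e : exists s1 : R,
    [/\ 0 < s1, `|arc_k S e| * s1 <= 1 / 8, s1 <= arc_l S e / 2 & clear_at e (mid e) (8 * s1)].
  by have [f hf] := choice h; exists f.
have [r r0 nb] := edge_clear (half_len e).
have k0 : 0 < 8 * (`|arc_k S e| + 1) by rewrite mulr_gt0 // ltr_wpDl.
have l0 := dlen_gt0 S (e, false); rewrite /dlen /= in l0.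
pose m := Num.min (r / 8) (Num.min ((8 * (`|arc_k S e| + 1))^-1) (arc_l S e / 2)).
have m0 : 0 < m by rewrite !lt_min !divr_gt0 // invr_gt0 k0.
have [m1 m2 m3] : [/\ m <= r / 8, m <= (8 * (`|arc_k S e| + 1))^-1 & m <= arc_l S e / 2].
  by split; rewrite /m !ge_min !lexx ?orbT.
exists m; split=> //; last by move=> p hp; apply: nb; lra.
have : 8 * (`|arc_k S e| + 1) * m <= 1 by rewrite mulrC -ler_pdivlMr // div1r.
have := normr_ge0 (arc_k S e); move: `|arc_k S e| => z; nra.
Qed.

Variable s1 : edge B -> R.
Hypothesis s1P : forall e,
  [/\ 0 < s1 e, `|arc_k S e| * s1 e <= 1 / 8, s1 e <= arc_l S e / 2 & clear_at e (mid e) (8 * s1 e)].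

Definition rho e : R := (arc_pt 0 0 (arc_k S e) (s1 e)).1.
Definition lcoord e p := coord (mid e) (ang e) p.
Definition lframe e q := frame (mid e) (ang e) q.
Definition inbox e q := `|q.1| < rho e /\ `|q.2| < 2 * rho e.
Definition box e := [set p | inbox e (lcoord e p)].

Lemma rho0 e : 0 < rho e.
Proof. by have [h1 h2 _ _] := s1P e; exact: rho_gt0. Qed.

Lemma krho e : `|arc_k S e| * rho e <= 1 / 8.
Proof. by have [h1 h2 _ _] := s1P e; exact: krho_small. Qed.

Lemma rho_s1 e : rho e <= s1 e.
Proof. by have [h1 h2 _ _] := s1P e; exact: rho_le. Qed.

Lemma inbox_near e q : inbox e q -> edist (lframe e q) (mid e) < 3 * s1 e.
Proof.
move=> [h1 h2].
have {1}-> : mid e = lframe e 0 by rewrite /lframe /frame /= !scale0r !addr0.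
rewrite edist_frame /edist subr0; apply: le_lt_trans (enorm_le_sum _) _.
by have := rho_s1 e; lra.
Qed.

Lemma box_near e p : box e p -> edist p (mid e) < 3 * s1 e.
Proof. by move/inbox_near; rewrite /lframe coordK. Qed.

Lemma box_support e p : box e p -> support B p -> exists2 s, 0 < s < arc_l S e & p = dpt S (e, false) s.
Proof.
move=> hp sp; have [h1 _ _ c] := s1P e.
by apply: (c p _).1 => //; have := box_near hp; lra.
Qed.

Lemma mid_apart e e' : e != e' -> 8 * s1 e <= edist (mid e) (mid e').
Proof.
move=> ee; rewrite leNgt; apply/negP => h; have [_ _ _ c] := s1P e.
have [s hs hm] : exists2 s, 0 < s < arc_l S e & mid e' = dpt S (e, false) s.
  apply: (c (mid e') _).1; first by rewrite edistC.
  by apply: dpt_support; case/andP: (half_len e') => *; rewrite !ltW.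
have : e' = e by case: (@dpt_inj R B S (e, false) (e', false) _ _ hs (half_len e') (esym hm)) => -[/(congr1 fst)].
by move/eqP; rewrite eq_sym (negbTE ee).
Qed.

Lemma box_disj e e' p : box e p -> box e' p -> e = e'.
Proof.
move=> h h'; apply/eqP; apply: contraT => ee.
have := mid_apart ee; have ee' : e' != e by rewrite eq_sym.
have := mid_apart ee'; rewrite (edistC (mid e')).
have := box_near h; have := box_near h'.
have [] := s1P e; have [] := s1P e'; move=> + _ _ _ + _ _ _.
by have := edist_triangle p (mid e) (mid e'); rewrite (edistC (mid e) p); lra.
Qed.

Definition push x p : plane R := \sum_e (x e * profile (rho e) (lcoord e p)) *: rot (ez (ang e)).

Lemma profile_nobox e p : ~ box e p -> profile (rho e) (lcoord e p) = 0.
Proof.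
move=> h; apply: (profile_out (rho0 e)).
have [h1|h1] := lerP (rho e) `|(lcoord e p).1|; first by left.
by right; rewrite leNgt; apply/negP => h2; apply: h.
Qed.

Lemma push_only x e p : (forall e', e' != e -> ~ box e' p) ->
  perturb (push x) p = lframe e (shifted (rho e) (x e) (lcoord e p)).
Proof.
move=> h; rewrite /perturb /push (bigD1 e) //= big1 ?addr0; last first.
  by move=> e' ee; rewrite profile_nobox ?mulr0 ?scale0r //; exact: h.
rewrite -{1}(coordK (mid e) (ang e) p) -/(lcoord e p) /lframe /frame /shifted /=.
by rewrite [(_ + x e * _) *: _]scalerDl !addrA.
Qed.

Lemma push_box x e p : box e p -> perturb (push x) p = lframe e (shifted (rho e) (x e) (lcoord e p)).
Proof.
by move=> h; apply: push_only => e' ee h'; have := box_disj h h'; move/eqP; rewrite eq_sym (negbTE ee).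
Qed.

Lemma push_nobox x p : (forall e, ~ box e p) -> perturb (push x) p = p.
Proof.
move=> h; rewrite /perturb /push big1 ?addr0 // => e _.
by rewrite profile_nobox ?mulr0 ?scale0r.
Qed.

Section Amplitude.
Variable x : edge B -> R.
Hypothesis xs : \sum_e `|x e| * (6 * rho e) <= 1.

Lemma x_small e : `|x e| * (6 * rho e) <= 1.
Proof.
apply: le_trans xs; rewrite (bigD1 e) //= lerDl sumr_ge0 // => e' _.
by rewrite mulr_ge0 // mulr_ge0 // ltW // rho0.
Qed.

Lemma enorm_sum (I : finType) (F : I -> plane R) : enorm (\sum_i F i) <= \sum_i enorm (F i).
Proof.
elim/big_ind2 : _ => // [|u a v b h1 h2]; first by rewrite enorm0.
by apply: le_trans (ler_enormD _ _) _; exact: lerD.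
Qed.

Lemma push_lip p q : enorm (push x p - push x q) <= edist p q / 2.
Proof.
rewrite /push -sumrB; apply: le_trans (enorm_sum _) _.
apply: (@le_trans _ _ (\sum_e (`|x e| * (6 * rho e)) * (edist p q / 2))); last first.
  by rewrite -mulr_suml ler_piMl // divr_ge0 // enorm_ge0.
apply: ler_sum => e _; rewrite -scalerBl enormZ rot_norm ez_norm mulr1 -mulrBr normrM.
have := profile_lip (rho0 e) (lcoord e p) (lcoord e q); rewrite edist_coord => h.
have -> : `|x e| * (6 * rho e) * (edist p q / 2) = `|x e| * (3 * rho e * edist p q) by field.
by rewrite ler_wpM2l.
Qed.

Lemma shifted_inbox e q : inbox e q <-> inbox e (shifted (rho e) (x e) q).
Proof.
have r0 := rho0 e; have h := x_small e.
have end_ a : `|a| = 2 * rho e -> (shifted (rho e) (x e) (q.1, a)).2 = a.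
  by move=> ha; rewrite /shifted /= profile_out ?mulr0 ?addr0 //=; right; rewrite ha.
have e1 := end_ (2 * rho e); have e2 := end_ (- (2 * rho e)).
have a0 : `|2 * rho e| = 2 * rho e by rewrite gtr0_norm // mulr_gt0.
have {}e1 := e1 a0; have {}e2 := e2 (etrans (normrN _) a0).
have qE : q = (q.1, q.2) by case: q {end_ e1 e2}.
rewrite /inbox /= !ltr_norml.
have l1 := shifted_lt r0 h q.1 (- (2 * rho e)) q.2; have l2 := shifted_lt r0 h q.1 q.2 (2 * rho e).
rewrite e2 -qE in l1; rewrite e1 -qE in l2.
by rewrite -[q.2 + _]/((shifted (rho e) (x e) q).2) l1 l2.
Qed.

Lemma box_push e p : box e p <-> box e (perturb (push x) p).
Proof.
have fw e' : box e' p -> box e' (perturb (push x) p).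
  move=> h; rewrite (push_box x h) /box /= /lcoord /lframe frameK.
  exact: (shifted_inbox e' _).1.
split; first exact: fw.
move=> h; have [[e' h']|no] := pselect (exists e', box e' p).
  by rewrite (box_disj h (fw e' h')).
by rewrite push_nobox // in h => e' h'; apply: no; exists e'.
Qed.

Lemma push_onto q : exists p, perturb (push x) p = q.
Proof.
have [[e h]|no] := pselect (exists e, box e q); last first.
  by exists q; apply: push_nobox => e he; apply: no; exists e.
have [y hy yE] := shifted_onto (rho0 e) (x e) (ltW h.2).
have ib : inbox e ((lcoord e q).1, y) by apply/shifted_inbox; rewrite yE.
exists (lframe e ((lcoord e q).1, y)).
have bx : box e (lframe e ((lcoord e q).1, y)) by rewrite /box /= /lcoord /lframe frameK.
by rewrite (push_box x bx) /lcoord /lframe frameK -/(lcoord e q) yE coordK.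
Qed.

End Amplitude.

Lemma region_lframe e q i : inbox e q ->
  region B i (lframe e q) <-> (arc_height (arc_k S e) q.1 < q.2 /\ i = lab S (e, false)) \/
                              (q.2 < arc_height (arc_k S e) q.1 /\ i = lab S (e, true)).
Proof.
move=> hq; have [h1 _ _ c] := s1P e.
rewrite (c (lframe e q) _).2; last by have := inbox_near hq; lra.
have -> : dside S (e, false) (lframe e q) = q.2 - arc_k S e / 2 * (q.1 ^+ 2 + q.2 ^+ 2).
  by rewrite /dside (arc_side_move _ _ _ (arc_l S e / 2)) -(arc_side_frame (mid e) (ang e)).
by have [-> ->] := side_height (krho e) (ltW hq.1) (ltW hq.2).
Qed.

(** The rate at which region [i] gains area when [e] is pushed to its left: the right-hand region
    grows and the left-hand one shrinks. *)
Definition jump e i : R := (lab S (e, true) == i)%:R - (lab S (e, false) == i)%:R.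

Lemma inbox_between e q : inbox e q <-> between (- rho e) (rho e) (fun=> - (2 * rho e)) (fun=> 2 * rho e) q.
Proof. by rewrite /inbox /between /= !ltr_norml. Qed.

Lemma meas_box e : meas_plane (box e).
Proof.
have -> : box e = lcoord e @^-1` between (- rho e) (rho e) (fun=> - (2 * rho e)) (fun=> 2 * rho e).
  by apply/seteqP; split=> p /= /inbox_between.
apply: mset_preimage; first exact: coord_continuous.
by apply: open_mset; apply: open_between => y; exact: cvg_cst.
Qed.

(** [D] is known only through the shift, which is increasing on every vertical line of the local
    frame. Hence in the box [D] is again the part above or below a graph, namely that of [hc c], and
    [bump_area] applies. *)
Lemma box_area e i : exists Z : R, forall c D, `|c| * (6 * rho e) <= 1 -> meas_plane D ->
  (forall q, inbox e q -> D (lframe e (shifted (rho e) c q)) <-> region B i (lframe e q)) ->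
  plane_area (D `&` box e) = (Z + c * (4 * rho e ^+ 3 / 3) * jump e i)%:E.
Proof.
have r0 := rho0 e; pose k := arc_k S e.
have hh := @arc_height_small R k (rho e) (krho e).
have ends (c u y : R) : `|y| = 2 * rho e -> shifted (rho e) c (u, y) = (u, y).
  move=> hy; have out : rho e <= `|u| \/ 2 * rho e <= `|y| by right; rewrite hy.
  by rewrite /shifted (@profile_out R (rho e) r0 (u, y) out) mulr0 addr0.
have [Z1 [Z2 hZ]] := bump_area r0 (@arc_height_continuous R k) hh.
pose hc c (x : R) := arc_height k x + c * (rho e ^+ 2 - x ^+ 2).
pose Z := (if lab S (e, false) == i then Z1 else 0) + (if lab S (e, true) == i then Z2 else 0).
exists Z => c D cs mD hD.
have mDb : meas_plane (D `&` box e) by apply: measurableI => //; exact: meas_box.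
rewrite -(plane_area_frame (mid e) (ang e) mDb).
have key (q' : plane R) : (frame (mid e) (ang e) @^-1` (D `&` box e)) q' <->
    inbox e q' /\ ((hc c q'.1 < q'.2 /\ i = lab S (e, false)) \/ (q'.2 < hc c q'.1 /\ i = lab S (e, true))).
  split.
    move=> [h1]; rewrite /box /= /lcoord frameK => ib; split=> //.
    have [y hy yE] := shifted_onto r0 c (ltW ib.2).
    have ib2 : inbox e (q'.1, y).
      split; first exact: ib.1.
      by rewrite lt_neqAle hy andbT; apply/eqP => /= yy; move: ib.2; rewrite -yE (ends c q'.1 y yy) /= yy ltxx.
    move: h1; rewrite -{1}yE; move/(hD _ ib2)/(region_lframe _ ib2); rewrite /=.
    have := shifted_lt r0 cs q'.1 (arc_height k q'.1) y.
    have := shifted_lt r0 cs q'.1 y (arc_height k q'.1).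
    rewrite yE /shifted /= (profile_core r0) //=; last 2 first.
    - exact: ltW ib.1.
    - by apply: le_trans (hh _ (ltW ib.1)) _; lra.
    by rewrite -/(hc c q'.1) => -> ->.
  move=> [ib h].
  have [y hy yE] := shifted_onto r0 c (ltW ib.2).
  have ib2 : inbox e (q'.1, y).
    split; first exact: ib.1.
    by rewrite lt_neqAle hy andbT; apply/eqP => /= yy; move: ib.2; rewrite -yE (ends c q'.1 y yy) /= yy ltxx.
  split; last by rewrite /box /= /lcoord frameK.
  rewrite -yE; apply/(hD _ ib2)/(region_lframe _ ib2) => /=; move: h.
  have := shifted_lt r0 cs q'.1 (arc_height k q'.1) y.
  have := shifted_lt r0 cs q'.1 y (arc_height k q'.1).
  rewrite yE /shifted /= (profile_core r0) //=; last 2 first.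
  - exact: ltW ib.1.
  - by apply: le_trans (hh _ (ltW ib.1)) _; lra.
  by rewrite -/(hc c q'.1) => -> ->.
have [A1 A2] := hZ c cs.
have hb (x : R) : `|x| < rho e -> - (2 * rho e) < hc c x < 2 * rho e.
  move=> hx; have := hh x (ltW hx); have : `|c * (rho e ^+ 2 - x ^+ 2)| <= rho e.
    rewrite normrM; have := sqr_ge0 x; have : x ^+ 2 <= rho e ^+ 2.
      by move: hx; rewrite ltr_norml => /andP[*]; nra.
    move=> h1 h2; have nn : 0 <= rho e ^+ 2 - x ^+ 2 by lra.
    rewrite (ger0_norm nn).
    by move: cs; move: `|c| (normr_ge0 c) => z *; nra.
  by rewrite /hc !ler_norml => /andP[? ?] /andP[? ?]; apply/andP; split; lra.
have sd := sides e; rewrite /Z /jump.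
have [e1|e1] := eqVneq (lab S (e, false)) i; have [e2|e2] := eqVneq (lab S (e, true)) i.
- by move: sd; rewrite e1 e2 eqxx.
- have -> : frame (mid e) (ang e) @^-1` (D `&` box e) = between (- rho e) (rho e) (hc c) (fun=> 2 * rho e).
    apply/seteqP; split=> q /=; rewrite /between /=.
      move/key => [[h1 h2] [[h3 _]|[_ h3]]]; last by move: e2; rewrite h3 eqxx.
      by move: h1 h2; rewrite !ltr_norml => -> /andP[_ ->]; rewrite h3.
    move=> [h1 /andP[h2 h3]]; apply/key; rewrite /inbox !ltr_norml h1 h3 h2 e1.
    have h1' : `|q.1| < rho e by rewrite ltr_norml.
    case/andP: (hb _ h1') => h4 _; rewrite (lt_trans h4 h2).
    by split=> //; left.
  by rewrite A1 addr0 sub0r mulrN1.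
- have -> : frame (mid e) (ang e) @^-1` (D `&` box e) = between (- rho e) (rho e) (fun=> - (2 * rho e)) (hc c).
    apply/seteqP; split=> q /=; rewrite /between /=.
      move/key => [[h1 h2] [[_ h3]|[h3 _]]]; first by move: e1; rewrite h3 eqxx.
      by move: h1 h2; rewrite !ltr_norml => -> /andP[-> _]; rewrite h3.
    move=> [h1 /andP[h2 h3]]; apply/key; rewrite /inbox !ltr_norml h1 h3 h2 e2.
    have h1' : `|q.1| < rho e by rewrite ltr_norml.
    case/andP: (hb _ h1') => _ h4; rewrite (lt_trans h3 h4).
    by split=> //; right.
  by rewrite A2 add0r subr0 mulr1.
- have -> : frame (mid e) (ang e) @^-1` (D `&` box e) = set0.
    apply/seteqP; split=> q //= /key [_ [[_ h3]|[_ h3]]].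
      by move: e1; rewrite h3 eqxx.
    by move: e2; rewrite h3 eqxx.
  by rewrite /plane_area measure0 addr0 subr0 mulr0 addr0.
Qed.

Lemma plane_area_split D : meas_plane D ->
  plane_area D = (plane_area (D `\` [set p | exists e, box e p]) + \sum_e plane_area (D `&` box e))%E.
Proof.
move=> mD.
have main (s : seq (edge B)) : uniq s -> plane_area D =
    (plane_area (D `\` [set p | exists2 e, e \in s & box e p]) + \sum_(e <- s) plane_area (D `&` box e))%E /\
    meas_plane (D `\` [set p | exists2 e, e \in s & box e p]).
  elim: s => [_|e s ih /= /andP[es us]].
    have -> : D `\` [set p | exists2 e, e \in [::] & box e p] = D.
      by apply/seteqP; split=> [p []//|p Dp]; split=> // -[].
    by rewrite big_nil adde0.
  have [IH mI] := ih us.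
  have E1 : D `\` [set p | exists2 e', e' \in s & box e' p] =
     (D `\` [set p | exists2 e', e' \in e :: s & box e' p]) `|` (D `&` box e).
    apply/seteqP; split=> p.
      move=> [Dp np]; have [be|be] := pselect (box e p); [by right|left; split=> //].
      by case=> e'; rewrite inE => /orP[/eqP->|es' be'] //; apply: np; exists e'.
    case=> -[Dp h]; split=> //.
      by case=> e' es' be'; apply: h; exists e' => //; rewrite inE es' orbT.
    by case=> e' es' be'; move: es; rewrite (box_disj h be') es'.
  have mb : meas_plane (D `&` box e) by apply: measurableI => //; exact: meas_box.
  have E2 : D `\` [set p | exists2 e', e' \in e :: s & box e' p] =
     (D `\` [set p | exists2 e', e' \in s & box e' p]) `\` (D `&` box e).
    apply/seteqP; split=> p.
      move=> [Dp h]; split; first by split=> // -[e' es' be']; apply: h; exists e' => //; rewrite inE es' orbT.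
      by case=> _ be; apply: h; exists e; rewrite ?inE ?eqxx.
    move=> [[Dp h1] h2]; split=> // -[e']; rewrite inE => /orP[/eqP->|es'] be'; first by apply: h2.
    by apply: h1; exists e'.
  have mM : meas_plane (D `\` [set p | exists2 e', e' \in e :: s & box e' p]).
    by rewrite E2; exact: measurableD.
  split=> //; rewrite big_cons addeA IH E1 plane_areaU //.
  by apply/seteqP; split=> p // -[[_ h] [_ be]]; apply: h; exists e; rewrite ?inE ?eqxx.
have [-> _] := main _ (index_enum_uniq (edge B)); congr (plane_area _ + _)%E.
apply/seteqP; split=> p [Dp h]; split=> // -[e]; first by move=> be; apply: h; exists e; rewrite ?mem_index_enum.
by move=> _ be; apply: h; exists e.
Qed.

Section Pushed.
Variable x : edge B -> R.
Hypothesis xs : \sum_e `|x e| * (6 * rho e) <= 1.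

Lemma pushed_area g i a : continuous g -> cancel (perturb (push x)) g -> cancel g (perturb (push x)) ->
  plane_area (region B i) = a%:E ->
  plane_area (g @^-1` region B i) = (a + \sum_e x e * (4 * rho e ^+ 3 / 3) * jump e i)%:E.
Proof.
move=> cg hK gK ha.
have mr : meas_plane (region B i) by apply: open_mset; exact: open_region.
have mg : meas_plane (g @^-1` region B i) by exact: mset_preimage.
have gbox e p : box e p <-> box e (g p) by rewrite (box_push xs e (g p)) gK.
have out : g @^-1` region B i `\` [set p | exists e, box e p] = region B i `\` [set p | exists e, box e p].
  have gid p : ~ (exists e, box e p) -> g p = p.
    move=> h; rewrite -{2}(gK p) push_nobox // => e /(gbox e p).2 be.
    by apply: h; exists e.
  by apply/seteqP; split=> p [h1 h2]; split=> //=; move: h1; rewrite /= gid.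
have := plane_area_split mr; have := plane_area_split mg; rewrite out ha.
have [Z hZ] := choice (fun e => box_area e i).
have E1 e : plane_area (region B i `&` box e) = (Z e)%:E.
  rewrite (hZ e 0) ?mul0r ?addr0 ?normr0 ?mul0r // => q hq.
  by rewrite /shifted mul0r addr0; case: q {hq}.
have E2 e : plane_area (g @^-1` region B i `&` box e) = (Z e + x e * (4 * rho e ^+ 3 / 3) * jump e i)%:E.
  apply: (hZ e); [exact: x_small|exact: mg|move=> q hq].
  have be : box e (lframe e q) by rewrite /box /= /lcoord frameK.
  have -> : lframe e (shifted (rho e) (x e) q) = perturb (push x) (lframe e q).
    by rewrite (push_box x be) /lcoord /lframe frameK.
  by rewrite /= hK.
rewrite (eq_bigr _ (fun e _ => E1 e)) (eq_bigr _ (fun e _ => E2 e)) !sumEFin.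
move: (plane_area _) (plane_area _) => [u||] [v||] //= [->] // [->].
by rewrite big_split /= addrA.
Qed.

Lemma curve_nobox e e' t : 0 <= t <= 1 -> e' != e -> ~ box e' (curve e t).
Proof.
move=> ht ee be.
have sp : support B (curve e t) by right; exists e, t.
have [s hs pE] := box_support be sp.
have [/andP[t0 t1]|] := boolP (0 < t < 1).
  have t01 : 0 < t < 1 by rewrite t0.
  have hs' := @arc_sig_range R B S e t t01.
  have E : dpt S (e', false) s = dpt S (e, false) (arc_sig S e t) by rewrite -pE (edge_param S e ht).
  have : e = e' by case: (@dpt_inj R B S (e', false) (e, false) _ _ hs hs' E) => -[/(congr1 fst)].
  by move/eqP; rewrite eq_sym (negbTE ee).
case/andP: ht => t0 t1; rewrite negb_and -!leNgt => /orP[h|h].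
  have t00 : t = 0 by apply/eqP; rewrite eq_le h t0.
  by apply: (@dpt_vertex R B S (e', false) s (edge_end (e, false)) hs); rewrite -pE t00 curve0.
have t11 : t = 1 by apply/eqP; rewrite eq_le h t1.
by apply: (@dpt_vertex R B S (e', false) s (edge_end (e, true)) hs); rewrite -pE t11 curve1.
Qed.

Lemma pushed_length e : (curve_length (perturb (push x) \o curve e) <=
  (arc_l S e - x e * arc_k S e * (4 * rho e ^+ 3 / 3) + 2 * rho e ^+ 2 * x e ^+ 2 * arc_l S e)%:E)%E.
Proof.
have [h1 h2 h3 _] := s1P e.
have kh : `|arc_k S e| * (arc_l S e / 2) <= pi by have := arc_turn S e; lra.
have [L LE hL] := shifted_arc_length h1 h2 (x_small xs e) h3 kh.
have ia := arcsP S e.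
have gE t : 0 <= t <= 1 -> perturb (push x) (curve e t) =
    lframe e (shifted (rho e) (x e) (arc_pt 0 0 (arc_k S e) (arc_sig S e t - arc_l S e / 2))).
  move=> ht; rewrite (@push_only x e); last by move=> e' ee; exact: curve_nobox.
  congr (lframe e (shifted _ _ _)); apply: (can_inj (frameK (mid e) (ang e))).
  rewrite /lcoord coordK frame_arc (edge_param S e ht) /dpt.
  set u := arc_sig S e t - arc_l S e / 2.
  have -> : arc_sig S e t = arc_l S e / 2 + u by rewrite /u subrKC.
  by rewrite arc_ptD.
have {}LE : L (arc_sig S e 1 - arc_l S e / 2) - L (arc_sig S e 0 - arc_l S e / 2) =
   arc_l S e - x e * arc_k S e * (4 * rho e ^+ 3 / 3) + 2 * rho e ^+ 2 * x e ^+ 2 * arc_l S e.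
  rewrite (arc_sig1 ia) (arc_sig0 ia) sub0r.
  have -> : arc_l S e - arc_l S e / 2 = arc_l S e / 2 by field.
  by rewrite LE -/(rho e); field.
rewrite -LE; apply: (curve_length_le (L := fun t => L (arc_sig S e t - arc_l S e / 2))) => s t s0 st t1.
rewrite /= !gE ?s0 ?t1 ?(le_trans s0 st) ?(le_trans st t1) // edist_frame.
have e1 := arc_sig_le ia s0 st t1.
have e2 := arc_sig_le ia (lexx 0) s0 (le_trans st t1).
have e3 := arc_sig_le ia (le_trans s0 st) t1 (lexx 1).
rewrite (arc_sig1 ia) in e3; rewrite (arc_sig0 ia) in e2.
by apply: hL; lra.
Qed.

End Pushed.

(** Dividing by [be e], the area swept by a bump of amplitude 1, makes [y e] the area that changes
    sides at [e]. *)
Lemma bump_competitor_radii : exists C eps : R, 0 < eps /\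
  forall y : edge B -> R, (forall e, `|y e| <= eps) -> exists B' : complex R n,
    (forall m, area B' m = area B m + \sum_e y e * jump e (Some m)) /\
    (graph_length B' <= (\sum_e (arc_l S e - y e * arc_k S e + C * y e ^+ 2))%:E)%E.
Proof.
pose be e := 4 * rho e ^+ 3 / 3.
have be0 e : 0 < be e by rewrite divr_gt0 // mulr_gt0 // exprn_gt0 // rho0.
have l0 e : 0 < arc_l S e by have := dlen_gt0 S (e, false).
pose C := \sum_e (2 * rho e ^+ 2 * arc_l S e / be e ^+ 2).
have Ce e : 2 * rho e ^+ 2 * arc_l S e / be e ^+ 2 <= C.
  rewrite /C (bigD1 e) //= lerDl sumr_ge0 // => e' _.
  apply: divr_ge0 (sqr_ge0 _); apply: mulr_ge0 (ltW (l0 e')).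
  by apply: mulr_ge0 => //; exact: sqr_ge0.
pose Q1 := \sum_e (6 * rho e / be e).
pose Q2 := \sum_m ((\sum_(e : edge B) 1) / area B m).
have Q10 : 0 <= Q1 by apply: sumr_ge0 => e _; apply: divr_ge0 (ltW (be0 e)); apply: mulr_ge0 (ltW (rho0 e)).
have N0 : 0 <= \sum_(e : edge B) (1 : R) by apply: sumr_ge0.
have Q20 : 0 <= Q2 by apply: sumr_ge0 => m _; apply: divr_ge0 (ltW (area_gt0 B m)).
(* [Q1] keeps the amplitudes within the range where the perturbation is a homeomorphism, [Q2] keeps
   the new areas positive. *)
exists C, (1 + Q1 + Q2)^-1; split=> [|y hy]; first by rewrite invr_gt0; lra.
set eps := _^-1 in hy.
have eps0 : 0 < eps by rewrite invr_gt0; lra.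
have epsE : eps * (1 + Q1 + Q2) = 1 by rewrite mulVf // lt0r_neq0 //; lra.
pose x e := y e / be e.
have xs : \sum_e `|x e| * (6 * rho e) <= 1.
  apply: (@le_trans _ _ (eps * Q1)); last by nra.
  rewrite mulr_sumr; apply: ler_sum => e _.
  rewrite /x normrM normfV (gtr0_norm (be0 e)).
  have -> : `|y e| / be e * (6 * rho e) = `|y e| * (6 * rho e / be e) by ring.
  by apply: ler_wpM2r (hy e); apply: divr_ge0 (ltW (be0 e)); apply: mulr_ge0 (ltW (rho0 e)).
have xb e : x e * be e = y e by rewrite /x divfK // lt0r_neq0.
have [g [ch cg hK gK]] := perturb_homeo (push_lip xs) (push_onto xs).
have areaE m : plane_area (g @^-1` region B (Some m)) = (area B m + \sum_e y e * jump e (Some m))%:E.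
  rewrite (pushed_area xs cg hK gK (interior_area B m)); congr (_ + _)%:E.
  by apply: eq_bigr => e _; rewrite -/(be e) xb.
have pos m : 0 < area B m + \sum_e y e * jump e (Some m).
  have am := area_gt0 B m.
  have : `|\sum_e y e * jump e (Some m)| <= eps * \sum_(e : edge B) 1.
    apply: le_trans (ler_norm_sum _ _ _) _; rewrite mulr_sumr; apply: ler_sum => e _.
    rewrite normrM; apply: ler_pM => //.
    by rewrite /jump; case: (_ == _); case: (_ == _); rewrite ?subrr ?subr0 ?sub0r ?normrN ?normr1 ?normr0.
  have : eps * (\sum_(e : edge B) 1) < area B m.
    have : (\sum_(e : edge B) 1) <= Q2 * area B m.
      rewrite -ler_pdivrMr // /Q2 (bigD1 m) //= lerDl sumr_ge0 // => m' _.
      by apply: divr_ge0 (ltW (area_gt0 B m')).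
    have : eps * Q2 < 1 by nra.
    by move: N0; move: (\sum_(e : edge B) 1) => N *; nra.
  by move=> h; rewrite ler_norml => /andP[]; lra.
have [B' [h1 h2]] := homeo_complex ch cg hK gK pos areaE.
exists B'; split=> //; rewrite h2 -sumEFin; apply: lee_sum => e _.
apply: le_trans (pushed_length xs e) _; rewrite lee_fin.
have -> : x e * arc_k S e * (4 * rho e ^+ 3 / 3) = y e * arc_k S e by rewrite mulrAC -/(be e) xb.
have -> : 2 * rho e ^+ 2 * x e ^+ 2 * arc_l S e = 2 * rho e ^+ 2 * arc_l S e / be e ^+ 2 * y e ^+ 2.
  by rewrite -xb; field; rewrite lt0r_neq0.
by rewrite lerD2l ler_wpM2r ?sqr_ge0.
Qed.

End Bumps.

Lemma bump_competitor (R : realType) (n : nat) (B : complex R n) (S : arcs B) : regular B ->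
  (forall e : edge B, lab S (e, false) != lab S (e, true)) -> exists C eps : R, 0 < eps /\
  forall y : edge B -> R, (forall e, `|y e| <= eps) -> exists B' : complex R n,
    (forall m, area B' m = area B m + \sum_e y e * jump S e (Some m)) /\
    (graph_length B' <= (\sum_e (arc_l S e - y e * arc_k S e + C * y e ^+ 2))%:E)%E.
Proof.
move=> rB sd; have [s1 s1P] := bump_radii S rB.
exact: (@bump_competitor_radii R n B S sd s1 s1P).
Qed.

(** * Pressures as Lagrange multipliers *)

Section FirstVariation.
Variables (R : realType) (n : nat) (B : complex R n) (S : arcs B).
Hypothesis rB : regular B.
Hypothesis mB : perimeter_minimizer B.

Lemma linear_term_zero (a K eps : R) : 0 < eps ->
  (forall t, `|t| <= eps -> 0 <= t * a + K * t ^+ 2) -> a = 0.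
Proof.
move=> e0 h; apply/eqP; rewrite -normr_eq0; apply: contraT; rewrite -normr_gt0 normr_id => a0.
pose t := Num.min eps (`|a| / (2 * (`|K| + 1))).
have k0 : 0 < 2 * (`|K| + 1) by rewrite mulr_gt0 // ltr_wpDl.
have t0 : 0 < t by rewrite lt_min e0 divr_gt0.
have tK : t * (2 * (`|K| + 1)) <= `|a| by rewrite -ler_pdivlMr // /t ge_min lexx orbT.
have te : t <= eps by rewrite /t ge_min lexx.
have K1 := ler_norm K; have K2 := normr_ge0 K.
have := h t; have := h (- t); rewrite normrN gtr0_norm // => /(_ te) h1 /(_ te) h2.
by move: a0 tK; case: (ger0P a) => a0 a1 tK; exfalso; nra.
Qed.

Lemma sides_neq (e : edge B) : lab S (e, false) != lab S (e, true).
Proof. by apply/eqP; exact: (sides_differ rB mB (d := (e, true))). Qed.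

Lemma graph_lengthE : graph_length B = (\sum_(e : edge B) arc_l S e)%:E.
Proof. by rewrite -sumEFin; apply: eq_bigr => e _; exact: arc_length (arcsP S e). Qed.

(** The bumps [t * y] preserve areas and change the length by at most [- t] times this sum plus a
    quadratic term. Minimality for both signs of [t] makes the sum vanish. *)
Lemma total_turn_zero (y : edge B -> R) : (forall m, \sum_e y e * jump S e (Some m) = 0) ->
  \sum_e y e * arc_k S e = 0.
Proof.
move=> hy; have [C [eps [eps0 hc]]] := bump_competitor rB sides_neq.
pose N := \sum_e `|y e|; have N0 : 0 <= N by exact: sumr_ge0.
apply/eqP; rewrite -oppr_eq0; apply/eqP.
apply: (@linear_term_zero _ (C * \sum_e y e ^+ 2) (eps / (1 + N))) => [|t ht].
  by rewrite divr_gt0 // ltr_pwDl.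
have [e|B' [aB lB]] := hc (fun e => t * y e).
  have : `|y e| <= N by rewrite /N (bigD1 e) //= lerDl sumr_ge0.
  have : `|t| * (1 + N) <= eps by rewrite -ler_pdivlMr // ltr_pwDl.
  by rewrite normrM; move: `|t| (normr_ge0 t) `|y e| => u *; nra.
have := le_trans (mB (B' := B') _) lB; rewrite graph_lengthE lee_fin !big_split /=.
have -> : \sum_e - (t * y e * arc_k S e) = t * - \sum_e y e * arc_k S e.
  by rewrite sumrN mulrN mulr_sumr; congr (- _); apply: eq_bigr => e _; ring.
have -> : \sum_e C * (t * y e) ^+ 2 = C * (\sum_e y e ^+ 2) * t ^+ 2.
  by rewrite mulr_sumr mulr_suml; apply: eq_bigr => e _; ring.
rewrite -addrA lerDl; apply => m; rewrite aB -[RHS]addr0; congr (_ + _).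
transitivity (t * \sum_e y e * jump S e (Some m)); last by rewrite hy mulr0.
by rewrite mulr_sumr; apply: eq_bigr => e _; ring.
Qed.

Definition extend (f : 'I_n -> R) (i : option 'I_n) : R := if i is Some m then f m else 0.

Lemma sum_jump (f : 'I_n -> R) e :
  \sum_m f m * jump S e (Some m) = extend f (lab S (e, true)) - extend f (lab S (e, false)).
Proof.
have h i : \sum_m f m * (i == Some m)%:R = extend f i.
  case: i => [m0|]; last by rewrite big1 // => m _; rewrite mulr0.
  rewrite (bigD1 m0) //= eqxx mulr1 big1 ?addr0 // => m mm.
  by rewrite -[Some m0 == _]/(m0 == m) eq_sym (negbTE mm) mulr0.
by rewrite -!h -sumrB; apply: eq_bigr => m _; rewrite -mulrBr.
Qed.

Let J : 'M[R]_(n, #|edge B|) := \matrix_(m, j) jump S (enum_val j) (Some m).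

Lemma sum_edges (F : edge B -> R) : \sum_(j < #|edge B|) F (enum_val j) = \sum_e F e.
Proof. by rewrite -big_enum_val. Qed.

(** The curvatures vanish on the kernel of the area differential [J], so they form a combination of
    its rows; the pressures are the coefficients with opposite sign. *)
Lemma pressures : exists P : 'I_n -> R, forall e,
  arc_k S e = extend P (lab S (e, false)) - extend P (lab S (e, true)).
Proof.
pose K : 'rV[R]_#|edge B| := \row_j arc_k S (enum_val j).
have : (K <= J)%MS.
  rewrite submxE; apply/eqP/rowP => c; rewrite !mxE.
  pose y e := cokermx J (enum_rank e) c.
  have hy m : \sum_e y e * jump S e (Some m) = 0.
    transitivity ((J *m cokermx J) m c); last by rewrite mulmx_coker mxE.
    rewrite mxE.
    rewrite -(sum_edges (fun e => y e * jump S e (Some m))); apply: eq_bigr => j _.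
    by rewrite /y enum_valK [J m j]mxE mulrC.
  transitivity (\sum_e y e * arc_k S e); last exact: total_turn_zero.
  rewrite -(sum_edges (fun e => y e * arc_k S e)); apply: eq_bigr => j _.
  by rewrite /y enum_valK [K 0 j]mxE mulrC.
case/submxP => D hD; exists (fun m => - D 0 m) => e.
have := congr1 (fun M : 'rV[R]_#|edge B| => M 0 (enum_rank e)) hD; rewrite !mxE enum_rankK => ->.
have -> : \sum_m D 0 m * J m (enum_rank e) = - \sum_m (- D 0 m) * jump S e (Some m).
  by rewrite -sumrN; apply: eq_bigr => m _; rewrite mxE enum_rankK mulNr opprK.
by rewrite sum_jump opprB.
Qed.

(** The first hypothesis says that [J] has full row rank, so some [y] changes each area at the rate
    of that area itself. Scaling combined with these bumps preserves areas, and its first variation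
    is the identity. *)
Lemma length_pressure (P : 'I_n -> R) :
  (forall f : 'I_n -> R, (forall e, extend f (lab S (e, false)) = extend f (lab S (e, true))) ->
    forall m, f m = 0) ->
  (forall e, arc_k S e = extend P (lab S (e, false)) - extend P (lab S (e, true))) ->
  \sum_(e : edge B) arc_l S e = 2 * \sum_m P m * area B m.
Proof.
move=> conn hP.
have /row_freeP[Bm hB] : row_free J.
  apply: inj_row_free => v hv; apply/rowP => m; rewrite mxE.
  apply: (conn (fun m => v 0 m)) => e; apply/eqP; rewrite eq_sym -subr_eq0 -sum_jump; apply/eqP.
  have := congr1 (fun M : 'rV[R]_#|edge B| => M 0 (enum_rank e)) hv; rewrite !mxE => h.
  by rewrite -[RHS]h; apply: eq_bigr => j _; rewrite mxE enum_rankK.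
pose y e := \sum_m Bm (enum_rank e) m * area B m.
have hy m : \sum_e y e * jump S e (Some m) = area B m.
  rewrite -(sum_edges (fun e => y e * jump S e (Some m))) /y.
  transitivity (\sum_j \sum_m' J m j * Bm j m' * area B m').
    by apply: eq_bigr => j _; rewrite mulr_suml; apply: eq_bigr => m' _; rewrite enum_valK mxE; ring.
  rewrite exchange_big /= (bigD1 m) //= [X in _ + X]big1 ?addr0 => [|m' mm].
    by rewrite -mulr_suml; have := congr1 (fun M : 'M[R]_n => M m m) hB; rewrite !mxE eqxx => ->; rewrite mul1r.
  rewrite -mulr_suml; have := congr1 (fun M : 'M[R]_n => M m m') hB; rewrite !mxE eq_sym (negbTE mm) => ->.
  by rewrite mul0r.
have kE : \sum_e y e * arc_k S e = - \sum_m P m * area B m.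
  under eq_bigr => e _ do rewrite hP -opprB -sum_jump mulrN mulr_sumr.
  rewrite sumrN exchange_big /=; congr (- _); apply: eq_bigr => m _.
  by rewrite -hy mulr_sumr; apply: eq_bigr => e _; ring.
have [C [eps [eps0 hc]]] := bump_competitor rB sides_neq.
set l := \sum_e arc_l S e; set pa := \sum_m P m * area B m in kE *.
pose Y2 := \sum_e y e ^+ 2; have Y20 : 0 <= Y2 by apply: sumr_ge0 => e _; exact: sqr_ge0.
pose N := \sum_e `|y e|; have N0 : 0 <= N by exact: sumr_ge0.
pose K := `|pa| * 100 + `|l| * 100 + `|C| * Y2 * 400.
apply/eqP; rewrite -subr_eq0; apply/eqP.
apply: (@linear_term_zero _ K (Num.min (1 / 2) (eps / (12 * (1 + N))))) => [|t].
  by rewrite lt_min divr_gt0 //= divr_gt0 // mulr_gt0 // ltr_pwDl.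
rewrite le_min => /andP[t2 te].
have [t3 t4] : - (1 / 2) <= t /\ t <= 1 / 2 by move: t2; rewrite ler_norml => /andP[].
pose s := 1 + t; have s0 : 0 < s by rewrite /s; lra.
(* [(1 + a) * s ^+ 2 = 1], so the bumps [a * y] undo the effect of the scaling on areas. To first
   order [a] is [- 2 * t], and the length changes by [t * (l - 2 * pa)]. *)
pose a := - (t * (2 + t)) / s ^+ 2.
have aE : a * s ^+ 2 = - (t * (2 + t)) by rewrite /a divfK // expf_neq0 // lt0r_neq0.
have an : `|a| <= 12 * `|t|.
  have : `|a| * s ^+ 2 = `|t| * (2 + t).
    rewrite -{1}(ger0_norm (sqr_ge0 s)) -normrM aE normrN normrM; congr (_ * _).
    by rewrite ger0_norm //; lra.
  have : 1 / 4 <= s ^+ 2 by rewrite /s; nra.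
  by move: (s ^+ 2) (`|t|) (normr_ge0 t) (`|a|) (normr_ge0 a) => u v v0 w w0 *; nra.
have [e|B1 [aB1 lB1]] := hc (fun e => a * y e).
  have : `|y e| <= N by rewrite /N (bigD1 e) //= lerDl sumr_ge0.
  have : `|t| * (12 * (1 + N)) <= eps by rewrite -ler_pdivlMr // mulr_gt0 // ltr_pwDl.
  rewrite normrM; move: (`|t|) (normr_ge0 t) (`|y e|) (`|a|) (normr_ge0 a) (normr_ge0 (y e)) an => u u0 z w w0 z0 *.
  have : w * z <= (12 * u) * N by apply: ler_pM.
  by nra.
have [B2 [aB2 lB2]] := scale_complex B1 s0.
have sa : same_areas B B2.
  move=> m; rewrite aB2 aB1.
  have -> : \sum_e a * y e * jump S e (Some m) = a * area B m.
    by rewrite -hy mulr_sumr; apply: eq_bigr => e _; ring.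
  have -> : s ^+ 2 * (area B m + a * area B m) = (s ^+ 2 + a * s ^+ 2) * area B m by ring.
  by rewrite aE /s; ring.
have := le_trans (mB sa) (le_trans lB2 (lee_wpmul2l _ lB1)).
rewrite lee_fin (ltW s0) graph_lengthE => /(_ isT).
rewrite -EFinM lee_fin !big_split /= -/l.
have -> : \sum_e - (a * y e * arc_k S e) = a * pa.
  rewrite sumrN; have -> : \sum_e a * y e * arc_k S e = a * \sum_e y e * arc_k S e.
    by rewrite mulr_sumr; apply: eq_bigr => e _; ring.
  by rewrite kE; ring.
have -> : \sum_e C * (a * y e) ^+ 2 = C * Y2 * a ^+ 2.
  by rewrite /Y2 mulr_sumr mulr_suml; apply: eq_bigr => e _; ring.
move=> h.
have a2 : a ^+ 2 <= 144 * t ^+ 2.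
  rewrite -[a ^+ 2]real_normK ?num_real // -[t ^+ 2]real_normK ?num_real //.
  by move: (`|a|) (`|t|) (normr_ge0 a) (normr_ge0 t) an => u v *; nra.
have h' : 0 <= t * l * s + a * s ^+ 2 * pa + s ^+ 2 * (C * Y2 * a ^+ 2).
  have -> : t * l * s + a * s ^+ 2 * pa + s ^+ 2 * (C * Y2 * a ^+ 2) =
    s * (s * (l + a * pa + C * Y2 * a ^+ 2) - l) by rewrite /s; ring.
  by rewrite mulr_ge0 ?(ltW s0) // subr_ge0.
rewrite aE in h'.
have b1 : s ^+ 2 * (C * Y2 * a ^+ 2) <= 360 * (`|C| * Y2) * t ^+ 2.
  apply: (@le_trans _ _ (s ^+ 2 * (`|C| * Y2 * (144 * t ^+ 2)))).
    apply: ler_wpM2l; first exact: sqr_ge0.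
    apply: (@le_trans _ _ (`|C| * Y2 * a ^+ 2)).
      by apply: ler_wpM2r; [exact: sqr_ge0|apply: ler_wpM2r => //; exact: ler_norm].
    by apply: ler_wpM2l => //; apply: mulr_ge0.
  have : s ^+ 2 <= 9 / 4 by rewrite /s; nra.
  have : 0 <= `|C| * Y2 * t ^+ 2 by apply: mulr_ge0; [apply: mulr_ge0|exact: sqr_ge0].
  by move: (`|C| * Y2) (t ^+ 2) (s ^+ 2) => u v w *; nra.
have := sqr_ge0 t; have := normr_ge0 pa; have := normr_ge0 l.
have p1 := ler_norm pa; have p2 := ler_norm (- pa); rewrite normrN in p2.
have l1 := ler_norm l; have l2 := ler_norm (- l); rewrite normrN in l2.
have n1 : t ^+ 2 * l <= t ^+ 2 * `|l| by apply: ler_wpM2l => //; exact: sqr_ge0.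
have n2 : t ^+ 2 * - pa <= t ^+ 2 * `|pa| by apply: ler_wpM2l => //; exact: sqr_ge0.
have n3 : 0 <= t ^+ 2 * `|l| by apply: mulr_ge0 => //; exact: sqr_ge0.
have n4 : 0 <= t ^+ 2 * `|pa| by apply: mulr_ge0 => //; exact: sqr_ge0.
have n5 : 0 <= `|C| * Y2 * t ^+ 2 by apply: mulr_ge0; [apply: mulr_ge0|exact: sqr_ge0].
by rewrite /K; move: h' b1; rewrite /s; move: n1 n2 n3 n4 n5 p1 p2 l1 l2; clear; lra.
Qed.

End FirstVariation.

Lemma derive_const_near (R : realType) (f : R -> R) (a b x df : R) : a < x < b ->
  (forall y, a < y < b -> f y = f x) -> is_derive x 1 f df -> df = 0.
Proof.
move=> hx hf d.
have d0 : is_derive x 1 f 0.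
  apply: (near_eq_is_derive _ (der_cst (f x) x)).
  near=> y; apply/esym/hf; near: y.
  have := @near_in_itvoo R a b x; rewrite in_itv /= => /(_ hx); apply: filterS => y.
  by rewrite in_itv.
by rewrite -(@derive_val _ _ _ _ _ _ _ d) (@derive_val _ _ _ _ _ _ _ d0).
Unshelve. all: by end_near. Qed.

(** * Pressures along a path *)

Section CarrierNormal.
Variables (R : realType) (z : plane R) (psi k L : R) (c : carrier R).
Hypothesis on : forall s, 0 < s < L -> on_carrier c (arc_pt z psi k s).
Implicit Types (s : R).

Let T s := ez (psi + k * s).

Lemma dot_der (u : plane R) s :
  is_derive s 1 (fun s => dot (arc_pt z psi k s) u) (dot (T s) u).
Proof.
apply: (der_eq (der_D (der_M (der_arc1 z psi k s) (der_cst u.1 s)) (der_M (der_arc2 z psi k s) (der_cst u.2 s)))).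
by rewrite /dot /T /ez /=; ring.
Qed.

Lemma dot_der2 (u : plane R) s : is_derive s 1 (fun s => dot (T s) u) (k * dot (rot (T s)) u).
Proof.
have dk : is_derive s 1 (fun s => psi + k * s) k.
  by apply: (der_eq (der_D (der_cst psi s) (der_Z k (der_id s)))); rewrite add0r mulr1.
apply: (der_eq (der_D (der_M (der_cos dk) (der_cst u.1 s)) (der_M (der_sin dk) (der_cst u.2 s)))).
by rewrite /dot /T /ez /rot /=; ring.
Qed.

(** The carrier in a crossing is arbitrary and must be compared with the chosen arc. Differentiating
    its equation once makes its normal orthogonal to the tangent, differentiating twice matches the
    curvatures. *)
Lemma carrier_normal s : 0 < s < L -> exists2 sg : R, sg ^+ 2 = 1 &
  normal c (arc_pt z psi k s) = sg *: rot (T s) /\ curvature c * sg = - k.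
Proof.
move=> hs; have rT x : enorm (rot (T x)) = 1 by rewrite rot_norm ez_norm.
case: c on => [p u|o r] h.
  have u1 : enorm u = 1 := (h s hs).1.
  have t0 x : 0 < x < L -> dot (T x) u = 0.
    move=> hx; apply: (derive_const_near hx _ (dot_der u x)) => y hy.
    have := (h x hx).2; have := (h y hy).2; rewrite /dot /=; lra.
  have k0 : k * dot (rot (T s)) u = 0.
    by apply: (derive_const_near hs _ (dot_der2 u s)) => y hy; rewrite !t0.
  have uE : u = dot u (rot (T s)) *: rot (T s).
    have dc a b : dot a b = dot b a :> R by rewrite /dot mulrC [X in _ + X]mulrC.
    by rewrite {1}(decompose u (ez_norm (psi + k * s))) dc t0 // scale0r add0r.
  have s2 : dot u (rot (T s)) ^+ 2 = 1.
    by have := congr1 (fun v => enorm v ^+ 2) uE; rewrite enormZ rT mulr1 u1 expr1n real_normK ?num_real.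
  exists (dot u (rot (T s))) => //; split=> //=; rewrite mul0r.
  have : dot u (rot (T s)) != 0 by rewrite -sqrf_eq0 s2 oner_neq0.
  move: k0; have -> : dot (rot (T s)) u = dot u (rot (T s)) by rewrite /dot mulrC [X in _ + X]mulrC.
  by move/eqP; rewrite mulf_eq0 => /orP[/eqP->|->] //; rewrite oppr0.
have [r0 _] := h s hs.
have n2 x : 0 < x < L -> dot (arc_pt z psi k x - o) (arc_pt z psi k x - o) = r ^+ 2.
  by move=> hx; rewrite -enorm_sqr -/(edist _ _) (h x hx).2.
have t0 x : 0 < x < L -> dot (T x) (arc_pt z psi k x - o) = 0.
  move=> hx.
  have d1 := der_sqr (der_B (der_arc1 z psi k x) (der_cst o.1 x)).
  have d2 := der_sqr (der_B (der_arc2 z psi k x) (der_cst o.2 x)).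
  have d := der_D d1 d2.
  suff : 2 * dot (T x) (arc_pt z psi k x - o) = 0 by lra.
  rewrite -[RHS](derive_const_near hx _ d).
    by rewrite /dot /T /ez /=; ring.
  by move=> y hy; have := n2 x hx; have := n2 y hy; rewrite /dot /= -!expr2 => -> ->.
have kb : k * dot (rot (T s)) (arc_pt z psi k s - o) = -1.
  have dk : is_derive s 1 (fun s => psi + k * s) k.
    by apply: (der_eq (der_D (der_cst psi s) (der_Z k (der_id s)))); rewrite add0r mulr1.
  have d := der_D (der_M (der_cos dk) (der_B (der_arc1 z psi k s) (der_cst o.1 s)))
                  (der_M (der_sin dk) (der_B (der_arc2 z psi k s) (der_cst o.2 s))).
  have h0 := derive_const_near hs _ d; have cs := cos2Dsin2 (psi + k * s).
  apply/eqP; rewrite -subr_eq0 opprK; apply/eqP.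
  transitivity (k * dot (rot (T s)) (arc_pt z psi k s - o) + (cos (psi + k * s) ^+ 2 + sin (psi + k * s) ^+ 2)).
    by rewrite cs.
  rewrite -[RHS]h0; last first.
    by move=> y hy; have := t0 s hs; have := t0 y hy; rewrite /dot /T /ez /= => -> ->.
  by rewrite /dot /T /ez /rot /=; ring.
set w := arc_pt z psi k s - o in n2 t0 kb *.
have wE : w = dot (rot (T s)) w *: rot (T s).
  have dc a b : dot a b = dot b a :> R by rewrite /dot mulrC [X in _ + X]mulrC.
  rewrite {1}(decompose w (ez_norm (psi + k * s))) dc t0 // scale0r add0r.
  by rewrite [dot w _]dc.
set b := dot (rot (T s)) w in kb wE.
have b2 : b ^+ 2 = r ^+ 2.
  by have := congr1 (fun v => enorm v ^+ 2) wE; rewrite enormZ rT mulr1 real_normK ?num_real // enorm_sqr n2.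
have rn : r != 0 by rewrite lt0r_neq0.
exists (b / r); first by rewrite exprMn b2 exprVn divff // expf_neq0.
split.
  have -> : normal (Circle o r) (arc_pt z psi k s) = r^-1 *: w.
    by apply: plane_eq; rewrite /= /GRing.scale /= mulrC.
  by rewrite wE scalerA mulrC.
have bn : b != 0 by rewrite -sqrf_eq0 b2 sqrf_eq0.
have -> : k = - b^-1 by apply: (mulIf bn); rewrite kb mulNr mulVf.
rewrite /= opprK; apply: (mulIf bn); rewrite mulVf //.
have -> : r^-1 * (b / r) * b = b ^+ 2 / r ^+ 2 by field.
by rewrite b2 divff // expf_neq0.
Qed.

End CarrierNormal.

Section PressurePath.
Variables (R : realType) (n : nat) (B : complex R n) (S : arcs B).
Hypothesis rB : regular B.
Implicit Types (f : option 'I_n -> R).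

(** Along the path [dside] vanishes at [t] with derivative [w], the normal velocity. It changes sign
    there, and the sign of [w] tells from which side the path comes. *)
Lemma crossing_regions r (t k : R) : crossing B r t k -> exists (a b : option 'I_n) (d : R) (e : edge B),
  [/\ 0 < d, (forall u, t - d < u -> u < t -> region B a (r u)),
      (forall u, t < u -> u < t + d -> region B b (r u)) &
      exists2 x : bool, k = (if x then arc_k S e else - arc_k S e) &
        (a = lab S (e, x) /\ b = lab S (e, ~~ x))].
Proof.
case=> e [x [c [v [[hx rE] ce dr v0 kE]]]].
have hs := @arc_sig_range R B S e x hx; set s := arc_sig S e x in hs.
have x01 : 0 <= x <= 1 by case/andP: hx => *; rewrite !ltW.
have zE : r t = dpt S (e, false) s by rewrite rE (edge_param S e x01).
have [sg sg2 [nE cE]] : exists2 sg : R, sg ^+ 2 = 1 &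
    normal c (r t) = sg *: dnor S (e, false) s /\ curvature c * sg = - arc_k S e.
  rewrite zE; apply: (@carrier_normal R _ _ _ (arc_l S e) c _ s hs) => s' hs'.
  have [t' ht' tE] := @edge_param_inv R B S (e, false) s' hs'.
  by rewrite -[arc_pt _ _ _ _]/(dpt S (e, false) s') -tE; apply: ce; case/andP: ht' => *; rewrite !ltW.
set N := dnor S (e, false) s in nE; set w := dot v N.
have vw : dot v (normal c (r t)) = sg * w by rewrite nE /w /dot /= /GRing.scale /=; ring.
have sgw : w != 0 by apply: contraNneq v0 => w0; rewrite vw w0 mulr0.
have [q q0 nb] := edge_clear rB hs.
pose K := arc_k S e / 2.
have sideE p : dside S (e, false) p = dot (p - r t) N - K * dot (p - r t) (p - r t).
  by rewrite /dside (arc_side_move _ _ _ s) zE.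
have near0 : \forall h \near 0^', edist (r (h + t)) (r t) < q /\
    0 < h^-1 * dside S (e, false) (r (h + t)) * w.
  have [dr1 dr2] := dr.
  have lim : h^-1 *: (r (h + t) - r t) @[h --> 0^'] --> v.
    have := dr1; rewrite /derivable => /cvg_ex[l hl].
    have lv : l = v by rewrite -dr2 /derive; apply/esym/cvg_lim => //.
    by rewrite -lv; move: hl; under eq_fun do rewrite [_ *: 1]mulr1.
  have lim0 : r (h + t) - r t @[h --> 0^'] --> (0 : plane R).
    have h0 : (h : R) @[h --> (0 : R)^'] --> (0 : R) by exact: cvg_within.
    have := cvgZ h0 lim; rewrite scale0r => c0; refine (cvg_trans _ (c0 _)).
    apply: (@near_eq_cvg _ _ _ _ (fun h : R => h *: (h^-1 *: (r (h + t) - r t))) (fun h => r (h + t) - r t)).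
    by near=> h; rewrite scalerA divff ?scale1r //; near: h; exact: nbhs_dnbhs_neq.
  have lim2 : h^-1 * dside S (e, false) (r (h + t)) * w @[h --> 0^'] --> (w - K * dot v 0) * w.
    apply: cvgM; last exact: cvg_cst.
    have -> : (fun h => h^-1 * dside S (e, false) (r (h + t))) =
       (fun h => dot (h^-1 *: (r (h + t) - r t)) N - K * dot (h^-1 *: (r (h + t) - r t)) (r (h + t) - r t)).
      apply/funext => h; rewrite sideE /dot /= /GRing.scale /=; ring.
    apply: cvgB; first by apply: (cvg_dot _ lim (cvg_cst N)).
    by apply: cvgM; [exact: cvg_cst|exact: (cvg_dot _ lim lim0)].
  have pos : 0 < (w - K * dot v 0) * w.
    by rewrite /dot /= !mulr0 addr0 mulr0 subr0 -expr2 exprn_even_gt0.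
  near=> h; split.
    near: h; apply: filterS ((cvg_edistP _ _ _).1 lim0 q q0) => h.
    by rewrite /edist subr0.
  by near: h; exact: (cvgr_gt _ lim2 _ pos).
move: near0; rewrite near_withinE => /nbhs_ballP[d /= d0 hd].
have hd' u : `|u - t| < d -> u != t -> edist (r u) (r t) < q /\ 0 < (u - t)^-1 * dside S (e, false) (r u) * w.
  move=> h1 h2; have := hd (u - t); rewrite /ball /= sub0r normrN subrK => /(_ h1); apply.
  by rewrite subr_eq0.
exists (lab S (e, 0 < w)), (lab S (e, ~~ (0 < w))), d, e; split=> //.
- move=> u u1 u2; have [||h1 h2] := hd' u; [by rewrite ltr_norml; apply/andP; split; lra|by rewrite lt_eqF|].
  rewrite zE in h1; apply/(nb _ h1).2.
  have i0 : (u - t)^-1 < 0 by rewrite invr_lt0; lra.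
  move: h2; rewrite -mulrA (nmulr_rgt0 _ i0); case: (boolP (0 < w)) => [w0|w0].
    by rewrite (pmulr_llt0 _ w0); right.
  have wn : w < 0 by rewrite lt_neqAle sgw leNgt.
  by rewrite (nmulr_llt0 _ wn); left.
- move=> u u1 u2; have [||h1 h2] := hd' u; [by rewrite ltr_norml; apply/andP; split; lra|by rewrite gt_eqF|].
  rewrite zE in h1; apply/(nb _ h1).2.
  have i0 : 0 < (u - t)^-1 by rewrite invr_gt0; lra.
  move: h2; rewrite -mulrA (pmulr_rgt0 _ i0); case: (boolP (0 < w)) => [w0|w0].
    by rewrite (pmulr_lgt0 _ w0); left.
  have wn : w < 0 by rewrite lt_neqAle sgw leNgt.
  by rewrite (nmulr_lgt0 _ wn); right.
exists (0 < w) => //; rewrite kE vw sgrM.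
have -> : curvature c = - arc_k S e * sg by rewrite -cE -mulrA -expr2 sg2 mulr1.
have sgE : Num.sg sg * sg = 1.
  have /eqP : (sg - 1) * (sg + 1) = 0 by rewrite -subr_sqr sg2 expr1n subrr.
  by rewrite mulf_eq0 subr_eq0 addr_eq0 => /orP[] /eqP ->; rewrite ?sgrN ?sgr1 ?mulrNN mulr1.
have -> : - (Num.sg sg * Num.sg w) * (- arc_k S e * sg) = (Num.sg sg * sg) * (Num.sg w * arc_k S e) by ring.
rewrite sgE mul1r; case: ifPn => [w0|w0]; first by rewrite gtr0_sg // mul1r.
by rewrite ltr0_sg ?mulN1r // lt_neqAle sgw leNgt.
Unshelve. all: by end_near. Qed.

(** For short intervals the index of the region jumps only at a crossing; Cousin's lemma adds these
    local identities. *)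
Lemma path_telescope f (r : R -> plane R) (ts : seq R) (phi : R -> R) i j :
  {within `[0, 1], continuous r} -> region B i (r 0) -> region B j (r 1) -> uniq ts ->
  (forall t, t \in ts <-> 0 <= t <= 1 /\ support B (r t)) ->
  (forall t, t \in ts -> exists a b (d : R), [/\ 0 < d, (forall u, t - d < u -> u < t -> region B a (r u)),
     (forall u, t < u -> u < t + d -> region B b (r u)) & phi t = f b - f a]) ->
  f j - f i = \sum_(t <- ts) phi t.
Proof.
move=> cr ri rj uts tsP cross.
(* [a] and [b] are the regions just before and just after [t], valid up to distance [d]; off the
   crossing times they agree. *)
pose Q (t : R) (abd : option 'I_n * option 'I_n * R) := let: (a, b, d) := abd in
    [/\ 0 < d, (forall u, 0 <= u -> t - d < u -> u < t -> region B a (r u)),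
       (forall u, u <= 1 -> t < u -> u < t + d -> region B b (r u)),
       t \in ts -> phi t = f b - f a & t \notin ts -> a = b /\ region B b (r t)].
have loc t : 0 <= t <= 1 -> exists abd, Q t abd.
  move=> ht; have [tin|tn] := boolP (t \in ts).
    have [a [b [d [d0 h1 h2 h3]]]] := cross t tin.
    by exists (a, b, d); split=> // [u _|u _|]; [exact: h1|exact: h2|rewrite tin].
  have nsup : ~ support B (r t) by move=> s; move/negP: tn; apply; apply/tsP.
  have [a ra] := @region_exists R n B _ nsup.
  have /nbhs_ballP[d /= d0 hd0] : nbhs t ((r \o @clamp01 R) @^-1` region B a).
    apply: (clamp01_continuous cr); apply: open_nbhs_nbhs; split; first exact: open_region.
    by rewrite /= clamp01_id.
  have hd u : ball t d u -> 0 <= u <= 1 -> region B a (r u).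
    by move=> /hd0 /= + hu; rewrite clamp01_id.
  exists (a, a, d); split=> //.
  - by move=> u u0 u1 u2; apply: hd; [rewrite /ball /= ltr_norml; apply/andP; split; lra|case/andP: ht => *; apply/andP; split; lra].
  - by move=> u u0 u1 u2; apply: hd; [rewrite /ball /= ltr_norml; apply/andP; split; lra|case/andP: ht => *; apply/andP; split; lra].
  - by move=> h; rewrite h in tn.
have /choice[F hF] : forall t, exists abd, 0 <= t <= 1 -> Q t abd.
  move=> t0; have [ht|ht] := boolP (0 <= t0 <= 1); first by have [y hy] := loc t0 ht; exists y.
  by exists (None, None, 0).
pose bt t := (F t).1.2.
have offb t c : 0 <= t <= 1 -> region B c (r t) -> bt t = c /\ t \notin ts.
  move=> ht rc; have tn : t \notin ts by apply/negP => /tsP[_]; exact: region_compl rc.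
  split=> //; have := hF t ht; rewrite /bt /Q; case: (F t) => [[a b] d] /= [_ _ _ _ /(_ tn)[_ rb]].
  exact: region_uniq rb rc.
(* [bt] is the region just after a time, so the crossing at [s] is already accounted for and the one
   at [t] is counted: half-open intervals make [P] additive. *)
pose P s t := f (bt t) - f (bt s) = \sum_(u <- ts | s < u <= t) phi u.
have main : P 0 1.
  apply: (@cousin R P) => // [x hx|s t u s0 st tu u1 h1 h2]; last first.
    rewrite /P in h1 h2 *; rewrite (bigID (fun u => u <= t)) /=.
    have -> : f (bt u) - f (bt s) = f (bt t) - f (bt s) + (f (bt u) - f (bt t)) by ring.
    rewrite h1 h2; congr (_ + _); apply: eq_bigl => y; last first.
      case: (leP y t) => yt /=; first by rewrite andbF.
      by rewrite andbT (le_lt_trans st yt).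
    by case: (leP y t) => yt /=; rewrite ?andbT ?andbF // (le_trans yt tu) andbT.
  have := hF x hx; rewrite /Q; case E : (F x) => [[a b] d] [d0 hl hr hin hout]; exists d => // s t s0 sx xt t1 ds dt.
  have [hs1 [ht0 [hsd htd]]] : s <= 1 /\ 0 <= t /\ x - d < s /\ t < x + d.
    by move: (s0) (sx) (xt) (t1) (ds) (dt); clear; lra.
  have bs : bt s = if s < x then a else b.
    have [sx'|xs] := ltP s x; last by rewrite /bt (_ : s = x) ?E //; apply/eqP; rewrite eq_le sx.
    by apply: (offb s _ _ _).1; [rewrite s0|exact: hl].
  have ebt : bt t = b.
    have [xt'|tx] := ltP x t; last by rewrite /bt (_ : t = x) ?E //; apply/eqP; rewrite eq_le xt tx.
    by apply: (offb t _ _ _).1; [rewrite ht0|exact: hr].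
  have only u : u \in ts -> s < u <= t -> u = x.
    move=> uin /andP[su ut]; have [u0 u1] := (ltW (le_lt_trans s0 su), le_trans ut t1).
    apply/eqP; apply: contraT; rewrite neq_lt => /orP[ux|xu].
      have ru : region B a (r u) by exact: hl u0 (lt_trans hsd su) ux.
      by have [|_ /negP] := offb u a _ ru; first by rewrite u0.
    have ru : region B b (r u) by exact: hr u1 xu (le_lt_trans ut htd).
    by have [|_ /negP] := offb u b _ ru; first by rewrite u0.
  rewrite /P bs ebt; have [xin|xn] := boolP (x \in ts).
    have [sx'|xs] := ltP s x.
      rewrite -(hin xin) big_mkcond (bigD1_seq x) //= sx' xt big1_seq ?addr0 // => u /andP[h2 h3].
      by case: ifP => // h1; rewrite (only u h3 h1) eqxx in h2.
    rewrite subrr big1_seq // => u /andP[h1 h3].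
    by have := h1; rewrite (only u h3 h1) ltNge xs.
  have [-> _] := hout xn; rewrite if_same subrr big1_seq // => u /andP[h1 h3].
  by move: xn; rewrite -(only u h3 h1) h3.
have z01 : (0 : R) <= 0 <= (1 : R) by rewrite lexx ler01.
have o01 : (0 : R) <= 1 <= (1 : R) by rewrite lexx ler01.
have [h0 n0] := offb 0 i z01 ri; have [h1 n1] := offb 1 j o01 rj.
move: main; rewrite /P h0 h1 => ->.
rewrite big_seq_cond [RHS]big_seq; apply: eq_bigl => u.
case uin : (u \in ts) => //=; have /tsP[/andP[u0 u1] _] := uin.
rewrite u1 andbT lt_neqAle u0 andbT; apply/eqP => u00.
by move: n0; rewrite u00 uin.
Qed.

Lemma pressure_potential (P : 'I_n -> R) m p :
  (forall e, arc_k S e = extend P (lab S (e, false)) - extend P (lab S (e, true))) ->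
  has_pressure B (Some m) p -> P m = p.
Proof.
move=> hP [r [ts [k [[cr [r0 r1]] uts tsP cross ->]]]].
have := @path_telescope (extend P) r ts k _ _ cr r0 r1 uts tsP; rewrite /= subr0; apply=> t tin.
have [a [b [d [e [d0 h1 h2 [x kE [aE bE]]]]]]] := crossing_regions (cross t tin).
exists a, b, d; split=> //; rewrite kE aE bE hP; case: x {kE aE bE} => //=; ring.
Qed.

(** The path that defines the pressure joins the region to the exterior, where [extend f] is 0. This
    supplies the rank hypothesis of [length_pressure]. *)
Lemma pressure_connected (f : 'I_n -> R) m p :
  (forall e, extend f (lab S (e, false)) = extend f (lab S (e, true))) ->
  has_pressure B (Some m) p -> f m = 0.
Proof.
move=> hf [r [ts [k [[cr [r0 r1]] uts tsP cross _]]]].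
have := @path_telescope (extend f) r ts (fun=> 0) _ _ cr r0 r1 uts tsP.
rewrite /= subr0 big1 // => -> // t tin.
have [a [b [d [e [d0 h1 h2 [x _ [aE bE]]]]]]] := crossing_regions (cross t tin).
by exists a, b, d; split=> //; rewrite aE bE; case: x {aE bE} => /=; rewrite hf subrr.
Qed.

End PressurePath.

(** * Winding numbers and boundary walks *)

Section AngleChange.
Variable R : realType.
Implicit Types (g : R -> plane R) (p q v : plane R) (t : R) (th f : R -> R).

Definition angle_along g p th := continuous th /\
  forall t, 0 <= t <= 1 -> g t - p = enorm (g t - p) *: ez (th t).

Lemma angle_along_exists g p : {within `[0, 1], continuous g} ->
  (forall t, 0 <= t <= 1 -> g t <> p) -> exists th, angle_along g p th.
Proof.
move=> cg gp; have cc := clamp01_continuous cg.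
have [|t|th cth hth] := @angle_lift R (fun t => g (clamp01 t) - p).
- by move=> t; apply: cvgB; [exact: cc|exact: cvg_cst].
- by rewrite subr_eq0; apply/eqP; apply: gp; exact: clamp01_range.
by exists th; split=> // t ht; have := hth t ht; rewrite clamp01_id.
Qed.

Lemma angle_dot g p p' th th' t : angle_along g p th -> angle_along g p' th' -> 0 <= t <= 1 ->
  dot (g t - p) (g t - p') = enorm (g t - p) * enorm (g t - p') * cos (th' t - th t) /\
  cross (g t - p) (g t - p') = enorm (g t - p) * enorm (g t - p') * sin (th' t - th t).
Proof.
move=> [_ h] [_ h'] ht; move: (h t ht) (h' t ht); rewrite -dot_ez -cross_ez.
move: (enorm (g t - p)) (enorm (g t - p')) (ez _) (ez _) => a b u w -> ->.
by rewrite /dot /cross /= /GRing.scale /=; split; ring.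
Qed.

(** Signed angle under which [v] sees [p] and [p'], exact only when it is acute. It depends on the
    point alone, so its values at vertices cancel in a flow. *)
Definition angle_at p p' v : R := asin (cross (v - p) (v - p') / (enorm (v - p) * enorm (v - p'))).

Lemma angle_atE g p p' th th' t : angle_along g p th -> angle_along g p' th' -> 0 <= t <= 1 ->
  g t <> p -> g t <> p' -> angle_at p p' (g t) = asin (sin (th' t - th t)).
Proof.
move=> h h' ht n n'; rewrite /angle_at (angle_dot h h' ht).2 mulrC mulKf //.
by rewrite mulf_neq0 // enorm_eq0 subr_eq0; apply/eqP.
Qed.

Lemma asin_sin_period (x y : R) : 0 < cos x ->
  let c := x - asin (sin x) in cos (y - c) = cos y /\ sin (y - c) = sin y.
Proof.
move=> cx /=; set a := asin (sin x).
have sa : sin a = sin x by apply: asinK; rewrite in_itv /= sin_geN1 sin_le1.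
have ca : cos a = cos x.
  rewrite /a cos_asin; last by rewrite sin_geN1 sin_le1.
  by rewrite -cos2sin2 sqrtr_sqr gtr0_norm.
have e1 : cos (x - a) = 1 by rewrite cosB ca sa -!expr2 cos2Dsin2.
have e2 : sin (x - a) = 0 by rewrite sinB ca sa mulrC subrr.
by split; [rewrite cosB|rewrite sinB]; rewrite e1 e2 mulr1 mulr0 ?addr0 ?subr0.
Qed.

Lemma ivt_between f (a b v : R) : continuous f -> a <= b -> (f a <= v <= f b) || (f b <= v <= f a) ->
  exists2 t, a <= t <= b & f t = v.
Proof.
move=> cf ab h; have [|t ht <-] := @IVT R f a b v ab (within_of_continuous (A := `[a, b]) cf).
  by case/orP: h => /andP[h1 h2]; rewrite ge_min le_max h1 h2 ?orbT.
by exists t => //; move: ht; rewrite in_itv.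
Qed.

Lemma asin_range (x : R) : 0 < cos x -> - (pi / 2) < asin (sin x) < pi / 2.
Proof.
move=> cx; have h : - 1 < sin x < 1.
  have cs := cos2Dsin2 x; have : 0 < cos x ^+ 2 by rewrite exprn_gt0.
  by move=> h; apply/andP; split; rewrite ltNge; apply/negP => h2; nra.
by case/andP: h => h1 h2; rewrite -ltr_norml ltr_norml asin_gtNpi2 ?asin_ltpi2 ?h1 ?h2 ?ltW.
Qed.

(** While the cosine is positive, [f] minus the arcsine of its sine is a multiple of [2 * pi], and
    [f] cannot pass from one multiple to another. *)
Lemma small_change f : continuous f -> (forall t, 0 <= t <= 1 -> 0 < cos (f t)) ->
  f 1 - asin (sin (f 1)) = f 0 - asin (sin (f 0)).
Proof.
move=> cf pos; have c0 : 0 < cos (f 0) by apply: pos; rewrite lexx ler01.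
have c1 : 0 < cos (f 1) by apply: pos; rewrite lexx ler01.
set c := f 0 - asin (sin (f 0)).
have per y := asin_sin_period y c0; rewrite /= -/c in per.
have r0 := asin_range c0.
have cfc : continuous (fun t => f t - c) by move=> t; apply: cvgB; [exact: cf|exact: cvg_cst].
have nz t : 0 <= t <= 1 -> f t - c != pi / 2 /\ f t - c != - (pi / 2).
  by move=> ht; split; apply: contraTneq (pos t ht) => h; rewrite -(per (f t)).1 h ?cosN cos_pihalf ltxx.
have f0E : f 0 - c = asin (sin (f 0)) by rewrite /c; ring.
have r1 : - (pi / 2) < f 1 - c < pi / 2.
  have pi0 := pi_gt0 R; apply/andP; split; rewrite ltNge; apply/negP => h.
    have [|t ht tE] := @ivt_between (fun t => f t - c) 0 1 (- (pi / 2)) cfc ler01.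
      by apply/orP; right; rewrite f0E h /= ltW //; case/andP: r0.
    by have := (nz t ht).2; rewrite tE eqxx.
  have [|t ht tE] := @ivt_between (fun t => f t - c) 0 1 (pi / 2) cfc ler01.
    by apply/orP; left; rewrite f0E h andbT ltW //; case/andP: r0.
  by have := (nz t ht).1; rewrite tE eqxx.
have : asin (sin (f 1)) = f 1 - c.
  by rewrite -(per (f 1)).2 sinK // in_itv /=; case/andP: r1 => *; rewrite !ltW.
by move=> ->; ring.
Qed.

Lemma half_jump f : continuous f -> 0 < cos (f 0) -> (forall t, 0 < t < 1 -> 0 < sin (f t)) ->
  cos (f 1) = -1 -> f 1 = f 0 - asin (sin (f 0)) + pi.
Proof.
move=> cf c0 pos c1; set c := f 0 - asin (sin (f 0)).
have per y := asin_sin_period y c0; rewrite /= -/c in per.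
have r0 := asin_range c0; have pi0 := pi_gt0 R.
have cfc : continuous (fun t => f t - c) by move=> t; apply: cvgB; [exact: cf|exact: cvg_cst].
have f0E : f 0 - c = asin (sin (f 0)) by rewrite /c; ring.
have cE1 : cos (f 1 - c) = -1 by rewrite (per _).1.
have mid (v : R) : (f 0 - c < v < f 1 - c) || (f 1 - c < v < f 0 - c) -> 0 < sin v.
  move=> h; have [|t /andP[t0 t1] tE] := @ivt_between (fun t => f t - c) 0 1 v cfc ler01.
    by case/orP: h => /andP[h1 h2]; apply/orP; [left|right]; rewrite !ltW.
  rewrite -tE (per _).2; apply: pos; rewrite !lt_neqAle t0 t1 !andbT.
  by apply/andP; split; apply: contraTneq h => e; rewrite -tE; [rewrite -e|rewrite e]; rewrite !ltxx ?andbF.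
rewrite f0E in mid; case/andP: r0 => ra rb.
have up : f 1 - c <= pi.
  rewrite leNgt; apply/negP => h.
  have hb : (asin (sin (f 0)) < pi < f 1 - c) || (f 1 - c < pi < asin (sin (f 0))).
    by apply/orP; left; apply/andP; split; lra.
  by have := mid pi hb; rewrite sinpi ltxx.
have lo : - pi < f 1 - c.
  rewrite ltNge; apply/negP => h.
  have hb : (asin (sin (f 0)) < - (3 * pi / 4) < f 1 - c) || (f 1 - c < - (3 * pi / 4) < asin (sin (f 0))).
    by apply/orP; right; apply/andP; split; lra.
  have := mid _ hb; rewrite sinN.
  have : 0 < sin (3 * pi / 4 : R) by apply: sin_gt0_pi; apply/andP; split; lra.
  lra.
have : f 1 - c - pi = 0.
  apply: cos_eq1; first by apply/andP; split; lra.
  by rewrite -[LHS]opprK -cosDpi subrK cE1 opprK.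
lra.
Qed.

(** Two half jumps: from an acute angle through positive sines up to [pi], then on through negative
    sines. The second is the first with time reversed and sign changed. *)
Lemma full_jump f t0 : continuous f -> 0 < t0 < 1 -> 0 < cos (f 0) -> 0 < cos (f 1) -> cos (f t0) = -1 ->
  (forall t, 0 < t < t0 -> 0 < sin (f t)) -> (forall t, t0 < t < 1 -> sin (f t) < 0) ->
  f 1 - asin (sin (f 1)) - (f 0 - asin (sin (f 0))) = 2 * pi.
Proof.
move=> cf /andP[t00 t01] c0 c1 ct s1 s2.
have clin (a b : R) : continuous (fun t => f (a + b * t)).
  move=> t; apply: (@continuous_comp _ _ _ (fun t => a + b * t) f); last exact: cf.
  by apply: cvgD; [exact: cvg_cst|apply: cvgM; [exact: cvg_cst|exact: cvg_id]].
have h1 : f t0 = f 0 - asin (sin (f 0)) + pi.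
  have := @half_jump (fun t => f (0 + t0 * t)) (clin 0 t0); rewrite /= mulr0 mulr1 !add0r; apply=> //.
  by move=> t /andP[ta tb]; apply: s1; rewrite add0r mulr_gt0 //= gtr_pMr.
have cN : continuous (fun t => - f (1 + (t0 - 1) * t)) by move=> t; apply: cvgN; exact: clin.
have aN : asin (- sin (f 1)) = - asin (sin (f 1)).
  rewrite -{1}[sin (f 1)]asinK; last by rewrite in_itv /= sin_geN1 sin_le1.
  by rewrite -sinN sinK // in_itv /= lerN2 lerNl; case/andP: (asin_range c1) => *; rewrite !ltW.
have h2 : - f t0 = - f 1 + asin (sin (f 1)) + pi.
  have := @half_jump (fun t => - f (1 + (t0 - 1) * t)) cN.
  rewrite /= mulr0 mulr1 addr0 subrKC !cosN sinN aN opprK; apply=> //.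
  move=> t /andP[ta tb]; rewrite sinN oppr_gt0; apply: s2; apply/andP; split; nra.
lra.
Qed.

End AngleChange.

(** * Winding numbers of flows *)

Section Winding.
Variables (R : realType) (n : nat) (B : complex R n) (S : arcs B).
Hypothesis rB : regular B.
Implicit Types (e : edge B) (d : edge B * bool) (p q : plane R) (z : edge B -> R).

Lemma wind_exists : exists W : edge B -> plane R -> R, forall e p, ~ support B p ->
  exists th, angle_along (curve e) p th /\ W e p = th 1 - th 0.
Proof.
have h (x : edge B * plane R) : exists w : R, ~ support B x.2 ->
    exists th, angle_along (curve x.1) x.2 th /\ w = th 1 - th 0.
  have [sp|nsp] := pselect (support B x.2); first by exists 0.
  have [|th hth] := angle_along_exists (@curve_continuous R B x.1) (p := x.2).
    by move=> t ht e; apply: nsp; right; exists x.1, t.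
  by exists (th 1 - th 0) => _; exists th.
by have [W hW] := choice h; exists (fun e p => W (e, p)) => e p /(hW (e, p)).
Qed.

Definition wind := projT1 (cid wind_exists).
(** For a flow [z] this is [2 * pi] times the winding number of the weighted edges about [p]. *)
Definition Phi z p := \sum_e z e * wind e p.

Lemma windP e p : ~ support B p -> exists th, angle_along (curve e) p th /\ wind e p = th 1 - th 0.
Proof. by rewrite /wind; case: cid => W hW /=; exact: hW. Qed.

Definition turning_at p p' (v : vertex B) := angle_at p p' (position v).

Lemma curve_off e p t : ~ support B p -> 0 <= t <= 1 -> curve e t <> p.
Proof. by move=> np ht e0; apply: np; right; exists e, t. Qed.

Lemma turning_ends e p p' th th' : ~ support B p -> ~ support B p' ->
  angle_along (curve e) p th -> angle_along (curve e) p' th' ->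
  turning_at p p' (edge_end (e, true)) = asin (sin (th' 1 - th 1)) /\
  turning_at p p' (edge_end (e, false)) = asin (sin (th' 0 - th 0)).
Proof.
move=> np np' h h'; rewrite /turning_at -curve1 -curve0.
by split; apply: angle_atE => //; rewrite ?lexx ?ler01 //; apply: curve_off; rewrite ?lexx ?ler01.
Qed.

Lemma angle_cos_gt0 e p p' th th' t : ~ support B p -> ~ support B p' ->
  angle_along (curve e) p th -> angle_along (curve e) p' th' -> 0 <= t <= 1 ->
  (0 < dot (curve e t - p) (curve e t - p')) = (0 < cos (th' t - th t)) /\
  ((0 < cross (curve e t - p) (curve e t - p')) = (0 < sin (th' t - th t)) /\
   (cross (curve e t - p) (curve e t - p') < 0) = (sin (th' t - th t) < 0)).
Proof.
move=> np np' h h' ht; have [-> ->] := angle_dot h h' ht.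
have pos : 0 < enorm (curve e t - p) * enorm (curve e t - p').
  by rewrite mulr_gt0 // enorm_gt0 subr_eq0; apply/eqP; apply: curve_off.
by rewrite !(pmulr_rgt0 _ pos) (pmulr_rlt0 _ pos).
Qed.

Lemma angle_continuous (th th' : R -> R) : continuous th -> continuous th' -> continuous (fun t => th' t - th t).
Proof. by move=> c c' t; apply: cvgB; [exact: c'|exact: c]. Qed.

(** Along [e] the angle between the directions to [p] and [p'] stays acute, so its change is exactly
    the difference of the arcsines at the two ends. *)
Lemma wind_change e p p' : ~ support B p -> ~ support B p' ->
  (forall t, 0 <= t <= 1 -> 0 < dot (curve e t - p) (curve e t - p')) ->
  wind e p' - wind e p = turning_at p p' (edge_end (e, true)) - turning_at p p' (edge_end (e, false)).
Proof.
move=> np np' pos; have [th [h ->]] := windP e np; have [th' [h' ->]] := windP e np'.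
have [-> ->] := turning_ends np np' h h'.
have := @small_change R (fun t => th' t - th t) (angle_continuous h.1 h'.1); rewrite /= => sc.
have {}sc := sc (fun t ht => etrans (esym (angle_cos_gt0 np np' h h' ht).1) (pos t ht)); lra.
Qed.

(** Kirchhoff's law in weak form, tested against all functions on the vertices; it is applied to
    [turning_at]. *)
Definition flow z := forall A : vertex B -> R,
  \sum_e z e * (A (edge_end (e, true)) - A (edge_end (e, false))) = 0.

Lemma Phi_near z p p' : flow z -> ~ support B p -> ~ support B p' ->
  (forall q, support B q -> 0 < dot (q - p) (q - p')) -> Phi z p' = Phi z p.
Proof.
move=> fz np np' pos; apply/eqP; rewrite -subr_eq0 /Phi -sumrB; apply/eqP.
rewrite -[RHS](fz (turning_at p p')); apply: eq_bigr => e _; rewrite -mulrBr wind_change //.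
by move=> t ht; apply: pos; right; exists e, t.
Qed.

Lemma Phi_local z p : flow z -> ~ support B p -> exists2 r : R, 0 < r &
  forall q, edist q p < r -> ~ support B q /\ Phi z q = Phi z p.
Proof.
move=> fz np; have /openP/(_ p np)[r r0 hr] := @open_complement R B.
exists r => // q qp; have nq := hr q qp; split=> //; apply: Phi_near => // x sx.
have h : r <= enorm (x - p) by rewrite leNgt; apply/negP => h; exact: (hr x h).
have -> : dot (x - p) (x - q) = dot (x - p) (x - p) - dot (x - p) (q - p).
  by rewrite /dot /=; ring.
have := dot_le (x - p) (q - p); rewrite -enorm_sqr; move: qp; rewrite /edist.
move: (enorm (x - p)) h (enorm (q - p)) (enorm_ge0 (q - p)) => a ha b b0; nra.
Qed.

Definition level z (c : R) := [set p | ~ support B p /\ Phi z p = c].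

(** [Phi z] is locally constant off the graph, so its levels are open and closed there. *)
Lemma level_face_closed z c : flow z -> face_closed B (level z c).
Proof.
move=> fz p [np pc]; split=> // q hq.
have nq : ~ support B q by exact: (connected_component_sub hq).
split=> //.
have oU : open (level z c).
  apply/openP => x [nx xc]; have [r r0 hr] := Phi_local fz nx.
  by exists r => // y /hr[ny yx]; split=> //; rewrite yx.
have oV : open [set x | ~ support B x /\ Phi z x <> c].
  apply/openP => x [nx xc]; have [r r0 hr] := Phi_local fz nx.
  by exists r => // y /hr[ny yx]; split=> //; rewrite yx.
set C := connected_component (~` support B) p in hq.
have pC : C p by exact: connected_component_refl.
have : C `&` level z c = C.
  apply: (@component_connected _ (~` support B) p).
  - by exists p; split.
  - by exists (level z c).
  exists (~` [set x | ~ support B x /\ Phi z x <> c]); first exact: open_closedC.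
  apply/seteqP; split=> x [Cx h]; split=> //; first by case=> _; apply; case: h.
  have nx : ~ support B x by exact: (connected_component_sub Cx).
  by split=> //; apply: contrapT => xc; apply: h.
by move=> E; have [_ []] : (C `&` level z c) q by rewrite E.
Qed.

(** The disc of radius [h] about the midpoint meets no other edge, and the normal diameter meets the
    graph in the midpoint only; its ends are the two points compared in [Phi_jump]. *)
Lemma halo_exists e : exists h : R, [/\ 0 < h,
  (forall x h', x = 1 \/ x = -1 -> 0 < h' <= h -> ~ support B (mid S e + (x * h') *: dnor S (e, false) (arc_l S e / 2))) &
  forall q, support B q -> edist q (mid S e) <= h -> exists2 s : R, 0 < s < arc_l S e & q = dpt S (e, false) s].
Proof.
have [r r0 cl] := edge_clear rB (half_len S e).
pose k := arc_k S e; pose m := Num.min (r / 2) (`|k| + 1)^-1.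
have k0 : 0 < `|k| + 1 by rewrite ltr_wpDl.
have m0 : 0 < m by rewrite lt_min divr_gt0 //= invr_gt0.
have [m1 m2] : m <= r / 2 /\ m <= (`|k| + 1)^-1 by rewrite /m !ge_min !lexx orbT.
exists m; split=> // [x h' hx /andP[h0 hm]|q sq hq]; last first.
  by apply: (cl q _).1 => //; rewrite -/(mid S e); lra.
move=> sp; have [|s hs E] := (cl _ _).1 sp.
  rewrite edist_shift ?dnor_norm //.
  have -> : `|x * h'| = h' by rewrite normrM (gtr0_norm h0); case: hx => ->; rewrite ?normrN normr1 mul1r.
  lra.
have := dside_normal S (e, false) (arc_l S e / 2) (x * h'); rewrite -/(mid S e) E dside_arc.
rewrite -[dk S (e, false)]/k => h.
have kb : k * h' < 1 /\ - 1 < k * h'.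
  have : `|k| * h' < 1.
    have : (`|k| + 1) * h' <= 1 by rewrite mulrC -ler_pdivlMr // div1r; lra.
    by rewrite mulrDl mul1r; lra.
  by rewrite -{1}(gtr0_norm h0) -normrM ltr_norml => /andP[? ?]; split; lra.
have : h' * (x - k / 2 * h' * (x * x)) = 0 by rewrite [RHS]h; ring.
by move/eqP; rewrite mulf_eq0 gt_eqF //= => /eqP; case: hx => -> ; lra.
Qed.

Definition halo e := projT1 (cid (halo_exists e)).

Definition side_pt d := dpt S d (dlen S d / 2) + halo d.1 *: dnor S d (dlen S d / 2).

Lemma haloP e : [/\ 0 < halo e,
  (forall x h', x = 1 \/ x = -1 -> 0 < h' <= halo e -> ~ support B (mid S e + (x * h') *: dnor S (e, false) (arc_l S e / 2))) &
  forall q, support B q -> edist q (mid S e) <= halo e -> exists2 s : R, 0 < s < arc_l S e & q = dpt S (e, false) s].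
Proof. by rewrite /halo; case: cid. Qed.

Lemma dart_mid d h : dpt S d (dlen S d / 2) + h *: dnor S d (dlen S d / 2) =
  mid S d.1 + ((if d.2 then -1 else 1) * h) *: dnor S (d.1, false) (arc_l S d.1 / 2).
Proof.
case: d => e [] /=; last by rewrite mul1r.
have E : dlen S (e, true) - dlen S (e, true) / 2 = dlen S (e, false) / 2 by rewrite /dlen /=; field.
rewrite -[(e, true)]/(rev (e, false)) dpt_rev dnor_rev -[dlen S (rev _)]/(dlen S (e, true)).
rewrite -[dlen S (e, false) - _]/(dlen S (e, true) - dlen S (e, true) / 2) E.
by rewrite mulN1r scaleNr scalerN.
Qed.

Lemma side_pt_level z d : flow z -> near_left S d (level z (Phi z (side_pt d))).
Proof.
move=> fz; have [h0 clr _] := haloP d.1.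
have sgn : (if d.2 then -1 else 1) = (1 : R) \/ (if d.2 then -1 else 1) = (-1 : R) by case: d.2; [right|left].
have off h' : 0 < h' <= halo d.1 -> ~ support B (dpt S d (dlen S d / 2) + h' *: dnor S d (dlen S d / 2)).
  by move=> hh; rewrite dart_mid; exact: (clr _ _ sgn hh).
apply: (near_left_intro (level_face_closed fz) (s := dlen S d / 2) _ h0 off).
  by have := dlen_gt0 S d => h; apply/andP; split; lra.
by split=> //; apply: off; rewrite h0 lexx.
Qed.

Lemma Phi_turn z d : flow z -> Phi z (side_pt (rev (turn S rB d))) = Phi z (side_pt d).
Proof.
move=> fz; have h1 := @side_pt_level z (rev (turn S rB d)) fz.
have h2 := (near_left_turn S rB d (@level_face_closed z (Phi z (side_pt d)) fz)).1 (@side_pt_level z d fz).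
by have [p [[_ <-] [_ <-]]] := near_left_meet h1 h2.
Qed.

Lemma side_pt_lab d : region B (lab S d) (side_pt d).
Proof.
have [h0 clr _] := haloP d.1.
have sgn : (if d.2 then -1 else 1) = (1 : R) \/ (if d.2 then -1 else 1) = (-1 : R) by case: d.2; [right|left].
have off h' : 0 < h' <= halo d.1 -> ~ support B (dpt S d (dlen S d / 2) + h' *: dnor S d (dlen S d / 2)).
  by move=> hh; rewrite dart_mid; exact: (clr _ _ sgn hh).
have hs : 0 < dlen S d / 2 < dlen S d by have := dlen_gt0 S d => h; apply/andP; split; lra.
have [i ri] : exists i, region B i (side_pt d).
  by apply: (@region_exists R n B); apply: off; rewrite h0 lexx.
by rewrite (lab_uniq (near_left_intro (@region_face_closed R n B i) hs h0 off ri)).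
Qed.

Lemma mid_arc_sign e s : 0 < s < arc_l S e ->
  let T := ez (ang S e) in let w := dpt S (e, false) s - mid S e in
  (s < arc_l S e / 2 -> dot w T < 0) /\ (arc_l S e / 2 < s -> 0 < dot w T).
Proof.
move=> /andP[s0 sl] T w; set x := s - arc_l S e / 2; set k := arc_k S e.
have wE : dot w T = (arc_pt 0 0 k x).1.
  have -> : w = frame (mid S e) (ang S e) (arc_pt 0 0 k x) - mid S e.
    rewrite frame_arc /w /x; congr (_ - _).
    by rewrite /dpt -{1}(subrKC (arc_l S e / 2) s) arc_ptD.
  by rewrite -[LHS]/((coord (mid S e) (ang S e) (frame (mid S e) (ang S e) (arc_pt 0 0 k x))).1) frameK.
have pos y : 0 < y < arc_l S e / 2 -> 0 < (arc_pt 0 0 k y).1.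
  move=> /andP[y0 yl]; rewrite /arc_pt; case: eqVneq => [_|k0]; rewrite /= /GRing.scale /= ?cos0 ?sin0 add0r ?mulr1 //.
  have tl : `|k| * y < pi.
    have := arc_turn S e; rewrite -/k => tl; apply: lt_le_trans (_ : `|k| * (arc_l S e / 2) <= pi); last by lra.
    by rewrite ltr_pM2l // normr_gt0.
  have -> : k^-1 * (- 0 - - sin (0 + k * y)) = `|k|^-1 * sin (`|k| * y).
    rewrite oppr0 sub0r opprK add0r; case: (ger0P k) => // _.
    by rewrite mulNr sinN invrN mulrNN.
  by rewrite mulr_gt0 ?invr_gt0 ?normr_gt0 // sin_gt0_pi // tl mulr_gt0 // normr_gt0.
rewrite wE; split=> h; last by apply: pos; rewrite /x; apply/andP; split; lra.
have : 0 < (arc_pt 0 0 k (- x)).1 by apply: pos; rewrite /x; apply/andP; split; lra.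
by rewrite (arc_even k x).1 oppr_gt0.
Qed.

(** Going from right to left of [e], every edge contributes the difference of a vertex function, and
    these sum to zero. On [e] itself the angle passes [pi] at the midpoint, which adds [2 * pi]. *)
Lemma Phi_jump z e : flow z -> Phi z (side_pt (e, false)) - Phi z (side_pt (e, true)) = 2 * pi * z e.
Proof.
move=> fz; have [h0 clr iso] := haloP e; set h := halo e in h0 clr iso.
set N := dnor S (e, false) (arc_l S e / 2) in clr.
have N1 : enorm N = 1 by exact: dnor_norm.
set p' := side_pt (e, false); set p := side_pt (e, true).
have p'E : p' = mid S e + h *: N by rewrite /p' /side_pt dart_mid mul1r.
have pE : p = mid S e - h *: N by rewrite /p /side_pt dart_mid mulN1r scaleNr.
have np' : ~ support B p' by rewrite p'E -[h]mul1r; apply: clr; [left|rewrite h0 lexx].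
have np : ~ support B p by rewrite pE -scaleNr -mulN1r; apply: clr; [right|rewrite h0 lexx].
(* Thales: exactly the points outside the circle with diameter [p p'] see the two points under an
   acute angle. *)
have dotE q : dot (q - p) (q - p') = edist q (mid S e) ^+ 2 - h ^+ 2.
  have NN : dot N N = 1 by rewrite -enorm_sqr N1 expr1n.
  rewrite /edist enorm_sqr -[h ^+ 2]mulr1 -NN p'E pE /dot /= /GRing.scale /=; ring.
have crossE q : cross (q - p) (q - p') = - 2 * h * dot (q - mid S e) (ez (ang S e)).
  rewrite pE p'E /N /dnor -/(ang S e) /cross /dot /ez /rot /= /GRing.scale /=; ring.
have far q : support B q -> (forall s : R, 0 < s < arc_l S e -> q <> dpt S (e, false) s) -> 0 < dot (q - p) (q - p').
  move=> sq nq; rewrite dotE subr_gt0 ltrXn2r // ?nnegrE ?enorm_ge0 ?ltW // ltNge.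
  by apply/negP => hq; have [s hs E] := iso q sq hq; exact: (nq s hs).
have vfar (v : vertex B) : 0 < dot (position v - p) (position v - p').
  apply: far; first by left; exists v.
  by move=> s hs E; exact: (@dpt_vertex R B S (e, false) s v hs (esym E)).
have other e' : e' != e -> wind e' p' - wind e' p =
    turning_at p p' (edge_end (e', true)) - turning_at p p' (edge_end (e', false)).
  move=> ee; apply: wind_change => // t ht; have [/andP[t0 t1]|] := boolP (0 < t < 1); last first.
    case/andP: ht => t0 t1; rewrite negb_and -!leNgt => /orP[hh|hh].
      by rewrite (_ : t = 0) ?curve0 //; apply/eqP; rewrite eq_le hh t0.
    by rewrite (_ : t = 1) ?curve1 //; apply/eqP; rewrite eq_le hh t1.
  apply: far; first by right; exists e', t.
  have t01 : 0 < t < 1 by rewrite t0.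
  move=> s hs E; have hs' := @arc_sig_range R B S e' t t01.
  have E' : dpt S (e, false) s = dpt S (e', false) (arc_sig S e' t) by rewrite -E (edge_param S e' ht).
  have : e' = e by case: (@dpt_inj R B S (e, false) (e', false) _ _ hs hs' E') => -[/(congr1 fst)].
  by move/eqP; rewrite (negbTE ee).
have self : wind e p' - wind e p =
    turning_at p p' (edge_end (e, true)) - turning_at p p' (edge_end (e, false)) + 2 * pi.
  have [th [a ->]] := windP e np; have [th' [a' ->]] := windP e np'.
  have [-> ->] := turning_ends np np' a a'.
  have [t0 t01 t0E] := @edge_param_inv R B S (e, false) _ (half_len S e).
  have sgn t : 0 < t < 1 -> (t < t0 -> 0 < sin (th' t - th t)) /\ (t0 < t -> sin (th' t - th t) < 0).
    move=> ht; have ht' : 0 <= t <= 1 by case/andP: ht => *; rewrite !ltW.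
    have [_ [<- <-]] := angle_cos_gt0 np np' a a' ht'.
    have ht0 : 0 <= t0 <= 1 by case/andP: t01 => *; rewrite !ltW.
    have st0 : arc_sig S e t0 = arc_l S e / 2.
      have hs' := @arc_sig_range R B S e t0 t01.
      have E : dpt S (e, false) (arc_sig S e t0) = dpt S (e, false) (arc_l S e / 2) by rewrite -(edge_param S e ht0).
      by case: (@dpt_inj R B S (e, false) (e, false) _ _ hs' (half_len S e) E) => -[] // /(congr1 snd).
    have [m1 m2] := mid_arc_sign (@arc_sig_range R B S e t ht).
    have inc := arc_sig_inc (arcsP S e).
    rewrite crossE (edge_param S e ht'); move: (dot _ _) m1 m2 => x m1 m2.
    case/andP: ht => ta tb; case/andP: ht0 => tc td.
    split=> lt.
      have : x < 0 by apply: m1; rewrite -st0; exact: inc (ltW ta) lt td.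
      by move=> *; nra.
    have : 0 < x by apply: m2; rewrite -st0; exact: inc tc lt (ltW tb).
    by move=> *; nra.
  have := @full_jump R (fun t => th' t - th t) t0 (angle_continuous a.1 a'.1) t01.
  rewrite /= => fj; have : th' 1 - th 1 - asin (sin (th' 1 - th 1)) - (th' 0 - th 0 - asin (sin (th' 0 - th 0))) = 2 * pi.
    case/andP: (t01) => ta tb; apply: fj.
    - rewrite -(angle_cos_gt0 np np' a a' _).1 ?lexx ?ler01 // curve0; exact: vfar.
    - rewrite -(angle_cos_gt0 np np' a a' _).1 ?lexx ?ler01 // curve1; exact: vfar.
    - have ht0 : 0 <= t0 <= 1 by rewrite !ltW.
      have := (angle_dot a a' ht0).1.
      have c0 : curve e t0 = mid S e := t0E.
      have e1 : enorm (mid S e - p) = h by rewrite pE opprB addrC subrK enormZ N1 mulr1 gtr0_norm.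
      have e2 : enorm (mid S e - p') = h.
        by rewrite p'E opprD addrA subrr sub0r enormN enormZ N1 mulr1 gtr0_norm.
      rewrite c0 dotE /edist subrr enorm0 e1 e2 => E.
      apply: (mulfI (expf_neq0 2 (lt0r_neq0 h0))); rewrite mulrN1 expr2 -E expr0n /=; ring.
    - by move=> t /andP[ua ub]; apply: (sgn t _).1 => //; apply/andP; split; lra.
    - by move=> t /andP[ua ub]; apply: (sgn t _).2 => //; apply/andP; split; lra.
  lra.
rewrite /Phi -sumrB (bigD1 e) //=; under eq_bigr => e' ee do rewrite -mulrBr other //.
have := fz (turning_at p p'); rewrite (bigD1 e) //= -mulrBr self.
move: (\sum_(_ | _) _) (turning_at _ _ _) (turning_at _ _ _) => T u w hf; lra.
Qed.

End Winding.

From mathcomp Require Import fingroup perm.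

(** * Boundary walks and the rank of the space of flows *)

Section Orbits.
Variables (R : realType) (n : nat) (B : complex R n) (S : arcs B).
Hypothesis rB : regular B.
Hypothesis noch : ~ exists C, empty_chamber B C.
Notation dart := (edge B * bool)%type.
Implicit Types (e : edge B) (d : dart) (p q : plane R) (z : edge B -> R).

(** Outside a disc that contains the graph, any point can be rotated to direction 0 and then moved
    radially. *)
Lemma Phi_far z (M : R) p : flow z -> 0 < M -> (forall q, support B q -> enorm q < M) -> M <= enorm p ->
  Phi z p = Phi z (M *: ez 0).
Proof.
move=> fz M0 hM Mp.
have far q : M <= enorm q -> ~ support B q by move=> h /hM; rewrite ltNge h.
have p0 : p != 0 by rewrite -enorm_gt0; lra.
have [s _ pE] := polar p0; set rho := enorm p in pE Mp.
have l0 : level z (Phi z p) (rho *: ez s) by rewrite -pE; split=> //; exact: far.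
have nrm (a t : R) : M <= a -> M <= enorm (a *: ez t).
  by move=> h; rewrite enormZ ez_norm mulr1 ger0_norm //; lra.
have fc := level_face_closed (c := Phi z p) fz.
have l1 : level z (Phi z p) (rho *: ez 0).
  apply: (face_closed_path (f := fun t => rho *: ez t) (a := s) fc) l0.
    by move=> t; apply: cvgZ; [exact: cvg_cst|exact: ez_continuous].
  by move=> t _; apply: far; exact: nrm.
have [_ <-] : level z (Phi z p) (M *: ez 0); last by [].
apply: (face_closed_path (f := fun t => t *: ez 0) (a := rho) fc) l1.
  by move=> t; apply: cvgZ; [exact: cvg_id|exact: cvg_cst].
by move=> t /andP[t0 t1]; apply: far; apply: nrm; nra.
Qed.

(** Without empty chambers every component of the exterior is unbounded and so reaches the outside
    of a large disc, where [Phi z] is constant. *)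
Lemma Phi_exterior z : flow z -> exists c, forall d, lab S d = None -> Phi z (side_pt S rB d) = c.
Proof.
move=> fz; have [M M0 hM] := @bounded_support R B.
exists (Phi z (M *: ez 0)) => d ld; have := side_pt_lab S rB d; rewrite ld.
set p := side_pt S rB d => rp; set C := connected_component (region B None) p.
have Cp : C p by exact: connected_component_refl.
have [[q [Cq Mq]]|nq] := pselect (exists q, C q /\ M <= enorm q); last first.
  exfalso; apply: noch; exists C; split; last by exists p.
  exists M; split; first exact: num_real.
  move=> N MN q Cq; apply: le_trans (norm_le_enorm q) _; apply: le_trans (ltW MN).
  by rewrite leNgt; apply/negP => h; apply: nq; exists q; split=> //; exact: ltW.
rewrite -(Phi_far fz M0 hM Mq); symmetry.
have np : ~ support B p := region_compl rp.
have cq : connected_component (~` support B) p q.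
  apply: (@component_max R (~` support B) C) => //; first exact: component_connected.
  move=> x Cx; have rx : region B None x by exact: (connected_component_sub Cx).
  exact: region_compl rx.
by have [] := (level_face_closed (c := Phi z p) fz (conj np erefl)).2 q cq.
Qed.

(** The dart before [d] on the boundary walk of the face to its left: it ends where [d] starts and
    has the same face on its left. *)
Definition back d := rev (turn S rB d).

Lemma back_inj : injective back.
Proof. by move=> d d' /(can_inj (@revK R B)) /turn_inj. Qed.

Definition step : {perm dart} := perm back_inj.

Lemma stepE d : step d = rev (turn S rB d).
Proof. by rewrite permE. Qed.

Lemma porbit_inv (T : Type) (F : dart -> T) : (forall d, F (step d) = F d) ->
  forall d d', d' \in porbit step d -> F d' = F d.
Proof.
move=> h d d' /porbitP[i ->]; elim: i => [|i ih]; first by rewrite expg0 perm1.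
by rewrite expgSr permM h.
Qed.

Lemma lab_step d : lab S (step d) = lab S d.
Proof. by rewrite stepE lab_turn. Qed.

(* The boundary walks of the interior regions, region on the left. *)
Definition Oint := [set o in porbits step | [exists d in o, lab S d != None]].

Lemma Oint_mem o d : o \in Oint -> d \in o -> o = porbit step d /\ lab S d != None.
Proof.
rewrite inE => /andP[/imsetP[d0 _ ->] /exists_inP[d1 h1 l1]] hd.
have -> : porbit step d0 = porbit step d by apply/eqP; rewrite eq_porbit_mem porbit_sym.
by split=> //; rewrite (porbit_inv lab_step hd) -(porbit_inv lab_step h1).
Qed.

Lemma Oint_porbit d : lab S d != None -> porbit step d \in Oint.
Proof.
move=> ld; rewrite inE; apply/andP; split; first by apply/imsetP; exists d.
by apply/exists_inP; exists d; rewrite ?porbit_id.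
Qed.

(** Its rows are the interior boundary walks as combinations of oriented edges. [Inc] is the
    incidence matrix, whose left kernel is the space of flows. *)
Let D : 'M[R]_(#|Oint|, #|edge B|) :=
  \matrix_(i < #|Oint|, j < #|edge B|) (((enum_val j, false) \in (enum_val i : {set dart}))%:R -
                                      ((enum_val j, true) \in (enum_val i : {set dart}))%:R).
Let Inc : 'M[R]_(#|edge B|, #|vertex B|) :=
  \matrix_(j, v) ((edge_end (enum_val j, true) == enum_val v)%:R - (edge_end (enum_val j, false) == enum_val v)%:R).

Lemma sum_delta (I : finType) (A : I -> R) (i : I) : \sum_j A j * (i == j)%:R = A i.
Proof.
rewrite (bigD1 i) //= eqxx mulr1 big1 ?addr0 // => j ji.
by rewrite eq_sym (negbTE ji) mulr0.
Qed.

Lemma kernel_flow (z : 'rV[R]_#|edge B|) : z *m Inc = 0 -> flow (fun e : edge B => z 0 (enum_rank e)).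
Proof.
move=> hz A.
transitivity (\sum_(v : vertex B) A v * (z *m Inc) 0 (enum_rank v)); last first.
  by rewrite hz big1 // => v _; rewrite mxE mulr0.
under [RHS]eq_bigr => v _ do rewrite mxE mulr_sumr.
rewrite exchange_big /= -(sum_edges (fun e => z 0 (enum_rank e) * _)); apply: eq_bigr => j _.
rewrite enum_valK.
under eq_bigr => v _ do rewrite [Inc j _]mxE enum_rankK mulrCA.
rewrite -mulr_sumr; congr (_ * _).
under eq_bigr => v _ do rewrite mulrBr.
by rewrite sumrB !sum_delta.
Qed.

(** By [Phi_jump] a flow is [g] on the left minus [g] on the right, where [g] is the winding number
    relative to the exterior. As [g] is constant along walks and 0 on exterior darts, the flow is
    the combination of interior walks with coefficients [g]. *)
Lemma kernel_sub : (kermx Inc <= D)%MS.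
Proof.
apply/row_subP => i0; set zr := row i0 (kermx Inc).
have hz : zr *m Inc = 0 by rewrite -row_mul mulmx_ker row0.
have fz := kernel_flow hz; set z := fun e => _ in fz.
have [c hc] := Phi_exterior fz.
pose g d := (Phi z (side_pt S rB d) - c) / (2 * pi).
have gs d : g (step d) = g d by rewrite /g stepE Phi_turn.
have pi0 : 2 * pi != 0 :> R by rewrite mulf_neq0 // lt0r_neq0 // pi_gt0.
have zE e : z e = g (e, false) - g (e, true).
  rewrite /g -mulrBl opprB addrA subrK (Phi_jump S rB e fz).
  by rewrite mulrC mulKf.
(* The common value of [g] on the walk; the default 0 for an empty set never matters. *)
pose go (o : {set dart}) := if [pick d in o] is Some d then g d else 0.
have gd d : \sum_(o in Oint) go o * (d \in o)%:R = g d.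
  have [ld|ld] := eqVneq (lab S d) None.
    rewrite big1 => [|o ho]; first by rewrite /g hc // subrr mul0r.
    case od : (d \in o); last by rewrite mulr0.
    by have [_] := Oint_mem ho od; rewrite ld eqxx.
  rewrite (bigD1 (porbit step d)) ?Oint_porbit //= porbit_id mulr1 big1 ?addr0.
    rewrite /go; case: pickP => [d' h'|/(_ d)]; last by rewrite porbit_id.
    exact: (porbit_inv gs h').
  move=> o /andP[ho oo]; case od : (d \in o); last by rewrite mulr0.
  by have [E _] := Oint_mem ho od; rewrite E eqxx in oo.
apply/submxP; exists (\row_i go (enum_val i)); apply/rowP => j.
have -> : zr 0 j = z (enum_val j) by rewrite /z enum_valK.
rewrite zE -!gd -sumrB big_enum_val mxE; apply: eq_bigr => i _.
by rewrite !mxE mulrBr.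
Qed.

(** With [k] classes of vertices not joined by edges, [Inc] has rank at most [V - k], so there are
    at least [E - V + k] independent flows, all spanned by the walks. The case [k = 1] replaces
    Euler's formula, and [k = 2] will give connectedness. *)
Lemma flows_rank (k : nat) (comp : vertex B -> 'I_k) (s : 'I_k -> vertex B) : (forall j, comp (s j) = j) ->
  (forall e, comp (edge_end (e, true)) = comp (edge_end (e, false))) ->
  (#|edge B| + k <= #|Oint| + #|vertex B|)%N.
Proof.
move=> hs hc.
pose Cm : 'M[R]_(#|vertex B|, k) := \matrix_(v, j) (comp (enum_val v) == j)%:R.
have IC : Inc *m Cm = 0.
  apply/matrixP => j m; rewrite !mxE.
  transitivity (\sum_(v : vertex B) (((comp v == m)%:R * (edge_end (enum_val j, true) == v)%:R) -
    ((comp v == m)%:R * (edge_end (enum_val j, false) == v)%:R)) : R).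
    rewrite [RHS](reindex (@enum_val _ (fun _ : vertex B => true))) /=; last first.
      by exists enum_rank => x _; rewrite ?enum_valK ?enum_rankK.
    by apply: eq_bigr => v _; rewrite !mxE mulrC mulrBr.
  by rewrite sumrB !sum_delta hc subrr.
have rC : (k <= \rank Cm)%N.
  pose Sm : 'M[R]_(k, #|vertex B|) := \matrix_(j, v) (s j == enum_val v)%:R.
  have SC : Sm *m Cm = 1%:M.
    apply/matrixP => j m; rewrite !mxE.
    transitivity (\sum_(v : vertex B) (comp v == m)%:R * (s j == v)%:R : R).
      rewrite [RHS](reindex (@enum_val _ (fun _ : vertex B => true))) /=; last first.
        by exists enum_rank => x _; rewrite ?enum_valK ?enum_rankK.
      by apply: eq_bigr => v _; rewrite !mxE mulrC.
    by rewrite sum_delta hs.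
  by rewrite -{1}(mxrank1 R k) -SC mxrankM_maxr.
have r1 := mulmx0_rank_max IC.
have r2 := mxrankS kernel_sub; rewrite mxrank_ker in r2.
have r3 := rank_leq_row D.
have r4 := rank_leq_row Inc.
move: rC r1 r2 r3 r4; move: (\rank Cm) (\rank Inc) (\rank D) => a b c.
rewrite leq_subLR => h1 h2 h3 h4 h5.
by apply: (@leq_trans (b + c + a)); [exact: leq_add|rewrite addnAC addnC leq_add].
Qed.

End Orbits.

Lemma ez_period (R : realType) (a b : R) : ez a = ez b -> exists m : int, a = b + 2 * pi * m%:~R.
Proof.
move=> h; have pi0 := pi_gt0 R.
have per (s : R) (n : nat) : ez (s + 2 * pi * n%:R) = ez s.
  elim: n => [|n ih]; first by rewrite mulr0 addr0.
  have -> : s + 2 * pi * n.+1%:R = s + 2 * pi * n%:R + 2 * pi by rewrite -[n.+1]addn1 natrD; ring.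
  by rewrite ez_2pi.
have peri (s : R) (m : int) : ez (s + 2 * pi * m%:~R) = ez s.
  case: m => n; first by rewrite -pmulrn per.
  by rewrite NegzE mulrNz -pmulrn mulrN -(per (s - 2 * pi * n.+1%:R) n.+1) subrK.
exists (Num.floor ((a - b) / (2 * pi))); set m := Num.floor _.
pose y := a - b - 2 * pi * m%:~R.
have /andP[m1 m2] := mem_rg1_floor ((a - b) / (2 * pi)).
move: m1 m2; rewrite -/m ler_pdivlMr ?ltr_pdivrMr; [|lra|lra] => m1 m2.
have : y = 0.
  apply: cos_eq1; first by rewrite /y; apply/andP; split; lra.
  have -> : y = a - (b + 2 * pi * m%:~R) by rewrite /y; ring.
  by rewrite -dot_ez peri h -enorm_sqr ez_norm expr1n.
rewrite /y; lra.
Qed.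

(** * Turning and chords of boundary walks *)

Section OrbitGeometry.
Variables (R : realType) (n : nat) (B : complex R n) (S : arcs B).
Hypothesis rB : regular B.
Notation dart := (edge B * bool)%type.
Implicit Types (e : edge B) (d : dart).

Notation step := (step S rB).

Lemma step_mem (o : {set dart}) d : o \in porbits step -> (step d \in o) = (d \in o).
Proof.
case/imsetP => x _ ->.
by rewrite -!eq_porbit_mem; have := porbit_perm step 1 d; rewrite expg1 => ->.
Qed.

Lemma orbit_reindex (V : nmodType) (F : dart -> V) (o : {set dart}) : o \in porbits step ->
  \sum_(d in o) F (step d) = \sum_(d in o) F d.
Proof.
move=> ho; rewrite [RHS](reindex_inj (@perm_inj _ step)) /=.
by apply: eq_bigl => d; rewrite step_mem.
Qed.

Definition dturn d : R := dk S d * dlen S d.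

(** [step d] comes before [d] on the walk, and at an interior angle of [2 * pi / 3] the walk turns
    left by [pi / 3]. *)
Lemma step_direction d : ez (dpsi S d) = ez (dpsi S (step d) + dturn (step d) + pi / 3).
Proof.
rewrite stepE; have := ez_dang_rev S (turn S rB d) (dlen S (turn S rB d)).
rewrite subrr {2}/dang mulr0 addr0 (turn_dir S rB d) -ezDpi => h.
have -> : dpsi S (rev (turn S rB d)) + dturn (rev (turn S rB d)) =
  dang S (rev (turn S rB d)) (dlen S (turn S rB d)) by [].
rewrite (ez_shift _ h); have -> : dpsi S d + 2 * pi / 3 + pi + pi / 3 = dpsi S d + 2 * pi by field.
by rewrite ez_2pi.
Qed.

(** The initial directions telescope around the orbit, so only periods of the angle remain. *)
Lemma orbit_turning (o : {set dart}) : o \in porbits step ->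
  exists m : int, \sum_(d in o) (dturn d + pi / 3) = 2 * pi * m%:~R.
Proof.
move=> ho; have [m hm] := choice (fun d => ez_period (step_direction d)).
exists (- \sum_(d in o) m d).
rewrite -(orbit_reindex _ ho) rmorphN rmorph_sum /= mulrN mulr_sumr -sumrN.
have -> : \sum_(d in o) (dturn (step d) + pi / 3) =
    \sum_(d in o) (dpsi S d - dpsi S (step d)) - \sum_(d in o) 2 * pi * (m d)%:~R.
  by rewrite -sumrB; apply: eq_bigr => d _; rewrite {1}(hm d); ring.
by rewrite sumrB (orbit_reindex (dpsi S) ho) subrr sub0r sumrN.
Qed.

(** The chords of a closed walk sum to zero, and a chord is at most its arc. *)
Lemma orbit_chord (o : {set dart}) x : o \in porbits step -> x \in o ->
  edist (dorg (rev x)) (dorg x) <= \sum_(d in o | d != x) dlen S d.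
Proof.
move=> ho xo.
have chord d : enorm (dorg (rev d) - dorg d : plane R) <= dlen S d.
  have := dpt_lip S d (dlen S d) 0; rewrite dptL dpt0 subr0 ger0_norm //.
  exact/ltW/dlen_gt0.
have h0 : \sum_(d in o) (dorg (rev d) - dorg d) = 0 :> plane R.
  rewrite sumrB -(orbit_reindex (fun d => dorg (rev d)) ho) -sumrB big1 // => d _.
  by rewrite stepE revK /dorg turn_end subrr.
have -> : edist (dorg (rev x)) (dorg x) = enorm (\sum_(d in o | d != x) (dorg (rev d) - dorg d)).
  move: h0; rewrite (bigD1 x) //= => /eqP; rewrite addr_eq0 => /eqP h.
  by rewrite /edist h enormN.
elim/big_ind2 : _ => [|u a v b h1 h2|d _]; first by rewrite enorm0.
  by apply: le_trans (ler_enormD _ _) _; exact: lerD.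
exact: chord.
Qed.

Lemma chord_sin d : dk S d != 0 ->
  `|dk S d| * edist (dorg (rev d)) (dorg d) = 2 * `|sin (dturn d / 2)|.
Proof.
move=> k0; rewrite -(dptL S) /dpt /arc_pt (negbTE k0) /edist addrC addKr enormZ mulrA normfV.
rewrite mulfV ?normr_eq0 // mul1r.
have -> : rot (ez (dpsi S d)) - rot (ez (dpsi S d + dk S d * dlen S d)) =
          rot (ez (dpsi S d) - ez (dpsi S d + dk S d * dlen S d)) by apply: plane_eq => /=; ring.
rewrite rot_norm -/(edist _ _) edist_ez opprD addrA subrr sub0r mulNr sinN normrN.
by [].
Qed.

Lemma sum_orbits (V : nmodType) (F : dart -> V) :
  \sum_(d | lab S d != None) F d = \sum_(o in Oint S rB) \sum_(d in o) F d.
Proof.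
rewrite (partition_big (porbit step) (mem (Oint S rB))) => [|d]; last exact: Oint_porbit.
apply: eq_bigr => o ho; apply: eq_bigl => d; apply/andP/idP => [[_ /eqP <-]|hd].
  by rewrite porbit_id.
by have [-> ->] := Oint_mem ho hd.
Qed.

Lemma lab_turn2 d : lab S (turn S rB (turn S rB d)) = lab S (rev d).
Proof. by rewrite -(lab_turn S rB (turn S rB (turn S rB d))) turn3. Qed.

(** The nearest point of the graph to a point of the region provides the dart. *)
Lemma lab_onto (e0 : edge B) m : exists d, lab S d = Some m.
Proof.
have ne : support B !=set0.
  by exists (curve e0 0); right; exists e0, 0; rewrite lexx ler01.
have [p rp] : exists p, region B (Some m) p.
  apply: contrapT => h; have := interior_area B m; have := area_gt0 B m.
  have -> : region B (Some m) = set0 by apply/seteqP; split=> p // hp; apply: h; exists p.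
  by rewrite /plane_area measure0 => h0 [E]; rewrite -E ltxx in h0.
have [d [s [h [hs h0 pE far]]]] := nearest_dart S rB ne (region_compl rp).
exists d; apply: lab_uniq.
rewrite pE in far rp; have := near_left_at (@region_face_closed R n B (Some m)) hs h0 far.
by case=> _ /(_ rp).
Qed.

Lemma trivalent_count : (#|edge B| * 2 = #|vertex B| * 3)%N.
Proof.
have <- : #|{: dart}| = (#|edge B| * 2)%N by rewrite card_prod card_bool.
rewrite -sum1_card (partition_big (@edge_end R B) (fun=> true)) //=.
rewrite -sum_nat_const; apply: eq_bigr => v _; rewrite -(regular_trivalent rB v) -sum1_card.
by apply: eq_bigl => d; rewrite inE.
Qed.

End OrbitGeometry.

(** * Equal pressures *)

From mathcomp Require Import zify.

(** [M] will be the total turning of the interior walks in units of [2 * pi]. It is at least the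
    number [o] of walks, so the rank inequality makes [c] positive, and [c = 1] turns both
    inequalities into equalities. *)
Lemma euler_count (c M : int) (o e v : nat) : M = c + e%:Z - v%:Z -> o%:Z <= M ->
  (e + 1 <= o + v)%N -> 1 <= c /\ (c = 1 -> (o + v = e + 1)%N /\ M = o%:Z).
Proof.
move=> ME h1 h2; split; first by lia.
move=> c1; split; first by lia.
by lia.
Qed.

(** If [c] were at least 2, then [t] would be at least [4 * pi + k * (pi / 3)]. For [k] at most 2
    this is more than [2 * pi * k]; for larger [k] it is at least [5 * pi], more than
    [2 * pi + 15 / 2]. *)
Lemma turning_bound (R : realType) (t : R) (c : int) (k : nat) : 1 <= c ->
  t = 2 * pi * c%:~R + k%:R * (pi / 3) -> t <= 2 * pi * k%:R -> t <= 2 * pi + 15 / 2 -> c = 1.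
Proof.
move=> c1 tE tk tb; have pi0 := pi_gt305 R.
apply/eqP; rewrite eq_le c1 andbT leNgt; apply/negP => c2.
have c2r : (2 : R) <= c%:~R.
  by rewrite (_ : 2 = (2 : int)%:~R) ?ler_int // -[2]/(1 + 1) -lez1D.
have h4 : k%:R * (pi / 3) + 4 * pi <= t by rewrite tE; nra.
clear tE c2 c1; have [k3|k3] := leqP 3 k.
  have k3r : (3 : R) <= k%:R by rewrite ler_nat.
  by move: (k%:R) k3r h4 tk => y *; clear k3; nra.
have k2 : k%:R <= (2 : R) by rewrite ler_nat -ltnS.
by move: (k%:R) k2 (ler0n R k) h4 tk => y *; clear k3; nra.
Qed.

Lemma turn_identity (R : realType) (t : R) (c : int) (e v k : nat) : (e * 2 = v * 3)%N ->
  t + (2 * e%:R - k%:R) * (pi / 3) = 2 * pi * (c + e%:Z - v%:Z)%:~R -> t = 2 * pi * c%:~R + k%:R * (pi / 3).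
Proof.
move=> EV; have EVr : e%:R * 2 = v%:R * 3 :> R by rewrite -!natrM EV.
rewrite rmorphB rmorphD /= -!pmulrn => TE.
have h1 : v%:R * pi = 2 * e%:R * (pi / 3) :> R.
  have -> : 2 * e%:R * (pi / 3) = e%:R * 2 * (pi / 3) :> R by ring.
  by rewrite EVr; field.
have h2 : e%:R * pi * 2 = v%:R * pi * 3 :> R by rewrite mulrAC EVr; ring.
lra.
Qed.

Section EqualPressure.
Variables (R : realType) (A : complex R 3) (S : arcs A) (p : R).
Hypothesis rA : regular A.
Hypothesis mA : perimeter_minimizer A.
Hypothesis noch : ~ exists C, empty_chamber A C.
Hypothesis kE : forall e, arc_k S e = extend (fun=> p) (lab S (e, false)) - extend (fun=> p) (lab S (e, true)).
Hypothesis lE : \sum_(e : edge A) arc_l S e = 2 * \sum_m p * area A m.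
Notation dart := (edge A * bool)%type.
Implicit Types (e : edge A) (d x : dart) (o : {set dart}).

Lemma edge_exists : exists e0 : edge A, True.
Proof.
have [M M0 [far near]] := @far_half_plane R 3 A.
apply: contrapT => no.
have noS q : ~ support A q.
  case=> [[v _]|[e _]]; last by apply: no; exists e.
  have : (0 < #|[set d | edge_end d == v]%SET|)%N by rewrite (regular_trivalent rA v).
  by case/card_gt0P => -[e b] _; apply: no; exists e.
have rn : region A None (M, 0) by exact: far.
have all i q : region A i q -> i = None.
  move=> h; have : region A i (M, 0) by apply: (region_seg h) => t _; exact: noS.
  by move=> h'; exact: region_uniq h' rn.
have h0 : region A (Some ord0) = set0 by apply/seteqP; split=> // q /all.
have := interior_area A ord0; rewrite h0 /plane_area measure0 => -[E].
by have := area_gt0 A ord0; rewrite -E ltxx.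
Qed.

Lemma total_area_gt0 : 0 < \sum_m area A m.
Proof.
rewrite (bigD1 ord0) //=; apply: ltr_pwDl; first exact: area_gt0.
by apply: sumr_ge0 => m _; exact/ltW/area_gt0.
Qed.

Lemma arc_l_gt0 e : 0 < arc_l S e.
Proof. exact: (dlen_gt0 S (e, false)). Qed.

Lemma pressure_gt0 : 0 < p.
Proof.
have [e0 _] := edge_exists; have a0 := total_area_gt0.
have : 0 < \sum_e arc_l S e.
  rewrite (bigD1 e0) //=; apply: ltr_pwDl; first exact: arc_l_gt0.
  by apply: sumr_ge0 => e _; exact/ltW/arc_l_gt0.
by rewrite lE -mulr_sumr pmulr_rgt0 // pmulr_lgt0.
Qed.

(* (2 pi + 3)^2 / (2 pi) = 2 pi + 6 + 9 / (2 pi), and pi > 3. *)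
Definition total_bound : R := 2 * pi + 15 / 2.

(** By [lE] the product of [p] and the length is the square of the length over twice the area. The
    disc bounds the length by [(2 * pi + 3) * r] with [pi * r ^+ 2] at most the area. *)
Lemma length_bound : p * (\sum_e arc_l S e) <= total_bound.
Proof.
have [r [r0 ra [B [aB lB]]]] := disc_competitor (area_gt0 A).
have := le_trans (mA (B' := B) aB) lB; rewrite (graph_lengthE S) lee_fin => l1.
have a0 := total_area_gt0; have p0 := pressure_gt0; have pi0 := pi_gt305 R.
have l2 : \sum_e arc_l S e = 2 * p * \sum_m area A m by rewrite lE -mulr_sumr mulrA.
move: l1 l2 ra a0; move: (\sum_e arc_l S e) (\sum_m area A m) => l a l1 l2 ra a0.
have l0 : 0 < l by rewrite l2 !mulr_gt0.
have b1 : l ^+ 2 <= (2 * pi + 3) ^+ 2 * r ^+ 2.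
  rewrite -exprMn; apply: lerXn2r; rewrite ?nnegrE ?(ltW l0) //; apply: mulr_ge0; lra.
have b2 : pi * l ^+ 2 <= (2 * pi + 3) ^+ 2 * a.
  apply: (@le_trans _ _ ((2 * pi + 3) ^+ 2 * (pi * r ^+ 2))); last by rewrite ler_wpM2l ?sqr_ge0.
  have -> : (2 * pi + 3) ^+ 2 * (pi * r ^+ 2) = pi * ((2 * pi + 3) ^+ 2 * r ^+ 2) by ring.
  by rewrite ler_wpM2l //; lra.
have b3 : 2 * pi * (p * l) <= (2 * pi + 3) ^+ 2.
  rewrite -(ler_pM2r a0); apply: le_trans b2.
  by rewrite le_eqVlt; apply/orP; left; apply/eqP; rewrite expr2 {2}l2; ring.
rewrite /total_bound -(@ler_pM2l _ (2 * pi)); last by lra.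
apply: le_trans b3 _; nra.
Qed.

(* X: the exterior edges seen from inside; Y: the edges between interior regions, twice each. *)
Definition X := [set d | (lab S d != None) && (lab S (rev d) == None)]%SET.
Definition Y := [set d | (lab S d != None) && (lab S (rev d) != None)]%SET.

Lemma in_X d : (d \in X) = (lab S d != None) && (lab S (rev d) == None).
Proof. by rewrite /X inE. Qed.

Lemma in_Y d : (d \in Y) = (lab S d != None) && (lab S (rev d) != None).
Proof. by rewrite /Y inE. Qed.

Lemma lab_rev_neq d : lab S (rev d) != lab S d.
Proof. by apply/eqP; exact: sides_differ. Qed.

Lemma dkE d : dk S d = extend (fun=> p) (lab S d) - extend (fun=> p) (lab S (rev d)).
Proof. by case: d => e [] /=; rewrite /dk /= kE // opprB. Qed.

Lemma dk_X d : d \in X -> dk S d = p.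
Proof. by rewrite in_X dkE => /andP[]; case: (lab S d) => //= i _ /eqP ->; rewrite subr0. Qed.

Lemma dturn_X d : d \in X -> dturn S d = p * dlen S d.
Proof. by move=> h; rewrite /dturn dk_X. Qed.

Lemma dturn_gt0 d : d \in X -> 0 < dturn S d.
Proof. by move=> h; rewrite dturn_X // mulr_gt0 ?pressure_gt0 ?dlen_gt0. Qed.

Lemma dturn_le d : d \in X -> dturn S d <= 2 * pi.
Proof.
move=> h; apply: le_trans (arc_turn S d.1); rewrite dturn_X //.
have -> // : `|arc_k S d.1| = p.
move: (dk_X h) pressure_gt0; rewrite /dk; case: (d.2) => <- h0; last by rewrite gtr0_norm.
by rewrite -normrN gtr0_norm.
Qed.

Lemma dturn_flat d : lab S d != None -> d \notin X -> dturn S d = 0.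
Proof.
move=> h; rewrite in_X h /= /dturn dkE; case: (lab S d) h => //= i _.
by case: (lab S (rev d)) => //= j _; rewrite subrr mul0r.
Qed.

Let k := #|X|.
Let E := #|edge A|.
Let V := #|vertex A|.
Let O := Oint S rA.
Definition Theta : R := \sum_(d in X) dturn S d.

Lemma lab_rev_None d : lab S d = None -> rev d \in X.
Proof. by move=> h; rewrite in_X revK h eqxx andbT -h lab_rev_neq. Qed.

Lemma card_exterior : #|[set d | lab S d == None]%SET| = k.
Proof.
rewrite /k -(card_imset (mem X) (can_inj (@revK R A))); apply: eq_card => d.
rewrite inE; apply/eqP/imsetP => [h|[d' h ->]].
  by exists (rev d); rewrite ?revK // lab_rev_None.
by move: h; rewrite in_X => /andP[_ /eqP].
Qed.

Lemma total_turn : \sum_(d | lab S d != None) (dturn S d + pi / 3) = Theta + (2 * E%:R - k%:R) * (pi / 3).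
Proof.
rewrite big_split /=; congr (_ + _).
  rewrite (bigID (mem X)) /= [X in _ + X]big1 ?addr0 => [|d /andP[h1 h2]]; last exact: dturn_flat.
  by apply: eq_bigl => d; apply: andb_idl; rewrite /= in_X => /andP[].
rewrite sumr_const -[LHS]mulr_natl; congr (_ * _).
have : (#|[pred d | lab S d != None]| + k = E * 2)%N.
  have <- : #|{: dart}| = (E * 2)%N by rewrite card_prod card_bool.
  rewrite -card_exterior addnC -(cardC [set d | lab S d == None]%SET); congr (_ + _)%N.
  by apply: eq_card => d; rewrite !inE.
by move=> h; have := congr1 (fun n => n%:R : R) h; rewrite natrD natrM => h'; lra.
Qed.

Lemma total_length : 2 * p * (\sum_e arc_l S e) = 2 * Theta + p * \sum_(d in Y) dlen S d.
Proof.
have -> : 2 * p * (\sum_e arc_l S e) = p * \sum_d dlen S d.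
  rewrite -(pair_bigA _ (fun e b => dlen S (e, b))) /=.
  under [X in _ = p * X]eq_bigr => e _ do rewrite big_bool /= /dlen /=.
  by rewrite big_split /=; ring.
rewrite (bigID (mem Y)) /= mulrDr addrC; congr (_ + _).
rewrite (bigID (mem X)) /= mulrDr.
have e1 : p * \sum_(d | (d \notin Y) && (d \in X)) dlen S d = Theta.
  rewrite mulr_sumr; apply: eq_big => [d|d /andP[_ h]]; last by rewrite dturn_X.
  by rewrite in_X in_Y; case: (lab S d != None); case: (lab S (rev d)).
have -> : \sum_(d | (d \notin Y) && (d \notin X)) dlen S d = \sum_(d | (d \notin Y) && (d \in X)) dlen S d.
  rewrite (reindex_inj (can_inj (@revK R A))) /=; apply: eq_bigl => d.
  rewrite !in_X !in_Y revK; have := lab_rev_neq d.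
  by case: (lab S d) => [i|]; case: (lab S (rev d)) => [j|].
by rewrite e1; ring.
Qed.

Lemma O_porbits o : o \in O -> o \in porbits (step S rA).
Proof. by rewrite inE => /andP[]. Qed.

Lemma O_nonempty o : o \in O -> (0 < #|o|)%N.
Proof.
by rewrite inE => /andP[/imsetP[d _ ->] _]; apply/card_gt0P; exists d; rewrite porbit_id.
Qed.

Lemma O_lab o d : o \in O -> d \in o -> lab S d != None.
Proof. by move=> ho hd; case: (Oint_mem ho hd). Qed.

Lemma sum_orbit o : o \in O -> \sum_(d in o) (dturn S d + pi / 3) =
  \sum_(d in X :&: o) dturn S d + #|o|%:R * (pi / 3).
Proof.
move=> ho; rewrite big_split /= sumr_const -[X in _ + X]mulr_natl; congr (_ + _).
rewrite (bigID (mem X)) /= [X in _ + X]big1 ?addr0 => [|d /andP[h1 h2]].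
  by apply: eq_bigl => d; rewrite !inE andbC.
by apply: dturn_flat => //; exact: O_lab ho h1.
Qed.

Lemma Theta_le : Theta <= 2 * pi * k%:R.
Proof. by rewrite mulr_natr -sumr_const; apply: ler_sum => d; exact: dturn_le. Qed.

Lemma Y_length_ge0 : 0 <= p * \sum_(d in Y) dlen S d.
Proof.
by apply: mulr_ge0; [exact/ltW/pressure_gt0|apply: sumr_ge0 => d _; exact/ltW/dlen_gt0].
Qed.

(** [Theta] is evaluated in two ways: as [p] times the exterior length it is at most [total_bound],
    and by adding the turnings of all walks it is [2 * pi * c + k * (pi / 3)] with [c = M - E + V].
    Hence [c = 1], and every walk has the least possible turning. *)
Lemma orbit_numbers : [/\ (#|O| + V = E + 1)%N, Theta = 2 * pi + k%:R * (pi / 3) &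
  forall o, o \in O -> \sum_(d in o) (dturn S d + pi / 3) = 2 * pi].
Proof.
have pi0 := pi_gt305 R; have [e0 _] := edge_exists.
have /choice[m hm] : forall o, exists m : int, o \in O -> \sum_(d in o) (dturn S d + pi / 3) = 2 * pi * m%:~R.
  move=> o; have [ho|] := boolP (o \in O); last by exists 0.
  by have [m h] := orbit_turning (O_porbits ho); exists m.
have m1 o : o \in O -> 1 <= m o.
  move=> ho; rewrite -gtz0_ge1 -(ltr0z R).
  suff : 0 < 2 * pi * (m o)%:~R :> R by rewrite pmulr_rgt0 //; lra.
  rewrite -hm // sum_orbit //; apply: ltr_pwDr.
    by apply: mulr_gt0; [rewrite ltr0n O_nonempty|lra].
  by apply: sumr_ge0 => d; rewrite inE => /andP[h _]; exact/ltW/dturn_gt0.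
set M := \sum_(o in O) m o.
have TE : Theta + (2 * E%:R - k%:R) * (pi / 3) = 2 * pi * M%:~R.
  rewrite -total_turn (sum_orbits S rA) /M rmorph_sum /= mulr_sumr.
  by apply: eq_bigr => o ho; rewrite hm.
have MO : (#|O|%:Z <= M)%R.
  have -> : #|O|%:Z = \sum_(o in O) 1 by rewrite sumr_const natz.
  by apply: ler_sum => o; exact: m1.
have EO : (E + 1 <= #|O| + V)%N.
  by apply: (@flows_rank R 3 A S rA noch 1 (fun=> ord0) (fun=> edge_end (e0, false))) => [j|e] //; rewrite [j]ord1.
have EV : (E * 2 = V * 3)%N := trivalent_count rA.
have TL : Theta <= total_bound.
  by have := Y_length_ge0; have := total_length; have := length_bound; lra.
have [c ME] : exists c : int, M = c + E%:Z - V%:Z by exists (M - E%:Z + V%:Z); ring.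
have [c1 OM] := euler_count ME MO EO.
have TE' : Theta = 2 * pi * c%:~R + k%:R * (pi / 3) by apply: turn_identity EV _; rewrite -ME.
have c2 : c = 1 := turning_bound c1 TE' Theta_le TL.
have [OE MOE] := OM c2.
split=> //; first by rewrite TE' c2 mulr1.
have meq : \sum_(o in O) (m o - 1) = 0 by rewrite sumrB sumr_const -/M natz MOE subrr.
move=> o ho; rewrite hm //.
have m0 : m o - 1 = 0.
  apply/eqP; move/eqP: meq; rewrite psumr_eq0 => [/allP/(_ o)|o' ho']; last by rewrite subr_ge0 m1.
  by rewrite mem_index_enum ho; apply.
have mo : m o = 1 by move/eqP: m0; rewrite subr_eq0 => /eqP.
by rewrite mo mulr1.
Qed.

(** Two classes of vertices without joining edges would need one more walk than there is. The
    connectedness of the graph is phrased as an induction principle. *)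
Lemma vertices_connected (U : pred (vertex A)) (v0 : vertex A) : U v0 ->
  (forall d : dart, U (edge_end d) -> U (edge_end (rev d))) -> forall v, U v.
Proof.
move=> U0 Uc v; apply: contraT => Uv; have [OE _ _] := orbit_numbers.
pose comp w : 'I_2 := if U w then ord0 else ord_max.
pose s (j : 'I_2) := if j == ord0 then v0 else v.
have := @flows_rank R 3 A S rA noch 2 comp s.
rewrite -/E -/V -/O OE; have -> // : (E + 2 <= E + 1)%N = false by rewrite leq_add2l.
apply=> [j|e]; rewrite /comp /s.
  case: (j =P ord0) => [->|j0]; first by rewrite U0.
  by rewrite (negbTE Uv); apply: val_inj; case: j j0 => [[|[|j]] hj] //= j0; case: j0; apply: val_inj.
have -> // : U (edge_end (e, true)) = U (edge_end (e, false)).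
by apply/idP/idP => h; [exact: (Uc (e, true))|exact: (Uc (e, false))].
Qed.

End EqualPressure.

(** * Counting exterior arcs on the walks *)

Section PressureCases.
Variables (R : realType) (A : complex R 3) (S : arcs A) (p : R).
Hypothesis rA : regular A.
Hypothesis mA : perimeter_minimizer A.
Hypothesis noch : ~ exists C, empty_chamber A C.
Hypothesis kE : forall e, arc_k S e = extend (fun=> p) (lab S (e, false)) - extend (fun=> p) (lab S (e, true)).
Hypothesis lE : \sum_(e : edge A) arc_l S e = 2 * \sum_m p * area A m.
Notation dart := (edge A * bool)%type.
Notation X := (X S).
Notation Y := (Y S).
Notation O := (Oint S rA).
Notation step := (step S rA).
Notation turn := (turn S rA).
Notation face d := (porbit step d).
Implicit Types (e : edge A) (d x : dart) (o : {set dart}).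

Let numbers := orbit_numbers rA mA noch kE lE.
Let sides d : lab S (rev d) != lab S d := lab_rev_neq S rA mA d.

Lemma face_step d : face (step d) = face d.
Proof. by have := porbit_perm step 1 d; rewrite expg1. Qed.

Lemma O_face o d : o \in O -> d \in o -> o = face d.
Proof. by move=> ho hd; case: (Oint_mem ho hd). Qed.

Lemma X_lab x : x \in X -> lab S x != None.
Proof. by rewrite in_X => /andP[]. Qed.

(** If two consecutive darts of a walk bordered the exterior, the third edge at their vertex would
    have the exterior on both sides. *)
Lemma step_X x : x \in X -> step x \notin X.
Proof.
rewrite !in_X => /andP[_ /eqP h1]; rewrite lab_step negb_and; apply/orP; right; apply/eqP => h2.
have := sides (turn (turn x)); rewrite lab_turn lab_turn2 h1.
by move: h2; rewrite stepE revK => ->; rewrite eqxx.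
Qed.

(** At the origin of [x] the exterior sector lies between [x] and the third edge. So the walk on the
    other side of the segment [step x] has this third edge as an exterior arc. *)
Lemma after_X x : x \in X -> step x \in Y -> step (rev (step x)) \in X.
Proof.
rewrite in_X in_Y => /andP[_ h] /andP[_ h2]; rewrite in_X lab_step h2 /=.
by rewrite !stepE !revK lab_turn2.
Qed.

Lemma before_X x y : x \in X -> step y = x -> y \in Y -> exists2 u, u \in X & step u = rev y.
Proof.
rewrite in_X in_Y => /andP[_ h] yx /andP[_ h2].
have ty : turn y = rev x by rewrite -yx stepE revK.
have su : step (turn (rev x)) = rev y by rewrite stepE -ty turn3.
by exists (turn (rev x)) => //; rewrite in_X -(lab_step S rA) su h2 lab_turn.
Qed.

(** By [step_X] the exterior arcs of a walk and their predecessors are disjoint sets. *)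
Lemma two_orbit o : o \in O -> (2 * #|X :&: o| <= #|o|)%N.
Proof.
move=> ho; have po := O_porbits ho.
rewrite mul2n -addnn -{2}(card_imset (mem (X :&: o)) (@perm_inj _ step)).
have h : disjoint (mem (X :&: o)) (mem (step @: (X :&: o))).
  rewrite disjoint_subset; apply/fintype.subsetP => d; rewrite inE => /andP[dX _].
  by rewrite inE; apply/imsetP => -[d']; rewrite inE => /andP[d'X _] dE; move: (step_X d'X); rewrite -dE dX.
move: h; rewrite -leq_card_setU => /eqP <-; apply: subset_leq_card; apply/fintype.subsetP => d.
rewrite !inE => /orP[/andP[] //|/imsetP[d']]; rewrite inE => /andP[_ d'o] ->.
by rewrite step_mem.
Qed.

Lemma orbit_angle o : o \in O -> \sum_(d in X :&: o) dturn S d = (6 - #|o|%:R) * (pi / 3).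
Proof.
move=> ho; have [_ _ h] := numbers; have := h o ho; rewrite (sum_orbit kE ho) => h1.
have -> : (6 - #|o|%:R) * (pi / 3) = 2 * pi - #|o|%:R * (pi / 3) :> R by field.
by rewrite -h1 addrK.
Qed.

Lemma orbit_lt6 o : o \in O -> (0 < #|X :&: o|)%N -> (#|o| < 6)%N.
Proof.
move=> ho /card_gt0P[x xo]; have pi0 := pi_gt0 R.
have := orbit_angle ho; rewrite (bigD1 x) //=.
have x0 : 0 < dturn S x by apply: (dturn_gt0 rA kE lE); move: xo; rewrite inE => /andP[].
have : 0 <= \sum_(d in X :&: o | d != x) dturn S d.
  by apply: sumr_ge0 => d /andP[]; rewrite inE => /andP[dX _] _; exact/ltW/(dturn_gt0 rA kE lE).
move=> h1 h2; have : 0 < (6 - #|o|%:R) * (pi / 3) :> R by lra.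
by rewrite pmulr_lgt0 ?divr_gt0 // subr_gt0 ltr_nat.
Qed.

Lemma orbit_le2 o : o \in O -> (#|X :&: o| <= 2)%N.
Proof.
move=> ho; have h2 := two_orbit ho; case: (posnP #|X :&: o|) => [->//|h].
by have := orbit_lt6 ho h; move: h2; clear; lia.
Qed.

Notation single o := (#|X :&: o| == 1)%N.
Notation double o := (#|X :&: o| == 2)%N.
Definition nsingle := #|[set o in O | single o]|.
Definition ndouble := #|[set o in O | double o]|.
(** The total angle, in units of [pi / 3], of the arcs on walks with a single exterior arc. *)
Definition wsum : nat := \sum_(o in O | single o) (6 - #|o|).

Lemma sum_classes (V : nmodType) (F : {set dart} -> V) : (forall o, o \in O -> #|X :&: o| = 0%N -> F o = 0) ->
  \sum_(o in O) F o = \sum_(o in O | single o) F o + \sum_(o in O | double o) F o.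
Proof.
move=> F0; rewrite (bigID (fun o => single o)) /=; congr (_ + _).
rewrite (bigID (fun o => double o)) /= [X in _ + X]big1 ?addr0 => [|o /andP[/andP[ho h1] h2]].
  by apply: eq_bigl => o; rewrite -andbA; congr (_ && _); case: eqP => //= ->.
by apply: F0 => //; move: (orbit_le2 ho) h1 h2; case: #|_| => [|[|[|m]]].
Qed.

Lemma X_count : (#|X| = nsingle + 2 * ndouble)%N.
Proof.
have -> : #|X| = (\sum_(d | lab S d != None) (d \in X))%N.
  rewrite -sum1_card big_mkcond [RHS]big_mkcond; apply: eq_bigr => d _.
  by case dX : (d \in X) => /=; [rewrite (X_lab dX)|case: ifP].
transitivity (\sum_(o in O) \sum_(d in o) ((d \in X) : nat))%N.
  exact: (@sum_orbits R 3 A S rA nat (fun d => (d \in X) : nat)).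
have cE o : (\sum_(d in o) ((d \in X) : nat))%N = #|X :&: o|.
  rewrite -sum1_card big_mkcond [RHS]big_mkcond; apply: eq_bigr => d _; rewrite finset.in_setI.
  by case: (d \in o); case: (d \in X).
under eq_bigr => o _ do rewrite cE.
transitivity ((\sum_(o in O | single o) #|X :&: o|) + \sum_(o in O | double o) #|X :&: o|)%N.
  exact: (@sum_classes nat (fun o => #|X :&: o|)).
congr (_ + _)%N.
  by rewrite /nsingle -sum1_card; apply: eq_big => [b|b /andP[_ /eqP ->]]; rewrite ?inE.
by rewrite /ndouble -sum1_card big_distrr /=; apply: eq_big => [b|b /andP[_ /eqP ->]]; rewrite ?inE.
Qed.

(** In units of [pi / 3] all exterior arcs turn by 6 plus their number. A walk with two of them has
    at least four darts and contributes at most 2, no more than its share, so the walks with one arc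
    must supply the rest. *)
Lemma wsum_ge : (6 + nsingle <= wsum)%N.
Proof.
have [_ TE _] := numbers; have pi0 := pi_gt0 R.
pose F o : R := \sum_(d in X :&: o) dturn S d.
have TO : Theta S = \sum_(o in O) F o.
  rewrite /Theta; transitivity (\sum_(d | lab S d != None) if d \in X then dturn S d else 0).
    rewrite -big_mkcondr; apply: eq_bigl => d; rewrite andbC; apply/esym/andb_idr.
    exact: X_lab.
  rewrite (sum_orbits S rA); apply: eq_bigr => o _; rewrite /F -big_mkcondr.
  by apply: eq_bigl => d; rewrite finset.in_setI andbC.
have F0 o : o \in O -> #|X :&: o| = 0%N -> F o = 0.
  by move=> _ /eqP; rewrite cards_eq0 /F => /eqP ->; rewrite big_set0.
rewrite (sum_classes F0) TE in TO.
pose W o : nat := (6 - #|o|)%N.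
have FW o : o \in O -> (0 < #|X :&: o|)%N -> F o = (W o)%:R * (pi / 3).
  move=> ho h; rewrite /F (orbit_angle ho) /W natrB //.
  exact/ltnW/orbit_lt6.
have E1 : \sum_(o in O | single o) F o = wsum%:R * (pi / 3).
  rewrite /wsum natr_sum mulr_suml; apply: eq_bigr => o /andP[ho /eqP h1].
  by apply: FW; rewrite // h1.
have E2 : \sum_(o in O | double o) F o <= (2 * ndouble)%:R * (pi / 3).
  have -> : (2 * ndouble)%N = \sum_(o in O | double o) 2.
    by rewrite sum_nat_cond_const mulnC; congr (_ * _)%N; apply: eq_card => o; rewrite !inE.
  rewrite natr_sum mulr_suml; apply: ler_sum => o /andP[ho /eqP h2].
  rewrite FW ?h2 // ler_wpM2r ?divr_ge0 ?(ltW pi0) // ler_nat /W.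
  by have := two_orbit ho; rewrite h2; clear; lia.
have h1 : #|X|%:R = nsingle%:R + 2 * ndouble%:R :> R by rewrite X_count natrD natrM.
have h2 : (2 * ndouble)%:R = 2 * ndouble%:R :> R by rewrite natrM.
have h3 : (6 + nsingle)%:R = 6 + nsingle%:R :> R by rewrite natrD.
have : (6 + nsingle)%:R * (pi / 3) <= wsum%:R * (pi / 3) :> R.
  rewrite h3; move: TO E2; rewrite E1 h1 h2.
  move: (nsingle%:R) (ndouble%:R) (wsum%:R * (pi / 3)) (\sum_(o in O | double o) F o) => a b w y TO E2.
  have -> : (6 + a) * (pi / 3) = 2 * pi + a * (pi / 3) by field.
  have e3 : (a + 2 * b) * (pi / 3) = a * (pi / 3) + 2 * b * (pi / 3) by ring.
  by move: TO; rewrite e3; lra.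
by rewrite ler_pM2r ?divr_gt0 // ler_nat.
Qed.

Lemma O_ge3 : (3 <= #|O|)%N.
Proof.
have [e0 _] := edge_exists rA.
have /choice[dl hdl] := lab_onto S rA e0.
have inj : injective (fun m => face (dl m)).
  move=> m m' h; have h' : dl m \in face (dl m') by rewrite -h porbit_id.
  by have := porbit_inv (lab_step S rA) h'; rewrite !hdl => -[].
rewrite -{1}(card_ord 3) -(card_imset predT inj); apply: subset_leq_card; apply/fintype.subsetP => o.
by case/imsetP => m _ ->; apply: Oint_porbit; rewrite hdl.
Qed.

Lemma uniq_orbit (s : seq dart) o : uniq s -> all (mem o) s -> (size s <= #|o|)%N.
Proof. by move=> us /allP hs; rewrite cardE; apply: uniq_leq_size => // d /hs; rewrite mem_enum. Qed.

Lemma step_nofix o x d : o \in O -> x \in o -> d \in o -> d != x -> step d != d.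
Proof.
move=> ho xo od dx; apply: (contra_neq _ dx) => sd.
have h y : (step y == d) = (y == d) by rewrite -{1}sd (inj_eq perm_inj).
have xd : x \in face d by rewrite -(O_face ho od).
by have := porbit_inv h xd; rewrite eqxx => /eqP.
Qed.

Lemma single_next o x d : o \in O -> x \in X -> x \in o -> d \in o -> d != x -> (#|o| <= 3)%N ->
  d = step x \/ step d = x.
Proof.
move=> ho xX xo od dx o3; have [|n1] := eqVneq d (step x); first by left.
have [|n2] := eqVneq (step d) x; first by right.
have po := O_porbits ho; have nf := step_nofix ho xo od dx.
have xs : step x != x by apply: contraNneq (step_X xX) => ->.
have := @uniq_orbit [:: x; step x; d; step d] o; rewrite /= !step_mem // xo od.
rewrite !inE !negb_or [x == _]eq_sym xs [x == d]eq_sym dx [x == _]eq_sym n2 [_ == d]eq_sym n1.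
rewrite (inj_eq perm_inj) [x == d]eq_sym dx [d == _]eq_sym nf => /(_ isT isT).
by rewrite leqNgt ltnS o3.
Qed.

Lemma two_cycle o x d : o \in O -> x \in X -> x \in o -> d \in o -> d != x -> #|o| = 2%N ->
  step x = d /\ step d = x.
Proof.
move=> ho xX xo od dx o2; have po := O_porbits ho; have nf := step_nofix ho xo od dx.
have xs : step x != x by apply: contraNneq (step_X xX) => ->.
split; apply/eqP; apply: contraT => h.
  have := @uniq_orbit [:: x; d; step x] o; rewrite /= !step_mem // xo od.
  by rewrite !inE negb_or [x == d]eq_sym dx [x == _]eq_sym xs [d == _]eq_sym h o2 => /(_ isT isT).
have := @uniq_orbit [:: x; d; step d] o; rewrite /= !step_mem // xo od.
by rewrite !inE negb_or [x == d]eq_sym dx [x == _]eq_sym h [d == _]eq_sym nf o2 => /(_ isT isT).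
Qed.

(** Both neighbours of [rev d] on its walk are exterior arcs, by [after_X] and [before_X]. They are
    distinct, since otherwise the graph would close up. *)
Lemma two_cycle_double o x d : o \in O -> x \in X -> x \in o -> d \in o -> d != x -> d \in Y -> #|o| = 2%N ->
  double (face (rev d)).
Proof.
move=> ho xX xo od dx dY o2; have [sx sd] := two_cycle ho xX xo od dx o2.
have tX : step (rev d) \in X by rewrite -sx; apply: after_X; rewrite ?sx.
have [u uX su] := before_X xX sd dY.
have fO : face (rev d) \in O by apply: Oint_porbit; move: dY; rewrite in_Y => /andP[].
have tf : step (rev d) \in face (rev d) by rewrite -(face_step (rev d)) porbit_id.
have uf : u \in face (rev d) by rewrite -su face_step porbit_id.
have le2 := orbit_le2 fO.
rewrite eqn_leq le2 /=; have [ut|ut] := eqVneq u (step (rev d)); last first.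
  apply: (@leq_trans #|[set u; step (rev d)]%SET|); first by rewrite cards2 ut.
  apply: subset_leq_card; apply/fintype.subsetP => y; rewrite in_set2 => /orP[]/eqP->; rewrite finset.in_setI.
    by rewrite uX uf.
  by rewrite tX tf.
(* If the neighbours coincide, every dart at the ends of [x] leads back to these two vertices. By
   connectedness there are at most two vertices, hence too few walks for three regions. *)
exfalso; have tx : turn x = rev d by rewrite -sx stepE revK.
have td : turn d = rev x by rewrite -sd stepE revK.
have uE : u = turn (rev x).
  apply: (@perm_inj _ step); rewrite su [RHS]stepE -td turn3.
  by [].
have ttx : turn (turn x) = rev (turn (rev x)) by rewrite tx -uE ut stepE revK.
pose U v := (v == edge_end x) || (v == edge_end d).
have ends d1 d2 : turn d1 = d2 -> edge_end d2 = edge_end d1 by move=> <-; exact: turn_end.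
have e1 : edge_end (rev x) = edge_end d by exact: ends td.
have e2 : edge_end (rev d) = edge_end x by exact: ends tx.
have e3 : edge_end (turn (rev x)) = edge_end d by rewrite turn_end.
have e4 : edge_end (turn (turn x)) = edge_end x by rewrite !turn_end.
have Uall v : U v.
  apply: (vertices_connected rA mA noch kE lE (U := U) (v0 := edge_end x)); first by rewrite /U eqxx.
  move=> d' /orP[/eqP h|/eqP h].
    have [->|n1] := eqVneq d' x; first by rewrite /U e1 eqxx orbT.
    have [->|n2] := eqVneq d' (turn x); first by rewrite tx revK /U eqxx orbT.
    by rewrite (turn_third h n1 n2) ttx revK /U e3 eqxx orbT.
  have [->|n1] := eqVneq d' d; first by rewrite /U e2 eqxx.
  have [->|n2] := eqVneq d' (turn d); first by rewrite td revK /U eqxx.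
  by rewrite (turn_third h n1 n2) td -[turn (rev x)]revK -ttx revK /U e4 eqxx.
have V2 : (#|vertex A| <= 2)%N.
  rewrite -cardsT; apply: leq_trans (_ : #|[set edge_end x; edge_end d]%SET| <= 2)%N; last first.
    by rewrite cards2; case: (_ != _).
  by apply: subset_leq_card; apply/fintype.subsetP => v _; rewrite !inE; exact: Uall.
have [OE _ _] := numbers; have := O_ge3; have := trivalent_count rA; move: OE V2; clear; lia.
Qed.

End PressureCases.

(** * Chord estimates for the segments *)

Section PressureConclusion.
Variables (R : realType) (A : complex R 3) (S : arcs A) (p : R).
Hypothesis rA : regular A.
Hypothesis mA : perimeter_minimizer A.
Hypothesis noch : ~ exists C, empty_chamber A C.
Hypothesis kE : forall e, arc_k S e = extend (fun=> p) (lab S (e, false)) - extend (fun=> p) (lab S (e, true)).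
Hypothesis lE : \sum_(e : edge A) arc_l S e = 2 * \sum_m p * area A m.
Notation dart := (edge A * bool)%type.
Notation X := (X S).
Notation Y := (Y S).
Notation O := (Oint S rA).
Notation step := (step S rA).
Notation turn := (turn S rA).
Notation face d := (porbit step d).
Implicit Types (e : edge A) (d x : dart) (o : {set dart}).

Notation single o := (#|X :&: o| == 1)%N.
Notation double o := (#|X :&: o| == 2)%N.
Let numbers := orbit_numbers rA mA noch kE lE.

(** The squared chords of a unit circle over the angles [n * (pi / 3)]. *)
Lemma cos_thirds (n : nat) : (1 <= n <= 4)%N ->
  2 * (1 - cos (n%:R * (pi / 3))) = (if n == 1 then 1 else if n == 3 then 4 else 3) :> R.
Proof.
have h2 := cos_2pi3 R.
have h1 : cos (pi / 3) = 1 / 2 :> R.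
  have -> : pi / 3 = - (2 * pi / 3) + pi :> R by field.
  by rewrite cosDpi cosN h2; ring.
case: n => [|[|[|[|[|n]]]]] // _ /=.
- by rewrite mul1r h1; lra.
- by rewrite mulrA h2; lra.
- have -> : 3 * (pi / 3) = pi :> R by field.
  by rewrite cospi; lra.
- have -> : 4 * (pi / 3) = pi / 3 + pi :> R by field.
  by rewrite cosDpi h1; lra.
Qed.

Definition segments o : R := \sum_(d in o | d \in Y) p * dlen S d.

Lemma single_elt o : single o -> exists x, X :&: o = [set x]%SET.
Proof. by move/cards1P. Qed.

Lemma segments_ge0 o : 0 <= segments o.
Proof.
apply: sumr_ge0 => d _; apply: mulr_ge0; first exact/ltW/(pressure_gt0 rA lE).
exact/ltW/dlen_gt0.
Qed.

Lemma in_single o x : X :&: o = [set x]%SET -> x \in X /\ x \in o.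
Proof. by move=> h; apply/andP; rewrite -finset.in_setI h finset.in_set1. Qed.

Lemma Y_single o x d : o \in O -> X :&: o = [set x]%SET -> d \in o -> (d \in Y) = (d != x).
Proof.
move=> ho hx od; have ld := O_lab ho od.
have -> : (d != x) = (d \notin X) by rewrite -(finset.in_set1 d x) -hx finset.in_setI od andbT.
by rewrite in_X in_Y ld.
Qed.

(** Scaled by [p] the exterior arc lies on a unit circle; its chord has to be spanned by the other
    darts of the walk, which are segments. *)
Lemma segments_sqr o : o \in O -> single o -> (2 <= #|o| <= 5)%N /\
  2 * (1 - cos ((6 - #|o|)%:R * (pi / 3))) <= segments o ^+ 2.
Proof.
move=> ho so; have [x hx] := single_elt so; have [xX xo] := in_single hx.
have n6 : (#|o| < 6)%N by apply: (orbit_lt6 mA noch kE lE ho); rewrite (eqP so).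
have n2 := two_orbit mA ho; rewrite (eqP so) muln1 in n2; split; first by rewrite n2.
have tx : dturn S x = (6 - #|o|)%:R * (pi / 3).
  by have := orbit_angle mA noch kE lE ho; rewrite hx big_set1 natrB // ltnW.
have k0 : dk S x != 0 by rewrite (dk_X kE xX) lt0r_neq0 // (pressure_gt0 rA lE).
have p0 := pressure_gt0 rA lE.
have h : 2 * `|sin (dturn S x / 2)| <= segments o.
  rewrite -(chord_sin k0) (dk_X kE xX) gtr0_norm // /segments -mulr_sumr.
  apply: ler_wpM2l; first exact: ltW.
  apply: le_trans (orbit_chord (O_porbits ho) xo) _.
  rewrite le_eqVlt; apply/orP; left; apply/eqP; apply: eq_bigl => d.
  by case od : (d \in o) => //=; rewrite (Y_single ho hx od).
rewrite -tx cos_double_half.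
have -> : 2 * (1 - (1 - 2 * sin (dturn S x / 2) ^+ 2)) = (2 * `|sin (dturn S x / 2)|) ^+ 2.
  by rewrite exprMn real_normK ?num_real //; ring.
by rewrite lerXn2r ?nnegrE ?segments_ge0 ?mulr_ge0.
Qed.

(* In a two-sided face the single segment is shared with a face that has two exterior arcs, so it counts twice. *)
Definition gain o : R := (if #|o| == 2%N then 2 else 1) * segments o.

(** For walks of 2, 3, 4 and 5 darts the chords give gains of at least [2 * sqrt 3], 2, [sqrt 3] and
    1, against 5 / 2, 2, 3 / 2 and 1. The constant 346 / 100 is just below [2 * sqrt 3]. *)
Lemma gain_ge o : o \in O -> single o -> (1 + (6 - #|o|)%:R) / 2 <= gain o /\
  (#|o| = 2%N -> 346 / 100 <= gain o).
Proof.
move=> ho so; have [n25 h] := segments_sqr ho so; have s0 := segments_ge0 o.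
have n14 : (1 <= 6 - #|o| <= 4)%N by move: n25; clear; lia.
rewrite (cos_thirds n14) in h; rewrite /gain; move: (segments o) s0 h => c c0.
case/andP: n25; case: #|o| => [|[|[|[|[|[|n]]]]]] // _ _ /= h; rewrite !subSS ?subn0 in h *; split=> // *; nra.
Qed.

Lemma class_sum (P : pred {set dart}) :
  \sum_(d in Y | P (face d)) p * dlen S d = \sum_(o in O | P o) segments o.
Proof.
rewrite (partition_big (porbit step) (fun o => (o \in O) && P o)) => [|d /andP[dY ->]]; last first.
  by rewrite andbT; apply: Oint_porbit; move: dY; rewrite in_Y => /andP[].
apply: eq_bigr => o /andP[ho Po]; apply: eq_bigl => d; apply/andP/andP.
  by move=> [/andP[dY _] /eqP <-]; rewrite porbit_id.
by move=> [od dY]; rewrite dY -(O_face ho od) Po eqxx.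
Qed.

(** The second count of the segment of a two-sided walk is charged to its reverse, which by
    [two_cycle_double] lies on a walk with two exterior arcs and is not counted otherwise. *)
Lemma gain_sum : \sum_(o in O | single o) gain o <= p * \sum_(d in Y) dlen S d.
Proof.
rewrite mulr_sumr (bigID (fun d => single (face d))) /= (class_sum (fun o => single o)).
rewrite (class_sum (fun o => ~~ single o)).
have -> : \sum_(o in O | single o) gain o = \sum_(o in O | single o) segments o +
    \sum_(o in O | single o && (#|o| == 2)%N) segments o.
  rewrite [Z in _ + Z](eq_bigl (fun o => ((o \in O) && single o) && (#|o| == 2)%N)); last by move=> o; rewrite andbA.
  rewrite [Z in _ = _ + Z]big_mkcondr -big_split; apply: eq_bigr => o _; rewrite /gain.
  by case: eqP => _; rewrite /= ?mul1r ?addr0 // mulr_natl.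
rewrite lerD2l -(class_sum (fun o => single o && (#|o| == 2)%N)) -(class_sum (fun o => ~~ single o)).
rewrite (reindex_inj (can_inj (@revK R A))) /= big_mkcond [leRHS]big_mkcond; apply: ler_sum => d _.
have p0 := pressure_gt0 rA lE; have F0 : 0 <= p * dlen S d by rewrite mulr_ge0 ?ltW // dlen_gt0.
have YE : (rev d \in Y) = (d \in Y) by rewrite !in_Y revK andbC.
rewrite YE; case dY : (d \in Y) => //=; case: ifP => [/andP[so o2]|_]; last by case: ifP.
have rO : face (rev d) \in O by apply: Oint_porbit; move: dY; rewrite -YE in_Y => /andP[].
have [x hx] := single_elt so; have [xX xo] := in_single hx.
have dr : rev d != x by rewrite -(Y_single rO hx) ?porbit_id // YE.
have := two_cycle_double mA noch kE lE rO xX xo (porbit_id _ _) dr; rewrite YE revK => /(_ dY (eqP o2)) /eqP ->.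
by [].
Qed.

(** [p] times the length is [Theta] plus half the contribution of [Y], and the summand [2 * pi] of
    [Theta] cancels the one in [total_bound]. *)
Lemma gain_bound : (\sum_(o in O | single o) gain o) / 2 + #|X|%:R * (pi / 3) <= 15 / 2.
Proof.
have [_ TE _] := numbers; have := total_length rA mA kE; have := length_bound rA mA lE.
have := gain_sum; rewrite TE /total_bound; lra.
Qed.

End PressureConclusion.

Lemma sum_extremal (T : finType) (P : pred T) (F : T -> nat) (c : nat) : (forall o, P o -> (F o <= c)%N) ->
  (\sum_(o | P o) F o <= #|P| * c)%N /\
  ((#|P| * c <= \sum_(o | P o) F o)%N -> forall o, P o -> F o = c).
Proof.
move=> h; have [] : (\sum_(o | P o) F o <= \sum_(o | P o) c ?= iff [forall (o | P o), F o == c])%N.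
  by apply: leqif_sum => o Po; split; [exact: h|].
have -> : (\sum_(o | P o) c = #|P| * c)%N by rewrite -sum_nat_const.
move=> h1 h2; split=> // h3 o Po.
by move: h2; rewrite eqn_leq h1 h3 => /esym/forallP/(_ o)/implyP/(_ Po)/eqP.
Qed.

(** [a] and [b] stand for the numbers of walks with one and with two exterior arcs, [w] for [wsum],
    [g] for the total gain, and 61 / 60 for a lower bound of [pi / 3]. *)
Lemma single_bound (R : realType) (a b g w : R) : 0 <= b -> 6 + a <= w -> (w + a) / 2 <= g ->
  g / 2 + (a + 2 * b) * (61 / 60) <= 15 / 2 -> a < 4 /\ (1 <= b -> a < 3).
Proof. by split=> *; lra. Qed.

(** Here the precision of [pi] counts: 1 in place of 61 / 60 would give only [g <= 7], while two
    gains of [2 * sqrt 3] make about 6.93. *)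
Lemma two_singles_bound (R : realType) (b g : R) : 1 <= b ->
  g / 2 + (2 + 2 * b) * (61 / 60) <= 15 / 2 -> g < 2 * (346 / 100).
Proof. lra. Qed.

(** * Exclusion of all other combinations of walks *)

Section StandardShape.
Variables (R : realType) (A : complex R 3) (S : arcs A) (p : R).
Hypothesis rA : regular A.
Hypothesis mA : perimeter_minimizer A.
Hypothesis noch : ~ exists C, empty_chamber A C.
Hypothesis kE : forall e, arc_k S e = extend (fun=> p) (lab S (e, false)) - extend (fun=> p) (lab S (e, true)).
Hypothesis lE : \sum_(e : edge A) arc_l S e = 2 * \sum_m p * area A m.
Notation dart := (edge A * bool)%type.
Notation X := (X S).
Notation Y := (Y S).
Notation O := (Oint S rA).
Notation step := (step S rA).
Notation turn := (turn S rA).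
Notation face d := (porbit step d).
Implicit Types (e : edge A) (d x : dart) (o : {set dart}).

Notation single o := (#|X :&: o| == 1)%N.
Notation double o := (#|X :&: o| == 2)%N.
Let numbers := orbit_numbers rA mA noch kE lE.

Lemma single_size o : o \in O -> single o -> (2 <= #|o| <= 5)%N.
Proof. by move=> ho so; case: (segments_sqr mA noch kE lE ho so). Qed.

Lemma single_card : #|[pred o | (o \in O) && single o]| = nsingle S rA.
Proof. by apply: eq_card => o; rewrite !inE. Qed.

Lemma gain_total : (wsum S rA + nsingle S rA)%:R / 2 <= \sum_(o in O | single o) gain S p o.
Proof.
rewrite addnC -single_card -sum1_card /wsum -big_split natr_sum mulr_suml /=.
by apply: ler_sum => o /andP[ho so]; rewrite natrD; case: (gain_ge mA noch kE lE ho so).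
Qed.

(** Let [a] be the number of walks with one exterior arc; their weights [6 - #|o|] add up to at
    least [6 + a]. If some walk has two exterior arcs, then [a <= 2], while weights of at most 4
    force [a = 2] with both weights 4, and the gains are too large. Otherwise no walk with one
    exterior arc has only two darts, weights are at most 3, and [a <= 3] forces three walks of
    weight 3. *)
Lemma final_numbers : [/\ ndouble S rA = 0%N, nsingle S rA = 3%N &
  forall o, o \in O -> single o -> #|o| = 3%N].
Proof.
have G := gain_bound rA mA noch kE lE; have GT := gain_total; have W := wsum_ge rA mA noch kE lE.
have XE := X_count rA mA noch kE lE; have pi0 := pi_gt305 R.
have size2 o : o \in O -> single o -> (#|o| >= 2)%N by move=> ho so; case/andP: (single_size ho so).
have [w4 w4'] := @sum_extremal _ [pred o | (o \in O) && single o] (fun o => 6 - #|o|)%N 4 (fun o ho =>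
  leq_sub2l 6 (size2 o (andP ho).1 (andP ho).2)).
have no2 : ndouble S rA = 0%N -> forall o, o \in O -> single o -> (#|o| >= 3)%N.
  move=> q0 o ho so; rewrite ltn_neqAle size2 // andbT; apply/eqP => o2.
  have [x hx] := single_elt so; have [xX xo] := in_single hx.
  have [d od dx] : exists2 d, d \in o & d != x.
    have : (0 < #|o :\ x|)%N by have := cardsD1 x o; rewrite xo -o2; case: #|_|.
    by case/card_gt0P => d; rewrite finset.in_setD1 => /andP[dx od]; exists d.
  have dY : d \in Y by rewrite (Y_single ho hx od).
  have h2 := two_cycle_double mA noch kE lE ho xX xo od dx dY (esym o2).
  have hO : face (rev d) \in O by apply: Oint_porbit; move: dY; rewrite in_Y => /andP[].
  have : face (rev d) \in [set o in O | double o]%SET by rewrite finset.in_set hO h2.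
  by move/eqP: q0; rewrite cards_eq0 => /eqP ->; rewrite finset.in_set0.
rewrite single_card in w4 w4'; rewrite -/(wsum S rA) in w4 w4'.
have Wr : 6 + (nsingle S rA)%:R <= (wsum S rA)%:R :> R by rewrite -natrD ler_nat.
move: G GT; rewrite XE natrD natrM natrD; set g := \sum_(o in O | _) _; move=> G GT.
have a0 := ler0n R (nsingle S rA); have b0 := ler0n R (ndouble S rA).
have {}G : g / 2 + ((nsingle S rA)%:R + 2 * (ndouble S rA)%:R) * (61 / 60) <= 15 / 2.
  by apply: le_trans _ G; rewrite lerD2l ler_wpM2l //; lra.
have [s3r s2r] := single_bound b0 Wr GT G.
have s3 : (nsingle S rA <= 3)%N by rewrite -ltnS -(ltr_nat R).
have [q0|q1] := posnP (ndouble S rA); last first.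
  exfalso; have q1r : (1 : R) <= (ndouble S rA)%:R by rewrite ler1n.
  have s2 : (nsingle S rA <= 2)%N by rewrite -ltnS -(ltr_nat R) s2r.
  have s2' : nsingle S rA = 2%N by move: s2 w4 W; clear; lia.
  have hw : (nsingle S rA * 4 <= wsum S rA)%N by move: W; rewrite s2'.
  have all2 : g >= (nsingle S rA)%:R * (346 / 100).
    rewrite -single_card -sum1_card natr_sum mulr_suml; apply: ler_sum => o /andP[ho so]; rewrite mul1r.
    case: (gain_ge mA noch kE lE ho so) => _; apply.
    have h : (6 - #|o| = 4)%N by apply: (w4' hw); rewrite /= ho.
    by have := single_size ho so; move: h; clear; lia.
  by rewrite s2' in all2 G; have := two_singles_bound q1r G; rewrite ltNge all2.
have [w3 w3'] := @sum_extremal _ [pred o | (o \in O) && single o] (fun o => 6 - #|o|)%N 3 (fun o ho =>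
  leq_sub2l 6 (no2 q0 o (andP ho).1 (andP ho).2)).
rewrite single_card -/(wsum S rA) in w3 w3'.
have s3' : nsingle S rA = 3%N by move: s3 w3 W; clear; lia.
have hw : (nsingle S rA * 3 <= wsum S rA)%N by move: W; rewrite s3'.
split=> // o ho so; have h : (6 - #|o| = 3)%N by apply: (w3' hw); rewrite /= ho.
by have := single_size ho so; move: h; clear; lia.
Qed.

End StandardShape.

(** * The standard triple bubble *)

Section StandardRegions.
Variables (R : realType) (A : complex R 3) (S : arcs A) (p : R).
Hypothesis rA : regular A.
Hypothesis mA : perimeter_minimizer A.
Hypothesis noch : ~ exists C, empty_chamber A C.
Hypothesis kE : forall e, arc_k S e = extend (fun=> p) (lab S (e, false)) - extend (fun=> p) (lab S (e, true)).
Hypothesis lE : \sum_(e : edge A) arc_l S e = 2 * \sum_m p * area A m.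
Notation dart := (edge A * bool)%type.
Notation X := (X S).
Notation Y := (Y S).
Notation O := (Oint S rA).
Notation step := (step S rA).
Notation turn := (turn S rA).
Notation face d := (porbit step d).
Implicit Types (e : edge A) (d x : dart) (o : {set dart}).

Notation single o := (#|X :&: o| == 1)%N.
Notation double o := (#|X :&: o| == 2)%N.
Let numbers := orbit_numbers rA mA noch kE lE.

Lemma O_none_double o : o \in O -> ~~ double o.
Proof.
move=> ho; apply/negP => h2; have [/eqP q0 _ _] := final_numbers rA mA noch kE lE.
have : o \in [set o in O | double o]%SET by rewrite finset.in_set ho.
by move: q0; rewrite cards_eq0 => /eqP ->; rewrite finset.in_set0.
Qed.

Lemma single_face x d : x \in X -> x \in face d -> single (face d).
Proof.
move=> xX xd; have fE : face d \in O.
  by apply: Oint_porbit; rewrite -(porbit_inv (lab_step S rA) xd) (X_lab xX).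
have := orbit_le2 mA noch kE lE fE; have := O_none_double fE.
have : (0 < #|X :&: face d|)%N by apply/card_gt0P; exists x; rewrite finset.in_setI xX.
by case: #|_| => [|[|[|m]]].
Qed.

(* The settled darts are closed under turning at a vertex and under reversal, hence are all darts. *)
Definition settled d := (lab S d == None) || single (face d).

(** On a walk of three darts every segment is adjacent to the exterior arc, so the walk across the
    segment also contains an exterior arc, and exactly one because no walk has two. *)
Lemma settled_rev d : settled d -> settled (rev d).
Proof.
have ext y : lab S y = None -> settled (rev y).
  by move=> /(lab_rev_None rA mA) h; rewrite /settled (single_face h (porbit_id _ _)) orbT.
move=> /orP[/eqP/ext //|sd]; have [/ext //|ld] := eqVneq (lab S d) None.
have ho : face d \in O by exact: Oint_porbit.
have [x hx] := single_elt sd; have [xX xo] := in_single hx.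
have [dx|dx] := eqVneq d x.
  by move: xX; rewrite -dx in_X /settled => /andP[_ ->].
have dY : d \in Y by rewrite (Y_single ho hx (porbit_id _ _)).
have [_ _ /(_ _ ho sd) n3] := final_numbers rA mA noch kE lE.
apply/orP; right; have [dE|dE] := single_next mA ho xX xo (porbit_id _ _) dx (eq_leq n3).
  apply: (@single_face (step (rev d))); last by rewrite -(face_step S rA (rev d)) porbit_id.
  by rewrite dE; apply: after_X; rewrite -?dE.
have [u uX su] := before_X xX dE dY; apply: single_face uX _.
by rewrite -su face_step porbit_id.
Qed.

Lemma settled_turn d : settled d -> settled (turn d).
Proof.
move=> sd; rewrite -[turn d]revK -stepE; apply: settled_rev.
by rewrite /settled lab_step face_step.
Qed.

Lemma all_settled d : settled d.
Proof.
have [_ s3 _] := final_numbers rA mA noch kE lE.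
have : (0 < nsingle S rA)%N by rewrite s3.
case/card_gt0P => o; rewrite finset.in_set => /andP[ho so].
have [x hx] := single_elt so; have [xX xo] := in_single hx.
pose U v := [forall d, (edge_end d == v) ==> settled d].
have end_U y : settled y -> U (edge_end y).
  move=> sy; apply/forallP => y'; apply/implyP => /eqP yy.
  have [->//|n1] := eqVneq y' y; have [->|n2] := eqVneq y' (turn y); first exact: settled_turn.
  by rewrite (turn_third yy n1 n2); do 2! apply: settled_turn.
have sx : settled x by rewrite /settled (single_face xX (porbit_id _ _)) orbT.
have U_end y : U (edge_end y) -> settled y by move=> /forallP/(_ y); rewrite eqxx.
apply: (U_end _ _); apply: (vertices_connected rA mA noch kE lE (U := U) (end_U _ sx)) => y /U_end sy.
exact/end_U/settled_rev.
Qed.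

Lemma O_single o : o \in O -> single o.
Proof.
move=> ho; have [d od] : exists d, d \in o.
  by have /imsetP[d _ ->] := O_porbits ho; exists d; rewrite porbit_id.
have [oE ld] := Oint_mem ho od.
by have := all_settled d; rewrite /settled (negbTE ld) -oE.
Qed.

Lemma O_card3 : #|O| = 3%N.
Proof.
have [_ s3 _] := final_numbers rA mA noch kE lE; apply: etrans s3.
by apply: eq_card => o; rewrite finset.in_set; case ho : (o \in O) => //=; rewrite O_single.
Qed.

Lemma standard_numbers : #|vertex A| = 4%N /\ #|edge A| = 6%N.
Proof.
have [+ _ _] := numbers; rewrite O_card3; have := trivalent_count rA; clear.
by move: (#|vertex A|) (#|edge A|) => v e; lia.
Qed.

(** There are three walks and each of the three regions has at least one, so each has exactly
    one. *)
Lemma face_lab d d' : lab S d != None -> lab S d' = lab S d -> face d' = face d.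
Proof.
move=> ld dd; have [e0 _] := edge_exists rA; have /choice[dl hdl] := lab_onto S rA e0.
have inj : injective (fun m => face (dl m)).
  move=> m m' h; have h' : dl m \in face (dl m') by rewrite -h porbit_id.
  by have := porbit_inv (lab_step S rA) h'; rewrite !hdl => -[].
have /eqP img : [set face (dl m) | m : 'I_3]%SET == O.
  rewrite eqEcard O_card3 card_imset // card_ord leqnn andbT.
  by apply/fintype.subsetP => _ /imsetP[m _ ->]; apply: Oint_porbit; rewrite hdl.
have rep y : lab S y != None -> exists2 m, face y = face (dl m) & lab S y = Some m.
  move=> /(Oint_porbit rA); rewrite -img => /imsetP[m _ fE]; exists m => //.
  have : y \in face (dl m) by rewrite -fE porbit_id.
  by move=> /(porbit_inv (lab_step S rA)) ->.
have [m -> lm] := rep d ld; have [|m' -> lm'] := rep d'; first by rewrite dd.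
by move: dd; rewrite lm lm' => -[->].
Qed.

Lemma near_left_face d d' (P : set (plane R)) : face_closed A P -> d' \in face d ->
  near_left S d P -> near_left S d' P.
Proof.
move=> hP dd nP; suff h : `[<near_left S d' P>] = `[<near_left S d P>].
  by apply/asboolP; rewrite h; apply/asboolP.
apply: (@porbit_inv _ _ _ _ rA bool (fun d => `[<near_left S d P>]) _ _ _ dd) => y.
by apply/asbool_equiv_eq; rewrite stepE; apply: iff_sym; exact: near_left_turn.
Qed.

Lemma region_near d p0 : lab S d != None -> region A (lab S d) p0 ->
  near_left S d (connected_component (~` support A) p0).
Proof.
move=> ld rp; have [e0 _] := edge_exists rA.
have ne : support A !=set0.
  by exists (curve e0 0); right; exists e0, 0; rewrite lexx ler01.
have np := region_compl rp.
set C := connected_component _ _; have fC : face_closed A C.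
  move=> q Cq; split; first exact: (connected_component_sub Cq).
  by rewrite /C -(same_connected_component Cq).
have [d' [s [h [hs h0 pE far]]]] := nearest_dart S rA ne np; rewrite pE in far rp.
have nd' P : face_closed A P -> P p0 -> near_left S d' P.
  by move=> fP; rewrite pE => Pp; apply/(near_left_at fP hs h0 far).
have dd : lab S d' = lab S d.
  by apply: lab_uniq; apply: nd'; [exact: region_face_closed|rewrite pE].
apply: (near_left_face fC _ (nd' _ fC _)); last exact: connected_component_refl.
by rewrite (face_lab ld dd) porbit_id.
Qed.

(** Every component of the region lies to the left of some dart of its only boundary walk, hence to
    the left of every dart of it. Two components therefore share points next to [d]. *)
Lemma regions_connected m : connected (region A (Some m)).
Proof.
have [e0 _] := edge_exists rA; have [d hd] := lab_onto S rA e0 m.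
have ld : lab S d != None by rewrite hd.
have [p0 rp] : exists p0, region A (Some m) p0.
  apply: contrapT => h; have := interior_area A m; have := area_gt0 A m.
  have -> : region A (Some m) = set0 by apply/seteqP; split=> q // hq; apply: h; exists q.
  by rewrite /plane_area measure0 => h0 [E]; rewrite -E ltxx in h0.
suff -> : region A (Some m) = connected_component (~` support A) p0 by exact: component_connected.
apply/seteqP; split=> [q rq|]; last exact: region_faces.
have n1 : near_left S d (connected_component (~` support A) p0) by apply: region_near; rewrite ?hd.
have n2 : near_left S d (connected_component (~` support A) q) by apply: region_near; rewrite ?hd.
have [z [h1 h2]] := near_left_meet n1 n2.
rewrite (same_connected_component h1) -(same_connected_component h2).
exact: connected_component_refl (region_compl rq).
Qed.

End StandardRegions.

Theorem corollary5p4 (R : realType) (A_ : nat -> complex R 3)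
    (A : complex R 3) :
  converges_in_length_and_area A_ A ->
  ~ (exists C, empty_chamber A C) ->
  equal_pressure_regions A ->
  ~ standard_triple_bubble A ->
  exists N : nat, forall i : nat, (N < i)%N -> ~ perimeter_minimizer (A_ i).
Proof.
move=> cA noch [p hp] nst; apply: contrapT => hN; apply: nst.
have rA : regular A by case: cA.
have mA : perimeter_minimizer A.
  apply: (@limit_minimizer R 3 A_ A isT cA) => N; apply: contrapT => h; apply: hN.
  by exists N => i Ni mi; apply: h; exists i.
have [S] := regular_arcs rA.
have [P kP] := pressures S rA mA.
have Pp m : P m = p by exact: (pressure_potential rA kP (hp m)).
have PE : P = (fun=> p) by apply/funext.
rewrite {}PE in kP.
have lE : \sum_(e : edge A) arc_l S e = 2 * \sum_m p * area A m.
  by apply: (length_pressure rA mA) kP => f hf m; exact: (pressure_connected rA hf (hp m)).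
have [V4 E6] := standard_numbers rA mA noch kP lE.
by split=> // m; exact: (regions_connected rA mA noch kP lE).
Qed.
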